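(* Assume that the bilinear forms $a(t;\cdot,\cdot)$, $t\in I$, are defined on $\mathcal V\times H_0^1(\Omega)^d$ and satisfy, with positive constants $\gamma,\Gamma,\tilde\Gamma$, $$a(t;\mathbf v,\mathbf v)\ge\gamma|\mathbf v|_{1,\Omega}^2,\qquad a(t;\mathbf u,\mathbf v)\le\Gamma|\mathbf u|_{1,\Omega}|\mathbf v|_{1,\Omega}\quad\text{for all }\mathbf u,\mathbf v\in\mathcal V,\ t\in I,$$ $$a(t;\mathbf v,\tilde{\mathbf v})\le\tilde\Gamma|\mathbf v|_{1,\Omega}|\tilde{\mathbf v}|_{1,\Omega}\quad\text{for all }(\mathbf v,\tilde{\mathbf v})\in\mathcal V\times H_0^1(\Omega)^d,\ t\in I.$$ Let $F\in L^2(I;H^{-1}(\Omega)^d)\subset X'$ and assume that the unique solution $\mathbf u^\ast\in V^0$ of $$\langle\rho\dot{\mathbf u}^\ast,\mathbf v\rangle+\int_0^T a(t;\mathbf u^\ast(t),\mathbf v(t))\,dt=F(\mathbf v)\quad\text{for all }\mathbf v\in X \qquad (\ast)$$ has smoothness $\frac{\partial\mathbf u^\ast}{\partial t}\in L^2(I;L^2(\Omega)^d)$, i.e. $\mathbf u^\ast\in U$. Consider the problem: determine $\mathbf u\in\tilde U$ with $\mathbf u(0)=0$ and $p\in L^2(I;L_0^2(\Omega))$ such that $$(\rho\dot{\mathbf u},\mathbf v)_{L^2}+\int_0^T a(t;\mathbf u(t),\mathbf v(t))\,dt-\int_0^T(p(t),\operatorname{div}\mathbf v(t))_{L^2(\Omega)}\,dt=F(\mathbf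 v),$$ $$\int_0^T(q(t),\operatorname{div}\mathbf u(t))_{L^2(\Omega)}\,dt=0,$$ for all $\mathbf v\in L^2(I;H_0^1(\Omega)^d)$ and $q\in L^2(I;L_0^2(\Omega))$. This problem has a unique solution $(\mathbf u,p)$, and $\mathbf u$ equals the unique solution $\mathbf u^\ast$ of $(\ast)$.
   Context: Setting. $\Omega\subset\mathbb R^d$ is an open bounded connected domain, $I=(0,T)$, $Q=\Omega\times I$. For each $t\in[0,T]$, $\Omega$ is split into two subdomains $\Omega_1(t),\Omega_2(t)$ separated by the interface $\Gamma(t)=\overline{\Omega_1(t)}\cap\overline{\Omega_2(t)}$ (not to be confused with the constant $\Gamma$); the space-time interface $\mathcal S=\bigcup_{t\in I}\Gamma(t)\times\{t\}$ is a connected Lipschitz hypersurface in $\mathbb R^{d+1}$. The density is $\rho(x,t)=\rho_i$ for $x\in\Omega_i(t)$, $i=1,2$, with constants $\rho_i>0$. $\mathbf w$ is a given velocity field with $\operatorname{div}\mathbf w=0$, $\mathbf w\in C(\bar I;L^2(\Omega)^d)\cap L^\infty(Q)^d$, and the material derivative is $\dot v=\frac{\partial v}{\partial t}+\mathbf w\cdot\nabla v$. The compatibility condition $\dot\rho=0$ holds in the weak (distributional) sense. $(\cdot,\cdot)_{L^2}$ is the (vector) $L^2(Q)$ scalar product. Spaces. $\mathcal V=\{v\in H_0^1(\Omega)^d : \operatorname{div} v=0\}$; $|v|_{1,\Omega}=\|\nabla v\|_{L^2(\Omega)}$; $X=L^2(I;\mathcal V)$ with $(\mathbf u,\mathbf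 v)_X=\int_0^T(\nabla \mathbf u(t),\nabla\mathbf v(t))_{L^2(\Omega)}\,dt$; $\langle\cdot,\cdot\rangle$ is the duality between $X'$ and $X$. $C_0^1(\Omega)^d\cap\mathcal V$ is dense in $\mathcal V$, and $\mathcal D_0=\{\sum_{i=1}^n g_i\boldsymbol\phi_i : n\in\mathbb N,\ g_i\in C_0^\infty(I),\ \boldsymbol\phi_i\in C_0^1(\Omega)^d\cap\mathcal V\}$ is dense in $X$ (subscript $0$: compact support). For $\mathbf v\in X$ the weak weighted material derivative is the functional $\langle\rho\dot{\mathbf v},\boldsymbol\phi\rangle=-(\rho\mathbf v,\dot{\boldsymbol\phi})_{L^2}$, $\boldsymbol\phi\in\mathcal D_0$; $\rho\dot{\mathbf v}\in X'$ means that it extends to a bounded functional on $X$. $W=\{\mathbf v\in X:\rho\dot{\mathbf v}\in X'\}$ with $\|\mathbf v\|_W^2=\|\mathbf v\|_X^2+\|\rho\dot{\mathbf v}\|_{X'}^2$. $U=\{\mathbf v\in X:\frac{\partial\mathbf v}{\partial t}\in L^2(I;L^2(\Omega)^d)\}$, with $\frac{\partial\mathbf v}{\partial t}$ the usual weak derivative, and $V=\overline{U}^{\|\cdot\|_W}$ (closure in $W$). The evaluation $\mathbf u\mapsto\mathbf u(t)$ extends from $U$ to a bounded trace operator $V\to L^2(\Omega)^d$; $V^0=\{\mathbf v\in V:\mathbf v(0)=0\}$. Problem $(\ast)$ is known to have a unique solution in $V^0$ for every $F\in X'$. $L_0^2(\Omega)=\{p\in L^2(\Omega):\int_\Omega p=0\}$;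 $\tilde U=\{\mathbf v\in L^2(I;H_0^1(\Omega)^d):\frac{\partial\mathbf v}{\partial t}\in L^2(I;L^2(\Omega)^d)\}$ (no divergence constraint). Since the second equation forces $\mathbf u(t)\in\mathcal V$ for a.e. $t$, the term $a(t;\mathbf u(t),\mathbf v(t))$ is well defined for any solution. It is understood that $t\mapsto a(t;\mathbf u(t),\mathbf v(t))$ is measurable for $\mathbf u\in X$, $\mathbf v\in L^2(I;H_0^1(\Omega)^d)$. The domain $\Omega$ is such that de Rham's theorem holds in the form the paper recalls as standard: the weak gradient $\nabla:L_0^2(\Omega)\to\{f\in H^{-1}(\Omega)^d:f|_{\mathcal V}=0\}$ is an isomorphism. *)

(* Defs.v *)
From HB Require Import structures.
From mathcomp Require Import all_boot all_order all_algebra.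
From mathcomp Require Import all_classical all_reals all_analysis.
From mathcomp Require Import measurable_realfun.

Set Implicit Arguments.
Unset Strict Implicit.
Unset Printing Implicit Defensive.
Import Order.TTheory GRing.Theory Num.Theory.
Import numFieldNormedType.Exports.
Local Open Scope classical_set_scope.
Local Open Scope ring_scope.

(* Lebesgue measure on R^n.  The sigma-algebra on 'rV[R]_n is generated by the
   coordinate maps, as in the library for n.-tuple; it is the Borel one (see
   open_measurable_rV). *)

Definition rV_display : measure_display.
Proof. exact: default_measure_display. Qed.

Section rV_measurable.
Context (R : realType) (n : nat).

Let coor : 'I_n -> 'rV[R]_n -> measurableTypeR R := fun i x => x ord0 i.

Let rV_set0 : g_sigma_preimage coor set0.
Proof. exact: sigma_algebra0. Qed.

Let rV_setC A : g_sigma_preimage coor A -> g_sigma_preimage coor (~` A).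
Proof. exact: sigma_algebraC. Qed.

Let rV_bigcup (F : (set 'rV[R]_n)^nat) :
  (forall i, g_sigma_preimage coor (F i)) ->
  g_sigma_preimage coor (\bigcup_i F i).
Proof. exact: sigma_algebra_bigcup. Qed.

HB.instance Definition _ := @isMeasurable.Build rV_display 'rV[R]_n
  (g_sigma_preimage coor) rV_set0 rV_setC rV_bigcup.

Lemma measurable_coor_rV (i : 'I_n) :
  measurable_fun [set: 'rV[R]_n] (fun x => x ord0 i : measurableTypeR R).
Proof.
move=> _ Y mY; rewrite setTI; apply: sub_sigma_algebra => /=.
rewrite -bigcup_seq/=; exists i => /=; first by rewrite mem_index_enum.
by exists Y => //; rewrite setTI.
Qed.

Lemma measurable_fun_rV d (T : measurableType d) (f : T -> 'rV[R]_n) :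
  (forall i, measurable_fun [set: T] (fun t => f t ord0 i : measurableTypeR R)) ->
  measurable_fun [set: T] f.
Proof.
move=> mf; have sub : (measurable : set (set 'rV[R]_n)) `<=`
    [set A | measurable (f @^-1` A)].
  apply: smallest_sub.
    split=> /=.
    - by rewrite preimage_set0; exact: measurable0.
    - by move=> A mA; rewrite setTD preimage_setC; exact: measurableC.
    - by move=> F mF; rewrite preimage_bigcup; exact: bigcup_measurable.
  rewrite -bigcup_seq/= => A [i _ [B mB <-]] /=.
  by have := mf i measurableT B mB; rewrite !setTI.
by move=> _ A mA; rewrite setTI; exact: sub.
Qed.

Lemma open_measurable_rV (O : set 'rV[R]_n) : open O -> measurable O.
Proof.
move=> oO.
pose q (c : {ffun 'I_n -> rat}) : 'rV[R]_n := \row_i ratr (c i).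
pose B (ck : {ffun 'I_n -> rat} * nat) :=
  [set x : 'rV[R]_n | forall i, `|x ord0 i - q ck.1 ord0 i| < ck.2.+1%:R^-1].
have mB ck : measurable (B ck).
  rewrite (_ : B ck = \bigcap_(i in [set: 'I_n])
      ((fun x : 'rV[R]_n => x ord0 i) @^-1`
         [set y : measurableTypeR R |
           `|(y : R) - q ck.1 ord0 i| < ck.2.+1%:R^-1])); last first.
    by apply/seteqP; split => x /= h => [i _|i]; [exact: h|exact: (h i)].
  apply: fin_bigcap_measurable => // i _; rewrite -[X in measurable X]setTI.
  apply: measurable_coor_rV => //.
  rewrite (_ : mkset _ = ball (q ck.1 ord0 i) (ck.2.+1%:R^-1)).
    by apply: open_measurable; apply: ball_open; rewrite invr_gt0.
  by apply/seteqP; split => y; rewrite /ball/= distrC.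
rewrite (_ : O = \bigcup_(ck in [set ck | B ck `<=` O]) B ck).
  rewrite bigcup_mkcond; apply: countable_bigcupT_measurable => // ck.
  by case: ifP.
apply/seteqP; split => [x Ox|x [ck /= BO Bx]]; last exact: BO.
have /nbhs_ballP[e /= e0 xe] : nbhs x O by exact: open_nbhs_nbhs.
have [k ke] : exists k : nat, k.+1%:R^-1 < e / 2.
  have := near_infty_natSinv_lt (PosNum (divr_gt0 e0 (ltr0Sn R 1))).
  by move=> [N _ /(_ N)/= /(_ (leqnn N)) h]; exists N.
have k0 : (0 : R) < k.+1%:R^-1 by rewrite invr_gt0.
have /choice[c hc] : forall i : 'I_n, exists r : rat,
    `|x ord0 i - ratr r| < k.+1%:R^-1.
  move=> i.
  have xk : x ord0 i - k.+1%:R^-1 < x ord0 i + k.+1%:R^-1.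
    by rewrite ltrD2l (lt_trans _ k0)// oppr_lt0.
  have [r] := rat_in_itvoo xk.
  rewrite in_itv/= => /andP[r1 r2]; exists r.
  by rewrite distrC ltr_distl r1 r2.
exists ([ffun i => c i], k); last first.
  by move=> i; rewrite mxE ffunE; exact: hc.
move=> y /= By; apply: xe; split=> // i j; rewrite ord1 /ball/=.
have := hc j; have := By j; rewrite mxE ffunE => h1 h2.
rewrite (le_lt_trans (ler_distD (ratr (c j)) _ _))//.
rewrite (splitr e) ltrD//; first exact: lt_trans ke.
by rewrite distrC; exact: lt_trans ke.
Qed.

End rV_measurable.

(* R^n x R -> R^(1+n), the new coordinate being put in front *)
Definition consrV (R : realType) (n : nat)
  (z : 'rV[R]_n * measurableTypeR R) : 'rV[R]_n.+1 :=
  row_mx (z.2 : R)%:M z.1 : 'rV[R]_(1 + n).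

Lemma consrV0 (R : realType) n (z : 'rV[R]_n * measurableTypeR R) :
  consrV z ord0 ord0 = z.2.
Proof.
rewrite /consrV mxE; case: splitP => [j _|//].
by rewrite mxE !ord1.
Qed.

Lemma consrVS (R : realType) n (z : 'rV[R]_n * measurableTypeR R) (i : 'I_n) :
  consrV z ord0 (lift ord0 i) = z.1 ord0 i.
Proof.
rewrite /consrV mxE; case: splitP => [j|k]; first by rewrite ord1.
by rewrite lift0 add1n => -[/val_inj->].
Qed.

Lemma measurable_consrV (R : realType) n :
  measurable_fun [set: 'rV[R]_n * measurableTypeR R] (@consrV R n).
Proof.
apply: measurable_fun_rV => i; case: (unliftP ord0 i) => [j|] ->.
  under eq_fun do rewrite consrVS.
  exact: (measurableT_comp (measurable_coor_rV j) measurable_fst).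
by under eq_fun do rewrite consrV0; exact: measurable_snd.
Qed.

Section lebesgue_rVS.
Context (R : realType) (n : nat) (mu : {measure set 'rV[R]_n -> \bar R}).

Definition lebesgue_rVS : set 'rV[R]_n.+1 -> \bar R :=
  pushforward (mu \x (@lebesgue_measure R))%E (@consrV R n).

Let mconsrV (A : set 'rV[R]_n.+1) :
  measurable A -> measurable (@consrV R n @^-1` A).
Proof. by move=> mA; rewrite -[X in measurable X]setTI; exact: measurable_consrV. Qed.

Let lebesgue_rVS0 : lebesgue_rVS set0 = 0%E.
Proof. by rewrite /lebesgue_rVS /pushforward preimage_set0 measure0. Qed.

Let lebesgue_rVS_ge0 A : (0 <= lebesgue_rVS A)%E.
Proof. by rewrite /lebesgue_rVS /pushforward; exact: measure_ge0. Qed.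

Let lebesgue_rVS_sigma_additive : semi_sigma_additive lebesgue_rVS.
Proof.
move=> F mF tF mUF; rewrite /lebesgue_rVS /pushforward preimage_bigcup.
apply: measure_semi_sigma_additive.
- by move=> k; exact: mconsrV.
- apply/trivIsetP => /= i j _ _ ij; rewrite -preimage_setI.
  by move/trivIsetP : tF => /(_ _ _ _ _ ij) ->//; rewrite preimage_set0.
- by rewrite -preimage_bigcup; exact: mconsrV.
Qed.

HB.instance Definition _ := isMeasure.Build _ _ _ lebesgue_rVS
  lebesgue_rVS0 lebesgue_rVS_ge0 lebesgue_rVS_sigma_additive.

End lebesgue_rVS.

Fixpoint lebesgue_rV (R : realType) (n : nat) :
    {measure set 'rV[R]_n -> \bar R} :=
  if n is m.+1 return {measure set 'rV[R]_n -> \bar R}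
  then lebesgue_rVS (lebesgue_rV R m) else \d_(0 : 'rV[R]_0).

Lemma lebesgue_rV_box (R : realType) n (A : 'I_n -> set (measurableTypeR R)) :
  (forall i, measurable (A i)) ->
  lebesgue_rV R n [set x | forall i, A i (x ord0 i)] =
  (\prod_(i < n) lebesgue_measure (A i))%E.
Proof.
elim: n A => [|n IH] A mA.
  by rewrite big_ord0 /= diracE mem_set// => -[].
pose B := [set x : 'rV[R]_n | forall i, A (lift ord0 i) (x ord0 i)].
have mB : measurable B.
  rewrite (_ : B = \bigcap_(i in [set: 'I_n])
      ((fun x : 'rV[R]_n => x ord0 i) @^-1` A (lift ord0 i))); last first.
    by apply/seteqP; split => x /= h => [i _|i]; [exact: h|exact: (h i)].
  apply: fin_bigcap_measurable => // i _; rewrite -[X in measurable X]setTI.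
  exact: measurable_coor_rV.
rewrite big_ord_recl muleC -(IH (fun i => A (lift ord0 i)))//.
rewrite -/B -product_measure1E//.
rewrite /= /lebesgue_rVS /pushforward.
rewrite (_ : @consrV R n @^-1` _ = B `*` A ord0)//.
apply/seteqP; split => -[x t] /=.
  move=> h; split => [i|].
    by have := h (lift ord0 i); rewrite consrVS.
  by have := h ord0; rewrite consrV0.
move=> [hx ht] i; case: (unliftP ord0 i) => [j|] ->.
  by rewrite consrVS; exact: hx.
by rewrite consrV0.
Qed.

Section test_functions.
Context (R : realType) (n : nat).
Implicit Types (D : set 'rV[R]_n) (f : 'rV[R]_n -> R).

Definition pderiv (i : 'I_n) f : 'rV[R]_n -> R :=
  fun x => 'D_(delta_mx ord0 i) f x.

Fixpoint Ck (k : nat) f : Prop :=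
  continuous f /\
  if k is m.+1 then
    forall i, (forall x, derivable f x (delta_mx ord0 i)) /\ Ck m (pderiv i f)
  else True.

Definition csupp D f :=
  compact (closure [set x | f x != 0]) /\ closure [set x | f x != 0] `<=` D.

Definition C1_0 D f := Ck 1 f /\ csupp D f.

Definition Coo_0 D f := (forall k, Ck k f) /\ csupp D f.

End test_functions.

Definition Coo_0_itv (R : realType) (T : R) (g : R -> R) :=
  [/\ forall k (t : R), derivable (derive1n k g) t 1,
      compact (closure [set t | g t != 0]) &
      closure [set t | g t != 0] `<=` `]0, T[].

(* Functionals on a subspace S of a vector space, S being given as a set and
   normed by N; only the values on S matter. *)

Section dual.
Context (R : realType) (E : lmodType R) (S : set E) (N : E -> R).

Definition linear_on (l : E -> R) :=
  forall c u v, S u -> S v -> l (c *: u + v) = c * l u + l v.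

Definition bounded_functional (l : E -> R) :=
  linear_on l /\ exists C, forall v, S v -> `|l v| <= C * N v.

Definition dual_norm (l : E -> R) : R :=
  sup [set `|l v| | v in [set v | S v /\ N v <= 1]].

End dual.

(* The Bochner space L^2(]0, T[; S), S being normed by N.  Elements are
   functions, not classes, and strong measurability is required at every t of
   ]0, T[: each class has such a representative.  The values u t may themselves
   be representatives of classes, N being then a seminorm. *)

Section bochner.
Context (R : realType) (T : R) (E : lmodType R) (S : set E) (N : E -> R).

Definition simple_function (s : R -> E) :=
  exists n (A : 'I_n -> set R) (e : 'I_n -> E),
    (forall k, measurable (A k : set (measurableTypeR R)) /\ S (e k)) /\
    s = fun t => \sum_(k < n) (\1_(A k) t : R) *: e k.

Definition L2I (u : R -> E) :=
  [/\ forall t : R, t \in `]0, T[ -> S (u t),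
      exists s : nat -> R -> E,
        (forall n, simple_function (s n)) /\
        (forall t : R, t \in `]0, T[ -> (N (s n t - u t)) @[n --> \oo] --> (0 : R)) &
      (@lebesgue_measure R).-integrable `]0, T[
        (fun t => (N (u t) ^+ 2)%:E)].

Definition normL2I (u : R -> E) : R :=
  Num.sqrt (\int[lebesgue_measure]_(t in `]0, T[) (N (u t) ^+ 2)).

End bochner.

Definition dotv (R : realType) n (x y : 'rV[R]_n) : R :=
  \sum_i x ord0 i * y ord0 i.

Definition vcomp (R : realType) d (v : 'rV[R]_d -> 'rV[R]_d) (i : 'I_d) :
  'rV[R]_d -> R := fun x => v x ord0 i.

(* Function spaces on a domain of R^d; their elements are Borel representatives
   of the classes. *)

Section sobolev.
Context (R : realType) (d : nat) (Omega : set 'rV[R]_d).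
Implicit Types (f g p : 'rV[R]_d -> R) (u v : 'rV[R]_d -> 'rV[R]_d).

Let mu : {measure set 'rV[R]_d -> \bar R} := lebesgue_rV R d.

Definition L2 f := measurable_fun Omega f /\
  mu.-integrable Omega (fun x => (f x ^+ 2)%:E).

Definition ipL2 f g : R := \int[mu]_(x in Omega) (f x * g x).

Definition normL2 f : R := Num.sqrt (ipL2 f f).

Definition L2_0 p := L2 p /\ \int[mu]_(x in Omega) p x = 0.

Definition L2v v := forall i, L2 (vcomp v i).

Definition ipL2v u v : R := \int[mu]_(x in Omega) dotv (u x) (v x).

Definition normL2v v : R := Num.sqrt (ipL2v v v).

Definition is_wpderiv (i : 'I_d) f g := L2 g /\
  forall phi, Coo_0 Omega phi -> ipL2 f (pderiv i phi) = - ipL2 g phi.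

(* the weak partial derivative, 0 if there is none in L^2 *)
Definition wpderiv (i : 'I_d) f : 'rV[R]_d -> R := xget 0 (is_wpderiv i f).

Definition H1 f := L2 f /\ forall i, exists g, is_wpderiv i f g.

Definition normH1 f : R :=
  Num.sqrt (normL2 f ^+ 2 + \sum_i normL2 (wpderiv i f) ^+ 2).

Definition H1_0 f := H1 f /\
  forall e, 0 < e -> exists phi, Coo_0 Omega phi /\ normH1 (f - phi) < e.

Definition H1_0v v := forall i, H1_0 (vcomp v i).

Definition seminorm1 v : R :=
  Num.sqrt (\sum_i \sum_j normL2 (wpderiv j (vcomp v i)) ^+ 2).

Definition divergence v : 'rV[R]_d -> R := fun x => \sum_i wpderiv i (vcomp v i) x.

Definition calV v := H1_0v v /\ {ae mu, forall x, Omega x -> divergence v x = 0}.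

(* H^{-1}(Omega)^d, the dual of H1_0v *)
Definition Hm1 (l : ('rV[R]_d -> 'rV[R]_d) -> R) :=
  bounded_functional H1_0v seminorm1 l.

Definition normHm1 (l : ('rV[R]_d -> 'rV[R]_d) -> R) : R :=
  dual_norm H1_0v seminorm1 l.

Definition weak_gradient p (v : 'rV[R]_d -> 'rV[R]_d) : R := - ipL2 p (divergence v).

(* weak_gradient is an isomorphism of normed spaces from L2_0 onto the
   functionals of Hm1 that vanish on calV *)
Definition de_rham :=
  [/\ forall p, L2_0 p ->
        Hm1 (weak_gradient p) /\ forall v, calV v -> weak_gradient p v = 0,
      forall l, Hm1 l -> (forall v, calV v -> l v = 0) ->
        exists2 p, L2_0 p & forall v, H1_0v v -> l v = weak_gradient p v &
      exists c C, [/\ 0 < c, 0 < C & forall p, L2_0 p ->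
        c * normL2 p <= normHm1 (weak_gradient p) <= C * normL2 p]].

Definition C1_0_calV v := (forall i, C1_0 Omega (vcomp v i)) /\ calV v.

Definition C1_0_dense := forall v, calV v -> forall e, 0 < e ->
  exists phi, C1_0_calV phi /\ seminorm1 (v - phi) < e.

End sobolev.

(* Functions of (t, x) are curried, with t first; integrals over the cylinder
   Q = Omega x ]0, T[ are iterated, L^2(Q) being L^2(]0, T[; L^2(Omega)). *)

Section spacetime.
Context (R : realType) (d : nat) (Omega : set 'rV[R]_d) (T : R).
Local Notation vfield := ('rV[R]_d -> 'rV[R]_d).
Implicit Types (t : R) (u v g : R -> vfield).

Let mu : {measure set 'rV[R]_d -> \bar R} := lebesgue_rV R d.

Definition eqQ (Y : Type) (f g : R -> 'rV[R]_d -> Y) :=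
  {ae (@lebesgue_measure R), forall t : R, t \in `]0, T[ ->
    {ae mu, forall x, Omega x -> f t x = g t x}}.

Definition intQ (f : R -> 'rV[R]_d -> R) : R :=
  \int[lebesgue_measure]_(t in `]0, T[) \int[mu]_(x in Omega) f t x.

Definition ipQ u v : R := intQ (fun t x => dotv (u t x) (v t x)).

Definition X u := L2I T (calV Omega) (seminorm1 Omega) u.

Definition normX u : R := normL2I T (seminorm1 Omega) u.

Definition L2I_H1_0 u := L2I T (H1_0v Omega) (seminorm1 Omega) u.

Definition L2I_L2 u := L2I T (L2v Omega) (normL2v Omega) u.

Definition L2I_L2_0 (p : R -> 'rV[R]_d -> R) :=
  L2I T (L2_0 Omega) (normL2 Omega) p.

Definition L2I_Hm1 (F : R -> vfield -> R) :=
  L2I T (Hm1 Omega) (normHm1 Omega) F.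

(* the functional on X, and on L2I_H1_0, defined by an element of L2I_Hm1 *)
Definition pairing (F : R -> vfield -> R) v : R :=
  \int[lebesgue_measure]_(t in `]0, T[) F t (v t).

(* The identity  int u theta' = - int g theta  of Bochner integrals in
   L^2(Omega)^d, tested against the elements psi of this space. *)
Definition is_wdt u g := L2I_L2 g /\
  forall theta psi, Coo_0_itv T theta -> L2v Omega psi ->
    \int[lebesgue_measure]_(t in `]0, T[)
       (derive1 theta t * ipL2v Omega (u t) psi) =
    - \int[lebesgue_measure]_(t in `]0, T[)
       (theta t * ipL2v Omega (g t) psi).

Definition wdt u : R -> vfield := xget 0 (is_wdt u).

Definition U u := X u /\ exists g, is_wdt u g.

Definition Utilde u := L2I_H1_0 u /\ exists g, is_wdt u g.

Definition CL2 u :=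
  (forall t : R, t \in `[0, T] -> L2v Omega (u t)) /\
  (forall t : R, t \in `[0, T] -> forall e, 0 < e -> exists2 delta, 0 < delta &
     forall s, s \in `[0, T] -> `|s - t| < delta ->
       normL2v Omega (u s - u t) < e).

(* z is the value at t of the representative of u in C([0, T]; L^2) *)
Definition value_at u (t : R) (z : vfield) :=
  exists uc, [/\ CL2 uc, eqQ uc u & {ae mu, forall x, Omega x -> uc t x = z x}].

(* R^(1+d), with the time coordinate first *)
Definition tcoor (z : 'rV[R]_d.+1) : R := z ord0 ord0.

Definition xcoor (z : 'rV[R]_d.+1) : 'rV[R]_d := \row_j z ord0 (lift ord0 j).

Definition Q : set 'rV[R]_d.+1 :=
  [set z | Omega (xcoor z) /\ tcoor z \in `]0, T[].

Definition gammat (Omega1 Omega2 : R -> set 'rV[R]_d) (t : R) : set 'rV[R]_d :=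
  closure (Omega1 t) `&` closure (Omega2 t).

Definition interface (Omega1 Omega2 : R -> set 'rV[R]_d) : set 'rV[R]_d.+1 :=
  [set z | gammat Omega1 Omega2 (tcoor z) (xcoor z) /\ tcoor z \in `]0, T[].

Definition subdomains (Omega1 Omega2 : R -> set 'rV[R]_d) :=
  forall t : R, t \in `[0, T] ->
  [/\ open (Omega1 t) /\ open (Omega2 t),
      Omega1 t `<=` Omega /\ Omega2 t `<=` Omega,
      Omega1 t `&` Omega2 t = set0 &
      Omega `<=` Omega1 t `|` Omega2 t `|` gammat Omega1 Omega2 t].

(* near each of its points and in suitable orthonormal coordinates z *m A, S is
   the graph of a Lipschitz function *)
Definition lipschitz_hypersurface (S : set 'rV[R]_d.+1) :=
  forall z, S z -> exists (O : set 'rV[R]_d.+1) (A : 'M[R]_d.+1)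
      (h : 'rV[R]_d -> R),
    [/\ open O /\ O z, A *m A^T = 1%:M, exists k, k.-lipschitz h &
        S `&` O = [set y | tcoor (y *m A) = h (xcoor (y *m A))] `&` O].

(* The density; its value on the interface, a null set of Q, is immaterial. *)
Definition density (Omega1 : R -> set 'rV[R]_d) (rho1 rho2 : R) (t : R)
    (x : 'rV[R]_d) : R :=
  if x \in Omega1 t then rho1 else rho2.

Definition LooQ (w : R -> vfield) :=
  (forall i, measurable_fun Q (fun z => vcomp (w (tcoor z)) i (xcoor z))) /\
  exists M, {ae (lebesgue_rV R d.+1), forall z, Q z ->
    `|w (tcoor z) (xcoor z)| <= M}.

Definition div_zero (w : R -> vfield) :=
  forall t : R, t \in `]0, T[ -> forall phi, Coo_0 Omega phi ->
    \int[mu]_(x in Omega) \sum_j w t x ord0 j * pderiv j phi x = 0.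

(* the material derivative of rho vanishes as a distribution on Q, div w being
   zero *)
Definition transported (w : R -> vfield) (rho : R -> 'rV[R]_d -> R) :=
  forall phi : 'rV[R]_d.+1 -> R, Coo_0 Q phi ->
    intQ (fun t x => rho t x * (pderiv ord0 phi (consrV (x, t)) +
      \sum_j w t x ord0 j * pderiv (lift ord0 j) phi (consrV (x, t)))) = 0.

Section material_derivative.
Context (w : R -> vfield) (rho : R -> 'rV[R]_d -> R).

Definition mdot u : R -> vfield := fun t x =>
  wdt u t x + \row_i \sum_j w t x ord0 j * wpderiv Omega j (vcomp (u t) i) x.

Definition D0 (phi : R -> vfield) := exists n (g : 'I_n -> R -> R) (f : 'I_n -> vfield),
  (forall k, Coo_0_itv T (g k) /\ C1_0_calV Omega (f k)) /\
  phi = fun t => \sum_(k < n) g k t *: f k.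

Definition D0_dense := forall v, X v -> forall e, 0 < e ->
  exists phi, D0 phi /\ normX (v - phi) < e.

Definition rhomul u : R -> vfield := fun t x => rho t x *: u t x.

(* l is the extension to X of the functional of D0 that defines the weak
   weighted material derivative of v *)
Definition is_rhodot v (l : (R -> vfield) -> R) :=
  bounded_functional X normX l /\
  forall phi, D0 phi -> l phi = - ipQ (rhomul v) (mdot phi).

Definition rhodot v : (R -> vfield) -> R := xget 0 (is_rhodot v).

Definition W v := X v /\ exists l, is_rhodot v l.

Definition normW v : R :=
  Num.sqrt (normX v ^+ 2 + dual_norm X normX (rhodot v) ^+ 2).

Definition V v := W v /\
  forall e, 0 < e -> exists u, U u /\ normW (v - u) < e.

(* The evaluation at t is bounded from (U, normW) to L^2(Omega)^d, so that it
   extends to a bounded operator on V, of which trace_at is the graph. *)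
Definition bounded_evaluation := forall t : R, t \in `[0, T] ->
  exists C, forall u z, U u -> value_at u t z -> normL2v Omega z <= C * normW u.

Definition trace_at v (t : R) (z : vfield) := L2v Omega z /\
  exists (u_ : nat -> R -> vfield) (z_ : nat -> vfield),
  [/\ forall n, U (u_ n) /\ value_at (u_ n) t (z_ n),
      (normW (u_ n - v)) @[n --> \oo] --> (0 : R) &
      (normL2v Omega (z_ n - z)) @[n --> \oo] --> (0 : R)].

Definition V0 v := V v /\ trace_at v 0 0.

Section problems.
Context (a : R -> vfield -> vfield -> R) (F : R -> vfield -> R).

Definition int_a u v : R :=
  \int[lebesgue_measure]_(t in `]0, T[) a t (u t) (v t).

Definition solves_star u :=
  V0 u /\ forall v, X v -> rhodot u v + int_a u v = pairing F v.

Definition solves_saddle u (p : R -> 'rV[R]_d -> R) :=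
  [/\ Utilde u, value_at u 0 0, L2I_L2_0 p,
      forall v, L2I_H1_0 v ->
        ipQ (rhomul (mdot u)) v + int_a u v
        - \int[lebesgue_measure]_(t in `]0, T[)
            ipL2 Omega (p t) (divergence Omega (v t))
        = pairing F v &
      forall q, L2I_L2_0 q ->
        \int[lebesgue_measure]_(t in `]0, T[)
          ipL2 Omega (q t) (divergence Omega (u t))
        = 0].

(* bilinearity of a t on calV x H1_0v *)
Definition bilinear_a := forall t : R, t \in `]0, T[ ->
  (forall v : vfield, H1_0v Omega v ->
     linear_on (calV Omega) (fun u : vfield => a t u v)) /\
  (forall u : vfield, calV Omega u -> linear_on (H1_0v Omega) (a t u)).

(* measurability for the Lebesgue sigma-algebra, i.e. up to a null set *)
Definition measurable_a := forall u v, X u -> L2I_H1_0 v ->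
  exists2 h : R -> R, measurable_fun (`]0, T[%classic : set R) h &
    {ae (@lebesgue_measure R), forall t : R, t \in `]0, T[ ->
      a t (u t) (v t) = h t}.

End problems.
End material_derivative.
End spacetime.

(* Main.v *)
Require Import Defs.
From HB Require Import structures.
From mathcomp Require Import all_boot all_order all_algebra.
From mathcomp Require Import finmap.
From mathcomp Require Import all_classical all_reals all_analysis.
From mathcomp Require Import measurable_realfun ring lra.

Set Implicit Arguments.
Unset Strict Implicit.
Unset Printing Implicit Defensive.
Import Order.TTheory GRing.Theory Num.Theory.
Import numFieldNormedType.Exports.
Local Open Scope classical_set_scope.
Local Open Scope ring_scope.

(** The velocity of a solution [(u, p)] has zero divergence, so that its
    pressure drops out against test paths in [calV] and [u] solves the reduced
    problem; conversely de Rham's theorem turns what the reduced problem leaves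
    in the full momentum equation into the gradient of a pressure.  The two
    problems must first be brought to the same form: in the reduced one the
    material derivative is the functional [rhodot], an extension by density of
    $\phi \mapsto -(\rho u, \dot\phi)$, while the full one contains the
    function $\rho \dot u$.

    That both agree when [u] has a square integrable time derivative
    ([rhodot_smooth]) is the integration by parts
    $$\frac{d}{dt} \int_\Omega \rho\, u \cdot f =
      \int_\Omega \rho\, \dot u \cdot f +
      \int_\Omega \rho\, u \cdot (\mathbf w \cdot \nabla) f,$$
    in the sense of distributions in time.  The density satisfies the transport
    equation as a distribution in space-time only, and [u] has a weak derivative
    with values in $L^2$ only, so neither can be differentiated in time inside
    the integral.  The transport equation, for products of test functions and
    then by density for products of elements of $H^1_0$ ([transport_H1_0]), is a
    statement about fixed fields; the time derivative of [u] is a statement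
    about fixed weights.  Doubling the time variable applies each where the
    other factor is frozen, with a mollifier between the two times, and lets
    the times merge at Lebesgue points ([transported_product_rule],
    [weighted_transport]).

    Existence.  For $u = u^*$ the residual
    $l_t = F(t) - (\rho \dot u(t), \cdot) - a(t; u(t), \cdot)$ is an element of
    $H^{-1}$ for each time, with norm square integrable in time
    ([residual_bound]), and the reduced problem says that
    $\int l_t(v(t))\,dt = 0$ for every path $v$ in [calV].  Testing with
    $\theta(t) e_n$, where $e_n$ runs through a dense sequence of [calV] and
    $\theta$ through bounded measurable functions, shows that $l_t$ vanishes on
    [calV] for almost every $t$, hence is the gradient of some $p(t)$.  The
    measurability of $p$ is Pettis' criterion for the norm of the gradient,
    which is a countable supremum of measurable functions of time
    ([pressure_exists]).  The initial condition passes from the trace, a limit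
    of values of smooth approximations, to the continuous representative of
    [u] ([initial_value]), which exists since [u] oscillates no more than the
    integral of the norm of its derivative ([continuous_representative]).

    Uniqueness.  The second equation, tested with the divergence of the
    velocity, shows that the velocity lies in [calV] at almost every time; after
    a change on a null set of times it solves the reduced problem
    ([solution_of_saddle]), hence is $u^*$.  Two pressures with the same
    velocity have gradients that agree at almost every time
    ([pressure_unique]).

    Fields are representatives of classes and the form $a$ is measurable in time
    only up to null sets.  The separability of the function spaces, obtained
    from an explicit countable family of smooth bumps ([bump_comb_dense]), is
    what reduces every statement about almost all times to countably many scalar
    ones. *)


(** * Sequences and seminorms *)

Section real_sequences.
Context (R : realType).
Implicit Types (u : nat -> R) (l b : R).

Lemma cvg_seqP u l : u n @[n --> \oo] --> l <->
  forall e, 0 < e -> exists n0, forall n, (n0 <= n)%N -> `|u n - l| < e.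
Proof.
split.
  move=> /cvgrPdist_lt h e /h [n0 _ hn]; exists n0 => n n0n.
  by rewrite distrC; exact: (hn n).
move=> h; apply/cvgrPdist_lt => e /h [n0 hn]; exists n0 => // n /= n0n.
by rewrite distrC; exact: (hn n).
Qed.

Lemma cvg_seq_le u l b : u n @[n --> \oo] --> l -> (forall n, u n <= b) -> l <= b.
Proof.
move=> /cvg_seqP h ub; rewrite leNgt; apply/negP => bl.
have lb0 : 0 < l - b by rewrite subr_gt0.
have [n0 /(_ _ (leqnn n0))] := h _ lb0.
by have := ub n0; rewrite ltr_norml => h1 /andP[h2 _]; lra.
Qed.

Lemma cvg_seq_norm u l : u n @[n --> \oo] --> l -> `|u n| @[n --> \oo] --> `|l|.
Proof.
move=> /cvg_seqP h; apply/cvg_seqP => e /h[n0 hn]; exists n0 => n /hn.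
by apply: le_lt_trans; exact: ler_dist_dist.
Qed.

Lemma cvg_seq_sqr u l : u n @[n --> \oo] --> l -> u n ^+ 2 @[n --> \oo] --> l ^+ 2.
Proof. by move=> h; under eq_fun do rewrite expr2; rewrite expr2; exact: cvgM. Qed.

Lemma exists_natSinv_lt (e : R) : 0 < e -> exists m : nat, m.+1%:R^-1 < e.
Proof.
move=> e0; have := near_infty_natSinv_lt (PosNum e0).
by move=> [M _ /(_ M)/= /(_ (leqnn M)) h]; exists M.
Qed.

Lemma le_eps (a b : R) : (forall e, 0 < e -> a <= b + e) -> a <= b.
Proof. by move=> h; apply/ler_addgt0Pr => e /h. Qed.

End real_sequences.


Section semi_inner.
Context (R : realType) (E : lmodType R) (S : set E).

Definition subspace_on := S 0 /\ forall c u v, S u -> S v -> S (c *: u + v).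

(** Vectors are representatives of classes of functions, so that norms are only
    seminorms, and they are controlled only on a set [S], where the integrals
    that define them converge. *)
Definition seminormed (N : E -> R) :=
  [/\ subspace_on, forall c u, S u -> N (c *: u) = `|c| * N u,
      forall u v, S u -> S v -> N (u + v) <= N u + N v & forall u, 0 <= N u].

Hypothesis sS : subspace_on.

Lemma subspaceD u v : S u -> S v -> S (u + v).
Proof. by move=> Su Sv; rewrite -(scale1r u); exact: sS.2. Qed.

Lemma subspaceZ c u : S u -> S (c *: u).
Proof. by move=> Su; rewrite -[_ *: _]addr0; apply: sS.2 => //; exact: sS.1. Qed.

Lemma subspaceB u v : S u -> S v -> S (u - v).
Proof. by move=> Su Sv; rewrite -scaleN1r addrC; exact: sS.2. Qed.

Lemma subspace_sum n (e : 'I_n -> E) : (forall k, S (e k)) -> S (\sum_(k < n) e k).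
Proof.
by move=> Se; apply: (big_ind S) => // [|u v]; [exact: sS.1|exact: subspaceD].
Qed.

Variable ip : E -> E -> R.

Definition semi_inner := [/\ forall c u v z, S u -> S v -> S z ->
    ip (c *: u + v) z = c * ip u z + ip v z,
  forall u v, S u -> S v -> ip u v = ip v u &
  forall u, 0 <= ip u u].

Hypothesis ipP : semi_inner.

Let N u := Num.sqrt (ip u u).

Lemma ipDl u v z : S u -> S v -> S z -> ip (u + v) z = ip u z + ip v z.
Proof. by case: ipP => h _ _ Su Sv Sz; rewrite -(scale1r u) h// mul1r scale1r. Qed.

Lemma ipZl c u z : S u -> S z -> ip (c *: u) z = c * ip u z.
Proof.
case: ipP => h _ _ Su Sz; have S0 := sS.1.
have := h 1 0 0 z S0 S0 Sz; rewrite scale1r mul1r addr0.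
move=> /eqP; rewrite -subr_eq0 opprD addNKr oppr_eq0 => /eqP ip0.
by rewrite -[c *: u]addr0 h// ip0 addr0.
Qed.

Lemma ipBl u v z : S u -> S v -> S z -> ip (u - v) z = ip u z - ip v z.
Proof.
move=> Su Sv Sz; rewrite -(scaleN1r v) ipDl ?ipZl ?mulN1r//; exact: subspaceZ.
Qed.

Lemma ipC u v : S u -> S v -> ip u v = ip v u.
Proof. by case: ipP => _ h _; exact: h. Qed.

Lemma ipBr u v z : S u -> S v -> S z -> ip z (u - v) = ip z u - ip z v.
Proof.
by move=> Su Sv Sz; rewrite ipC ?ipBl 1?(ipC Su) 1?(ipC Sv)//; exact: subspaceB.
Qed.

Lemma ipDr u v z : S u -> S v -> S z -> ip z (u + v) = ip z u + ip z v.
Proof.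
by move=> Su Sv Sz; rewrite ipC ?ipDl 1?(ipC Su) 1?(ipC Sv)//; exact: subspaceD.
Qed.

Lemma ipZr c u z : S u -> S z -> ip z (c *: u) = c * ip z u.
Proof. by move=> Su Sz; rewrite ipC ?ipZl 1?(ipC Su)//; exact: subspaceZ. Qed.

Lemma sqr_ipnorm u : N u ^+ 2 = ip u u.
Proof. by case: ipP => _ _ h; rewrite sqr_sqrtr. Qed.

Lemma ipnorm_ge0 u : 0 <= N u. Proof. exact: sqrtr_ge0. Qed.

(** The discriminant argument also covers a vector [v] of norm zero, for which
    the quadratic polynomial degenerates to an affine one that is bounded from
    one side. *)
Lemma CauchySchwarz_ip u v : S u -> S v -> `|ip u v| <= N u * N v.
Proof.
move=> Su Sv.
have key c : - (2 * c * ip u v) <= N u ^+ 2 + c ^+ 2 * N v ^+ 2.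
  case: (ipP) => _ _ /(_ (c *: v + u)).
  have Scv : S (c *: v) by exact: subspaceZ.
  rewrite ipDl ?ipDr ?ipZl ?ipZr// ?sqr_ipnorm 1?(ipC Sv Su); last exact: subspaceD.
  by rewrite -!sqr_ipnorm; nra.
have [Nv0|Nv0] := eqVneq (N v) 0.
  have [->|ip0] := eqVneq (ip u v) 0; first by rewrite normr0 mulr_ge0// ipnorm_ge0.
  have := key (- ((N u ^+ 2 + 1) / ip u v)).
  rewrite Nv0 expr0n mulr0 addr0 !mulrN mulNr opprK mulrA divfK//.
  by have := exprn_ge0 2 (ipnorm_ge0 u); rewrite /= -/(N u); lra.
have Nvp : 0 < N v ^+ 2 by rewrite exprn_even_gt0.
rewrite -(ler_pXn2r (n := 2))// ?nnegrE ?mulr_ge0 ?ipnorm_ge0// exprMn.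
rewrite real_normK ?num_real//.
have := key (- (ip u v / N v ^+ 2)).
rewrite -(ler_pM2r Nvp) mulrDl sqrrN expr_div_n.
rewrite (_ : - _ * _ = 2 * ip u v ^+ 2); last by field.
have eqn (x y z : R) : z != 0 -> (x + y / z ^+ 2 * z) * z = x * z + y.
  by move=> z0; field.
by rewrite eqn ?sqrf_eq0//; lra.
Qed.

Lemma ip_seminormed : seminormed N.
Proof.
split=> //; last by move=> u; exact: sqrtr_ge0.
  move=> c u Su; rewrite /N ipZl// ?ipZr//; last exact: subspaceZ.
  by rewrite mulrA -expr2 sqrtrM ?sqr_ge0// sqrtr_sqr.
move=> u v Su Sv.
rewrite -(ler_pXn2r (n := 2))// ?nnegrE ?addr_ge0 ?ipnorm_ge0//.
have := CauchySchwarz_ip Su Sv => /ler_normlW cs.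
rewrite sqr_ipnorm ipDl ?ipDr//; last exact: subspaceD.
by rewrite sqrrD !sqr_ipnorm (ipC Sv Su); lra.
Qed.

End semi_inner.

Section seminormed_theory.
Context (R : realType) (E : lmodType R) (S : set E) (N : E -> R).
Hypothesis SN : seminormed S N.

Lemma seminormed_sub : subspace_on S. Proof. by case: SN. Qed.

Lemma seminormZ c u : S u -> N (c *: u) = `|c| * N u. Proof. by case: SN => _ + _ _; exact. Qed.

Lemma seminorm_ge0 u : 0 <= N u. Proof. by case: SN. Qed.

Lemma seminorm0 : N 0 = 0.
Proof.
by rewrite -(scale0r (0 : E)) seminormZ ?normr0 ?mul0r//; exact: seminormed_sub.1.
Qed.

Lemma seminormN u : S u -> N (- u) = N u.
Proof. by move=> Su; rewrite -scaleN1r seminormZ// normrN1 mul1r. Qed.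

Lemma seminormD u v : S u -> S v -> N (u + v) <= N u + N v.
Proof. by case: SN => _ _ + _; exact. Qed.

Lemma seminormB u v : S u -> S v -> N (u - v) <= N u + N v.
Proof.
move=> Su Sv; rewrite -(seminormN Sv); apply: seminormD => //.
by rewrite -scaleN1r; exact: (subspaceZ seminormed_sub).
Qed.

Lemma seminormBC u v : S u -> S v -> N (u - v) = N (v - u).
Proof. by move=> Su Sv; rewrite -seminormN ?opprB//; exact: (subspaceB seminormed_sub). Qed.

Lemma seminorm_triangle u v w : S u -> S v -> S w -> N (u - w) <= N (u - v) + N (v - w).
Proof.
move=> Su Sv Sw; rewrite (_ : u - w = (u - v) + (v - w)); last by rewrite addrA subrK.
by apply: seminormD; exact: (subspaceB seminormed_sub).
Qed.

Lemma seminorm_dist u v : S u -> S v -> `|N u - N v| <= N (u - v).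
Proof.
move=> Su Sv; have Suv := subspaceB seminormed_sub Su Sv.
have h1 : N u <= N (u - v) + N v by rewrite -{1}(subrK v u); exact: seminormD.
have h2 : N v <= N (u - v) + N u.
  rewrite seminormBC// -{1}(subrK u v); apply: seminormD => //.
  exact: (subspaceB seminormed_sub).
by rewrite ler_norml; apply/andP; split; lra.
Qed.

Lemma seminormed_sub_on S' : S' `<=` S -> subspace_on S' -> seminormed S' N.
Proof.
by case: SN => _ h1 h2 h3 sub sS'; split=> // *; [apply: h1|apply: h2]; auto.
Qed.

(** For each point of the dense sequence of the ambient space and each scale,
    one element of the subset is chosen nearby if there is any. The ambient
    space enters only through the distances [delta k] to its points. *)
Lemma separable_subset (K : countType) (delta : K -> E -> R) :
  (forall u, S u -> forall e, 0 < e -> exists k, delta k u < e) ->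
  (forall k u v, S u -> S v -> N (u - v) <= delta k u + delta k v) ->
  exists c : nat -> E, (forall n, S (c n)) /\
    forall u, S u -> forall e, 0 < e -> exists n, N (u - c n) < e.
Proof.
move=> dense tri; have S0 := seminormed_sub.1.
have /choice[c hc] : forall km : K * nat, exists c, S c /\
    ((exists c', S c' /\ delta km.1 c' < km.2.+1%:R^-1) ->
     delta km.1 c < km.2.+1%:R^-1).
  move=> [k m]; have [[c' [Sc' h]]|nh] := pselect (exists c', S c' /\ delta k c' < m.+1%:R^-1).
    by exists c'.
  by exists 0; split=> // h; exfalso; exact: nh h.
exists (fun n => if @choice.unpickle (K * nat)%type n is Some km then c km else 0); split.
  by move=> n; case: choice.unpickle => [km|//]; exact: (hc km).1.
move=> u Su e e0.
have [m me] := exists_natSinv_lt (divr_gt0 e0 (ltr0Sn R 1)).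
have m0 : (0 : R) < m.+1%:R^-1 by rewrite invr_gt0.
have [k ku] := dense _ Su _ m0.
exists (choice.pickle (k, m)); rewrite choice.pickleK.
have h := (hc (k, m)).2 (ex_intro _ u (conj Su ku)); rewrite /= in h.
rewrite (le_lt_trans (tri k _ _ Su (hc (k, m)).1))// (splitr e).
by rewrite ltrD// ?(lt_trans ku)// (lt_trans h).
Qed.

End seminormed_theory.

(** * Integrals and square integrable functions *)

Section integral_lemmas.
Context d (T : measurableType d) (R : realType).
Variables (mu : {measure set T -> \bar R}) (D : set T).
Hypothesis mD : measurable D.
Import HBNNSimple.

(** An integral is a supremum over simple functions, which can be restricted to
    the complement of the null set where [f] and [g] differ. The integrands [a
    t (u t) (v t)] are only measurable up to such a set. *)
Lemma ge0_ae_eq_integral_nonmeasurable (f g : T -> \bar R) :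
  (forall x, 0 <= f x)%E -> (forall x, 0 <= g x)%E -> measurable_fun setT g ->
  {ae mu, forall x, f x = g x} ->
  (\int[mu]_x f x = \int[mu]_x g x)%E.
Proof.
move=> f0 g0 mg [N [mN N0 subN]].
have fg x : ~ N x -> f x = g x by move=> Nx; apply: contrapT => h; apply: Nx; exact: subN.
rewrite [RHS](ge0_negligible_integral mN)//.
apply/eqP; rewrite eq_le; apply/andP; split.
  rewrite ge0_integralTE//; apply: ge_ereal_sup => _ [h /= hf <-].
  rewrite -integralT_nnsfun (ge0_negligible_integral mN)//; last first.
  - by move=> x _; rewrite lee_fin.
  - exact/measurable_EFinP.
  apply: ge0_le_integral => //.
  - exact: measurableD.
  - by move=> x _; rewrite lee_fin.
  - apply/measurable_funTS; exact/measurable_EFinP.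
  - exact: measurable_funTS.
  - by move=> x [_ Nx]; rewrite -fg.
rewrite setTD integral_mkcond ge0_integralTE; last first.
  by move=> x; rewrite patchE; case: ifP.
rewrite ge0_integralTE//; apply: le_ereal_sup => _ [h /= hf <-]; exists h => //= x.
have := hf x; rewrite patchE; case: ifPn => [|_ h0].
  by rewrite inE /= => Nx; rewrite fg.
by rewrite (le_trans h0).
Qed.

Lemma ae_eq_integral_nonmeasurable (f g : T -> \bar R) : measurable_fun D g ->
  {ae mu, forall x, D x -> f x = g x} ->
  (\int[mu]_(x in D) f x = \int[mu]_(x in D) g x)%E.
Proof.
move=> mg fg; rewrite integralE [RHS]integralE; congr (_ - _)%E.
  rewrite integral_mkcond [RHS]integral_mkcond.
  apply: ge0_ae_eq_integral_nonmeasurable.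
  - by move=> x; rewrite patchE; case: ifP.
  - by move=> x; rewrite patchE; case: ifP.
  - exact/(measurable_restrictT _ mD).1/measurable_funepos.
  - apply: filterS fg => x fg; rewrite !patchE; case: ifPn => //.
    by rewrite inE => Dx; rewrite !funeposE fg.
rewrite integral_mkcond [RHS]integral_mkcond.
apply: ge0_ae_eq_integral_nonmeasurable.
- by move=> x; rewrite patchE; case: ifP.
- by move=> x; rewrite patchE; case: ifP.
- exact/(measurable_restrictT _ mD).1/measurable_funeneg.
- apply: filterS fg => x fg; rewrite !patchE; case: ifPn => //.
  by rewrite inE => Dx; rewrite !funenegE fg.
Qed.

Lemma ae_eq_Rintegral (f g : T -> R) : measurable_fun D g ->
  {ae mu, forall x, D x -> f x = g x} ->
  \int[mu]_(x in D) f x = \int[mu]_(x in D) g x.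
Proof.
move=> mg fg; congr fine; apply: ae_eq_integral_nonmeasurable.
  exact/measurable_EFinP.
by apply: filterS fg => x fg Dx; rewrite fg.
Qed.

Lemma integrable_measurable (f : T -> R) :
  mu.-integrable D (EFin \o f) -> measurable_fun D f.
Proof. by move=> /(@measurable_int _ _ _ mu)/measurable_EFinP. Qed.

Lemma integrable_le (f g : T -> R) : mu.-integrable D (EFin \o g) ->
  measurable_fun D f -> (forall x, D x -> `|f x| <= g x) ->
  mu.-integrable D (EFin \o f).
Proof.
move=> ig mf fg; apply: le_integrable ig => //.
  exact/measurable_EFinP.
move=> x Dx /=; rewrite lee_fin (le_trans (fg _ Dx))//.
by rewrite ler_norm.
Qed.

Lemma integrable_lin (c : R) (f g : T -> R) : mu.-integrable D (EFin \o f) ->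
  mu.-integrable D (EFin \o g) -> mu.-integrable D (EFin \o (fun x => c * f x + g x)).
Proof.
move=> f1 g1; rewrite (_ : _ \o _ =
    (fun x => c%:E * (EFin \o f) x)%E \+ (EFin \o g))//.
by apply: integrableD => //; exact: integrableZl.
Qed.

Lemma Rintegral_lin (c : R) (f g : T -> R) : mu.-integrable D (EFin \o f) ->
  mu.-integrable D (EFin \o g) ->
  \int[mu]_(x in D) (c * f x + g x) =
  c * \int[mu]_(x in D) f x + \int[mu]_(x in D) g x.
Proof.
move=> f1 g1; rewrite RintegralD// ?RintegralZl//.
exact: (@integrableZl _ _ _ mu D mD c (EFin \o f)).
Qed.

Lemma integrableD_fin (f g : T -> R) : mu.-integrable D (EFin \o f) ->
  mu.-integrable D (EFin \o g) -> mu.-integrable D (EFin \o (fun x => f x + g x)).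
Proof.
move=> f1 g1; rewrite (_ : _ \o _ = (EFin \o f) \+ (EFin \o g))%E//.
exact: integrableD.
Qed.

Lemma integrableN_fin (f : T -> R) : mu.-integrable D (EFin \o f) ->
  mu.-integrable D (EFin \o (fun x => - f x)).
Proof. by move=> f1; exact: (@integrableN _ _ _ mu D (EFin \o f)). Qed.

Lemma integrableZ_fin c (f : T -> R) : mu.-integrable D (EFin \o f) ->
  mu.-integrable D (EFin \o (fun x => c * f x)).
Proof. by move=> f1; exact: (@integrableZl _ _ _ mu D mD c (EFin \o f)). Qed.

Lemma integrable_sum_fin (I : Type) (s : seq I) (f : I -> T -> R) :
  (forall i, mu.-integrable D (EFin \o f i)) ->
  mu.-integrable D (EFin \o (fun x => \sum_(i <- s) f i x)).
Proof.
move=> fi; elim: s => [|i s IH].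
  rewrite (_ : _ \o _ = cst 0%E); first exact: integrable0.
  by apply/funext => x /=; rewrite big_nil.
rewrite (_ : _ \o _ = (EFin \o (fun x => f i x + \sum_(i <- s) f i x))).
  exact: integrableD_fin.
by apply/funext => x /=; rewrite big_cons.
Qed.

Lemma Rintegral_sum (I : Type) (s : seq I) (f : I -> T -> R) :
  (forall i, mu.-integrable D (EFin \o f i)) ->
  \int[mu]_(x in D) (\sum_(i <- s) f i x) = \sum_(i <- s) \int[mu]_(x in D) f i x.
Proof.
move=> fi; elim: s => [|i s IH].
  rewrite big_nil; under eq_Rintegral do rewrite big_nil.
  by rewrite Rintegral_cst// mul0r.
rewrite big_cons -IH -RintegralD//; last exact: integrable_sum_fin.
by apply: eq_Rintegral => x _; rewrite big_cons.
Qed.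

Lemma Rintegral_norm_le (f g : T -> R) : mu.-integrable D (EFin \o g) ->
  mu.-integrable D (EFin \o f) -> (forall x, D x -> `|f x| <= g x) ->
  `|\int[mu]_(x in D) f x| <= \int[mu]_(x in D) g x.
Proof.
move=> ig jf fg; apply: le_trans (le_normr_Rintegral mD jf) _.
by apply: le_Rintegral => //; exact: (integrable_norm jf).
Qed.

Lemma EFin_Rintegral (f : T -> R) : mu.-integrable D (EFin \o f) ->
  (\int[mu]_(x in D) f x)%:E = (\int[mu]_(x in D) (f x)%:E)%E.
Proof. by move=> fi; rewrite fineK//; exact: integrable_fin_num. Qed.

Lemma Rintegral_eq0_ae (f : T -> R) : mu.-integrable D (EFin \o f) ->
  (forall x, D x -> 0 <= f x) -> \int[mu]_(x in D) f x = 0 ->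
  {ae mu, forall x, D x -> f x = 0}.
Proof.
move=> fi f0 if0'; have := congr1 EFin if0'; rewrite EFin_Rintegral// => if0.
have h : (\int[mu]_(x in D) `|(EFin \o f) x| = 0)%E.
  rewrite -[RHS]if0; apply: eq_integral => x; rewrite inE => Dx.
  by rewrite gee0_abs// lee_fin f0.
have /ae_eq_integral_abs := h; move=> /(_ mD (measurable_int _ fi)).
by apply: filterS => x /= h1 Dx; move: (h1 Dx) => [].
Qed.

End integral_lemmas.

Section L2_space.
Context d (T : measurableType d) (R : realType).
Variables (mu : {measure set T -> \bar R}) (D : set T).
Implicit Types (f g h m : T -> R) (c e M : R).

Definition sqint (f : T -> R) := measurable_fun D f /\
  mu.-integrable D (fun x => (f x ^+ 2)%:E).

Definition ipD (f g : T -> R) := \int[mu]_(x in D) (f x * g x).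

Definition norm2 f := Num.sqrt (ipD f f).

Hypothesis mD : measurable D.

Lemma sqint_measurable f : sqint f -> measurable_fun D f. Proof. by case. Qed.

Lemma integrable_mul f g : sqint f -> sqint g ->
  mu.-integrable D (EFin \o (fun x => f x * g x)).
Proof.
move=> [mf f2] [mg g2].
apply: (@integrable_le _ _ _ mu D mD _ (fun x => 1 * f x ^+ 2 + g x ^+ 2)).
- exact: integrable_lin.
- exact: measurable_funM.
- move=> x _; rewrite normrM mul1r -(real_normK (num_real (f x))).
  rewrite -(real_normK (num_real (g x))).
  by have := sqr_ge0 (`|f x| - `|g x|); have := sqr_ge0 (`|f x| + `|g x|); nra.
Qed.

Lemma integrable_sqr f : sqint f -> mu.-integrable D (EFin \o (fun x => f x * f x)).
Proof. by move=> L; exact: integrable_mul. Qed.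

Lemma sqint_le (f g : T -> R) : sqint g -> measurable_fun D f ->
  (forall x, D x -> `|f x| <= `|g x|) -> sqint f.
Proof.
move=> [mg g2] mf fg; split => //.
apply: (@integrable_le _ _ _ mu D mD (fun x => f x ^+ 2) (fun x => g x ^+ 2)) => //.
- exact: measurable_funX.
- move=> x Dx; rewrite normrX -(real_normK (num_real (g x))).
  by rewrite ler_pXn2r// ?nnegrE// fg.
Qed.

Lemma sqint0 : sqint 0.
Proof.
split; first exact: (@measurable_cst _ _ _ _ D (0 : R)).
rewrite (_ : (fun _ => _) = cst 0%E); first exact: integrable0.
by apply/funext => x; rewrite /GRing.zero/= expr0n.
Qed.

Lemma sqint_lin c f g : sqint f -> sqint g -> sqint (c *: f + g).
Proof.
move=> Lf Lg; have [mf f2] := Lf; have [mg g2] := Lg.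
split; first by apply: measurable_funD => //; exact: measurable_funM.
have h := integrable_lin mD (c ^+ 2) f2 (integrable_lin mD (2 * c) (integrable_mul Lf Lg) g2).
apply: eq_integrable h => // x _ /=; congr EFin.
rewrite [RHS](_ : _ = (c * f x + g x) ^+ 2)//.
by ring.
Qed.

Lemma sqint_subspace : subspace_on sqint.
Proof. by split; [exact: sqint0|exact: sqint_lin]. Qed.

Lemma ipD_semi_inner : semi_inner sqint ipD.
Proof.
split.
- move=> c u v z Su Sv Sz; rewrite /ipD -Rintegral_lin//; last 2 first.
  + exact: integrable_mul.
  + exact: integrable_mul.
  apply: eq_Rintegral => x _.
  by rewrite [LHS](_ : _ = (c * u x + v x) * z x)//; ring.
- by move=> u v _ _; apply: eq_Rintegral => x _; rewrite mulrC.
- by move=> u; apply: Rintegral_ge0 => x _; rewrite -expr2 sqr_ge0.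
Qed.

Lemma norm2_seminormed : seminormed sqint norm2.
Proof. exact: (ip_seminormed sqint_subspace ipD_semi_inner). Qed.

Lemma sqr_norm2 f : norm2 f ^+ 2 = ipD f f.
Proof. by rewrite sqr_sqrtr// Rintegral_ge0// => x _; rewrite -expr2 sqr_ge0. Qed.

Lemma CauchySchwarz_L2 f g : sqint f -> sqint g -> `|ipD f g| <= norm2 f * norm2 g.
Proof. exact: (CauchySchwarz_ip sqint_subspace ipD_semi_inner). Qed.

Lemma norm2_eq0_ae f : sqint f -> norm2 f = 0 -> {ae mu, forall x, D x -> f x = 0}.
Proof.
move=> Lf /(congr1 (fun x => x ^+ 2)); rewrite sqr_norm2 expr0n => /= f0.
have := Rintegral_eq0_ae mD (integrable_sqr Lf) _ f0.
move=> /(_ (fun x _ => _)) h; have {}h := h (fun x => ltac:(by rewrite -expr2 sqr_ge0)).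
by apply: filterS h => x h Dx; have /eqP := h Dx; rewrite mulf_eq0 orbb => /eqP.
Qed.

Lemma ipD_ae f f' g g' : sqint f' -> sqint g' ->
  {ae mu, forall x, D x -> f x = f' x} -> {ae mu, forall x, D x -> g x = g' x} ->
  ipD f g = ipD f' g'.
Proof.
move=> [mf _] [mg _] ff gg; apply: ae_eq_Rintegral => //.
  exact: measurable_funM.
by apply: filterS2 ff gg => x ff gg Dx; rewrite ff// gg.
Qed.

Lemma norm2_ae f g : sqint g -> {ae mu, forall x, D x -> f x = g x} -> norm2 f = norm2 g.
Proof. by move=> Lg fg; rewrite /norm2 (ipD_ae Lg Lg). Qed.

Lemma sqint_mul_bounded m M f : measurable_fun D m -> (forall x, D x -> `|m x| <= M) ->
  sqint f -> sqint (fun x => m x * f x) /\ norm2 (fun x => m x * f x) <= M * norm2 f.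
Proof.
move=> mm mM Lf; have [mf f2] := Lf.
have [[x0 Dx0]|D0] := pselect (D !=set0); last first.
  have {}D0 : D = set0 by apply/eqP; apply: contra_notT D0 => /set0P.
  rewrite /norm2 /ipD /sqint {}D0; split.
    split; first exact: measurable_fun_set0.
    by apply: integrable_set0.
  by rewrite !Rintegral_set0 sqrtr0 mulr0.
have M0 : 0 <= M by exact: le_trans (mM _ Dx0).
have Lm : sqint (fun x => m x * f x).
  apply: (@sqint_le _ (M *: f)).
  - by rewrite -[M *: f]addr0; apply: sqint_lin => //; exact: sqint0.
  - exact: measurable_funM.
  - move=> x Dx; rewrite (_ : (M *: f) x = M * f x)// !normrM ler_wpM2r//.
    by rewrite (le_trans (mM _ Dx))// ler_norm.
split => //; rewrite -(ler_pXn2r (n := 2))// ?nnegrE ?mulr_ge0 ?sqrtr_ge0//.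
rewrite exprMn sqr_norm2 sqr_norm2 /ipD -(RintegralZl _ mD (integrable_sqr Lf)).
apply: le_Rintegral => //; first exact: integrable_mul.
  by apply: integrableZ_fin => //; exact: integrable_mul.
move=> x Dx; rewrite mulrACA -!expr2 ler_wpM2r ?sqr_ge0//.
by rewrite -(real_normK (num_real (m x))) ler_pXn2r// ?nnegrE// mM.
Qed.

Section finite.
Hypothesis fD : (mu D < +oo)%E.

Lemma integrable_bounded (f : T -> R) M : measurable_fun D f ->
  (forall x, D x -> `|f x| <= M) -> mu.-integrable D (EFin \o f).
Proof.
move=> mf fM; apply: measurable_bounded_integrable => //.
by exists M; split; [exact: num_real|move=> r Mr x Dx; rewrite /= (le_trans (fM _ Dx))// ltW].
Qed.

Lemma sqint_bounded f M : measurable_fun D f -> (forall x, D x -> `|f x| <= M) -> sqint f.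
Proof.
move=> mf fM; split=> //; apply: (@integrable_bounded (fun x => f x ^+ 2) (M ^+ 2)).
  exact: measurable_funX.
move=> x Dx; rewrite normrX ler_pXn2r ?nnegrE//; first exact: fM.
exact: le_trans (fM _ Dx).
Qed.

Lemma sqint_cst c : sqint (cst c).
Proof. by apply: (@sqint_bounded _ `|c|). Qed.

Lemma sqint_integrable f : sqint f -> mu.-integrable D (EFin \o f).
Proof.
move=> Lf; have := integrable_mul (sqint_cst 1) Lf.
by apply: eq_integrable => // x _ /=; rewrite mul1r.
Qed.

Lemma sqint_dominated (f_ : nat -> T -> R) f h : (forall n, measurable_fun D (f_ n)) ->
  sqint h -> (forall n x, D x -> `|f_ n x| <= `|h x|) ->
  (forall x, D x -> f_ n x @[n --> \oo] --> f x) ->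
  sqint f /\ forall e, 0 < e -> exists n0, forall n, (n0 <= n)%N -> norm2 (f_ n - f) < e.
Proof.
move=> mf_ Lh fh ff.
have mf : measurable_fun D f by exact: measurable_fun_cvg mf_ ff.
have fh' x : D x -> `|f x| <= `|h x|.
  by move=> Dx; apply: (cvg_seq_le (cvg_seq_norm (ff _ Dx))) => n; exact: fh.
have Lf : sqint f by exact: sqint_le Lh mf fh'.
split => // e e0.
pose g_ n x := ((f_ n x - f x) ^+ 2)%:E.
have mg n : measurable_fun D (g_ n).
  by apply/measurable_EFinP; apply: measurable_funX; exact: measurable_funB.
have ih : mu.-integrable D (fun x => (4 * h x ^+ 2)%:E).
  by apply: (@integrableZ_fin _ _ _ mu D mD 4 (fun x => h x ^+ 2)); case: Lh.
have [] := @dominated_convergence _ _ _ mu D mD g_ (cst 0%E) (fun x => (4 * h x ^+ 2)%:E) mg.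
- exact: measurable_cst.
- apply: aeW => x Dx; rewrite /g_; apply: cvg_EFin; first exact: nearW.
  rewrite (_ : fine \o _ = fun n => (f_ n x - f x) ^+ 2)//.
  rewrite [X in _ --> X](_ : _ = (f x - f x) ^+ 2) /=; last by rewrite subrr expr0n.
  by apply: cvg_seq_sqr; apply: cvgB; [exact: ff|exact: cvg_cst].
- exact: ih.
- apply: aeW => x n Dx; rewrite /g_ lee_fin ger0_norm ?sqr_ge0//.
  rewrite -(real_normK (num_real (h x))) -(real_normK (num_real (_ - _))).
  have := ler_normB (f_ n x) (f x); have := fh n x Dx; have := fh' x Dx.
  have := normr_ge0 (f_ n x - f x); have := normr_ge0 (h x).
  by nra.
- move=> _ _; rewrite integral_cst// mul0e => /fine_cvgP[fin_ cvg_].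
  have e20 : 0 < e ^+ 2 by rewrite exprn_gt0.
  move/cvgr0Pnorm_lt : cvg_ => /(_ _ e20)[n0 _ hn0]; exists n0 => n /= n0n.
  rewrite -(ltr_pXn2r (n := 2))// ?nnegrE ?sqrtr_ge0 ?ltW// sqr_norm2.
  apply: le_lt_trans (hn0 n n0n); rewrite ger0_norm; last first.
    by apply: fine_ge0; apply: integral_ge0 => x _; rewrite lee_fin sqr_ge0.
  by rewrite le_eqVlt; apply/orP; left; apply/eqP; congr fine.
Qed.

End finite.
End L2_space.

Section L2_complete.
Context d (T : measurableType d) (R : realType).
Variables (mu : {measure set T -> \bar R}) (D : set T).
Hypotheses (mD : measurable D) (fD : (mu D < +oo)%E).
Implicit Types (f g h m : T -> R) (c e M : R).
Local Notation sqint := (sqint mu D).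
Local Notation norm2 := (norm2 mu D).

(** Bounds in norm pass to limits almost everywhere, which identifies the limit
    of a Cauchy sequence. *)
Lemma norm2_fatou (f_ : nat -> T -> R) f g b : (forall n, sqint (f_ n)) ->
  measurable_fun D f -> sqint g ->
  {ae mu, forall x, D x -> f_ n x @[n --> \oo] --> f x} ->
  (forall n, norm2 (f_ n - g) <= b) -> sqint (f - g) /\ norm2 (f - g) <= b.
Proof.
move=> Lf mf Lg ff fb.
have b0 : 0 <= b by apply: le_trans (fb O); exact: sqrtr_ge0.
have SN := norm2_seminormed mu mD.
have Lfg n : sqint (f_ n - g) by apply: (subspaceB (sqint_subspace mu mD)).
pose g_ n x := ((f_ n x - g x) ^+ 2)%:E.
have mg n : measurable_fun D (g_ n).
  apply/measurable_EFinP; apply: measurable_funX; apply: measurable_funB.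
    exact: (sqint_measurable (Lf n)).
  exact: (sqint_measurable Lg).
have mfg : measurable_fun D (fun x => ((f x - g x) ^+ 2)%:E).
  apply/measurable_EFinP; apply: measurable_funX; apply: measurable_funB => //.
  exact: (sqint_measurable Lg).
have le2 : (\int[mu]_(x in D) ((f x - g x) ^+ 2)%:E <= (b ^+ 2)%:E)%E.
  have := fatou mu mD mg (fun n x _ => ltac:(by rewrite /g_ lee_fin sqr_ge0)).
  set I := (X in (X <= _)%E); have -> : I = (\int[mu]_(x in D) ((f x - g x) ^+ 2)%:E)%E.
    apply: ae_eq_integral_nonmeasurable => //; apply: filterS ff => x /= ff Dx.
    apply: (@cvg_limn_einf_sup R (fun n => g_ n x) ((f x - g x) ^+ 2)%:E _).1.
    apply: cvg_EFin; first exact: nearW.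
    rewrite (_ : fine \o _ = fun n => (f_ n x - g x) ^+ 2)//.
    by apply: cvg_seq_sqr; apply: cvgB; [exact: ff|exact: cvg_cst].
  move=> /le_trans; apply; rewrite limn_einf_lim; apply: lime_le.
    exact: is_cvg_einfs.
  apply: nearW => n; apply: (@le_trans _ _ (\int[mu]_(x in D) g_ n x)%E).
    by apply: ereal_inf_lbound; exists n => /=.
  have -> : g_ n = (EFin \o (fun x => (f_ n - g) x * (f_ n - g) x)).
    by apply/funext => x; rewrite /g_ expr2.
  rewrite -(EFin_Rintegral mD (integrable_sqr mD (Lfg n))).
rewrite lee_fin -/(ipD mu D (f_ n - g) (f_ n - g)) -sqr_norm2.
by rewrite ler_pXn2r ?nnegrE ?sqrtr_ge0.
have L : sqint (f - g).
  split; first by apply: measurable_funB => //; exact: (sqint_measurable Lg).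
  apply/integrableP; split; first exact: mfg.
  apply: (@le_lt_trans _ _ (b ^+ 2)%:E); last by rewrite ltry.
  rewrite (le_trans _ le2)// le_eqVlt; apply/orP; left; apply/eqP.
  by apply: eq_integral => x _; rewrite gee0_abs// lee_fin sqr_ge0.
split => //; rewrite -(ler_pXn2r (n := 2))// ?nnegrE ?sqrtr_ge0// sqr_norm2.
by rewrite -lee_fin EFin_Rintegral//; exact: integrable_mul.
Qed.

(** Riesz--Fischer.  The space having finite measure, the increments of a fast
    Cauchy subsequence are summable in $L^1$, hence almost everywhere. *)
Lemma L2_complete (f_ : nat -> T -> R) : (forall n, sqint (f_ n)) ->
  (forall e, 0 < e -> exists n0, forall n m : nat, (n0 <= n)%N -> (n0 <= m)%N ->
    norm2 (f_ n - f_ m) < e) ->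
  exists2 f, sqint f & forall e, 0 < e -> exists n0, forall n, (n0 <= n)%N ->
    norm2 (f_ n - f) < e.
Proof.
move=> Lf cauchy; have SN := norm2_seminormed mu mD.
have sub := sqint_subspace mu mD.
have half0 j : (0 : R) < 2^-1 ^+ j by rewrite exprn_gt0.
have /choice[k hk] : forall j : nat, exists n0 : nat, forall n m : nat, (n0 <= n)%N -> (n0 <= m)%N ->
    norm2 (f_ n - f_ m) < 2^-1 ^+ j by move=> j; exact: cauchy.
(* [K] is increasing and dominates [k], so that [f_ (K j)] is a fast Cauchy
   subsequence *)
pose K j := (\sum_(i < j.+1) (k i).+1)%N.
have kK j : (k j <= K j)%N by rewrite /K big_ord_recr /= ltnW// addnS ltnS leq_addl.
have KK j : (K j <= K j.+1)%N by rewrite /K [leqRHS]big_ord_recr /= leq_addr.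
have KKn j n : (K j <= K (j + n))%N.
  by elim: n => [|n IH]; rewrite ?addn0// addnS (leq_trans IH).
pose g j := f_ (K j).
have Lg j : sqint (g j) by exact: Lf.
have gg j : norm2 (g j.+1 - g j) < 2^-1 ^+ j by apply: hk; rewrite ?kK// (leq_trans (kK j)).
have gn j n : norm2 (g (j + n)%N - g j) < 2^-1 ^+ j.
  by apply: hk; rewrite ?kK// (leq_trans (kK j)).
pose a j x : R := `|g j.+1 x - g j x|.
have ma j : measurable_fun D (EFin \o a j).
  apply/measurable_EFinP; apply: measurableT_comp => //; apply: measurable_funB.
    exact: (sqint_measurable (Lg _)).
  exact: (sqint_measurable (Lg _)).
have ia j : (\int[mu]_(x in D) (a j x)%:E <= (norm2 (cst 1) * 2^-1 ^+ j)%:E)%E.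
  have L1 := sqint_cst mD fD (1 : R).
  have Ld : sqint (g j.+1 - g j) by exact: subspaceB.
  have La : sqint (a j).
    apply: (sqint_le mD Ld); first by apply/measurable_EFinP.
    by move=> x _; rewrite normr_id.
  rewrite -EFin_Rintegral//; last exact: sqint_integrable.
  rewrite lee_fin.
  have := CauchySchwarz_L2 mD L1 La; rewrite /ipD.
  under eq_Rintegral do rewrite mul1r.
  move=> /ler_normlW/le_trans; apply; rewrite ler_wpM2l ?sqrtr_ge0//.
  suff -> : norm2 (a j) = norm2 (g j.+1 - g j) by exact: ltW.
  congr Num.sqrt; apply: eq_Rintegral => x _.
  by rewrite /a -normrM ger0_norm// -expr2 sqr_ge0.
have isum : (\int[mu]_(x in D) (\sum_(0 <= j <oo) (a j x)%:E) < +oo)%E.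
  rewrite integral_nneseries//; last by move=> n x _; rewrite lee_fin normr_ge0.
  apply: (@le_lt_trans _ _ (\sum_(0 <= j <oo) (norm2 (cst 1) * 2^-1 ^+ j)%:E)%E).
    apply: lee_nneseries => [j _ _|j _]; last exact: ia.
    by apply: integral_ge0 => x _; rewrite lee_fin normr_ge0.
  rewrite (_ : (fun n => _) = EFin \o (series (geometric (norm2 (cst 1)) 2^-1))); last first.
    by apply/funext => n; rewrite /= sumEFin.
  have := @cvg_geometric_series R (norm2 (cst 1)) 2^-1 ltac:(by rewrite ger0_norm; lra).
  move=> h; have : EFin \o series (geometric (norm2 (cst 1)) 2^-1) @ \oo -->
      (norm2 (cst 1) / (1 - 2^-1))%:E by apply: cvg_EFin; [exact: nearW|exact: h].
  by move=> /cvg_lim ->//; rewrite ltry.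
have mS : measurable_fun D (fun x => (\sum_(0 <= j <oo) (a j x)%:E)%E).
  apply: (@ge0_emeasurable_sum _ _ _ D (fun j x => (a j x)%:E) xpredT) => [j x _ _|j _].
    by rewrite lee_fin normr_ge0.
  exact: ma.
have aeS : {ae mu, forall x, D x -> (\sum_(0 <= j <oo) (a j x)%:E)%E \is a fin_num}.
  apply: integrable_ae => //; apply/integrableP; split => //.
  under eq_integral => x _.
    rewrite gee0_abs; last by apply: nneseries_ge0 => *; rewrite lee_fin normr_ge0.
    over.
  exact: isum.
pose A := D `&` [set x | (\sum_(0 <= j <oo) (a j x)%:E)%E \is a fin_num].
have mA : measurable A by exact: emeasurable_fin_num.
pose h j x := g j x * \1_A x.
have cvgh x : cvgn (fun j => h j x).
  have [Ax|Ax] := boolP (x \in A); last first.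
    rewrite (_ : (fun j => h j x) = cst 0); first exact: is_cvg_cst.
    by apply/funext => j; rewrite /h indicE (negbTE Ax) mulr0.
  rewrite (_ : (fun j => h j x) = (fun j => g 0%N x + series (fun j => g j.+1 x - g j x) j)); last first.
    apply/funext => j; rewrite /h indicE Ax mulr1 /series /= telescope_sumr//.
    by rewrite addrC subrK.
  apply: is_cvgD; first exact: is_cvg_cst.
  apply: (@normed_cvg _ R^o).
  move: Ax; rewrite inE => -[_ /= fin].
  rewrite (_ : [normed series _] = series (a ^~ x))//.
  have := is_cvg_nneseries (fun j _ _ => ltac:(by rewrite lee_fin normr_ge0) : (0 <= (a j x)%:E)%E).
  move=> /(_ xpredT O) /cvg_ex[l hl]; move: fin; rewrite (cvg_lim _ hl)// => lfin.
  move: hl; rewrite -(fineK lfin) => /fine_cvgP[_ hl].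
  apply/cvg_ex; exists (fine l); move: hl; rewrite (_ : fine \o _ = series (a ^~ x))//.
  by apply/funext => n /=; rewrite sumEFin.
pose f x := limn (fun j => h j x).
have mg j : measurable_fun D (g j) by exact: (sqint_measurable (Lg j)).
have mf : measurable_fun D f.
  apply: (measurable_fun_cvg (h := h)) => [j|x _]; last exact: cvgh.
  by apply: measurable_funM => //; exact: measurable_indic.
have gf : {ae mu, forall x, D x -> g j x @[j --> \oo] --> f x}.
  apply: filterS aeS => x /= aeS Dx.
  rewrite (_ : (fun j => g j x) = (fun j => h j x)); first exact: cvgh.
  apply/funext => j; rewrite /h indicE mem_set ?mulr1//.
  by split=> //; exact: aeS.
have key j : sqint (f - g j) /\ norm2 (f - g j) <= 2^-1 ^+ j.
  apply: (@norm2_fatou (fun n => g (j + n)%N)) => //; last by move=> n; exact: ltW.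
  apply: filterS gf => x gf Dx; have := gf Dx.
  move=> /cvg_seqP hx; apply/cvg_seqP => e /hx[n0 hn]; exists n0 => n n0n.
  by apply: hn; rewrite (leq_trans n0n)// leq_addl.
have Lff : sqint f.
  by rewrite -(subrK (g 0%N) f); apply: subspaceD => //; exact: (key O).1.
exists f => // e e0.
have [n0 hn0] := cauchy _ (divr_gt0 e0 (ltr0Sn R 1)).
have [j1 hj1] : exists j1 : nat, (2^-1 : R) ^+ j1 < e / 2.
  have /cvg_seqP/(_ _ (divr_gt0 e0 (ltr0Sn R 1)))[N /(_ _ (leqnn N))] :=
    @cvg_expr R 2^-1 ltac:(by rewrite ger0_norm; lra).
  by rewrite subr0 => hN; exists N; apply: le_lt_trans hN; exact: ler_norm.
pose j := (j1 + n0)%N.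
have n0K : (n0 <= K j)%N.
  suff jK i : (i <= K i)%N by rewrite (leq_trans _ (jK j))// leq_addl.
  elim: i => // i IH; by rewrite /K big_ord_recr /= addnS ltnS (leq_trans IH)// leq_addr.
exists n0 => n n0n.
have := seminorm_triangle SN (Lf n) (Lg j) Lff.
move=> /le_lt_trans; apply; rewrite (splitr e) ltrD//; first exact: hn0.
rewrite (seminormBC SN)//; apply: le_lt_trans (key j).2 _.
apply: le_lt_trans hj1; rewrite exprD; apply: ler_piMr; first exact: ltW.
by rewrite exprn_ile1//; lra.
Qed.

End L2_complete.

(** * Density of countably many functions in $L^2$ *)

Section L2_dense.
Context d (T : measurableType d) (R : realType).
Variables (mu : {measure set T -> \bar R}) (D : set T).
Hypotheses (mD : measurable D) (fD : (mu D < +oo)%E).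
Variables (I : countType) (beta : I -> T -> R).
Hypothesis mbeta : forall j, measurable_fun D (beta j).
Hypothesis beta01 : forall j x, 0 <= beta j x <= 1.
Variable G : set (set T).
Hypotheses (GE : @measurable _ T = <<s G >>) (GI : setI_closed G) (GT : G setT).
Hypothesis G_beta : forall O, G O -> exists J : set I, forall x, D x ->
  (O x <-> exists2 j, J j & 0 < beta j x).
Implicit Types (f g h m : T -> R) (c e M : R).
Local Notation sqint := (sqint mu D).
Local Notation norm2 := (norm2 mu D).
Let SN := norm2_seminormed mu mD.
Let sub := sqint_subspace mu mD.

(** One minus a product of factors [1 - beta j] vanishes off the union of the
    sets [beta j > 0], and is close to [1] on it when each [j] is repeated
    many times in [L]. *)
Definition bump_union (L : seq I) : T -> R := fun x => 1 - \prod_(j <- L) (1 - beta j x).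

(** Rational combinations, coded by elements of a countable type. *)
Definition bump_comb (E : seq (rat * seq I)) : T -> R :=
  fun x => \sum_(p <- E) ratr p.1 * bump_union p.2 x.

(** Any class of functions that is closed under linear combinations and
    products contains the combinations as soon as it contains the bumps; the
    test functions form such a class. *)
Lemma bump_comb_ind (P : (T -> R) -> Prop) : P (fun=> 0) ->
  (forall c f g, P f -> P g -> P (fun x => c * f x + g x)) ->
  (forall f g, P f -> P g -> P (fun x => f x * g x)) ->
  (forall j, P (beta j)) -> forall E, P (bump_comb E).
Proof.
move=> P0 Plin PM Pb; have PU L : P (bump_union L).
  elim: L => [|j L IH].
    rewrite (_ : bump_union _ = fun=> 0)//.
    by apply/funext => x; rewrite /bump_union big_nil subrr.
  rewrite (_ : bump_union _ = fun x => 1 * beta j x +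
      (-1 * (beta j x * bump_union L x) + bump_union L x)).
    by apply: (Plin) => //; apply: (Plin) => //; exact: PM.
  by apply/funext => x; rewrite /bump_union big_cons; ring.
elim=> [|p E IH].
  rewrite (_ : bump_comb _ = fun=> 0)//.
  by apply/funext => x; rewrite /bump_comb big_nil.
rewrite (_ : bump_comb _ = fun x => ratr p.1 * bump_union p.2 x + bump_comb E x).
  exact: Plin.
by apply/funext => x; rewrite /bump_comb big_cons.
Qed.

Lemma bump_prod01 L x : 0 <= \prod_(j <- L) (1 - beta j x) <= 1.
Proof.
elim: L => [|j L /andP[IH0 IH1]]; rewrite ?big_nil ?big_cons ?ler01 ?lexx//.
have /andP[b0 b1] := beta01 j x.
by rewrite mulr_ge0 ?subr_ge0//= mulr_ile1// ?subr_ge0// lerBlDr lerDl.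
Qed.

Lemma bump_union01 L x : 0 <= bump_union L x <= 1.
Proof. by have := bump_prod01 L x; rewrite /bump_union; lra. Qed.

Lemma measurable_bump_union L : measurable_fun D (bump_union L).
Proof.
apply: measurable_funB => //; apply: measurable_prod => j _.
by apply: measurable_funB.
Qed.

Lemma sqint_bump_comb E : sqint (bump_comb E).
Proof.
elim: E => [|p E IH].
  rewrite (_ : bump_comb [::] = 0); first exact: sub.1.
  by apply/funext => x; rewrite /bump_comb big_nil.
rewrite (_ : bump_comb _ = ratr p.1 *: bump_union p.2 + bump_comb E).
  apply: sub.2 => //; apply: (sqint_bounded mD fD (M := 1)).
    exact: measurable_bump_union.
  by move=> x _; have /andP[b0 b1] := bump_union01 p.2 x; rewrite ger0_norm.
by apply/funext => x; rewrite /bump_comb big_cons.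
Qed.

Let cl f := sqint f /\ forall e, 0 < e -> exists E, norm2 (f - bump_comb E) < e.

Let cl_lim f : sqint f -> (forall e, 0 < e -> exists2 g, cl g & norm2 (f - g) < e) -> cl f.
Proof.
move=> Lf h; split=> // e e0; have e20 := divr_gt0 e0 (ltr0Sn R 1).
have [g [Lg clg] fg] := h _ e20; have [E gE] := clg _ e20; exists E.
apply: le_lt_trans (seminorm_triangle SN Lf Lg (sqint_bump_comb E)) _.
by rewrite (splitr e) ltrD.
Qed.

Let clD f g : cl f -> cl g -> cl (f + g).
Proof.
move=> [Lf hf] [Lg hg]; split; first exact: subspaceD.
move=> e e0; have e20 := divr_gt0 e0 (ltr0Sn R 1).
have [E fE] := hf _ e20; have [E' gE'] := hg _ e20; exists (E ++ E').
rewrite (_ : f + g - _ = (f - bump_comb E) + (g - bump_comb E')); last first.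
  apply/funext => x; rewrite /bump_comb/= !fctE big_cat/=; ring.
apply: le_lt_trans (seminormD SN _ _) _.
- by apply: subspaceB => //; exact: sqint_bump_comb.
- by apply: subspaceB => //; exact: sqint_bump_comb.
by rewrite (splitr e) ltrD.
Qed.

Let clZ c f : cl f -> cl (c *: f).
Proof.
move=> [Lf hf]; split; first exact: subspaceZ.
move=> e e0; have e20 := divr_gt0 e0 (ltr0Sn R 1).
have N1 : 0 < norm2 f + 1 by rewrite ltr_wpDl// sqrtr_ge0.
have [q qc] : exists q : rat, `|c - ratr q| * (norm2 f + 1) < e / 2.
  have d0 : 0 < e / 2 / (norm2 f + 1) by rewrite divr_gt0.
  have cd : c < c + e / 2 / (norm2 f + 1) by rewrite ltrDl.
  have [q] := rat_in_itvoo cd; rewrite in_itv/= => /andP[q1 q2]; exists q.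
  by rewrite distrC ger0_norm ?subr_ge0 ?ltW// -ltr_pdivlMr// ltrBlDl.
have q1 : 0 < `|ratr q : R| + 1 by rewrite ltr_wpDl.
have [E fE] := hf _ (divr_gt0 e20 q1).
exists [seq (q * p.1, p.2) | p <- E].
rewrite (_ : c *: f - _ = (c - ratr q) *: f + ratr q *: (f - bump_comb E)); last first.
  apply/funext => x; rewrite [RHS](_ : _ = (c - ratr q) * f x + ratr q * (f x - bump_comb E x))//.
  rewrite [LHS](_ : _ = c * f x - bump_comb [seq (q * p.1, p.2) | p <- E] x)//.
  rewrite (_ : bump_comb _ x = ratr q * bump_comb E x); first by ring.
  rewrite /bump_comb big_map mulr_sumr; apply: eq_bigr => p _ /=.
  by rewrite rmorphM/= mulrA.
have LE := sqint_bump_comb E.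
apply: le_lt_trans (seminormD SN _ _) _.
- exact: subspaceZ.
- by apply: subspaceZ => //; exact: subspaceB.
rewrite !(seminormZ SN)//; last exact: subspaceB.
rewrite (splitr e) ltr_leD//.
  apply: le_lt_trans qc; rewrite ler_wpM2l// lerDl//.
rewrite (@le_trans _ _ ((`|ratr q| + 1) * norm2 (f - bump_comb E)))//.
  by rewrite ler_wpM2r ?sqrtr_ge0// lerDl.
by rewrite mulrC -ler_pdivlMr// ltW.
Qed.

Let cl0 : cl 0.
Proof.
split; first exact: sub.1.
move=> e e0; exists [::]; rewrite (_ : 0 - _ = 0) ?(seminorm0 SN)//.
by apply/funext => x; rewrite /bump_comb !fctE big_nil subr0.
Qed.

Let clB f g : cl f -> cl g -> cl (f - g).
Proof. by move=> cf cg; rewrite -scaleN1r; apply: clD => //; exact: clZ. Qed.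

Let cl_dominated (f_ : nat -> T -> R) f h : (forall n, cl (f_ n)) -> sqint h ->
  (forall n x, D x -> `|f_ n x| <= `|h x|) ->
  (forall x, D x -> f_ n x @[n --> \oo] --> f x) -> cl f.
Proof.
move=> clf Lh fh ff.
have [Lf lim] := sqint_dominated mD (fun n => sqint_measurable (clf n).1) Lh fh ff.
apply: cl_lim => // e /lim[n0 hn]; exists (f_ n0); first exact: clf.
by rewrite (seminormBC SN)//; [exact: hn|exact: (clf n0).1].
Qed.

Let cl_bump L : cl (bump_union L).
Proof.
split.
  apply: (sqint_bounded mD fD (M := 1)); first exact: measurable_bump_union.
  by move=> x _; have /andP[b0 b1] := bump_union01 L x; rewrite ger0_norm.
move=> e e0; exists [:: (1%Q, L)]; rewrite (_ : _ - _ = 0) ?(seminorm0 SN)//.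
by apply/funext => x; rewrite !fctE /bump_comb big_seq1/= rmorph1 mul1r subrr.
Qed.

Let cl_G O : G O -> cl \1_O.
Proof.
move=> /G_beta[J OJ].
pose l n := [seq j <- pmap (@choice.unpickle I) (iota 0 n) | j \in J].
pose L n := flatten (nseq n (l n)).
apply: (@cl_dominated (fun n => bump_union (L n)) \1_O (cst 1)) => //.
- exact: sqint_cst.
- by move=> n x _; have /andP[b0 b1] := bump_union01 (L n) x; rewrite normr1 ger0_norm.
move=> x Dx; rewrite indicE.
have [Ox|nOx] := boolP (x \in O); last first.
  rewrite [X in X @ \oo](_ : _ = cst 0) /=; first exact: cvg_cst.
  apply/funext => n; rewrite /bump_union big1_seq ?subrr// => j /andP[_].
  move=> /flattenP[s /nseqP[-> _]]; rewrite mem_filter => /andP[/set_mem Jj _].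
  have /andP[b0 _] := beta01 j x; suff -> : beta j x = 0 by rewrite subr0.
  apply/eqP; rewrite eq_le b0 andbT leNgt; apply/negP => bj.
  by move: nOx; rewrite notin_setE; apply; apply/OJ => //; exists j.
have [j0 Jj0 bj0] : exists2 j, J j & 0 < beta j x by apply/OJ => //; rewrite inE in Ox.
have /andP[_ bj1] := beta01 j0 x.
have prod_le s n : j0 \in s ->
    \prod_(j <- flatten (nseq n s)) (1 - beta j x) <= (1 - beta j0 x) ^+ n.
  move=> j0s; elim: n => [|n IH]; first by rewrite /= big_nil expr0.
  rewrite /= big_cat exprS /= ler_pM//.
  - by have /andP[] := bump_prod01 s x.
  - by have /andP[] := bump_prod01 (flatten (nseq n s)) x.
  - move: j0s; elim: s {IH} => // j s IH; rewrite inE => js.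
    have /andP[b0 b1] := beta01 j x; have /andP[p0 p1] := bump_prod01 s x.
    rewrite big_cons; move: js => /predU1P[->|/IH {}IH].
      by apply: ler_piMr => //; lra.
    by apply: le_trans IH; apply: ler_piMl => //; lra.
apply/cvg_seqP => e e0.
have /cvg_seqP/(_ _ e0)[N hN] := @cvg_expr R (1 - beta j0 x) ltac:(by rewrite ger0_norm; lra).
exists (maxn N (choice.pickle j0).+1) => n; rewrite geq_max => /andP[Nn pn].
rewrite /bump_union addrAC subrr sub0r normrN.
have j0l : j0 \in l n.
  rewrite mem_filter mem_set//= mem_pmap; apply/mapP; exists (choice.pickle j0).
    by rewrite mem_iota.
  by rewrite choice.pickleK.
have /andP[p0 _] := bump_prod01 (L n) x.
rewrite ger0_norm//; apply: le_lt_trans (prod_le (l n) n j0l) _.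
by have := hN _ Nn; rewrite subr0 ger0_norm// exprn_ge0// subr_ge0.
Qed.

Let cl_indic A : measurable A -> cl \1_A.
Proof.
rewrite GE => sA.
suff : <<s G >> `<=` [set A | measurable A /\ cl \1_A] by move=> /(_ _ sA)[].
apply: lambda_system_subset => //; last first.
  by move=> B GB; split; [rewrite GE; exact: sub_gen_smallest|exact: cl_G].
split => //.
- by split => //; exact: cl_G.
- move=> A' B BA [mA' clA] [mB clB']; split; first exact: measurableD.
  rewrite (_ : \1_(A' `\` B) = \1_A' - \1_B); first exact: clB.
  apply/funext => x; rewrite !fctE !indicE in_setD.
  have [Bx|] := boolP (x \in B); last by rewrite andbT subr0.
  by rewrite andbF (_ : x \in A') ?subrr// inE; apply: BA; rewrite inE in Bx.
- move=> F ndF HF; split; first by apply: bigcupT_measurable => k; exact: (HF k).1.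
  apply: (@cl_dominated (fun n => \1_(F n)) _ (cst 1)) => //.
  + by move=> n; exact: (HF n).2.
  + exact: sqint_cst.
  + by move=> n x _; rewrite indicE normr1 normr_nat; case: (_ \in _).
  move=> x _; rewrite indicE; have [|nF] := boolP (x \in \bigcup_n F n).
    rewrite inE => -[k _ Fkx]; apply/cvg_seqP => e e0; exists k => n kn.
    rewrite indicE mem_set ?subrr ?normr0//.
    by have /subsetPset := ndF _ _ kn; exact.
  rewrite [X in X @ \oo](_ : _ = cst 0) /=; first exact: cvg_cst.
  apply/funext => n; rewrite indicE memNset// => Fn.
  by move: nF; rewrite notin_setE; apply; exists n.
Qed.

Import HBNNSimple.

Let cl_nnsfun (h : {nnsfun T >-> R}) : cl h.
Proof.
rewrite (_ : (h : T -> R) = \sum_(i < #|` fset_set (h @` setT)|%fset)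
   ((fset_set (h @` setT))`_i *: \1_(h @^-1` [set (fset_set (h @` setT))`_i]))).
  apply: (big_ind cl) => [|f g|i _]; [exact: cl0|exact: clD|].
  by apply: clZ; apply: cl_indic.
by apply/funext => x; rewrite fimfunEord fct_sumE.
Qed.

Let cl_ge0 f : sqint f -> (forall x, D x -> 0 <= f x) -> cl f.
Proof.
move=> Lf f0; have mf : measurable_fun D (EFin \o f) by apply/measurable_EFinP; case: Lf.
have f0' x : D x -> (0 <= (EFin \o f) x)%E by move=> Dx; rewrite lee_fin f0.
apply: (@cl_dominated (fun n => nnsfun_approx mD mf n) f f) => //.
- move=> n x Dx; rewrite !ger0_norm ?f0//.
  by have := le_approx n f0' Dx; rewrite -(nnsfun_approxE mD mf) lee_fin.
- move=> x Dx; have := cvg_nnsfun_approx mD mf f0' Dx.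
  by move=> /fine_cvgP[_].
Qed.

(** The closure of the combinations contains the indicators of the sets of [G],
    hence those of all measurable sets by the monotone class theorem, hence
    simple functions and their dominated limits. *)
Theorem bump_comb_dense f e : sqint f -> 0 < e -> exists E, norm2 (f - bump_comb E) < e.
Proof.
move=> Lf e0; suff [_ /(_ _ e0)//] : cl f.
have mf := sqint_measurable Lf.
rewrite (_ : f = (fun x => Num.max (f x) 0) - (fun x => Num.max (- f x) 0)).
  apply: clB; apply: cl_ge0 => [|x _].
  - apply: (sqint_le mD Lf); first exact: measurable_maxr.
    by move=> x _; case: (leP (f x) 0) => h; rewrite ?normr0.
  - by rewrite le_max lexx orbT.
  - apply: (sqint_le mD Lf).
      by apply: measurable_maxr => //; exact: measurable_funN.
    by move=> x _; case: (leP (- f x) 0) => h; rewrite ?normr0 ?normrN.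
  - by rewrite le_max lexx orbT.
by apply/funext => x; rewrite !fctE; case: (leP (f x) 0); case: (leP (- f x) 0); lra.
Qed.

End L2_dense.

(** * Lebesgue measure on $R^n$ *)

Section translation.
Context (R : realType).

Lemma pushforward_measure d1 d2 (T1 : measurableType d1) (T2 : measurableType d2)
    (m : {measure set T1 -> \bar R}) (f : T1 -> T2) : measurable_fun setT f ->
  exists m' : {measure set T2 -> \bar R}, forall A, m' A = m (f @^-1` A).
Proof.
by move=> mf; exists (measure_function_pushforward__canonical__measure_function_Measure m mf).
Qed.

Lemma measurable_shiftR (h : R) :
  measurable_fun [set: measurableTypeR R] (fun t : measurableTypeR R => (t : R) + h : measurableTypeR R).
Proof. exact: (@measurable_funD _ (measurableTypeR R) R setT id (cst h)). Qed.

Lemma lebesgue_measure_shift (h : R) (A : set (measurableTypeR R)) : measurable A ->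
  lebesgue_measure ((fun t : measurableTypeR R => (t : R) + h) @^-1` A) = lebesgue_measure A.
Proof.
move=> mA; have [m mE] := pushforward_measure lebesgue_measure (measurable_shiftR h).
rewrite -mE; apply/esym; apply: lebesgue_measure_unique => // X.
move=> [[a b] /= _ <-]; rewrite mE.
rewrite (_ : _ @^-1` _ = `]a - h, b - h]%classic); last first.
  by apply/seteqP; split => t /=; rewrite !in_itv/= ltrBlDr lerBrDr.
rewrite lebesgue_measure_itv [RHS](@lebesgue_measure_itv R `]a - h, b - h])/=.
by rewrite !lte_fin ltrD2r -!EFinB opprB addrA addrNK.
Qed.

Lemma integral_measure_preserving d1 (X : measurableType d1) (mu : {measure set X -> \bar R})
    (phi : X -> X) (f : X -> \bar R) : measurable_fun setT phi ->
  (forall A, measurable A -> mu (phi @^-1` A) = mu A) ->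
  measurable_fun setT f -> (forall x, 0 <= f x)%E ->
  (\int[mu]_x f (phi x) = \int[mu]_x f x)%E.
Proof.
move=> mphi phiE mf f0; transitivity (\int[pushforward mu phi]_x f x)%E.
  by rewrite ge0_integral_pushforward.
pose m : {measure set X -> \bar R} := measure_function_pushforward__canonical__measure_function_Measure mu mphi.
by rewrite -[LHS]/(\int[m]_x f x)%E; apply: eq_measure_integral => A mA _; exact: phiE.
Qed.

End translation.

Section lebesgue_rV_theory.
Context (R : realType).

Definition shift_rV n (i : 'I_n) (h : R) (x : 'rV[R]_n) : 'rV[R]_n :=
  x + h *: delta_mx ord0 i.

Lemma shift_rVE n (i j : 'I_n) h x : shift_rV i h x ord0 j = x ord0 j + (h *+ (j == i)).
Proof. by rewrite !mxE eqxx /= mulr_natr. Qed.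

Lemma measurable_shift_rV n (i : 'I_n) h : measurable_fun setT (shift_rV i h).
Proof.
apply: measurable_fun_rV => j; under eq_fun do rewrite shift_rVE.
by apply: measurable_funD => //; exact: measurable_coor_rV.
Qed.

Lemma shift_consrV0 n h (x : 'rV[R]_n) (t : R) :
  shift_rV ord0 h (consrV (x, t)) = consrV (x, t + h).
Proof.
apply/rowP => j; rewrite shift_rVE; case: (unliftP ord0 j) => [k|] ->.
  by rewrite !consrVS/= addr0.
by rewrite !consrV0 /=.
Qed.

Lemma shift_consrVS n (i : 'I_n) h (x : 'rV[R]_n) (t : R) :
  shift_rV (lift ord0 i) h (consrV (x, t)) = consrV (shift_rV i h x, t).
Proof.
apply/rowP => j; rewrite shift_rVE; case: (unliftP ord0 j) => [k|] ->.
  by rewrite !consrVS/= shift_rVE (inj_eq lift_inj).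
by rewrite !consrV0 /= addr0.
Qed.

(** A translation along the front coordinate translates the sections on the
    line; a translation along another coordinate permutes the sections, and
    preserves the measure that integrates them by induction. *)
Lemma lebesgue_rV_shift n (i : 'I_n) h (A : set 'rV[R]_n) : measurable A ->
  lebesgue_rV R n (shift_rV i h @^-1` A) = lebesgue_rV R n A.
Proof.
elim: n i A => [|n IH] i A mA; first by case: i.
have mc (B : set 'rV[R]_n.+1) : measurable B -> measurable (@consrV R n @^-1` B).
  by move=> mB; rewrite -[X in measurable X]setTI; exact: measurable_consrV.
rewrite /= /lebesgue_rVS /pushforward /product_measure1.
case: (unliftP ord0 i) => [k|] ->; last first.
  apply: eq_integral => x _ /=.
  rewrite (_ : xsection _ x = (fun t : measurableTypeR R => (t : R) + h) @^-1`
      xsection (@consrV R n @^-1` A) x).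
    by rewrite lebesgue_measure_shift//; apply: measurable_xsection; exact: mc.
  by apply/seteqP; split => t; rewrite /xsection/= !inE/= shift_consrV0.
pose phi x := lebesgue_measure (xsection (@consrV R n @^-1` A) x).
have mphi : measurable_fun setT phi by apply: measurable_fun_xsection; exact: mc.
have := integral_measure_preserving (measurable_shift_rV k h) (IH k) mphi _.
rewrite -[X in _ = X]/(\int[lebesgue_rV R n]_x phi x)%E => <-; last first.
  by move=> x; rewrite /phi measure_ge0.
apply: eq_integral => x _ /=; congr lebesgue_measure.
by apply/seteqP; split => t; rewrite /xsection/= !inE/= shift_consrVS.
Qed.

Lemma integral_shift_rV n (i : 'I_n) h (f : 'rV[R]_n -> \bar R) :
  measurable_fun setT f -> (forall t, 0 <= f t)%E ->
  (\int[lebesgue_rV R n]_x f (shift_rV i h x) = \int[lebesgue_rV R n]_x f x)%E.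
Proof.
move=> mf f0; apply: integral_measure_preserving => //.
  exact: measurable_shift_rV.
exact: lebesgue_rV_shift.
Qed.

Definition boxoo n (a b : 'I_n -> R) : set 'rV[R]_n :=
  [set x | forall i, a i < x ord0 i < b i].

Definition boxcc n (a b : 'I_n -> R) : set 'rV[R]_n :=
  [set x | forall i, a i <= x ord0 i <= b i].

Lemma measurable_forall_coor n (A : 'I_n -> set (measurableTypeR R)) :
  (forall i, measurable (A i)) -> measurable [set x : 'rV[R]_n | forall i, A i (x ord0 i)].
Proof.
move=> mA; rewrite (_ : mkset _ = \bigcap_(i in [set: 'I_n])
    ((fun x : 'rV[R]_n => x ord0 i) @^-1` A i)); last first.
  by apply/seteqP; split => x /= h => [i _|i]; [exact: h|exact: (h i)].
apply: fin_bigcap_measurable => // i _; rewrite -[X in measurable X]setTI.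
exact: measurable_coor_rV.
Qed.

Lemma boxccE n (a b : 'I_n -> R) :
  boxcc a b = [set x | forall i, (`[a i, b i]%classic : set R) (x ord0 i)].
Proof. by apply/seteqP; split => x /= h i; have := h i; rewrite /= in_itv/=. Qed.

Lemma measurable_boxcc n (a b : 'I_n -> R) : measurable (boxcc a b).
Proof.
rewrite boxccE; apply: (@measurable_forall_coor n (fun i => `[a i, b i]%classic)) => i.
exact: measurable_itv.
Qed.

Lemma lebesgue_boxcc_lty n (a b : 'I_n -> R) : (lebesgue_rV R n (boxcc a b) < +oo)%E.
Proof.
rewrite boxccE (@lebesgue_rV_box R n (fun i => `[a i, b i]%classic)); last first.
  by move=> i; exact: measurable_itv.
rewrite ltey_eq prode_fin_num// => i _.
by rewrite lebesgue_measure_itv/=; case: ifP.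
Qed.

Lemma compact_boxcc n (a b : 'I_n -> R) : compact (boxcc a b).
Proof.
rewrite boxccE; apply: (@rV_compact R n (fun i => `[a i, b i]%classic)) => i.
exact: segment_compact.
Qed.

Lemma bounded_boxcc n (A : set 'rV[R]_n) : bounded_set A ->
  exists M : R, 0 < M /\ A `<=` boxcc (fun=> - M) (fun=> M).
Proof.
move=> [M0 [_ hM]]; exists (`|M0| + 1); split; first by rewrite ltr_wpDl.
move=> x Ax i; rewrite -ler_norml.
have M0lt : M0 < `|M0| + 1 by rewrite (le_lt_trans (ler_norm _))// ltrDl.
apply: le_trans (hM _ M0lt x Ax); rewrite [leRHS]mx_normrE.
by apply/bigmax_geP; right => /=; exists (ord0, i).
Qed.

Lemma lebesgue_bounded_lty n (A : set 'rV[R]_n) : measurable A -> bounded_set A ->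
  (lebesgue_rV R n A < +oo)%E.
Proof.
move=> mA /bounded_boxcc[M [M0 AM]].
apply: le_lt_trans (lebesgue_boxcc_lty (fun=> - M) (fun=> M)).
by apply: le_measure => //; rewrite inE//; exact: measurable_boxcc.
Qed.

Lemma sigma_finite_lebesgue_rV n : sigma_finite setT (lebesgue_rV R n).
Proof.
exists (fun k => boxcc (fun=> - k%:R) (fun=> k%:R)).
  apply/esym/seteqP; split=> // x _.
  have [M [M0 hM]] := @bounded_boxcc n [set x] (compact_bounded (@compact_set1 _ x)).
  exists (Num.truncn M).+1 => //= i; have /andP[h1 h2] := hM x erefl i.
  by have := truncnS_gt M; lra.
by move=> k; split; [exact: measurable_boxcc|exact: lebesgue_boxcc_lty].
Qed.

Lemma measurable_rV_open n : @measurable _ 'rV[R]_n = <<s [set O : set 'rV[R]_n | open O] >>.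
Proof.
apply/seteqP; split; last first.
  by apply: smallest_sub => [|O /= oO]; [exact: sigma_algebra_measurable|exact: open_measurable_rV].
apply: smallest_sub; first exact: smallest_sigma_algebra.
rewrite -bigcup_seq/= => A [i _ [B mB <-]] /=; rewrite setTI.
suff : (measurable : set (set (measurableTypeR R))) `<=`
    [set B | <<s [set O : set 'rV[R]_n | open O] >> ((fun x : 'rV[R]_n => x ord0 i) @^-1` B)].
  exact.
rewrite [X in X `<=` _](RGenOInfty.measurableE R); apply: smallest_sub.
  split=> /=.
  - by rewrite preimage_set0; exact: sigma_algebra0.
  - by move=> C; rewrite setTD preimage_setC; exact: sigma_algebraC.
  - by move=> F mF; rewrite preimage_bigcup; exact: sigma_algebra_bigcup.
move=> _ [a ->] /=; apply: sub_sigma_algebra => /=.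
apply: open_comp => [x _|]; first exact: coord_continuous.
exact: rray_open.
Qed.

Lemma measurable_continuous_rV n (f : 'rV[R]_n -> R) : continuous f -> measurable_fun setT f.
Proof.
move=> cf; apply: (measurability _ (RGenOInfty.measurableE R)) => _ [_ [a ->] <-].
rewrite setTI; apply: open_measurable_rV; apply: open_comp => [x _|]; first exact: cf.
exact: rray_open.
Qed.

End lebesgue_rV_theory.

(** * Smooth functions *)

Section smooth1.
Context (R : realType).
Implicit Types (f g : R -> R) (k m n : nat).

(** This form exposes the first derivative, so that the rules for products and
    compositions are proved by induction on the order. *)
Fixpoint smooth_upto k f : Prop :=
  if k is m.+1 then (forall t : R, derivable f t 1) /\ smooth_upto m (derive1 f) else True.

Definition smooth f := forall k (t : R), derivable (derive1n k f) t 1.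

Lemma smoothP f : smooth f <-> forall k, smooth_upto k f.
Proof.
split=> [sf k|sf k t].
  elim: k f sf => //= k IH f sf; split; first exact: (sf 0%N).
  by apply: IH => j t; rewrite -derive1Sn; exact: sf.
suff : forall k f, smooth_upto k.+1 f -> forall t : R, derivable (derive1n k f) t 1.
  by move=> /(_ k f (sf k.+1)).
elim=> [g [+ _]|j IH g [_ sg] t']; first exact.
by rewrite derive1Sn; exact: IH.
Qed.

Lemma is_derive_derive1 f f' : (forall t : R, is_derive t 1 f (f' t)) ->
  (forall t : R, derivable f t 1) /\ derive1 f = f'.
Proof.
move=> h; split=> [t|]; first exact: (@ex_derive _ _ _ _ _ _ _ (h t)).
by apply/funext => t; rewrite derive1E; apply: (@derive_val _ _ _ _ _ _ _ (h t)).
Qed.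

Lemma derivable_is_derive1 f : (forall t : R, derivable f t 1) ->
  forall t : R, is_derive t 1 f (derive1 f t).
Proof. by move=> df t; rewrite derive1E; exact: derivableP. Qed.

Lemma smooth_uptoS k f : smooth_upto k.+1 f -> smooth_upto k f.
Proof. by elim: k f => // k IH f [df sf]; split => //; exact: IH. Qed.

Lemma smooth_upto_cst k c : smooth_upto k (cst c : R -> R).
Proof.
elim: k c => //= k IH c.
have [d1 d2] := is_derive_derive1 (fun t : R => is_derive_cst (c : R) t (1 : R)).
by rewrite d2; split => //; exact: (IH 0).
Qed.

Lemma smooth_uptoD k f g : smooth_upto k f -> smooth_upto k g ->
  smooth_upto k (fun t => f t + g t).
Proof.
elim: k f g => //= k IH f g [df sf] [dg sg].
have [d1 d2] := is_derive_derive1 (fun t => is_deriveD (derivable_is_derive1 df t) (derivable_is_derive1 dg t)).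
by rewrite -[fun t => _]/(f + g) d2; split => //; exact: IH.
Qed.

Lemma smooth_uptoM k f g : smooth_upto k f -> smooth_upto k g ->
  smooth_upto k (fun t => f t * g t).
Proof.
elim: k f g => //= k IH f g [df sf] [dg sg].
have [d1 d2] := is_derive_derive1 (fun t => is_deriveM (derivable_is_derive1 df t) (derivable_is_derive1 dg t)).
rewrite -[fun t => _]/(f * g) d2; split => //.
apply: (@smooth_uptoD _ (fun t => f t * derive1 g t) (fun t => g t * derive1 f t)); apply: IH => //.
  by apply: smooth_uptoS; split.
by apply: smooth_uptoS; split.
Qed.

Lemma smooth_upto_comp_affine k f (c e : R) : smooth_upto k f ->
  smooth_upto k (fun t => f (c * t + e)).
Proof.
elim: k f => //= k IH f [df sf].
have da (t : R) : is_derive t 1 (fun t => c * t + e) c.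
  have := is_deriveD (is_deriveZ c (is_derive_id t (1 : R))) (is_derive_cst e t (1 : R)).
  by move=> /is_derive_eq; apply; rewrite addr0 -[RHS]mulr1.
have [d1 d2] := is_derive_derive1 (fun t => is_derive1_comp (g := fun t => c * t + e) (derivable_is_derive1 df (c * t + e)) (da t)).
rewrite (_ : (fun t => f (c * t + e)) = f \o (fun t => c * t + e))// d2; split => //.
by apply: smooth_uptoM; [exact: IH|exact: smooth_upto_cst].
Qed.

(** $y \mapsto y^{-k} e^{-1/y}$ for $y > 0$, extended by $0$: the family of
    these functions is closed under derivation up to linear combinations. *)
Definition flat k (y : R) : R := if 0 < y then y^-1 ^+ k * expR (- y^-1) else 0.

Lemma flat_ge0 k y : 0 <= flat k y.
Proof.
by rewrite /flat; case: ifPn => // y0; rewrite mulr_ge0 ?expR_ge0// exprn_ge0// invr_ge0 ltW.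
Qed.

(** From $e^{x} \ge x^{k+2}/(k+2)!$ at $x = 1/y$. The bound makes the
    difference quotient at $0$ of the flat functions vanish in the limit. *)
Lemma flat_bound k (y : R) : flat k.+1 y <= (k.+2)`!%:R * `|y|.
Proof.
rewrite /flat; case: ifPn => y0; last by rewrite mulr_ge0.
have v0 : 0 < y^-1 by rewrite invr_gt0.
rewrite gtr0_norm// expRN.
have h := expR_ge1Dxn k.+1 (ltW v0).
have f0 : 0 < (k.+2)`!%:R :> R by rewrite ltr0n fact_gt0.
rewrite ler_pdivrMr ?expR_gt0// -ler_pdivrMl; last by rewrite mulr_gt0.
apply: le_trans h; rewrite ler_wpDl// invfM mulrC mulrA.
by rewrite mulrAC -exprSr.
Qed.

Lemma is_derive_flat k (y : R) :
  is_derive y 1 (flat k) (flat k.+2 y - k%:R * flat k.+1 y).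
Proof.
have [y0|y0|<-] := ltgtP 0 y.
- have yn0 := lt0r_neq0 y0.
  have dv : is_derive y 1 (fun t : R => t^-1) (- y ^- 2).
    apply: (is_derive_eq (is_deriveV (lt0r_neq0 y0) (is_derive_id y (1 : R)))).
    by rewrite -[LHS]/(- y ^- 2 * 1) mulr1.
  have dX := is_deriveX k dv.
  have dE : is_derive y 1 (fun t : R => expR (- t^-1)) (expR (- y^-1) * (- - y ^- 2)).
    exact: (is_derive1_comp (f := expR) (g := fun t => - t^-1) (is_derive_expR (- y^-1)) (is_deriveN dv)).
  apply: (near_eq_is_derive _ (is_derive_eq (is_deriveM dX dE) _)).
    near=> t; rewrite /flat ifT; last by near: t; exact: lt_nbhsr.
    by rewrite -[LHS]/(_ * _)/= fctE.
  rewrite /flat y0 -![_ *: _]/(_ * _) !fctE.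
  case: k dX => [|k] dX; rewrite ?expr0 ?mul0r ?subr0 ?mulr0 ?addr0 /= !(exprS, expr0) -?exprVn.
    by field.
  by field.
- apply: (near_eq_is_derive _ (is_derive_eq (is_derive_cst (0 : R) y (1 : R)) _)).
    by near=> t; rewrite /flat ifF//; apply/negbTE; rewrite -leNgt ltW//; near: t; exact: lt_nbhsl.
  by rewrite /flat !ifF ?mulr0 ?subr0//; apply/negbTE; rewrite -leNgt ltW.
- rewrite /flat ltxx mulr0 subr0.
  have lim0 : h^-1 *: ((flat k \o shift 0) (h *: 1) - flat k 0) @[h --> 0^'] --> (0 : R).
    apply/cvgrPdist_le => e e0.
    have b0 : 0 < (k.+2)`!%:R :> R by rewrite ltr0n fact_gt0.
    near=> h; rewrite sub0r normrN /= addr0 -[h *: 1]/(h * 1) mulr1.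
    rewrite [flat k 0]/flat ltxx subr0 -[_ *: _]/(h^-1 * flat k h).
    have [h0|h0] := ltP 0 h; last first.
      by rewrite {1}/flat ifF ?mulr0 ?normr0 ?ltW//; apply/negbTE; rewrite -leNgt.
    rewrite (_ : h^-1 * flat k h = flat k.+1 h); last first.
      by rewrite /flat h0 exprS mulrA.
    rewrite ger0_norm ?flat_ge0// (le_trans (flat_bound _ _))// -ler_pdivlMl//.
    near: h; apply: dnbhs0_le; first by rewrite mulr_gt0 ?invr_gt0.
  by apply: DeriveDef; [apply/cvg_ex; exists 0; exact: lim0|exact: (cvg_lim _ lim0)].
Unshelve. all: by end_near. Qed.

Lemma smooth_flat k : smooth (flat k).
Proof.
apply/smoothP => m; elim: m k => //= m IH k.
have [d1 d2] := is_derive_derive1 (is_derive_flat k).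
rewrite d2; split => //; apply: smooth_uptoD => //.
rewrite (_ : (fun t => _) = (fun t => (- k%:R) * flat k.+1 t)); last first.
  by apply/funext => t; rewrite mulNr.
by apply: (@smooth_uptoM m (cst (- k%:R))) => //; exact: smooth_upto_cst.
Qed.

Definition bump1 (a b t : R) : R := flat 0 (t - a) * flat 0 (b - t).

Lemma flat0_le1 y : flat 0 y <= 1.
Proof.
rewrite /flat; case: ifPn => [y0|_]; last exact: ler01.
by rewrite expr0 mul1r -expR0 ler_expR oppr_le0 invr_ge0 ltW.
Qed.

Lemma flat0_gt0 y : (0 < flat 0 y) = (0 < y).
Proof.
rewrite /flat; case: ifPn => [y0|_]; last by rewrite ltxx.
by rewrite expr0 mul1r expR_gt0.
Qed.

Lemma bump1_01 a b t : 0 <= bump1 a b t <= 1.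
Proof. by rewrite mulr_ge0 ?flat_ge0//= mulr_ile1 ?flat_ge0// flat0_le1. Qed.

Lemma bump1_gt0 a b t : (0 < bump1 a b t) = (a < t < b).
Proof.
rewrite /bump1; have [h1|h1] := ltP 0 (flat 0 (t - a)).
  by rewrite pmulr_rgt0// flat0_gt0; move: h1; rewrite flat0_gt0 !subr_gt0 => ->.
have -> : flat 0 (t - a) = 0 by apply/eqP; rewrite eq_le h1 flat_ge0.
rewrite mul0r ltxx; apply/esym/negbTE; rewrite negb_and -leNgt.
by move: h1; rewrite [flat _ _ <= 0]leNgt flat0_gt0 subr_gt0 -leNgt => ->.
Qed.

Lemma bump1_eq0 a b t : (bump1 a b t != 0) = (a < t < b).
Proof. by rewrite -bump1_gt0 lt0r; have /andP[-> _] := bump1_01 a b t; rewrite andbT. Qed.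

Lemma smooth_bump1 a b : smooth (bump1 a b).
Proof.
apply/smoothP => k; apply: smooth_uptoM.
  have := smooth_upto_comp_affine 1 (- a) ((smoothP (flat 0)).1 (@smooth_flat 0%N) k).
  by under eq_fun do rewrite mul1r.
have := smooth_upto_comp_affine (-1) b ((smoothP (flat 0)).1 (@smooth_flat 0%N) k).
by under eq_fun do rewrite mulN1r addrC.
Qed.

Lemma smooth_continuous f : smooth f -> continuous f.
Proof.
move=> sf t; apply: differentiable_continuous; apply/derivable1_diffP.
exact: (sf 0%N).
Qed.

Lemma smooth_derive1 f : smooth f -> smooth (derive1 f).
Proof. by move=> sf k t; rewrite -derive1Sn; exact: sf. Qed.

Lemma smoothM f g : smooth f -> smooth g -> smooth (fun t => f t * g t).
Proof. by move=> /smoothP sf /smoothP sg; apply/smoothP => k; exact: smooth_uptoM. Qed.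

Lemma smoothD f g : smooth f -> smooth g -> smooth (fun t => f t + g t).
Proof. by move=> /smoothP sf /smoothP sg; apply/smoothP => k; exact: smooth_uptoD. Qed.

Lemma smooth_cst c : smooth (cst c).
Proof. by apply/smoothP => k; exact: smooth_upto_cst. Qed.

Lemma smooth_comp_affine f c e : smooth f -> smooth (fun t => f (c * t + e)).
Proof. by move=> /smoothP sf; apply/smoothP => k; exact: smooth_upto_comp_affine. Qed.

End smooth1.

Section Ck_theory.
Context (R : realType) (n : nat).
Implicit Types (f g : 'rV[R]_n -> R) (k : nat).
Local Notation e_ i := (delta_mx ord0 i : 'rV[R]_n).

Lemma Ck_continuous k f : Ck k f -> continuous f. Proof. by case: k => [[]|k []]. Qed.

Lemma CkS k f : Ck k.+1 f -> Ck k f.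
Proof.
elim: k f => [f []//|k IH f [cf h]]; split => // i; have [d1 d2] := h i.
by split => //; exact: IH.
Qed.

Lemma pderiv_is_derive i f f' : (forall x, is_derive x (e_ i) f (f' x)) ->
  (forall x, derivable f x (e_ i)) /\ pderiv i f = f'.
Proof.
move=> h; split=> [x|]; first exact: (@ex_derive _ _ _ _ _ _ _ (h x)).
by apply/funext => x; apply: (@derive_val _ _ _ _ _ _ _ (h x)).
Qed.

Lemma Ck_is_derive k f i x : Ck k.+1 f -> is_derive x (e_ i) f (pderiv i f x).
Proof. by move=> [_ /(_ i)[df _]]; exact: derivableP. Qed.

Lemma Ck_pderiv k f i : Ck k.+1 f -> Ck k (pderiv i f).
Proof. by move=> [_ /(_ i)[]]. Qed.

Lemma Ck_cst k c : Ck k (cst c : 'rV[R]_n -> R).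
Proof.
elim: k c => [|k IH] c; first by split => //; exact: cst_continuous.
split=> [|i]; first exact: cst_continuous.
have [d1 d2] := pderiv_is_derive (fun x => is_derive_cst (c : R) x (e_ i)).
by rewrite d2; split => //; exact: (IH 0).
Qed.

Lemma CkD k f g : Ck k f -> Ck k g -> Ck k (fun x => f x + g x).
Proof.
elim: k f g => [|k IH] f g Cf Cg; split => //; try by move=> x; apply: continuousD;
  [exact: (Ck_continuous Cf)|exact: (Ck_continuous Cg)].
move=> i.
have [d1 d2] := pderiv_is_derive (fun x => is_deriveD (Ck_is_derive i x Cf) (Ck_is_derive i x Cg)).
rewrite -[fun x => _]/(f + g) d2; split => //.
by apply: IH; exact: Ck_pderiv.
Qed.

Lemma pderivM f g i : Ck 1 f -> Ck 1 g ->
  pderiv i (fun x => f x * g x) = (fun x => f x * pderiv i g x + g x * pderiv i f x).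
Proof.
move=> Cf Cg; exact: (pderiv_is_derive (fun x => is_deriveM (Ck_is_derive i x Cf) (Ck_is_derive i x Cg))).2.
Qed.

Lemma CkM k f g : Ck k f -> Ck k g -> Ck k (fun x => f x * g x).
Proof.
elim: k f g => [|k IH] f g Cf Cg; split => //; try by move=> x; apply: continuousM;
  [exact: (Ck_continuous Cf)|exact: (Ck_continuous Cg)].
move=> i.
have [d1 d2] := pderiv_is_derive (fun x => is_deriveM (Ck_is_derive i x Cf) (Ck_is_derive i x Cg)).
rewrite -[fun x => _]/(f * g) d2; split => //.
apply: (@CkD _ (fun x => f x * pderiv i g x) (fun x => g x * pderiv i f x)); apply: IH.
- exact: CkS.
- exact: Ck_pderiv.
- exact: CkS.
- exact: Ck_pderiv.
Qed.

Lemma CkZ k c f : Ck k f -> Ck k (fun x => c * f x).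
Proof. by move=> Cf; apply: (@CkM k (cst c)) => //; exact: Ck_cst. Qed.

Lemma is_derive_coor (theta : R -> R) (i j : 'I_n) x : smooth theta ->
  is_derive x (e_ j) (fun x => theta (x ord0 i)) ((i == j)%:R * derive1 theta (x ord0 i)).
Proof.
move=> st; have dt := derivable_is_derive1 (st 0%N) (x ord0 i).
have E : (fun h : R => h^-1 *: (((fun x => theta (x ord0 i)) \o shift x) (h *: e_ j) - theta (x ord0 i)))
   = (fun h : R => (i == j)%:R * (h^-1 *: ((theta \o shift (x ord0 i)) (h *: 1) - theta (x ord0 i)))).
  apply/funext => h; rewrite /= !mxE eqxx andTb.
  case: (i == j); first by rewrite mul1r.
  by rewrite mulr0 add0r subrr scaler0 mul0r.
have lim : h^-1 *: (((fun x => theta (x ord0 i)) \o shift x) (h *: e_ j) - theta (x ord0 i)) @[h --> 0^']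
    --> (i == j)%:R * derive1 theta (x ord0 i).
  rewrite E; apply: cvgMr; rewrite derive1E.
  exact: (@ex_derive _ _ _ _ _ _ _ dt).
by apply: DeriveDef; [apply/cvg_ex; eexists; exact: lim|exact: (cvg_lim _ lim)].
Qed.

Lemma Ck_coor k (theta : R -> R) (i : 'I_n) : smooth theta -> Ck k (fun x : 'rV[R]_n => theta (x ord0 i)).
Proof.
elim: k theta => [|k IH] theta st; split => //.
- by move=> x; apply: continuous_comp; [exact: coord_continuous|exact: smooth_continuous].
- by move=> x; apply: continuous_comp; [exact: coord_continuous|exact: smooth_continuous].
move=> j; have [d1 d2] := pderiv_is_derive (fun x => is_derive_coor i j x st).
rewrite d2; split => //; apply: CkZ; apply: IH; exact: smooth_derive1.
Qed.

Lemma Ck_prod k (I : Type) (s : seq I) (F : I -> 'rV[R]_n -> R) : (forall i, Ck k (F i)) ->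
  Ck k (fun x => \prod_(i <- s) F i x).
Proof.
move=> CF; elim: s => [|i s IH].
  by under eq_fun do rewrite big_nil; exact: (Ck_cst k 1).
by under eq_fun do rewrite big_cons; exact: CkM.
Qed.

End Ck_theory.

(** * Test functions *)

Section L2_dense_sequence.
Context d (T : measurableType d) (R : realType).
Variables (mu : {measure set T -> \bar R}) (D : set T) (mD : measurable D).

Definition dense_in_L2 (c : nat -> T -> R) :=
  forall f, sqint mu D f -> forall e, 0 < e -> exists n, norm2 mu D (f - c n) < e.

Lemma orthogonal_dense_eq0 (c : nat -> T -> R) h : (forall n, sqint mu D (c n)) ->
  dense_in_L2 c -> sqint mu D h -> (forall n, ipD mu D h (c n) = 0) -> norm2 mu D h = 0.
Proof.
move=> Lc dc Lh hc; have SN := norm2_seminormed mu mD.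
have N0 := seminorm_ge0 SN h.
apply/eqP; rewrite eq_le N0 andbT; apply: le_eps => e e0; rewrite add0r.
have [n hn] := dc _ Lh _ e0.
have [->|Nh] := eqVneq (norm2 mu D h) 0; first exact: ltW.
have Nh0 : 0 < norm2 mu D h by rewrite lt_neqAle eq_sym Nh.
have sub := sqint_subspace mu mD.
rewrite -(ler_pM2l Nh0) -expr2 sqr_norm2.
have -> : ipD mu D h h = ipD mu D h (h - c n).
  by rewrite (ipBr sub (ipD_semi_inner mu mD))// hc subr0.
apply: le_trans (ler_norm _) _; apply: le_trans (CauchySchwarz_L2 mD Lh _) _.
  exact: subspaceB.
by rewrite ler_wpM2l// ltW.
Qed.

Lemma dense_in_L2_comb (I : countType) (beta : I -> T -> R) :
  (forall f e, sqint mu D f -> 0 < e -> exists E, norm2 mu D (f - bump_comb beta E) < e) ->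
  exists c : nat -> T -> R, (forall n, exists E, c n = bump_comb beta E) /\ dense_in_L2 c.
Proof.
move=> h; exists (fun n => if @choice.unpickle (seq (rat * seq I)) n is Some E
   then bump_comb beta E else bump_comb beta [::]); split.
  by move=> n; case: choice.unpickle => [E|]; [exists E|exists [::]].
move=> f Lf e e0; have [E hE] := h _ _ Lf e0.
by exists (choice.pickle E); rewrite choice.pickleK.
Qed.

End L2_dense_sequence.

Section compact_support.
Context (T : topologicalType) (R : realType).
Implicit Types (D : set T) (f g h : T -> R).

Definition supp_in D f := compact (closure [set x | f x != 0]) /\
  closure [set x | f x != 0] `<=` D.

Lemma supp_in_sub D f g : (forall x, g x != 0 -> f x != 0) -> supp_in D f -> supp_in D g.
Proof.
move=> gf [cf fD]; have sub : closure [set x | g x != 0] `<=` closure [set x | f x != 0].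
  by apply: closureS => x /=; exact: gf.
split; last exact: subset_trans fD.
by apply: subclosed_compact cf sub; exact: closed_closure.
Qed.

Lemma supp_inU D f g h : (forall x, h x != 0 -> f x != 0 \/ g x != 0) ->
  supp_in D f -> supp_in D g -> supp_in D h.
Proof.
move=> hfg [cf fD] [cg gD].
have sub : closure [set x | h x != 0] `<=`
    closure [set x | f x != 0] `|` closure [set x | g x != 0].
  by rewrite -closureU; apply: closureS => x /=; exact: hfg.
split; last by move=> x /sub[/fD|/gD].
apply: subclosed_compact sub; first exact: closed_closure.
exact: compactU.
Qed.

Lemma supp_in_closed D C f : compact C -> closed C -> C `<=` D ->
  (forall x, f x != 0 -> C x) -> supp_in D f.
Proof.
move=> cC clC CD fC; have sub : closure [set x | f x != 0] `<=` C.
  by rewrite [X in _ `<=` X]((closure_id C).1 clC); exact: closureS.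
split; last exact: subset_trans CD.
by apply: subclosed_compact cC sub; exact: closed_closure.
Qed.

Lemma supp_in_lin D c f g : supp_in D f -> supp_in D g -> supp_in D (fun x => c * f x + g x).
Proof.
apply: supp_inU => x h; have [f0|] := eqVneq (f x) 0; last by left.
by right; move: h; rewrite f0 mulr0 add0r.
Qed.

Lemma supp_inMr D f g : supp_in D f -> supp_in D (fun x => f x * g x).
Proof. by apply: supp_in_sub => x; apply: contra_neq => ->; rewrite mul0r. Qed.

Lemma supp_in0 D : supp_in D (fun _ => 0 : R).
Proof.
apply: (@supp_in_closed D set0) => //; [exact: compact0|exact: closed0|].
by move=> x /eqP.
Qed.

Lemma supp_in_outside D f x : supp_in D f -> ~ D x -> f x = 0.
Proof.
move=> [_ sD] nDx; apply/eqP/negPn/negP => fx; apply: nDx; apply: sD.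
exact: subset_closure.
Qed.

Lemma supp_in_bounded D f : continuous f -> supp_in D f -> exists M, forall x, `|f x| <= M.
Proof.
move=> cf [cs _].
have : compact (f @` closure [set x | f x != 0]).
  by apply: continuous_compact => //; exact: continuous_subspaceT.
move=> /compact_bounded[M0 [_ hM]]; exists (`|M0| + 1) => x.
have [->|fx] := eqVneq (f x) 0; first by rewrite normr0 addr_ge0.
apply: hM; first by rewrite (le_lt_trans (ler_norm _))// ltrDl.
by exists x => //; exact: subset_closure.
Qed.

End compact_support.

Lemma supp_in_derive (R : realType) (V : normedModType R) (D : set V) (f : V -> R) v :
  supp_in D f -> supp_in D (fun x => 'D_v f x).
Proof.
move=> [cs sD].
apply: (@supp_in_closed _ _ D (closure [set x | f x != 0])) => //.
  exact: closed_closure.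
move=> x; apply: contra_neqP => nx.
have nf : \forall y \near x, 0 = f y.
  have : nbhs x (~` closure [set x | f x != 0]).
    by apply: open_nbhs_nbhs; split => //; rewrite openC; exact: closed_closure.
  apply: filterS => y ny; apply/eqP; rewrite eq_sym; apply/negPn/negP => fy.
  by apply: ny; exact: subset_closure.
have d0 : is_derive x v (cst 0 : V -> R) 0 by exact: is_derive_cst.
exact: (@derive_val _ _ _ _ _ _ _ (near_eq_is_derive nf d0)).
Qed.

Section Coo_0_theory.
Context (R : realType) (n : nat).
Implicit Types (D : set 'rV[R]_n) (f g : 'rV[R]_n -> R).

Lemma Coo_0_lin D c f g : Coo_0 D f -> Coo_0 D g -> Coo_0 D (fun x => c * f x + g x).
Proof.
move=> [Cf sf] [Cg sg]; split; last exact: supp_in_lin.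
by move=> k; apply: (@CkD _ _ _ (fun x => c * f x)) => //; exact: CkZ.
Qed.

Lemma Coo_0Mr D f g : Coo_0 D f -> (forall k, Ck k g) -> Coo_0 D (fun x => f x * g x).
Proof. by move=> [Cf sf] Cg; split; [move=> k; exact: CkM|exact: supp_inMr]. Qed.

Lemma Coo_00 D : Coo_0 D (fun _ => 0).
Proof. by split; [move=> k; exact: (Ck_cst n k 0)|exact: supp_in0]. Qed.

Lemma Coo_0_pderiv D f i : Coo_0 D f -> Coo_0 D (pderiv i f).
Proof.
move=> [Cf sf]; split; last exact: supp_in_derive.
by move=> k; exact: Ck_pderiv (Cf k.+1).
Qed.

Lemma Coo_0_bounded D f : Coo_0 D f -> exists M, forall x, `|f x| <= M.
Proof. by move=> [Cf]; apply: supp_in_bounded; exact: (Ck_continuous (Cf 0%N)). Qed.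

Lemma Coo_0_measurable D f : Coo_0 D f -> measurable_fun setT f.
Proof. by move=> [Cf _]; apply: measurable_continuous_rV; exact: (Ck_continuous (Cf 0%N)). Qed.

Let rat_vec := {ffun 'I_n -> rat}.
Let ivl (a : rat_vec) : 'I_n -> R := fun i => ratr (a i).

Definition bump_rV D (p : rat_vec * rat_vec) (x : 'rV[R]_n) : R :=
  if `[< boxcc (ivl p.1) (ivl p.2) `<=` D >]
  then \prod_(i < n) bump1 (ivl p.1 i) (ivl p.2 i) (x ord0 i) else 0.

Lemma bump_rV01 D p x : 0 <= bump_rV D p x <= 1.
Proof.
rewrite /bump_rV; case: ifP => _; last by rewrite lexx ler01.
by apply: (big_ind (fun z : R => 0 <= z <= 1)) => [|u v|i _]; [rewrite ler01 lexx|nra|exact: bump1_01].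
Qed.

Lemma bump_rV_gt0 D p x : 0 < bump_rV D p x <->
  boxcc (ivl p.1) (ivl p.2) `<=` D /\ boxoo (ivl p.1) (ivl p.2) x.
Proof.
rewrite /bump_rV; case: asboolP => [sub|nsub]; last by rewrite ltxx; split=> // -[].
split=> [h|[_ h]].
  split => // i; rewrite -bump1_gt0 lt0r; have /andP[-> _] := bump1_01 (ivl p.1 i) (ivl p.2 i) (x ord0 i).
  rewrite andbT; apply/negP => /eqP h0; move: h.
  by rewrite (bigD1 i)//= h0 mul0r ltxx.
by apply: prodr_gt0 => i _; rewrite bump1_gt0.
Qed.

Lemma Coo_0_bump_rV D p : Coo_0 D (bump_rV D p).
Proof.
have [sub|nsub] := pselect (boxcc (ivl p.1) (ivl p.2) `<=` D); last first.
  rewrite (_ : bump_rV D p = fun=> 0); first exact: Coo_00.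
  by apply/funext => x; rewrite /bump_rV; case: asboolP.
split.
  move=> k; rewrite (_ : bump_rV D p =
     fun x => \prod_(i < n) bump1 (ivl p.1 i) (ivl p.2 i) (x ord0 i)); last first.
    by apply/funext => x; rewrite /bump_rV; case: asboolP.
  by apply: Ck_prod => i; apply: Ck_coor; exact: smooth_bump1.
apply: (@supp_in_closed _ _ D (boxcc (ivl p.1) (ivl p.2))) => //.
- exact: compact_boxcc.
- apply: compact_closed; [exact: norm_hausdorff|exact: compact_boxcc].
- move=> x fx; have /andP[f0 _] := bump_rV01 D p x.
  have /bump_rV_gt0[_ h] : 0 < bump_rV D p x by rewrite lt_neqAle eq_sym fx.
  by move=> i; have /andP[/ltW -> /ltW ->] := h i.
Qed.

Section dense.
Variable D : set 'rV[R]_n.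
Hypotheses (oD : open D) (bD : bounded_set D).
Let mu : {measure set 'rV[R]_n -> \bar R} := lebesgue_rV R n.
Let mD : measurable D := open_measurable_rV oD.
Let fD : (mu D < +oo)%E := lebesgue_bounded_lty mD bD.

Lemma Coo_0_sqint f : Coo_0 D f -> sqint mu D f.
Proof.
move=> Cf; have [M hM] := Coo_0_bounded Cf.
apply: (sqint_bounded mD fD (M := M)) => //.
by apply: measurable_funTS; exact: Coo_0_measurable Cf.
Qed.

(** The open sets are the unions of the positivity sets of the bumps in boxes
    with rational vertices. *)
Lemma Coo_0_dense_sequence : exists c : nat -> 'rV[R]_n -> R,
  (forall k, Coo_0 D (c k)) /\ dense_in_L2 mu D c.
Proof.
have [|c [hc dc]] := @dense_in_L2_comb _ _ R mu D _ (bump_rV D); last first.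
  exists c; split => // k; have [E ->] := hc k.
  apply: bump_comb_ind => [|c0 f g|f g Cf Cg|j].
  - exact: Coo_00.
  - exact: Coo_0_lin.
  - by apply: Coo_0Mr => //; case: Cg.
  - exact: Coo_0_bump_rV.
move=> f e Lf e0.
apply: (@bump_comb_dense _ _ _ mu D mD fD _ (bump_rV D) _ _ _ (measurable_rV_open R n)) => //.
- by move=> j; apply: measurable_funTS; exact: Coo_0_measurable (Coo_0_bump_rV D j).
- by move=> j x; exact: bump_rV01.
- by move=> A B; exact: openI.
- exact: openT.
move=> O /= oO.
exists [set p | boxcc (ivl p.1) (ivl p.2) `<=` O] => x Dx; split; last first.
  move=> [p /= sub /bump_rV_gt0[_ h]]; apply: sub => i.
  by have /andP[/ltW -> /ltW ->] := h i.
move=> Ox; have /nbhs_ballP[e1 /= e10 xe] : nbhs x (O `&` D).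
  by apply: open_nbhs_nbhs; split => //; exact: openI.
have /choice[c hc] : forall i : 'I_n, exists r : rat, x ord0 i - e1 < ratr r < x ord0 i.
  move=> i; have xk : x ord0 i - e1 < x ord0 i by rewrite ltrBlDr ltrDl.
  by have [r] := rat_in_itvoo xk; rewrite in_itv/= => h; exists r.
have /choice[c' hc'] : forall i : 'I_n, exists r : rat, x ord0 i < ratr r < x ord0 i + e1.
  move=> i; have xk : x ord0 i < x ord0 i + e1 by rewrite ltrDl.
  by have [r] := rat_in_itvoo xk; rewrite in_itv/= => h; exists r.
have sub : boxcc (ivl [ffun i => c i]) (ivl [ffun i => c' i]) `<=` O `&` D.
  move=> y hy; apply: xe; split => // i j; rewrite ord1 /ball/=.
  have := hy j; rewrite /ivl !ffunE; have := hc j; have := hc' j.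
  move=> /andP[h1 h2] /andP[h3 h4] /andP[h5 h6].
  by rewrite ltr_distlC; apply/andP; split; [exact: lt_le_trans h5|exact: le_lt_trans h2].
exists ([ffun i => c i], [ffun i => c' i]); first by move=> y /sub[].
apply/bump_rV_gt0; split; first by move=> y /sub[].
move=> i; rewrite /ivl !ffunE; have := hc i; have := hc' i.
by move=> /andP[-> _] /andP[_ ->].
Qed.

End dense.
End Coo_0_theory.

Section Coo_0_itv_theory.
Context (R : realType) (T : R).
Implicit Types (f g : R -> R).

Lemma Coo_0_itvP f : Coo_0_itv T f <-> smooth f /\ supp_in `]0, T[%classic f.
Proof. by split => [[? ? ?]|[? [? ?]]]. Qed.

Lemma Coo_0_itv_lin c f g : Coo_0_itv T f -> Coo_0_itv T g ->
  Coo_0_itv T (fun x => c * f x + g x).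
Proof.
move=> /Coo_0_itvP[Cf sf] /Coo_0_itvP[Cg sg]; apply/Coo_0_itvP; split; last exact: supp_in_lin.
apply: (smoothD (f := fun x => c * f x) _ Cg).
exact: (smoothM (f := cst c) (@smooth_cst R c) Cf).
Qed.

Lemma Coo_0_itvMr f g : Coo_0_itv T f -> smooth g -> Coo_0_itv T (fun x => f x * g x).
Proof.
move=> /Coo_0_itvP[Cf sf] sg; apply/Coo_0_itvP; split; [exact: smoothM|exact: supp_inMr].
Qed.

Lemma Coo_0_itv0 : Coo_0_itv T (fun _ => 0).
Proof. by apply/Coo_0_itvP; split; [exact: (@smooth_cst R 0)|exact: supp_in0]. Qed.

Lemma Coo_0_itv_derive1 f : Coo_0_itv T f -> Coo_0_itv T (derive1 f).
Proof.
move=> /Coo_0_itvP[Cf sf]; apply/Coo_0_itvP; split; first exact: smooth_derive1.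
rewrite (_ : derive1 f = fun t => 'D_1 f t); first exact: supp_in_derive.
by apply/funext => t; rewrite derive1E.
Qed.

Lemma continuous_measurable f : continuous f ->
  measurable_fun [set: measurableTypeR R] (f : measurableTypeR R -> measurableTypeR R).
Proof. by move=> cf; exact: continuous_measurable_fun. Qed.

Lemma Coo_0_itv_continuous f : Coo_0_itv T f -> continuous f.
Proof. by move=> /Coo_0_itvP[sf _]; exact: smooth_continuous. Qed.

Lemma Coo_0_itv_bounded f : Coo_0_itv T f -> exists M, forall x, `|f x| <= M.
Proof.
move=> h; apply: (supp_in_bounded (Coo_0_itv_continuous h)).
by move/Coo_0_itvP : h => [_]; exact.
Qed.

Lemma Coo_0_itv_measurable f : Coo_0_itv T f ->
  measurable_fun [set: measurableTypeR R] (f : measurableTypeR R -> measurableTypeR R).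
Proof. by move=> /Coo_0_itv_continuous; exact: continuous_measurable. Qed.

Definition bump_itv (p : rat * rat) (t : R) : R :=
  if (0 < p.1) && (ratr p.2 < T) then bump1 (ratr p.1) (ratr p.2) t else 0.

Lemma bump_itv01 p t : 0 <= bump_itv p t <= 1.
Proof. by rewrite /bump_itv; case: ifP => _; [exact: bump1_01|rewrite lexx ler01]. Qed.

Lemma Coo_0_itv_bump p : Coo_0_itv T (bump_itv p).
Proof.
have [/andP[p1 p2]|np] := boolP ((0 < p.1) && (ratr p.2 < T)); last first.
  rewrite (_ : bump_itv p = fun=> 0); first exact: Coo_0_itv0.
  by apply/funext => x; rewrite /bump_itv (negbTE np).
rewrite (_ : bump_itv p = bump1 (ratr p.1) (ratr p.2)); last first.
  by apply/funext => x; rewrite /bump_itv p1 p2.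
apply/Coo_0_itvP; split; first exact: smooth_bump1.
apply: (@supp_in_closed R R `]0, T[%classic `[ratr p.1, ratr p.2]%classic).
- exact: segment_compact.
- exact: interval_closed.
- move=> x /=; rewrite !in_itv/= => /andP[h1 h2].
  by rewrite (lt_le_trans _ h1) ?ltr0q//= (le_lt_trans h2).
- by move=> x; rewrite bump1_eq0 /= in_itv/= => /andP[/ltW -> /ltW ->].
Qed.

Let lam : {measure set (measurableTypeR R) -> \bar R} := @lebesgue_measure R.
Let I : set (measurableTypeR R) := `]0, T[%classic.

Lemma measurable_itvI : measurable I. Proof. exact: measurable_itv. Qed.

Lemma lebesgue_itvI_lty : (lam I < +oo)%E.
Proof.
have -> : lam I = lebesgue_measure (`]0, T[%classic : set R) by [].
rewrite (@lebesgue_measure_itv R `]0, T[)/=; case: ifP => _; last exact: ltry.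
by rewrite -EFinB ltry.
Qed.

Lemma measurableR_open : @measurable _ (measurableTypeR R) = <<s [set O : set R | open O] >>.
Proof.
apply/seteqP; split; last first.
  by apply: smallest_sub => [|O /= oO]; [exact: sigma_algebra_measurable|exact: open_measurable].
rewrite [X in X `<=` _](RGenOInfty.measurableE R); apply: smallest_sub.
  exact: smallest_sigma_algebra.
move=> _ [a ->] /=; apply: sub_sigma_algebra => /=; exact: rray_open.
Qed.

Lemma Coo_0_itv_sqint f : Coo_0_itv T f -> sqint lam I f.
Proof.
move=> Cf; have [M hM] := Coo_0_itv_bounded Cf.
apply: (sqint_bounded measurable_itvI lebesgue_itvI_lty (M := M)) => //.
by apply: measurable_funTS; exact: Coo_0_itv_measurable Cf.
Qed.

Lemma Coo_0_itv_dense_sequence : exists c : nat -> R -> R,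
  (forall k, Coo_0_itv T (c k)) /\ dense_in_L2 lam I c.
Proof.
have [|c [hc dc]] := @dense_in_L2_comb _ _ R lam I _ bump_itv; last first.
  exists c; split => // k; have [E ->] := hc k.
  apply: bump_comb_ind => [|c0 f g|f g Cf Cg|j].
  - exact: Coo_0_itv0.
  - exact: Coo_0_itv_lin.
  - by apply: Coo_0_itvMr => //; have /Coo_0_itvP[] := Cg.
  - exact: Coo_0_itv_bump.
move=> f e Lf e0.
apply: (@bump_comb_dense _ _ _ lam I measurable_itvI lebesgue_itvI_lty _ bump_itv _ _ _ measurableR_open) => //.
- by move=> j; apply: measurable_funTS; exact: Coo_0_itv_measurable (Coo_0_itv_bump j).
- by move=> j x; exact: bump_itv01.
- by move=> A B; exact: openI.
- exact: openT.
move=> O /= oO.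
exists [set p | forall t : R, ratr p.1 <= t <= ratr p.2 -> O t] => x; rewrite /I /= in_itv/= => /andP[x0 xT]; split; last first.
  move=> [p /= sub]; rewrite /bump_itv; case: ifP => _; last by rewrite ltxx.
  by rewrite bump1_gt0 => /andP[/ltW h1 /ltW h2]; apply: sub; rewrite h1.
move=> Ox; have /nbhs_ballP[e1 /= e10 xe] : nbhs x O by exact: open_nbhs_nbhs.
have xk1 : Num.max 0 (x - e1) < x by rewrite gt_max x0 ltrBlDr ltrDl.
have xk2 : x < Num.min T (x + e1) by rewrite lt_min xT ltrDl.
have [r1] := rat_in_itvoo xk1; rewrite in_itv/= gt_max => /andP[/andP[a1 a2] a3].
have [r2] := rat_in_itvoo xk2; rewrite in_itv/= lt_min => /andP[b1 /andP[b2 b3]].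
exists (r1, r2) => /=.
  move=> t /andP[t1 t2]; apply: xe; rewrite /ball/= ltr_distlC.
  by rewrite (lt_le_trans a2)//= (le_lt_trans t2).
by rewrite /bump_itv /= -(ltr0q R) a1 b2 bump1_gt0 a3.
Qed.

End Coo_0_itv_theory.

(** * Integration by parts and the Poincare inequality *)

Section integration_by_parts.
Context (R : realType) (n : nat) (D : set 'rV[R]_n).
Hypotheses (oD : open D) (bD : bounded_set D).
Let mu : {measure set 'rV[R]_n -> \bar R} := lebesgue_rV R n.
Implicit Types (f g chi : 'rV[R]_n -> R) (i : 'I_n).
Local Notation e_ i := (delta_mx ord0 i : 'rV[R]_n).

Lemma measurable_domain : measurable D. Proof. exact: open_measurable_rV. Qed.

Lemma domain_lty : (mu D < +oo)%E.
Proof. by apply: lebesgue_bounded_lty => //; exact: measurable_domain. Qed.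

Let mD := measurable_domain.
Let fD := domain_lty.

Lemma supp_in_sqint f : continuous f -> supp_in D f -> sqint mu D f.
Proof.
move=> cf sf; have [M hM] := supp_in_bounded cf sf.
apply: (sqint_bounded mD fD (M := M)) => //.
by apply: measurable_funTS; exact: measurable_continuous_rV.
Qed.

Lemma supp_in_integrable f : continuous f -> supp_in D f -> mu.-integrable D (EFin \o f).
Proof. by move=> cf sf; apply: (sqint_integrable mD fD); exact: supp_in_sqint. Qed.

Lemma is_derive_line f i x (s : R) : Ck 1 f ->
  is_derive s 1 (fun s : R => f (shift_rV i s x)) (pderiv i f (shift_rV i s x)).
Proof.
move=> Cf; have := Ck_is_derive i (shift_rV i s x) Cf.
move=> [df vf].
have E : (fun h : R => h^-1 *: ((f \o shift (shift_rV i s x)) (h *: e_ i) - f (shift_rV i s x)))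
  = (fun h : R => h^-1 *: (((fun s : R => f (shift_rV i s x)) \o shift s) (h *: 1) - f (shift_rV i s x))).
  apply/funext => h /=; congr (_ *: (f _ - _)).
  by rewrite /shift_rV -[h *: 1]/(h * 1) mulr1 scalerDl addrCA addrA.
apply: DeriveDef; first by rewrite /derivable -E.
by rewrite /derive -E.
Qed.

Lemma Rintegral_shift i h chi : mu.-integrable setT (EFin \o chi) ->
  \int[mu]_x chi (shift_rV i h x) = \int[mu]_x chi x.
Proof.
move=> ic; have mc := measurable_int _ ic.
rewrite /Rintegral; congr fine; rewrite integralE [RHS]integralE; congr (_ - _)%E.
  have := integral_shift_rV i h (measurable_funepos mc) (fun x => funepos_ge0 _ x).
  by move=> <-; apply: eq_integral => x _; rewrite !funeposE.
have := integral_shift_rV i h (measurable_funeneg mc) (fun x => funeneg_ge0 _ x).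
by move=> <-; apply: eq_integral => x _; rewrite !funenegE.
Qed.

(** Difference quotients of [chi] have integral [0] because the measure is
    translation invariant, and they converge boundedly to the derivative. *)
Lemma Rintegral_pderiv_eq0 chi i : Ck 1 chi -> supp_in D chi ->
  \int[mu]_(x in D) pderiv i chi x = 0.
Proof.
move=> C1 sc; have cc := Ck_continuous C1.
have cp : continuous (pderiv i chi) by exact: (Ck_continuous (Ck_pderiv i C1)).
have sp : supp_in D (pderiv i chi) := supp_in_derive _ sc.
have [M hM] := supp_in_bounded cp sp.
have [L [L0 DL]] := bounded_boxcc bD.
pose B : set 'rV[R]_n := boxcc (fun=> - (L + 1)) (fun=> L + 1).
have mB : measurable B by exact: measurable_boxcc.
have mchi : measurable_fun setT chi by exact: measurable_continuous_rV.
have M0 : 0 <= M by exact: le_trans (hM 0).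
have ichi : mu.-integrable setT (EFin \o chi).
  have := supp_in_integrable cc sc; rewrite integrable_mkcond//.
  apply: eq_integrable => // x _; rewrite patchE; case: ifPn => //.
  by rewrite notin_setE => nDx; rewrite /= (supp_in_outside sc).
pose h k : R := k.+1%:R^-1.
have h0 k : 0 < h k by rewrite invr_gt0.
have h1 k : h k <= 1 by rewrite invf_le1// ler1n.
pose q k x := (h k)^-1 * (chi (shift_rV i (h k) x) - chi x).
have mshift k : measurable_fun setT (fun x => chi (shift_rV i (h k) x)).
  by apply: measurableT_comp => //; exact: measurable_shift_rV.
have mq k : measurable_fun setT (EFin \o q k).
  apply/measurable_EFinP; apply: measurable_funM => //; exact: measurable_funB.
have ishift k : mu.-integrable setT (EFin \o (fun x => chi (shift_rV i (h k) x))).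
  apply/integrableP; split; first exact/measurable_EFinP.
  have := integral_shift_rV i (h k) (measurableT_comp (@abse_measurable _ setT) (measurable_int _ ichi)) (fun x => abse_ge0 _).
  by move=> /= ->; case/integrableP : ichi.
have iq k : \int[mu]_x q k x = 0.
  rewrite RintegralZl//; last first.
    rewrite (_ : _ \o _ = (EFin \o (fun x => chi (shift_rV i (h k) x))) \- (EFin \o chi))%E//.
    exact: integrableB.
  by rewrite RintegralB// Rintegral_shift// subrr mulr0.
have qM k x : `|q k x| <= M.
  have [c _ hc] := @MVT R (fun s => chi (shift_rV i s x)) (fun s => pderiv i chi (shift_rV i s x)) 0 (h k) (h0 k)
    (fun s _ => is_derive_line i x s C1) ltac:(
     apply: derivable_within_continuous => s _;
     exact: (@ex_derive _ _ _ _ _ _ _ (is_derive_line i x s C1))).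
  move: hc; rewrite subr0 {2}/shift_rV scale0r addr0 /q => ->.
  by rewrite mulrCA mulVf ?gt_eqF// mulr1.
have qB k x : ~ B x -> q k x = 0.
  move=> nBx; rewrite /q (supp_in_outside (x := x) sc); last first.
    move=> /DL hx; apply: nBx => j; have := hx j; lra.
  rewrite (supp_in_outside sc) ?subr0 ?mulr0// => /DL hx; apply: nBx => j.
  have := hx j; rewrite shift_rVE; have := h0 k; have := h1 k.
  by case: (j == i); rewrite ?mulr1n ?mulr0n; lra.
have qlim x : q k x @[k --> \oo] --> pderiv i chi x.
  apply/cvg_seqP => e e0; have [dc vc] := Ck_is_derive i x C1.
  have : h^-1 *: ((chi \o shift x) (h *: e_ i) - chi x) @[h --> 0^'] --> pderiv i chi x.
    by rewrite -vc.
  move=> /cvgrPdist_lt /(_ _ e0)[de /= de0 hd].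
  have [k0 hk0] := exists_natSinv_lt de0; exists k0 => k kk.
  have hk : h k < de.
    apply: le_lt_trans hk0; rewrite /h lef_pV2 ?posrE// ler_nat ltnS//.
  have := hd (h k); rewrite /ball_/= sub0r normrN gtr0_norm// => /(_ hk (lt0r_neq0 (h0 k))).
  by rewrite distrC /q /shift_rV [x + _]addrC.
pose G x := (M * \1_B x)%:E.
have iG : mu.-integrable setT G.
  have : mu.-integrable B (EFin \o cst M).
    apply: (integrable_bounded mB (lebesgue_boxcc_lty _ _) (M := M)) => //.
    by move=> x _; rewrite ger0_norm.
  rewrite integrable_mkcond//; apply: eq_integrable => // x _.
  by rewrite patchE /G indicE; case: ifP => _; rewrite ?mulr1 ?mulr0.
have [] := @dominated_convergence _ _ R mu setT measurableT (fun k => EFin \o q k) (EFin \o pderiv i chi) G.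
- by move=> k; exact: mq.
- by apply/measurable_EFinP; exact: measurable_continuous_rV.
- apply: aeW => x _; apply: cvg_EFin; first exact: nearW.
  exact: qlim.
- exact: iG.
- apply: aeW => x k _; rewrite /G lee_fin indicE.
  have [xB|xB] := boolP (x \in B); first by rewrite mulr1 qM.
  by rewrite mulr0 qB ?normr0//; move: xB; rewrite notin_setE.
move=> _ _ lim.
have I0 : (\int[mu]_x (EFin \o pderiv i chi) x)%E = 0%E.
  have <- := cvg_lim (@ereal_hausdorff R) lim.
  rewrite (_ : [sequence _]_k = cst 0%E) ?lim_cst//.
  apply/funext => k /=; rewrite -EFin_Rintegral ?iq//.
  rewrite (_ : _ \o _ = (fun x => (h k)^-1%:E * ((EFin \o (fun x => chi (shift_rV i (h k) x))) \- (EFin \o chi)) x)%E)//.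
  by apply: integrableZl => //; exact: integrableB.
rewrite Rintegral_mkcond /Rintegral.
rewrite (_ : (\int[mu]_x _)%E = (\int[mu]_x (EFin \o pderiv i chi) x)%E) ?I0//.
rewrite -I0; apply: eq_integral => x _ /=; rewrite patchE; case: ifPn => //.
by rewrite notin_setE => nDx; rewrite (supp_in_outside sp).
Qed.

Lemma integration_by_parts f g i : Ck 1 f -> Ck 1 g -> supp_in D g ->
  \int[mu]_(x in D) (f x * pderiv i g x) = - \int[mu]_(x in D) (pderiv i f x * g x).
Proof.
move=> Cf Cg sg.
have sfg : supp_in D (fun x => f x * g x).
  by under eq_fun do rewrite mulrC; exact: supp_inMr.
have cfp : continuous (pderiv i f) by exact: (Ck_continuous (Ck_pderiv i Cf)).
have cgp : continuous (pderiv i g) by exact: (Ck_continuous (Ck_pderiv i Cg)).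
have cf := Ck_continuous Cf; have cg := Ck_continuous Cg.
have i1 : mu.-integrable D (EFin \o (fun x => f x * pderiv i g x)).
  apply: supp_in_integrable; first by move=> x; apply: continuousM; [exact: cf|exact: cgp].
  by under eq_fun do rewrite mulrC; apply: supp_inMr; exact: supp_in_derive.
have i2 : mu.-integrable D (EFin \o (fun x => g x * pderiv i f x)).
  apply: supp_in_integrable; first by move=> x; apply: continuousM; [exact: cg|exact: cfp].
  exact: supp_inMr.
have := Rintegral_pderiv_eq0 i (CkM Cf Cg) sfg.
rewrite (pderivM i Cf Cg) RintegralD// => /eqP; rewrite addr_eq0 => /eqP ->.
by congr (- _); apply: eq_Rintegral => x _; rewrite mulrC.
Qed.

(** Integrating the derivative of $x_i \chi^2$ over the domain. *)
Lemma poincare_smooth (L : R) chi i : 0 <= L -> D `<=` boxcc (fun=> - L) (fun=> L) -> Coo_0 D chi ->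
  norm2 mu D chi <= 2 * L * norm2 mu D (pderiv i chi).
Proof.
move=> L0 DL Cchi; have [Cc sc] := Cchi; have C1 := Cc 1%N.
have Cx : Ck 1 (fun x : 'rV[R]_n => x ord0 i).
  apply: (@Ck_coor R n 1 id); apply/smoothP => k; elim: k => // k _ /=.
  have [d1 d2] := is_derive_derive1 (fun t : R => is_derive_id t (1 : R)).
  by split => //; rewrite d2; exact: (@smooth_upto_cst R k 1).
have dx x : pderiv i (fun x : 'rV[R]_n => x ord0 i) x = 1.
  have sid : smooth (id : R -> R).
    apply/smoothP => k; elim: k => // k _ /=.
    have [d1 d2] := is_derive_derive1 (fun t : R => is_derive_id t (1 : R)).
    by split => //; rewrite d2; exact: (@smooth_upto_cst R k 1).
  have := (pderiv_is_derive (fun x => is_derive_coor i i x sid)).2.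
  move=> ->; rewrite eqxx mul1r derive1E.
  by have := @derive_val _ _ _ _ _ _ _ (is_derive_id (x ord0 i) (1 : R)).
have Lchi := Coo_0_sqint oD bD Cchi.
have Ldchi := Coo_0_sqint oD bD (Coo_0_pderiv i Cchi).
have [mL1 mL2] : sqint mu D (fun x => x ord0 i * chi x) /\
    norm2 mu D (fun x => x ord0 i * chi x) <= L * norm2 mu D chi.
  apply: sqint_mul_bounded => //.
    by apply: measurable_funTS; exact: measurable_coor_rV.
  by move=> x /DL hx; rewrite ler_norml; exact: hx.
have Cxc : Ck 1 (fun x : 'rV[R]_n => x ord0 i * chi x) by exact: CkM.
have := integration_by_parts i Cxc C1 sc.
rewrite (pderivM i Cx C1).
have -> : \int[mu]_(x in D) ((x ord0 i * pderiv i chi x + chi x * pderiv i (fun x => x ord0 i) x) * chi x)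
  = ipD mu D (fun x => x ord0 i * chi x) (pderiv i chi) + ipD mu D chi chi.
  rewrite /ipD -RintegralD//; last 2 first.
  - exact: integrable_mul.
  - exact: integrable_mul.
  by apply: eq_Rintegral => x _; rewrite dx; ring.
rewrite -/(ipD mu D (fun x => x ord0 i * chi x) (pderiv i chi)) -sqr_norm2 => ibp.
have := CauchySchwarz_L2 mD mL1 Ldchi => /ler_normlP[cs1 cs2].
have N0 := sqrtr_ge0 (ipD mu D chi chi); rewrite -/(norm2 mu D chi) in N0.
have P0 := sqrtr_ge0 (ipD mu D (pderiv i chi) (pderiv i chi)).
rewrite -/(norm2 mu D (pderiv i chi)) in P0.
have [->|Nc] := eqVneq (norm2 mu D chi) 0; first by rewrite !mulr_ge0.
have Nc0 : 0 < norm2 mu D chi by rewrite lt_neqAle eq_sym Nc.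
(* $\|\chi\|^2 = - 2 (x_i \chi, \partial_i \chi)$, by parts *)
rewrite -(ler_pM2l Nc0) -expr2.
have := ler_wpM2r P0 mL2; lra.
Qed.

End integration_by_parts.

(** * Spaces normed by finitely many $L^2$ norms *)

Lemma scaled_lt_half (R : realFieldType) (c x e : R) : 0 <= c -> 0 <= x ->
  x * (2 * (c + 1)) < e -> c * x < e / 2.
Proof. nra. Qed.

Section sum_of_L2_forms.
Context d (T : measurableType d) (R : realType).
Variables (mu : {measure set T -> \bar R}) (D : set T) (mD : measurable D).
Variables (E : lmodType R) (S : set E) (J : finType) (L : J -> E -> T -> R).
Local Notation sqint := (sqint mu D).
Local Notation norm2 := (norm2 mu D).
Local Notation ipD := (ipD mu D).
Hypothesis sS : subspace_on S.
Hypothesis LS : forall j u, S u -> sqint (L j u).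
Hypothesis Llin : forall j c u v, S u -> S v ->
  {ae mu, forall x, D x -> L j (c *: u + v) x = (c *: L j u + L j v) x}.

(** This form covers the scalar products of [L2v], [H1] and [H1_0v] at once.
    The maps [L j] are linear almost everywhere only, because weak derivatives
    are chosen representatives. *)
Definition ip_sum u v := \sum_j ipD (L j u) (L j v).
Definition norm_sum u := Num.sqrt (ip_sum u u).

Lemma norm_sum_subterm u v j : S u -> S v -> norm2 (L j (u - v)) = norm2 (L j u - L j v).
Proof.
move=> Su Sv; apply: (norm2_ae mD).
  rewrite (_ : _ - _ = (-1) *: L j v + L j u); last by rewrite scaleN1r addrC.
  by apply: (sqint_lin mD); exact: LS.
rewrite (_ : u - v = (-1) *: v + u); last by rewrite scaleN1r addrC.
apply: filterS (Llin j (-1) Sv Su) => x h Dx; rewrite (h Dx).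
by rewrite scaleN1r addrC.
Qed.

Lemma ip_sum_semi_inner : semi_inner S ip_sum.
Proof.
have [ipl ips ip0] := ipD_semi_inner mu mD.
split.
- move=> c u v z Su Sv Sz; rewrite /ip_sum mulr_sumr -big_split/=; apply: eq_bigr => j _.
  rewrite -ipl; try exact: LS.
  apply: (ipD_ae mD); [|exact: LS|exact: Llin|exact: aeW].
  by apply: (sqint_lin mD); exact: LS.
- by move=> u v Su Sv; apply: eq_bigr => j _; apply: ips; exact: LS.
- by move=> u; apply: sumr_ge0 => j _; exact: ip0.
Qed.

Lemma norm_sum_seminormed : seminormed S norm_sum.
Proof. exact: (ip_seminormed sS ip_sum_semi_inner). Qed.

Lemma norm_sum_ge j u : norm2 (L j u) <= norm_sum u.
Proof.
rewrite -[leLHS]ger0_norm ?sqrtr_ge0// -sqrtr_sqr ler_wsqrtr// sqr_norm2.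
have [_ _ ip0] := ipD_semi_inner mu mD.
by rewrite /ip_sum (bigD1 j)//= lerDl sumr_ge0.
Qed.

Lemma norm_sum_le u : norm_sum u <= \sum_j norm2 (L j u).
Proof.
have A0 : 0 <= \sum_j norm2 (L j u) by apply: sumr_ge0 => j _; exact: sqrtr_ge0.
rewrite -[leRHS]ger0_norm// -sqrtr_sqr ler_wsqrtr// expr2 mulr_sumr.
apply: ler_sum => j _; rewrite -sqr_norm2 expr2 ler_wpM2r ?sqrtr_ge0//.
rewrite (bigD1 j)//= lerDl; apply: sumr_ge0 => i _; exact: sqrtr_ge0.
Qed.

(** A space that embeds isometrically into a finite power of a separable $L^2$
    is separable. *)
Lemma norm_sum_separable (S' : set E) (c : nat -> T -> R) : S' `<=` S ->
  (forall n, sqint (c n)) -> dense_in_L2 mu D c -> subspace_on S' ->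
  exists b : nat -> E, (forall n, S' (b n)) /\
    forall u, S' u -> forall e, 0 < e -> exists n, norm_sum (u - b n) < e.
Proof.
move=> S'S cS cd sS'; have SN := norm2_seminormed mu mD.
apply: (@separable_subset _ _ S' norm_sum (seminormed_sub_on norm_sum_seminormed S'S sS')
  [the countType of {ffun J -> nat}] (fun k u => \sum_j norm2 (L j u - c (k j)))) => //.
- move=> u /S'S Su e e0.
  pose m : R := #|J|.+1%:R.
  have e'0 : 0 < e / m by rewrite divr_gt0.
  have /choice[k hk] : forall j, exists k, norm2 (L j u - c k) < e / m.
    by move=> j; exact: cd (LS j Su) _ e'0.
  exists [ffun j => k j]; apply: le_lt_trans (_ : _ <= \sum_(j : J) e / m) _.
    by apply: ler_sum => j _; rewrite ffunE; exact/ltW.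
  by rewrite sumr_const -mulr_natl mulrCA gtr_pMr// ltr_pdivrMr// mul1r ltr_nat.
- move=> k u v /S'S Su /S'S Sv; apply: le_trans (norm_sum_le _) _.
  rewrite -big_split/=; apply: ler_sum => j _; rewrite norm_sum_subterm//.
  have := seminorm_triangle SN (LS j Su) (cS (k j)) (LS j Sv).
  by rewrite (seminormBC SN (cS (k j)) (LS j Sv)).
Qed.

End sum_of_L2_forms.

(** * Weak derivatives *)

Section weak_derivatives.
Context (R : realType) (d : nat) (Omega : set 'rV[R]_d).
Hypotheses (oO : open Omega) (bO : bounded_set Omega).
Implicit Types (f g phi : 'rV[R]_d -> R) (i : 'I_d).
Let mu : {measure set 'rV[R]_d -> \bar R} := lebesgue_rV R d.
Let mD : measurable Omega := measurable_domain oO.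
Let fD : (mu Omega < +oo)%E := domain_lty oO bO.
Local Notation sqint := (sqint mu Omega).
Local Notation norm2 := (norm2 mu Omega).
Local Notation ipD := (ipD mu Omega).
Local Notation is_wpderiv := (is_wpderiv Omega).
Local Notation wpderiv := (wpderiv Omega).
Local Notation H1 := (H1 Omega).
Local Notation H1_0 := (H1_0 Omega).
Local Notation Coo_0 := (Coo_0 Omega).
Let SN := norm2_seminormed mu mD.
Let ipP := ipD_semi_inner mu mD.
Let sS := sqint_subspace mu mD.

Lemma is_wpderiv_unique i f g g' : is_wpderiv i f g -> is_wpderiv i f g' ->
  {ae mu, forall x, Omega x -> g x = g' x}.
Proof.
move=> [Lg hg] [Lg' hg']; have [c [Cc dc]] := Coo_0_dense_sequence oO bO.
have Lgg : sqint (g - g') by exact: (subspaceB sS Lg Lg').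
have cS n : sqint (c n) by exact: Coo_0_sqint.
have : norm2 (g - g') = 0.
  apply: (orthogonal_dense_eq0 mD cS dc Lgg) => n.
  rewrite (ipBl sS ipP)//; have := hg _ (Cc n); rewrite (hg' _ (Cc n)) => /oppr_inj.
  by move=> h; apply/eqP; rewrite subr_eq0 eq_sym; apply/eqP.
move=> /(norm2_eq0_ae mD Lgg); apply: filterS => x h /h /eqP.
by rewrite subr_eq0 => /eqP.
Qed.

Lemma H1_sqint f : H1 f -> sqint f. Proof. by case. Qed.

Lemma wpderivP i f : H1 f -> is_wpderiv i f (wpderiv i f).
Proof. by move=> [_ /(_ i)]; exact: xgetPex. Qed.

Lemma sqint_wpderiv i f : H1 f -> sqint (wpderiv i f).
Proof. by move=> /(wpderivP i)[]. Qed.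

Lemma is_wpderiv_lin i c f g f' g' : sqint f -> sqint f' ->
  is_wpderiv i f g -> is_wpderiv i f' g' -> is_wpderiv i (c *: f + f') (c *: g + g').
Proof.
have [ipl _ _] := ipP.
move=> Lf Lf' [Lg hg] [Lg' hg']; split; first exact: (sqint_lin mD).
move=> phi Cphi; have Lphi := Coo_0_sqint oO bO Cphi.
have Lp := Coo_0_sqint oO bO (Coo_0_pderiv i Cphi).
have -> : ipL2 Omega (c *: f + f') (pderiv i phi) = _ := ipl _ _ _ _ Lf Lf' Lp.
have -> : ipL2 Omega (c *: g + g') phi = _ := ipl _ _ _ _ Lg Lg' Lphi.
have -> : ipD f (pderiv i phi) = _ := hg _ Cphi.
have -> : ipD f' (pderiv i phi) = _ := hg' _ Cphi.
by rewrite mulrN opprD.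
Qed.

Lemma H1_subspace : subspace_on H1.
Proof.
split.
  split; first exact: sqint0.
  move=> i; exists 0; split; first exact: sqint0.
  by move=> phi _; rewrite /ipL2; under eq_Rintegral do rewrite mul0r;
    under [in RHS]eq_Rintegral do rewrite mul0r; rewrite Rintegral_cst// mul0r oppr0.
move=> c f g [Lf hf] [Lg hg]; split; first exact: (sqint_lin mD).
move=> i; have [f' hf'] := hf i; have [g' hg'] := hg i.
by exists (c *: f' + g'); exact: is_wpderiv_lin.
Qed.

Lemma wpderiv_lin i c f g : H1 f -> H1 g ->
  {ae mu, forall x, Omega x -> wpderiv i (c *: f + g) x = (c *: wpderiv i f + wpderiv i g) x}.
Proof.
move=> Hf Hg; apply: (is_wpderiv_unique (wpderivP i (H1_subspace.2 c _ _ Hf Hg))).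
by apply: is_wpderiv_lin; [exact: H1_sqint|exact: H1_sqint|exact: wpderivP|exact: wpderivP].
Qed.

Let H1form (o : option 'I_d) f := if o is Some i then wpderiv i f else f.

Let H1formS o f : H1 f -> sqint (H1form o f).
Proof. by case: o => [i|] Hf; [exact: sqint_wpderiv|exact: H1_sqint]. Qed.

Let H1form_lin o c f g : H1 f -> H1 g ->
  {ae mu, forall x, Omega x -> H1form o (c *: f + g) x = (c *: H1form o f + H1form o g) x}.
Proof. by case: o => [i|] Hf Hg /=; [exact: wpderiv_lin|exact: aeW]. Qed.

Lemma normH1E : normH1 Omega = norm_sum mu Omega H1form.
Proof.
apply/funext => f; rewrite /normH1 /norm_sum /ip_sum (bigD1 None)//= -sqr_norm2.
congr (Num.sqrt (_ + _)); rewrite (reindex_omap Some id)/=; last by case.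
by apply: eq_big => [i|i _]; rewrite ?eqxx// -sqr_norm2.
Qed.

Lemma normH1_seminormed : seminormed H1 (normH1 Omega).
Proof. by rewrite normH1E; exact: (norm_sum_seminormed mD H1_subspace H1formS H1form_lin). Qed.

Lemma norm2_le_normH1 f : norm2 f <= normH1 Omega f.
Proof. by rewrite normH1E; exact: (@norm_sum_ge _ _ _ mu _ mD _ _ H1form None f). Qed.

Lemma norm2_wpderiv_le_normH1 i f : norm2 (wpderiv i f) <= normH1 Omega f.
Proof. by rewrite normH1E; exact: (@norm_sum_ge _ _ _ mu _ mD _ _ H1form (Some i) f). Qed.

Lemma norm2_wpderiv_le i f g : H1 f -> H1 g ->
  norm2 (wpderiv i f - wpderiv i g) <= normH1 Omega (f - g).
Proof.
move=> Hf Hg; rewrite -(@norm_sum_subterm _ _ _ mu _ mD _ _ _ _ H1formS H1form_lin f g (Some i) Hf Hg).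
by rewrite normH1E; exact: (@norm_sum_ge _ _ _ mu _ mD _ _ H1form (Some i) (f - g)).
Qed.

Lemma is_wpderiv_Coo_0 i phi : Coo_0 phi -> is_wpderiv i phi (pderiv i phi).
Proof.
move=> Cphi; split; first exact: (Coo_0_sqint oO bO (Coo_0_pderiv i Cphi)).
move=> psi [Cpsi spsi]; exact: (integration_by_parts oO bO i (Cphi.1 1%N) (Cpsi 1%N) spsi).
Qed.

Lemma Coo_0_H1 phi : Coo_0 phi -> H1 phi.
Proof.
move=> Cphi; split; first exact: Coo_0_sqint.
by move=> i; exists (pderiv i phi); exact: is_wpderiv_Coo_0.
Qed.

Lemma wpderiv_Coo_0 i phi : Coo_0 phi ->
  {ae mu, forall x, Omega x -> wpderiv i phi x = pderiv i phi x}.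
Proof.
move=> Cphi; apply: (is_wpderiv_unique (wpderivP i (Coo_0_H1 Cphi))).
exact: is_wpderiv_Coo_0.
Qed.

Lemma Coo_0_H1_0 phi : Coo_0 phi -> H1_0 phi.
Proof.
move=> Cphi; split; first exact: Coo_0_H1.
move=> e e0; exists phi; split => //.
by rewrite subrr (seminorm0 normH1_seminormed).
Qed.

Lemma H1_0_subspace : subspace_on H1_0.
Proof.
split; first by apply: Coo_0_H1_0; exact: Coo_00.
move=> c f g [Hf hf] [Hg hg]; split; first exact: (H1_subspace.2).
move=> e e0.
have [p [Cp hp]] := hf (e / (2 * (`|c| + 1))) ltac:(by rewrite divr_gt0// mulr_gt0// ltr_wpDl).
have [q [Cq hq]] := hg (e / 2) ltac:(by rewrite divr_gt0).
exists (c *: p + q); split; first exact: (Coo_0_lin c Cp Cq).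
rewrite (_ : _ - _ = c *: (f - p) + (g - q)); last by rewrite scalerBr opprD addrACA.
have Hfp := subspaceB H1_subspace Hf (Coo_0_H1 Cp).
have Hgq := subspaceB H1_subspace Hg (Coo_0_H1 Cq).
apply: le_lt_trans (seminormD normH1_seminormed _ Hgq) _.
  exact: (subspaceZ H1_subspace c Hfp).
rewrite (seminormZ normH1_seminormed)// [e]splitr ltr_leD ?ltW//.
move: hp; rewrite ltr_pdivlMr ?mulr_gt0 ?ltr_wpDl// => hp.
have := seminorm_ge0 normH1_seminormed (f - p); have := normr_ge0 c.
by move=> c0 n0; exact: (scaled_lt_half c0 n0 hp).
Qed.

(** By parts for test functions, then by approximation. *)
Lemma Rintegral_wpderiv_eq0 i f : H1_0 f -> \int[mu]_(x in Omega) wpderiv i f x = 0.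
Proof.
move=> Hf; have [H1f hf] := Hf; apply/eqP; rewrite -normr_eq0 eq_le normr_ge0 andbT.
have L1 := sqint_cst mD fD (1 : R).
set K := norm2 (cst 1 : 'rV[R]_d -> R); have K0 : 0 <= K by exact: sqrtr_ge0.
apply: le_eps => e e0; rewrite add0r.
have [phi [Cphi hphi]] := hf (e / (K + 1)) ltac:(by rewrite divr_gt0// ltr_wpDl).
have Lw := sqint_wpderiv i H1f; have Lp := Coo_0_sqint oO bO (Coo_0_pderiv i Cphi).
have Lwp := sqint_wpderiv i (Coo_0_H1 Cphi).
have -> : \int[mu]_(x in Omega) wpderiv i f x = ipD (wpderiv i f - wpderiv i phi) (cst 1).
  rewrite (ipBl sS ipP Lw Lwp L1).
  rewrite (ipD_ae (f' := pderiv i phi) mD Lp L1 (wpderiv_Coo_0 i Cphi) (aeW _ _))//.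
  have ip1 h : ipD h (cst 1) = \int[mu]_(x in Omega) h x.
    by apply: eq_Rintegral => x _; rewrite mulr1.
  by rewrite !ip1 (Rintegral_pderiv_eq0 oO bO i (Cphi.1 1%N) Cphi.2) subr0.
apply: le_trans (CauchySchwarz_L2 mD (subspaceB sS Lw Lwp) L1) _; rewrite -/K.
have := norm2_wpderiv_le i H1f (Coo_0_H1 Cphi).
move: hphi; rewrite ltr_pdivlMr ?ltr_wpDl// => hphi.
have := seminorm_ge0 normH1_seminormed (f - phi).
have := sqrtr_ge0 (ipD (wpderiv i f - wpderiv i phi) (wpderiv i f - wpderiv i phi)).
rewrite -/(norm2 (wpderiv i f - wpderiv i phi)).
move=> w0 n0 h; apply: le_trans (ltW hphi).
by rewrite ler_pM// lerDl.
Qed.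

(** The inequality for test functions passes to the limit in the norm of [H1]. *)
Lemma poincare : exists2 P : R, 0 < P & forall i f, H1_0 f -> norm2 f <= P * norm2 (wpderiv i f).
Proof.
have [L [L0 DL]] := bounded_boxcc bO; exists (2 * L); first by rewrite mulr_gt0.
move=> i f [Hf hf]; apply: le_eps => e e0.
have K0 : 0 < 1 + 2 * L by rewrite addr_gt0// mulr_gt0.
have [phi [Cphi hphi]] := hf (e / (1 + 2 * L)) ltac:(by rewrite divr_gt0).
have Hp := Coo_0_H1 Cphi; have Lp := Coo_0_sqint oO bO (Coo_0_pderiv i Cphi).
have h1 := poincare_smooth oO bO i (ltW L0) DL Cphi.
have h2 := seminorm_triangle SN (H1_sqint Hf) (H1_sqint Hp) (sS.1).
have h3 := norm2_le_normH1 (f - phi).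
have h4 := norm2_wpderiv_le i Hf Hp.
have h5 := seminorm_triangle SN (sqint_wpderiv i Hp) (sqint_wpderiv i Hf) (sS.1).
rewrite (seminormBC SN (sqint_wpderiv i Hp) (sqint_wpderiv i Hf)) in h5.
move: h2 h5; rewrite !subr0 (norm2_ae mD Lp (wpderiv_Coo_0 i Cphi)) => h2 h5.
move: hphi; rewrite ltr_pdivlMr// => hphi.
move: L0 h1 h2 h3 h4 h5 hphi e0; clear.
move: (norm2 _) (norm2 _) (norm2 _) (norm2 _) (normH1 _ _) (norm2 _) => *; nra.
Qed.

End weak_derivatives.

(** * Dual norms *)

Section dual_norm.
Context (R : realType) (E : lmodType R) (S : set E) (N : E -> R).
Hypothesis SN : seminormed S N.
Implicit Types (l : E -> R) (u v : E).
Let sS := seminormed_sub SN.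

Lemma linear_on0 l : linear_on S l -> l 0 = 0.
Proof.
move=> /(_ (-1) 0 0 sS.1 sS.1); rewrite scaleN1r oppr0 addr0 mulN1r => ->.
by rewrite addNr.
Qed.

Lemma linear_onZ l c u : linear_on S l -> S u -> l (c *: u) = c * l u.
Proof. by move=> ll Su; have := ll c u 0 Su sS.1; rewrite !addr0 (linear_on0 ll) addr0. Qed.

Lemma linear_onB l u v : linear_on S l -> S u -> S v -> l (u - v) = l u - l v.
Proof.
by move=> ll Su Sv; have := ll (-1) v u Sv Su; rewrite scaleN1r mulN1r addrC => ->; rewrite addrC.
Qed.

Lemma has_sup_dual_norm l : bounded_functional S N l ->
  has_sup [set `|l v| | v in [set v | S v /\ N v <= 1]].
Proof.
move=> [ll [C hC]]; split.
  by exists `|l 0|; exists 0 => //; split; [exact: sS.1|rewrite (seminorm0 SN)].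
exists `|C| => _ [v [Sv Nv] <-]; apply: le_trans (hC _ Sv) _.
apply: le_trans (ler_wpM2r (seminorm_ge0 SN v) (ler_norm C)) _.
by rewrite ler_piMr.
Qed.

Lemma dual_norm_ge0 l : bounded_functional S N l -> 0 <= dual_norm S N l.
Proof.
move=> bl; have [_ ub] := has_sup_dual_norm bl; apply: le_trans (ub_le_sup ub _).
  exact: (normr_ge0 (l 0)).
by exists 0 => //; split; [exact: sS.1|rewrite (seminorm0 SN)].
Qed.

Lemma le_dual_norm l v : bounded_functional S N l -> S v -> `|l v| <= dual_norm S N l * N v.
Proof.
move=> bl Sv; have [_ ub] := has_sup_dual_norm bl; have [ll [C hC]] := bl.
have [Nv0|Nv] := eqVneq (N v) 0.
  by have := hC _ Sv; rewrite Nv0 !mulr0.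
have Nv0 : 0 < N v by rewrite lt_neqAle eq_sym Nv (seminorm_ge0 SN).
rewrite -ler_pdivrMr// -[leLHS]ger0_norm ?divr_ge0// ?(ltW Nv0)//.
rewrite normrM normr_id -normrM mulrC -(linear_onZ _ ll Sv).
apply: (ub_le_sup ub); exists ((N v)^-1 *: v) => //; split; first exact: (subspaceZ sS).
by rewrite (seminormZ SN)// ger0_norm ?mulVf// invr_ge0 ltW.
Qed.

Lemma dual_norm_le l C : bounded_functional S N l -> 0 <= C ->
  (forall v, S v -> `|l v| <= C * N v) -> dual_norm S N l <= C.
Proof.
move=> bl C0 hC; apply: ge_sup; first by case: (has_sup_dual_norm bl).
move=> _ [v [Sv Nv] <-]; apply: le_trans (hC _ Sv) _.
by rewrite ler_piMr.
Qed.

Lemma bounded_functional_continuous l u v : bounded_functional S N l -> S u -> S v ->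
  `|l u - l v| <= dual_norm S N l * N (u - v).
Proof.
move=> bl Su Sv; rewrite -(linear_onB bl.1 Su Sv); apply: le_dual_norm => //.
exact: (subspaceB sS).
Qed.

Lemma bounded_functional_eq (D : set E) l l' : D `<=` S ->
  (forall v, S v -> forall e, 0 < e -> exists2 u, D u & N (v - u) < e) ->
  bounded_functional S N l -> bounded_functional S N l' ->
  (forall u, D u -> l u = l' u) -> forall v, S v -> l v = l' v.
Proof.
move=> DS dD bl bl' ll' v Sv; apply/eqP; rewrite -subr_eq0 -normr_eq0 eq_le normr_ge0 andbT.
apply: le_eps => e e0; rewrite add0r.
pose K := dual_norm S N l + dual_norm S N l'.
have K0 : 0 <= K by rewrite addr_ge0 ?dual_norm_ge0.
have [u Du hu] := dD _ Sv (e / (K + 1)) ltac:(by rewrite divr_gt0// ltr_wpDl).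
have Su := DS _ Du.
have -> : l v - l' v = (l v - l u) - (l' v - l' u) by rewrite (ll' u Du); ring.
apply: le_trans (ler_normB _ _) _.
apply: le_trans (lerD (bounded_functional_continuous bl Sv Su) (bounded_functional_continuous bl' Sv Su)) _.
rewrite -mulrDl -/K; move: hu; rewrite ltr_pdivlMr ?ltr_wpDl// mulrDr mulr1 => hu.
rewrite mulrC; apply/ltW; apply: le_lt_trans hu.
by rewrite lerDl (seminorm_ge0 SN).
Qed.

(** A bound on the dual norm is a countable intersection of conditions: this is
    how dual norms turn out to be measurable in time. *)
Lemma dual_norm_le_dense (b : nat -> E) l r : (forall n, S (b n)) ->
  (forall u, S u -> forall e, 0 < e -> exists n, N (u - b n) < e) ->
  bounded_functional S N l -> 0 <= r ->
  (dual_norm S N l <= r <-> forall n, `|l (b n)| <= r * N (b n)).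
Proof.
move=> Sb db bl r0; split => [h n|h].
  by apply: le_trans (le_dual_norm bl (Sb n)) _; rewrite ler_wpM2r ?(seminorm_ge0 SN).
apply: dual_norm_le => // v Sv; apply: le_eps => e e0.
pose K := dual_norm S N l + r.
have K0 : 0 <= K by rewrite addr_ge0 ?dual_norm_ge0.
have [n hn] := db _ Sv (e / (K + 1)) ltac:(by rewrite divr_gt0// ltr_wpDl).
have -> : l v = l (b n) + (l v - l (b n)) by rewrite addrC subrK.
apply: le_trans (ler_normD _ _) _.
have h1 := bounded_functional_continuous bl Sv (Sb n).
have h2 := seminorm_triangle SN (Sb n) Sv sS.1.
rewrite !subr0 (seminormBC SN (Sb n) Sv) in h2.
have h3 := h n; have h4 := ler_wpM2l r0 h2.
move: hn; rewrite ltr_pdivlMr ?ltr_wpDl// => h5.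
have h6 := seminorm_ge0 SN (v - b n).
move: h5; rewrite /K; lra.
Qed.

End dual_norm.

Lemma ae_forall_countable d (T : measurableType d) (R : realType)
  (mu : {measure set T -> \bar R}) (I : countType) (P : I -> T -> Prop) :
  (forall i, {ae mu, forall x, P i x}) -> {ae mu, forall x, forall i, P i x}.
Proof.
move=> h; have : {ae mu, forall x, forall n, if choice.unpickle n is Some i then P i x else True}.
  by apply: ae_foralln => n; case: (choice.unpickle n) => [i|]; [exact: h|exact: aeW].
by apply: filterS => x hx i; have := hx (choice.pickle i); rewrite choice.pickleK.
Qed.

(** * Vector fields *)

Section vector_fields.
Context (R : realType) (d : nat) (Omega : set 'rV[R]_d).
Hypotheses (oO : open Omega) (bO : bounded_set Omega).
Local Notation vfield := ('rV[R]_d -> 'rV[R]_d).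
Implicit Types (f g p : 'rV[R]_d -> R) (u v : vfield).
Let mu : {measure set 'rV[R]_d -> \bar R} := lebesgue_rV R d.
Let mD : measurable Omega := measurable_domain oO.
Let fD : (mu Omega < +oo)%E := domain_lty oO bO.
Local Notation sqint := (sqint mu Omega).
Local Notation norm2 := (norm2 mu Omega).
Local Notation ipD := (ipD mu Omega).
Local Notation wpderiv := (wpderiv Omega).
Local Notation H1 := (H1 Omega).
Local Notation H1_0 := (H1_0 Omega).
Local Notation H1_0v := (H1_0v Omega).
Local Notation calV := (calV Omega).
Local Notation seminorm1 := (seminorm1 Omega).
Local Notation divergence := (divergence Omega).
Local Notation L2v := (L2v Omega).
Local Notation L2_0 := (L2_0 Omega).
Let SN := norm2_seminormed mu mD.
Let ipP := ipD_semi_inner mu mD.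
Let sS := sqint_subspace mu mD.

Lemma vcomp_lin c u v i : vcomp (c *: u + v) i = c *: vcomp u i + vcomp v i.
Proof. by apply/funext => x; rewrite /vcomp !fctE !mxE. Qed.

Lemma L2v_subspace : subspace_on L2v.
Proof.
split.
  move=> i; rewrite (_ : vcomp 0 i = 0); first exact: sqint0.
  by apply/funext => x; rewrite /vcomp mxE.
by move=> c u v Lu Lv i; rewrite vcomp_lin; exact: (sqint_lin mD c (Lu i) (Lv i)).
Qed.

Let vform (i : 'I_d) v := vcomp v i.

Lemma ipL2vE u v : L2v u -> L2v v -> ipL2v Omega u v = ip_sum mu Omega vform u v.
Proof.
move=> Lu Lv; rewrite /ipL2v /ip_sum /dotv Rintegral_sum// => i.
exact: (integrable_mul mD (Lu i) (Lv i)).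
Qed.

Let vform_lin i c u v : {ae mu, forall x, Omega x -> vform i (c *: u + v) x = (c *: vform i u + vform i v) x}.
Proof. by apply: aeW => x _; rewrite /vform vcomp_lin. Qed.

Lemma ipL2v_semi_inner : semi_inner L2v (ipL2v Omega).
Proof.
have [vl vs v0] := ip_sum_semi_inner mD (L := vform) (fun i u Lu => Lu i) (fun i c u v _ _ => vform_lin i c u v).
have sv := L2v_subspace.
split.
- move=> c u v z Lu Lv Lz; rewrite !ipL2vE//; first exact: vl.
  exact: sv.2.
- by move=> u v Lu Lv; rewrite !ipL2vE//; exact: vs.
- move=> u; apply: Rintegral_ge0 => x _; apply: sumr_ge0 => i _.
  by rewrite -expr2 sqr_ge0.
Qed.

Lemma normL2v_seminormed : seminormed L2v (normL2v Omega).
Proof. exact: (ip_seminormed L2v_subspace ipL2v_semi_inner). Qed.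

Lemma CauchySchwarz_L2v u v : L2v u -> L2v v ->
  `|ipL2v Omega u v| <= normL2v Omega u * normL2v Omega v.
Proof. exact: (CauchySchwarz_ip L2v_subspace ipL2v_semi_inner). Qed.

Lemma normL2vE v : L2v v -> normL2v Omega v = norm_sum mu Omega vform v.
Proof. by move=> Lv; rewrite /normL2v ipL2vE. Qed.

Lemma norm2_le_normL2v v i : L2v v -> norm2 (vcomp v i) <= normL2v Omega v.
Proof. by move=> Lv; rewrite normL2vE//; exact: (@norm_sum_ge _ _ _ mu _ mD _ _ vform i v). Qed.

Lemma normL2v_le v : L2v v -> normL2v Omega v <= \sum_i norm2 (vcomp v i).
Proof. by move=> Lv; rewrite normL2vE//; exact: norm_sum_le. Qed.

Lemma normL2v_eq0 v : L2v v -> normL2v Omega v = 0 -> {ae mu, forall x, Omega x -> v x = 0}.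
Proof.
move=> Lv v0; have h i : {ae mu, forall x, Omega x -> vcomp v i x = 0}.
  apply: norm2_eq0_ae => //; first exact: Lv.
  by apply: le_anti; rewrite sqrtr_ge0 andbT -v0 norm2_le_normL2v.
apply: filterS (ae_forall_countable h) => x hx Ox; apply/rowP => i; rewrite mxE.
exact: hx.
Qed.

Lemma L2v_separable (S' : set vfield) : S' `<=` L2v -> subspace_on S' ->
  exists b : nat -> vfield, (forall n, S' (b n)) /\
    forall u, S' u -> forall e, 0 < e -> exists n, normL2v Omega (u - b n) < e.
Proof.
move=> S'L sS'; have [c [Cc dc]] := Coo_0_dense_sequence oO bO.
have cS n : sqint (c n) by exact: Coo_0_sqint.
have [b [hb db]] := norm_sum_separable mD L2v_subspace (L := vform) (fun i u Lu => Lu i)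
  (fun i c u v _ _ => vform_lin i c u v) S'L cS dc sS'.
exists b; split => // u Su e e0; have [n hn] := db _ Su _ e0.
by exists n; rewrite normL2vE//; apply: S'L; exact: (subspaceB sS').
Qed.

Lemma H1_0v_L2v v : H1_0v v -> L2v v.
Proof. by move=> Hv i; apply: H1_sqint; exact: (Hv i).1. Qed.

Lemma H1_0v_subspace : subspace_on H1_0v.
Proof.
have [h0 hl] := H1_0_subspace oO bO; split.
  move=> i; rewrite (_ : vcomp 0 i = 0)//.
  by apply/funext => x; rewrite /vcomp mxE.
by move=> c u v Hu Hv i; rewrite vcomp_lin; exact: (hl _ _ _ (Hu i) (Hv i)).
Qed.

Let dform (p : 'I_d * 'I_d) v := wpderiv p.2 (vcomp v p.1).

Let dformS (p : 'I_d * 'I_d) v : H1_0v v -> sqint (dform p v).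
Proof. by move=> Hv; apply: sqint_wpderiv; exact: (Hv p.1).1. Qed.

Lemma wpderiv_vcomp_lin i j c u v : H1_0v u -> H1_0v v -> {ae mu, forall x, Omega x ->
  wpderiv j (vcomp (c *: u + v) i) x = (c *: wpderiv j (vcomp u i) + wpderiv j (vcomp v i)) x}.
Proof.
move=> Hu Hv; rewrite vcomp_lin.
by apply: (wpderiv_lin oO bO); [exact: (Hu i).1|exact: (Hv i).1].
Qed.

Let dform_lin (p : 'I_d * 'I_d) c u v : H1_0v u -> H1_0v v ->
  {ae mu, forall x, Omega x -> dform p (c *: u + v) x = (c *: dform p u + dform p v) x}.
Proof. exact: wpderiv_vcomp_lin. Qed.

Lemma seminorm1E : seminorm1 = norm_sum mu Omega dform.
Proof.
apply/funext => v; rewrite /seminorm1 pair_bigA/=; congr Num.sqrt.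
by apply: eq_bigr => p _; rewrite -sqr_norm2.
Qed.

Lemma seminorm1_seminormed : seminormed H1_0v seminorm1.
Proof. by rewrite seminorm1E; exact: (norm_sum_seminormed mD H1_0v_subspace dformS dform_lin). Qed.

Lemma H1_0v_separable (S' : set vfield) : S' `<=` H1_0v -> subspace_on S' ->
  exists b : nat -> vfield, (forall n, S' (b n)) /\
    forall u, S' u -> forall e, 0 < e -> exists n, seminorm1 (u - b n) < e.
Proof.
move=> S'L sS'; have [c [Cc dc]] := Coo_0_dense_sequence oO bO.
have cS n : sqint (c n) by exact: Coo_0_sqint.
by rewrite seminorm1E; exact: (norm_sum_separable mD H1_0v_subspace dformS dform_lin S'L cS dc sS').
Qed.

Lemma norm2_wpderiv_le_seminorm1 i j v : norm2 (wpderiv j (vcomp v i)) <= seminorm1 v.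
Proof. by rewrite seminorm1E; exact: (@norm_sum_ge _ _ _ mu _ mD _ _ dform (i, j) v). Qed.

Lemma poincare_vector : exists2 P : R, 0 < P & forall v, H1_0v v ->
  normL2v Omega v <= P * seminorm1 v.
Proof.
have [P P0 hP] := poincare oO bO; exists (d.+1%:R * P); first by rewrite mulr_gt0.
move=> v Hv; apply: le_trans (normL2v_le (H1_0v_L2v Hv)) _.
apply: le_trans (_ : \sum_(i < d) P * seminorm1 v <= _).
  apply: ler_sum => i _; apply: le_trans (hP i _ (Hv i)) _.
  by apply: (ler_wpM2l (ltW P0)); exact: norm2_wpderiv_le_seminorm1.
rewrite sumr_const card_ord -[leLHS]mulr_natl -mulrA.
apply: ler_wpM2r; last by rewrite ler_nat.
by rewrite mulr_ge0 ?sqrtr_ge0// ltW.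
Qed.

Lemma sqint_sum (I : finType) (F : I -> 'rV[R]_d -> R) : (forall i, sqint (F i)) ->
  sqint (fun x => \sum_i F i x) /\ norm2 (fun x => \sum_i F i x) <= \sum_i norm2 (F i).
Proof.
move=> LF; rewrite (_ : (fun x => \sum_i F i x) = \sum_i F i); last first.
  by apply/funext => x; rewrite fct_sumE.
elim/big_ind2 : _ => //.
- by split; [exact: sqint0|rewrite (seminorm0 SN)].
- move=> f1 x1 f2 x2 [L1 h1] [L2 h2]; split; first exact: (subspaceD sS).
  by apply: le_trans (seminormD SN L1 L2) _; rewrite lerD.
Qed.

Lemma sqint_divergence v : H1_0v v -> sqint (divergence v).
Proof.
by move=> Hv; apply: (sqint_sum _).1 => i; apply: sqint_wpderiv; exact: (Hv i).1.
Qed.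

Lemma norm2_divergence v : H1_0v v -> norm2 (divergence v) <= d%:R * seminorm1 v.
Proof.
move=> Hv; apply: le_trans (sqint_sum (F := fun i => wpderiv i (vcomp v i)) _).2 _.
  by move=> i; apply: sqint_wpderiv; exact: (Hv i).1.
apply: le_trans (_ : \sum_(i < d) seminorm1 v <= _).
  by apply: ler_sum => i _; exact: norm2_wpderiv_le_seminorm1.
by rewrite sumr_const card_ord mulr_natl.
Qed.

Lemma divergence_L2_0 v : H1_0v v -> L2_0 (divergence v).
Proof.
move=> Hv; split; first exact: sqint_divergence.
rewrite Rintegral_sum ?big1// => [i _|i].
  by rewrite (Rintegral_wpderiv_eq0 oO bO).
by apply: sqint_integrable => //; apply: sqint_wpderiv; exact: (Hv i).1.
Qed.

Lemma divergence_lin c u v : H1_0v u -> H1_0v v -> {ae mu, forall x, Omega x ->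
  divergence (c *: u + v) x = (c *: divergence u + divergence v) x}.
Proof.
move=> Hu Hv; have h i := wpderiv_vcomp_lin i i c Hu Hv.
apply: filterS (ae_forall_countable h) => x hx Ox; rewrite !fctE /divergence scaler_sumr -big_split/=.
by apply: eq_bigr => i _; rewrite hx.
Qed.

Lemma ipL2_divergence_lin p c u v : sqint p -> H1_0v u -> H1_0v v ->
  ipD p (divergence (c *: u + v)) = c * ipD p (divergence u) + ipD p (divergence v).
Proof.
move=> Lp Hu Hv; have Lu := sqint_divergence Hu; have Lv := sqint_divergence Hv.
have Luv := subspaceZ sS c Lu.
rewrite (ipD_ae (f' := p) mD Lp (sqint_lin mD c Lu Lv) (aeW _ (fun _ _ => erefl)) (divergence_lin c Hu Hv)).
by rewrite (ipDr sS ipP) ?(ipZr sS ipP).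
Qed.

Lemma calV_H1_0v : calV `<=` H1_0v. Proof. by move=> v []. Qed.

Lemma calV_subspace : subspace_on calV.
Proof.
have s0 := H1_0v_subspace.1; split.
  split => //; have := divergence_lin (-1) s0 s0; apply: filterS => x hx Ox.
  by move: (hx Ox); rewrite scaleN1r oppr0 addr0 !fctE => ->; rewrite scaleN1r addNr.
move=> c u v [Hu du] [Hv dv]; split; first exact: H1_0v_subspace.2.
have := divergence_lin c Hu Hv.
apply: filterS3 du dv => x hu hv hx Ox; rewrite hx// !fctE hu// hv//.
by rewrite scaler0 addr0.
Qed.

Lemma L2_0_subspace : subspace_on L2_0.
Proof.
split; first by split; [exact: sqint0|rewrite Rintegral_cst// mul0r].
move=> c f g [Lf f0] [Lg g0]; split; first exact: (sqint_lin mD).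
rewrite (_ : _ + _ = fun x => c * f x + g x)// Rintegral_lin//.
- by rewrite f0 g0 mulr0 addr0.
- exact: (sqint_integrable mD fD).
- exact: (sqint_integrable mD fD).
Qed.

Lemma L2_0_separable : exists b : nat -> 'rV[R]_d -> R, (forall n, L2_0 (b n)) /\
    forall p, L2_0 p -> forall e, 0 < e -> exists n, norm2 (p - b n) < e.
Proof.
have [c [Cc dc]] := Coo_0_dense_sequence oO bO.
have cS n : sqint (c n) by exact: Coo_0_sqint.
have sub : L2_0 `<=` sqint by move=> p [].
have [||b hb] := @separable_subset _ _ L2_0 norm2 (seminormed_sub_on SN sub L2_0_subspace)
  nat (fun k f => norm2 (f - c k)); last by exists b.
- by move=> u [Lu _] e e0; exact: dc.
- move=> k u v [Lu _] [Lv _]; have := seminorm_triangle SN Lu (cS k) Lv.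
  by rewrite (seminormBC SN (cS k) Lv).
Qed.

End vector_fields.

(** * Strong measurability and Bochner spaces *)

Section strong_measurability.
Context (R : realType) (T : R) (E : lmodType R) (S : set E) (N : E -> R).
Hypothesis SN : seminormed S N.
Let sS := seminormed_sub SN.
Let I : set (measurableTypeR R) := `]0, T[%classic.
Let mI : measurable I := measurable_itvI T.
Implicit Types (u v : R -> E) (t : R).

Definition strongly_measurable u := exists s : nat -> R -> E,
  (forall n, simple_function S (s n)) /\
  forall t : R, t \in `]0, T[ -> (N (s n t - u t)) @[n --> \oo] --> (0 : R).

(** Grouping the times by the pieces that contain them makes the level sets
    disjoint. *)
Lemma simple_function_finite s : simple_function S s ->
  exists (B : finType) (b : R -> B) (h : B -> E),
  [/\ forall x, measurable (b @^-1` [set x] : set (measurableTypeR R)),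
      forall x, S (h x) & s = h \o b].
Proof.
move=> [n [A [e [Ae ->]]]]; exists {ffun 'I_n -> bool}, (fun t => [ffun k => t \in A k]),
  (fun x : {ffun 'I_n -> bool} => \sum_k (x k)%:R *: e k); split.
- move=> x; rewrite (_ : _ @^-1` _ = \bigcap_(k in [set: 'I_n]) (if x k then A k else ~` A k)).
    apply: fin_bigcap_measurable => // k _; case: (x k); first exact: (Ae k).1.
    by apply: measurableC; exact: (Ae k).1.
  apply/seteqP; split => t /=.
    by move=> <- k _; rewrite ffunE; case: ifPn; [rewrite inE|rewrite notin_setE].
  move=> h; apply/ffunP => k; rewrite ffunE; have := h k Logic.I; case: (x k).
    by move=> /mem_set.
  by move=> /= nA; apply/negbTE; rewrite notin_setE.
- move=> x; apply: (subspace_sum sS) => k; apply: (subspaceZ sS); exact: (Ae k).2.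
- by apply/funext => t /=; apply: eq_bigr => k _; rewrite ffunE indicE.
Qed.

Lemma simple_function_ord n (b : R -> 'I_n) (h : 'I_n -> E) :
  (forall x, measurable (b @^-1` [set x] : set (measurableTypeR R))) ->
  (forall x, S (h x)) -> simple_function S (h \o b).
Proof.
move=> mb Sh; exists n, (fun k => b @^-1` [set k]), h; split => //.
apply/funext => t /=; rewrite (bigD1 (b t))//= indicE mem_set// scale1r big1 ?addr0// => k kb.
by rewrite indicE memNset ?scale0r//= => bk; move: kb; rewrite bk eqxx.
Qed.

Lemma lipschitz_cvg (phi : E -> R) (C : R) (e_ : nat -> E) e :
  (forall n, S (e_ n)) -> S e ->
  (forall f g, S f -> S g -> `|phi f - phi g| <= C * N (f - g)) ->
  N (e_ n - e) @[n --> \oo] --> (0 : R) -> phi (e_ n) @[n --> \oo] --> phi e.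
Proof.
move=> Se_ Se hphi /cvg_seqP cv; apply/cvg_seqP => r r0.
have K0 : 0 < `|C| + 1 by rewrite ltr_wpDl.
have [n0 hn] := cv (r / (`|C| + 1)) ltac:(by rewrite divr_gt0).
exists n0 => n nn; apply: le_lt_trans (hphi _ _ (Se_ n) Se) _.
have := hn n nn; rewrite subr0 ger0_norm ?(seminorm_ge0 SN)// ltr_pdivlMr// => h.
apply: le_lt_trans h; rewrite mulrC ler_wpM2l ?(seminorm_ge0 SN)//.
by rewrite (le_trans (ler_norm _))// lerDl.
Qed.

(** The parameter [y] is the time itself, or a pair of times of which [u] sees
    only one. *)
Lemma measurable_caratheodory d (Y : measurableType d) (D : set Y) (pr : Y -> R)
    (Phi : Y -> E -> R) u : measurable D ->
  measurable_fun D (pr : Y -> measurableTypeR R) -> (forall y, D y -> I (pr y)) ->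
  (forall e, S e -> measurable_fun D (Phi ^~ e)) ->
  (forall y, D y -> exists C, forall e e', S e -> S e' -> `|Phi y e - Phi y e'| <= C * N (e - e')) ->
  (forall t, I t -> S (u t)) -> strongly_measurable u ->
  measurable_fun D (fun y => Phi y (u (pr y))).
Proof.
move=> mD mpr prI mPhi LPhi Su [s [ss su]].
apply: (@measurable_fun_cvg _ _ _ _ (fun n y => Phi y (s n (pr y)))).
  move=> n; have [B [b [h [mb Sh ->]]]] := simple_function_finite (ss n).
  rewrite (_ : (fun y => _) = (fun y => \sum_(x : B) Phi y (h x) * \1_(b @^-1` [set x]) (pr y))).
    apply: measurable_sum => x; apply: measurable_funM; first exact: mPhi.
    apply: (@measurableT_comp _ _ _ _ _ _ (\1_(b @^-1` [set x]) : measurableTypeR R -> R)) => //.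
  apply/funext => y /=; rewrite (bigD1 (b (pr y)))//= indicE mem_set// mulr1 big1 ?addr0// => x xb.
  by rewrite indicE memNset ?mulr0//= => bx; move: xb; rewrite bx eqxx.
move=> y Dy; have [C hC] := LPhi y Dy; have It := prI _ Dy.
apply: (lipschitz_cvg (C := C)) => //; last exact: su.
  move=> n; have [B [b [h [mb Sh ->]]]] := simple_function_finite (ss n); exact: Sh.
exact: Su.
Qed.

Lemma measurable_norm u e : (forall t, I t -> S (u t)) -> strongly_measurable u -> S e ->
  measurable_fun I (fun t => N (u t - e)).
Proof.
move=> Su mu Se; apply: (@measurable_caratheodory _ _ I id (fun _ f => N (f - e)) u) => //.
move=> y Iy; exists 1 => v w Sv Sw; rewrite mul1r.
apply: le_trans (seminorm_dist SN (subspaceB sS Sv Se) (subspaceB sS Sw Se)) _.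
by rewrite opprB addrA subrK.
Qed.

(** Pettis' criterion. The approximation takes the best of the first elements
    of a dense sequence. *)
Lemma pettis (c : nat -> E) u : (forall n, S (c n)) ->
  (forall e, S e -> forall r, 0 < r -> exists n, N (e - c n) < r) ->
  (forall t, I t -> S (u t)) -> (forall n, measurable_fun I (fun t => N (u t - c n))) ->
  strongly_measurable u.
Proof.
move=> Sc dc Su mu.
(* [D n t] is the distance to [c n], and [b n t] the index of the best of the
   first elements of the sequence *)
pose D n t := if t \in I then N (u t - c n) else 0.
have mD n : measurable_fun setT (D n : measurableTypeR R -> R).
  rewrite (_ : (D n : measurableTypeR R -> R) = (fun t => N (u t - c n)) \_ I).
    by apply: (proj1 (measurable_restrictT _ mI)); exact: mu.
  by apply/funext => t; rewrite patchE.
pose b := fix b n t : nat := if n is m.+1 then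
  (if D m.+1 t < D (b m t) t then m.+1 else b m t) else 0%N.
have bn n t : (b n t <= n)%N.
  by elim: n => //= n IH; case: ifP => // _; exact: leq_trans IH _.
have bD n k t : (k <= n)%N -> D (b n t) t <= D k t.
  elim: n k => [|n IH] k; first by rewrite leqn0 => /eqP ->.
  rewrite leq_eqVlt => /orP[/eqP ->|]/=.
    by case: ltP.
  rewrite ltnS => /IH kn; case: ltP => // h; exact: le_trans (ltW h) kn.
have mb n : measurable_fun setT (b n : measurableTypeR R -> nat) /\
    measurable_fun setT (fun t : measurableTypeR R => D (b n t) t).
  elim: n => [|n [IH1 IH2]]; first by split; [exact: measurable_cst|exact: (mD 0%N)].
  have ml : measurable_fun setT (fun t : measurableTypeR R => D n.+1 t < D (b n t) t).
    by apply: measurable_fun_ltr.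
  split; first exact: measurable_fun_ifT.
  rewrite (_ : (fun t => _) = fun t => if D n.+1 t < D (b n t) t then D n.+1 t else D (b n t) t).
    exact: measurable_fun_ifT.
  by apply/funext => t /=; case: ifP.
pose B n t : 'I_n.+1 := inord (b n t).
exists (fun n => (fun k : 'I_n.+1 => c k) \o B n); split.
  move=> n; apply: simple_function_ord => // x.
  have := (mb n).1 measurableT [set nat_of_ord x] Logic.I; rewrite setTI.
  congr (measurable _); apply/seteqP; split => t /=.
    by rewrite /B => ->; rewrite inord_val.
  by rewrite /B => <-; rewrite inordK// ltnS.
move=> t It; have It' : I t by [].
apply/cvg_seqP => r r0; have [n0 hn0] := dc _ (Su _ It') _ r0.
exists n0 => n nn; rewrite subr0 ger0_norm ?(seminorm_ge0 SN)//= /B inordK ?ltnS//.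
rewrite (seminormBC SN)//; last exact: Su.
apply: le_lt_trans hn0; have := bD n n0 t nn.
by rewrite /D mem_set.
Qed.

End strong_measurability.

Section L2I_theory.
Context (R : realType) (T : R) (E : lmodType R) (S : set E) (N : E -> R).
Hypothesis SN : seminormed S N.
Let sS := seminormed_sub SN.
Let lam : {measure set (measurableTypeR R) -> \bar R} := @lebesgue_measure R.
Let I : set (measurableTypeR R) := `]0, T[%classic.
Let mI : measurable I := measurable_itvI T.
Let fI : (lam I < +oo)%E := lebesgue_itvI_lty T.
Implicit Types (u v : R -> E) (t : R) (e f g : E).

Lemma L2I_in u t : L2I T S N u -> I t -> S (u t).
Proof. by case=> + _ _ It; apply. Qed.

Lemma L2I_strong u : L2I T S N u -> strongly_measurable T S N u.
Proof. by case. Qed.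

Lemma L2I_caratheodory d (Y : measurableType d) (D : set Y) (pr : Y -> R)
    (Phi : Y -> E -> R) u : measurable D ->
  measurable_fun D (pr : Y -> measurableTypeR R) -> (forall y, D y -> I (pr y)) ->
  (forall e, S e -> measurable_fun D (Phi ^~ e)) ->
  (forall y, D y -> exists C, forall e e', S e -> S e' -> `|Phi y e - Phi y e'| <= C * N (e - e')) ->
  L2I T S N u -> measurable_fun D (fun y => Phi y (u (pr y))).
Proof.
move=> mD mpr prI mPhi LPhi Lu; apply: (measurable_caratheodory (Phi := Phi) (u := u) SN mD mpr prI) => //.
  by move=> t; exact: L2I_in.
exact: L2I_strong.
Qed.

Lemma L2I_sqint u : L2I T S N u -> sqint lam I (fun t => N (u t)).
Proof.
move=> Lu; split; last by case: Lu.
have := measurable_norm SN (fun t => L2I_in Lu (t := t)) (L2I_strong Lu) sS.1.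
by apply: eq_measurable_fun => t _; rewrite subr0.
Qed.

Lemma normL2IE u : normL2I T N u = norm2 lam I (fun t => N (u t)).
Proof. by congr Num.sqrt; apply: eq_Rintegral => t _; rewrite expr2. Qed.

Lemma lipschitz_affine (c : R) f g e : S f -> S g -> S e ->
  `|N (c *: f + e) - N (c *: g + e)| <= `|c| * N (f - g).
Proof.
move=> Sf Sg Se; have Sc h : S h -> S (c *: h + e) by move=> Sh; exact: sS.2.
apply: le_trans (seminorm_dist SN (Sc _ Sf) (Sc _ Sg)) _.
by rewrite opprD addrACA subrr addr0 -scalerBr (seminormZ SN)//; exact: (subspaceB sS).
Qed.

Lemma L2I_sub (S' : set E) (N' : E -> R) (C : R) u : seminormed S' N' -> S `<=` S' ->
  (forall e, S e -> N' e <= C * N e) -> L2I T S N u -> L2I T S' N' u.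
Proof.
move=> SN' SS' hC Lu; have [uS [s [ss su]] iu] := Lu.
have mu : strongly_measurable T S' N' u.
  exists s; split.
    move=> n; have [k [A [e [Ae ->]]]] := ss n; exists k, A, e; split => // j.
    by split; [exact: (Ae j).1|apply: SS'; exact: (Ae j).2].
  move=> t It; have Sut := uS t It; apply/cvg_seqP => r r0.
  have K0 : 0 < `|C| + 1 by rewrite ltr_wpDl.
  have [n0 hn] := (cvg_seqP _ _).1 (su t It) (r / (`|C| + 1)) ltac:(by rewrite divr_gt0).
  exists n0 => n nn; have := hn n nn.
  rewrite !subr0 (ger0_norm (seminorm_ge0 SN _)) (ger0_norm (seminorm_ge0 SN' _)).
  have Ss : S (s n t).
    by have [B [b [h [mb Sh ->]]]] := simple_function_finite SN (ss n); exact: Sh.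
  rewrite ltr_pdivlMr// => h; apply: le_lt_trans h; apply: le_trans (hC _ (subspaceB sS Ss Sut)) _.
  rewrite mulrC ler_wpM2l ?(seminorm_ge0 SN)//.
  by rewrite (le_trans (ler_norm _))// lerDl.
have uS' t : I t -> S' (u t) by move=> /uS /SS'.
split => //; suff [] : sqint lam I (fun t => N' (u t)) by [].
apply: (sqint_le (g := fun t => C * N (u t)) mI).
- exact: (subspaceZ (sqint_subspace lam mI) C (L2I_sqint Lu)).
- have := measurable_norm SN' uS' mu (seminormed_sub SN').1.
  by apply: eq_measurable_fun => t _; rewrite subr0.
- move=> t It; rewrite ger0_norm ?(seminorm_ge0 SN')//.
  by apply: le_trans (hC _ (uS t It)) (ler_norm _).
Qed.

Lemma norm2_le (f g : measurableTypeR R -> R) : sqint lam I g -> measurable_fun I f ->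
  (forall t, I t -> `|f t| <= `|g t|) -> norm2 lam I f <= norm2 lam I g.
Proof.
move=> Lg mf fg; have Lf := sqint_le mI Lg mf fg.
rewrite /norm2 ler_wsqrtr//; apply: le_Rintegral => //; try exact: integrable_mul.
by move=> t It; rewrite -!expr2 -real_normK ?num_real// -[leRHS]real_normK ?num_real// ler_pXn2r ?nnegrE// fg.
Qed.

Section separable.
Hypothesis sep : exists c : nat -> E, (forall n, S (c n)) /\
  forall e, S e -> forall r, 0 < r -> exists n, N (e - c n) < r.

Lemma L2I_pettis u (h : R -> R) : (forall t, I t -> S (u t)) ->
  (forall e, S e -> measurable_fun I (fun t => N (u t - e))) ->
  sqint lam I h -> (forall t, I t -> N (u t) <= h t) -> L2I T S N u.
Proof.
move=> uS mu Lh uh; have [c [Sc dc]] := sep.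
have su : strongly_measurable T S N u by apply: (pettis SN Sc dc uS) => n; exact: mu.
split => //; suff [] : sqint lam I (fun t => N (u t)) by [].
apply: (sqint_le mI Lh).
  by have := mu _ sS.1; apply: eq_measurable_fun => t _; rewrite subr0.
by move=> t It; rewrite ger0_norm ?(seminorm_ge0 SN)// (le_trans (uh t It))// ler_norm.
Qed.

Lemma L2I_lin (c : R) u v : L2I T S N u -> L2I T S N v -> L2I T S N (c *: u + v).
Proof.
move=> Lu Lv; have uS t := L2I_in Lu (t := t); have vS t := L2I_in Lv (t := t).
apply: (@L2I_pettis _ (fun t => `|c| * N (u t) + N (v t))).
- by move=> t It; apply: sS.2; [exact: uS|exact: vS].
- move=> e Se; rewrite (_ : (fun t => _) = fun t => N (1 *: v t + (c *: u t - e))); last first.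
    by apply/funext => t; rewrite !fctE scale1r addrA [v t + _]addrC.
  apply: (L2I_caratheodory (Phi := fun t f => N (1 *: f + (c *: u t - e))) (pr := id)) => //.
    move=> f Sf; rewrite (_ : (fun t => _) = fun t => N (c *: u t + (f - e))); last first.
      by apply/funext => t; rewrite scale1r addrCA.
    apply: (L2I_caratheodory (Phi := fun t g => N (c *: g + (f - e))) (pr := id)) => //.
    move=> t It; exists `|c| => g g' Sg Sg'; apply: lipschitz_affine => //.
    exact: (subspaceB sS).
  move=> t It; exists `|1| => f f' Sf Sf'; apply: lipschitz_affine => //.
  by apply: (subspaceB sS) => //; apply: (subspaceZ sS); exact: uS.
- exact: (sqint_lin mI `|c| (L2I_sqint Lu) (L2I_sqint Lv)).
- move=> t It; rewrite -(seminormZ SN); last exact: uS.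
  by apply: (seminormD SN); [apply: (subspaceZ sS); exact: uS|exact: vS].
Qed.

Lemma L2I_cst e : S e -> L2I T S N (fun=> e).
Proof.
move=> Se; apply: (@L2I_pettis _ (cst (N e))) => //.
exact: (sqint_cst mI fI).
Qed.

Lemma L2I_subspace : subspace_on (L2I T S N).
Proof. by split; [exact: (L2I_cst sS.1)|move=> c u v; exact: L2I_lin]. Qed.

Lemma L2I_scale (theta : R -> R) u (M : R) : measurable_fun I (theta : measurableTypeR R -> R) ->
  (forall t, I t -> `|theta t| <= M) -> L2I T S N u -> L2I T S N (fun t => theta t *: u t).
Proof.
move=> mth thM Lu; have uS t := L2I_in Lu (t := t).
apply: (@L2I_pettis _ (fun t => M * N (u t))).
- by move=> t It; apply: (subspaceZ sS); exact: uS.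
- move=> e Se; apply: (L2I_caratheodory (Phi := fun t f => N (theta t *: f - e)) (pr := id)) => //.
    move=> f Sf; apply: (@measurableT_comp _ _ _ _ _ _ (fun r : measurableTypeR R => N (r *: f - e))) => //.
    apply: continuous_measurable => r; apply/cvgrPdist_le => /= eps eps0.
    have K0 : 0 < N f + 1 by rewrite ltr_wpDl// (seminorm_ge0 SN).
    near=> s; apply: le_trans (seminorm_dist SN _ _) _; try by apply: (subspaceB sS) => //; exact: (subspaceZ sS).
    rewrite opprB addrA subrK -scalerBl (seminormZ SN)//.
    apply: (@le_trans _ _ (eps / (N f + 1) * (N f + 1))); last by rewrite divfK// gt_eqF.
    apply: ler_pM; rewrite ?(seminorm_ge0 SN) ?lerDl//.
    near: s; apply: cvgr_dist_le; first exact: cvg_id.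
    by rewrite divr_gt0.
  move=> t It; exists `|theta t| => f f' Sf Sf'; apply: lipschitz_affine => //.
  by rewrite -scaleN1r; exact: (subspaceZ sS).
- exact: (subspaceZ (sqint_subspace lam mI) M (L2I_sqint Lu)).
- move=> t It; rewrite (seminormZ SN); last exact: uS.
  by rewrite ler_wpM2r ?(seminorm_ge0 SN) ?thM.
Unshelve. all: by end_near. Qed.

Lemma normL2I_seminormed : seminormed (L2I T S N) (normL2I T N).
Proof.
have LN := norm2_seminormed lam mI.
split.
- exact: L2I_subspace.
- move=> c u Lu; rewrite !normL2IE -(normr_id c).
  rewrite -(seminormZ LN `|c| (L2I_sqint Lu)).
  rewrite /norm2 /ipD; congr Num.sqrt; apply: eq_Rintegral => t; rewrite inE => It.
  by rewrite !fctE (seminormZ SN)//; exact: (L2I_in Lu).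
- move=> u v Lu Lv; rewrite !normL2IE.
  apply: le_trans (seminormD LN (L2I_sqint Lu) (L2I_sqint Lv)).
  apply: norm2_le.
  + exact: (subspaceD (sqint_subspace lam mI) (L2I_sqint Lu) (L2I_sqint Lv)).
  + exact: (L2I_sqint (subspaceD L2I_subspace Lu Lv)).1.
  + move=> t It; rewrite ger0_norm ?(seminorm_ge0 SN)//.
    apply: le_trans (ler_norm _); rewrite !fctE.
    by apply: (seminormD SN); exact: L2I_in.
- by move=> u; exact: sqrtr_ge0.
Qed.

End separable.
End L2I_theory.

(** * Mollifiers in time *)

Lemma dist_unit_interval (R : realFieldType) (a b : R) : 0 <= a <= 1 -> 0 <= b <= 1 -> `|a - b| <= 1.
Proof. by move=> /andP[? ?] /andP[? ?]; rewrite ler_norml; apply/andP; split; lra. Qed.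

Lemma dist_approx (R : realFieldType) (a b x y e : R) : `|a - x| < e / 2 -> `|b - y| < e / 2 ->
  `|y - x| <= `|a - b| + e.
Proof.
move=> /ltr_normlP[? ?] /ltr_normlP[? ?].
have := ler_norm (a - b); have := ler_norm (- (a - b)); rewrite normrN => ? ?.
by rewrite ler_norml; apply/andP; split; lra.
Qed.

Section mollifier.
Context (R : realType).
Implicit Types (f g h : R -> R) (s t : R).
Let lam : {measure set (measurableTypeR R) -> \bar R} := @lebesgue_measure R.

Lemma smooth_uptoV k f : (forall t : R, f t != 0) -> smooth f -> smooth_upto k (fun t => (f t)^-1).
Proof.
move=> f0 sf; elim: k => //= k IH.
have [d1 d2] := is_derive_derive1 (fun t => is_deriveV (f0 t)
  (derivable_is_derive1 (fun t => sf 0%N t) t)).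
split => //; rewrite d2.
have -> : (fun t : R => - (f t)^-2 *: derive1 f t) =
    fun t => cst (-1) t * ((f t)^-1 * (f t)^-1) * derive1 f t.
  by apply/funext => t; rewrite /cst mulN1r -invfM -expr2.
apply: smooth_uptoM; last by apply: (smoothP _).1; exact: smooth_derive1.
by apply: smooth_uptoM; [exact: smooth_upto_cst|exact: smooth_uptoM].
Qed.

(** Rises smoothly from $0$ at $-1$ to $1$ at $1$; its rescaled derivatives are
    the mollifiers. *)
Definition smooth_step t : R := flat 0 (1 + t) / (flat 0 (1 + t) + flat 0 (1 - t)).

Let den_gt0 t : 0 < flat 0 (1 + t) + flat 0 (1 - t).
Proof.
have [t0|t0] := leP 0 t; first by rewrite ltr_pwDl ?flat0_gt0 ?flat_ge0// ltr_pwDl.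
by rewrite ltr_wpDl ?flat0_gt0 ?flat_ge0// subr_gt0 (lt_trans t0).
Qed.

Lemma smooth_smooth_step : smooth smooth_step.
Proof.
have s1 : smooth (fun t : R => flat 0 (1 + t)).
  have := @smooth_comp_affine _ _ 1 1 (@smooth_flat R 0%N).
  by under eq_fun do rewrite mul1r addrC.
have s2 : smooth (fun t : R => flat 0 (1 - t)).
  have := @smooth_comp_affine _ _ (-1) 1 (@smooth_flat R 0%N).
  by under eq_fun do rewrite mulN1r addrC.
apply: smoothM => //; apply/smoothP => k; apply: smooth_uptoV; last exact: smoothD.
by move=> t; rewrite gt_eqF.
Qed.

Lemma smooth_step0 t : t <= -1 -> smooth_step t = 0.
Proof.
move=> t1; rewrite /smooth_step (_ : flat 0 (1 + t) = 0) ?mul0r//.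
by rewrite /flat ltNge -lerBrDl sub0r t1.
Qed.

Lemma smooth_step1 t : 1 <= t -> smooth_step t = 1.
Proof.
move=> t1; have d0 := den_gt0 t; rewrite /smooth_step.
have e0 : flat 0 (1 - t) = 0 by rewrite /flat ltNge subr_le0 t1.
by move: d0; rewrite e0 addr0 => d0; rewrite divff// gt_eqF.
Qed.

Lemma smooth_step01 t : 0 <= smooth_step t <= 1.
Proof.
rewrite /smooth_step divr_ge0 ?flat_ge0//=; last exact: ltW.
by rewrite ler_pdivrMr// mul1r lerDl flat_ge0.
Qed.

(* the factor 2 leaves a margin inside the ball of radius 1/(n+1) *)
Definition step n s t : R := smooth_step (2 * n.+1%:R * t + - (2 * n.+1%:R * s)).

Lemma smooth_step_n n s : smooth (step n s).
Proof. exact: smooth_comp_affine smooth_smooth_step. Qed.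

Lemma step01 n s t : 0 <= step n s t <= 1. Proof. exact: smooth_step01. Qed.

Lemma step0 n s t : t <= s - n.+1%:R^-1 -> step n s t = 0.
Proof.
move=> h; apply: smooth_step0; rewrite -mulrBr.
have n0 : (0 : R) < n.+1%:R by [].
have := ler_wpM2l (ltW n0) h; rewrite [leRHS]mulrBr divff ?gt_eqF//; lra.
Qed.

Lemma step1 n s t : s + n.+1%:R^-1 <= t -> step n s t = 1.
Proof.
move=> h; apply: smooth_step1; rewrite -mulrBr.
have n0 : (0 : R) < n.+1%:R by [].
have := ler_wpM2l (ltW n0) h; rewrite mulrDr divff ?gt_eqF//; lra.
Qed.

(** A smooth approximation of the Dirac mass at [s]. *)
Definition mollifier n s t : R := derive1 (step n s) t.

Lemma mollifierE n s t : mollifier n s t =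
  2 * n.+1%:R * derive1 smooth_step (2 * n.+1%:R * t + - (2 * n.+1%:R * s)).
Proof.
have da (r : R) : is_derive r 1 (fun r => 2 * n.+1%:R * r + - (2 * n.+1%:R * s)) (2 * n.+1%:R).
  rewrite -[X in is_derive _ _ _ X]addr0 -[X in is_derive _ _ _ (X + _)]mulr1.
  by apply: is_deriveD; apply: is_deriveZ.
have ds := derivable_is_derive1 (fun t => @smooth_smooth_step 0%N t).
have := @is_derive1_comp _ _ _ t _ _ (ds (2 * n.+1%:R * t + - (2 * n.+1%:R * s))) (da t).
move=> h; rewrite /mollifier derive1E (@derive_val _ _ _ _ _ _ _ h).
by rewrite mulrC.
Qed.

Lemma continuous_mollifier n s : continuous (mollifier n s).
Proof. by apply: smooth_continuous; apply: smooth_derive1; exact: smooth_step_n. Qed.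

Lemma derive1_near_cst f (c : R) t : (\forall s \near t, f s = c) -> derive1 f t = 0.
Proof.
move=> h; rewrite derive1E.
have h' : \forall s \near t, cst c s = f s by apply: filterS h => s ->.
by rewrite (@derive_val _ _ _ _ _ _ _ (near_eq_is_derive h' (is_derive_cst c t 1))).
Qed.

Lemma derive1_smooth_step0 t : 1 < `|t| -> derive1 smooth_step t = 0.
Proof.
move=> t1; have [t0|t0] := leP 0 t.
  rewrite ger0_norm// in t1; apply: (derive1_near_cst (c := 1)).
  have : nbhs t `]1, +oo[%classic by apply: open_nbhs_nbhs; split; [exact: interval_open|rewrite /= in_itv/= t1].
  by apply: filterS => s /=; rewrite in_itv/= andbT => /ltW; exact: smooth_step1.
rewrite ltr0_norm// ltrNr in t1; apply: (derive1_near_cst (c := 0)).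
have : nbhs t `]-oo, -1[%classic by apply: open_nbhs_nbhs; split; [exact: interval_open|rewrite /= in_itv/= t1].
by apply: filterS => s /=; rewrite in_itv/= => /ltW; exact: smooth_step0.
Qed.

Lemma mollifier_eq0 n s t : n.+1%:R^-1 <= `|t - s| -> mollifier n s t = 0.
Proof.
move=> h; rewrite mollifierE derive1_smooth_step0 ?mulr0//.
rewrite -mulrBr normrM gtr0_norm ?mulr_gt0//.
have n0 : (0 : R) < n.+1%:R by [].
have := ler_wpM2l (ltW n0) h; rewrite divff ?gt_eqF//; lra.
Qed.

Lemma mollifier_bounded : exists2 C : R, 0 < C & forall n s t, `|mollifier n s t| <= 2 * n.+1%:R * C.
Proof.
have [M hM] : exists M, forall t : R, `|derive1 smooth_step t| <= M.
  apply: (@supp_in_bounded _ _ setT).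
    by apply: smooth_continuous; apply: smooth_derive1; exact: smooth_smooth_step.
  apply: (supp_in_closed (C := (`[-1, 1]%classic : set R))) => //.
  - exact: segment_compact.
  - exact: interval_closed.
  - move=> t; apply: contra_neqP => /= /negP; rewrite in_itv/= -ler_norml -ltNge.
    exact: derive1_smooth_step0.
exists (`|M| + 1); first by rewrite ltr_wpDl.
move=> n s t; rewrite mollifierE normrM gtr0_norm ?mulr_gt0// ler_pM2l ?mulr_gt0//.
by apply: le_trans (hM _) _; rewrite (le_trans (ler_norm _))// lerDl.
Qed.

Lemma Rintegral_derive1 f (a b : R) : a < b -> smooth f ->
  \int[lam]_(t in `]a, b[) derive1 f t = f b - f a.
Proof.
move=> ab sf; have cf := smooth_continuous (smooth_derive1 sf).
have icf : lam.-integrable `[a, b] (EFin \o derive1 f).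
  apply: continuous_compact_integrable; first exact: segment_compact.
  exact: continuous_subspaceT.
have io : lam.-integrable `[a, b[ (EFin \o derive1 f).
  by apply: integrableS icf => //; apply: subset_itvl; rewrite bnd_simp.
rewrite Rintegral_itv_obnd_cbnd; last first.
  by apply: integrableS io => //; apply: subset_itvr; rewrite bnd_simp.
rewrite Rintegral_itv_bndo_bndc// /Rintegral (@continuous_FTC2 _ (derive1 f) f a b)//.
  exact: continuous_subspaceT.
have cF := smooth_continuous sf; split => [t _||]; first exact: (sf 0%N t).
- exact: cvg_at_right_filter (cF a).
- exact: cvg_at_left_filter (cF b).
Qed.

Section interval.
Variable T : R.
Let I : set (measurableTypeR R) := `]0, T[%classic.
Let mI : measurable I := measurable_itvI T.
Let fI : (lam I < +oo)%E := lebesgue_itvI_lty T.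

(** The average of [f] against a mollifier differs from its value by at most a
    multiple of the mean oscillation on a small ball. *)
Lemma mollifier_cvg f s : lam.-integrable I (EFin \o f) -> I s -> lebesgue_pt (f \_ I) s ->
  forall e, 0 < e -> exists n0, forall n, (n0 <= n)%N ->
    `|\int[lam]_(t in I) (mollifier n s t * f t) - f s| < e.
Proof.
move=> If Is /fine_cvgP[_ fs] e e0.
have [C C0 hC] := mollifier_bounded.
have e'0 : 0 < e / (4 * C) by rewrite divr_gt0// mulr_gt0.
have := fs; move=> /cvgrPdist_lt /(_ _ e'0) [d1 /= d10 hd1].
have /nbhs_ballP[d2 /= d20 hd2] : nbhs s I by apply: open_nbhs_nbhs; split => //; exact: interval_open.
have [n0 hn0] := @exists_natSinv_lt _ (Num.min d1 d2) ltac:(by rewrite lt_min d10).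
exists n0 => n nn.
pose r : R := n.+1%:R^-1; have r0 : 0 < r by rewrite invr_gt0.
have : r < Num.min d1 d2.
  by apply: le_lt_trans hn0; rewrite lef_pV2 ?posrE// ler_nat ltnS.
rewrite lt_min => /andP[rd1 rd2].
pose J : set (measurableTypeR R) := `]s - r, s + r[%classic.
have JE : J = ball s r by rewrite ball_itv.
have mJ : measurable J by exact: measurable_itv.
have JI : J `<=` I by rewrite JE => t /= ht; apply: hd2; exact: lt_trans rd2.
have IfJ : lam.-integrable J (EFin \o f) by exact: integrableS If.
have fJ : (lam J < +oo)%E by apply: le_lt_trans fI; apply: le_measure => //; rewrite inE.
have bJ (c : R) : lam.-integrable J (EFin \o cst c).
  by apply: (@integrable_bounded _ _ _ _ _ mJ fJ _ `|c|).
have Iabs (g : R -> R) : lam.-integrable J (EFin \o g) ->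
    lam.-integrable J (EFin \o (fun t => 2 * n.+1%:R * C * `|g t|)).
  move=> Ig; apply: integrableZ_fin => //; rewrite (_ : _ \o _ = fun t => `|(g t)%:E|%E)//.
  exact: integrable_abse.
have bm (g : R -> R) : lam.-integrable J (EFin \o g) ->
    lam.-integrable J (EFin \o (fun t => mollifier n s t * g t)).
  move=> Ig; apply: (@integrable_le _ _ _ lam J mJ _ (fun t => 2 * n.+1%:R * C * `|g t|)).
  - exact: Iabs.
  - apply: measurable_funM; last exact: (integrable_measurable Ig).
    by apply: measurable_funTS; apply: continuous_measurable; exact: continuous_mollifier.
  - by move=> t _; rewrite normrM ler_wpM2r.
have -> : \int[lam]_(t in I) (mollifier n s t * f t) = \int[lam]_(t in J) (mollifier n s t * f t).
  rewrite Rintegral_mkcond [RHS]Rintegral_mkcond; apply: eq_Rintegral => t _.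
  rewrite !patchE; have [tJ|tJ] := boolP (t \in J).
    by rewrite mem_set//; apply: JI; exact: set_mem.
  case: ifP => // tI; rewrite mollifier_eq0 ?mul0r// leNgt; apply/negP => h.
  by move: tJ; rewrite notin_setE JE; apply; rewrite /ball/= distrC.
have int1 : \int[lam]_(t in J) mollifier n s t = 1.
  rewrite Rintegral_derive1; first by rewrite step1// step0// subr0.
    by rewrite ltrD2l gtrN.
  exact: smooth_step_n.
have If2 : lam.-integrable J (EFin \o (fun t => f t - f s)).
  apply: integrableD_fin => //; exact: bJ.
have -> : \int[lam]_(t in J) (mollifier n s t * f t) - f s =
    \int[lam]_(t in J) (mollifier n s t * (f t - f s)).
  rewrite -[X in _ - X]mul1r -int1 -RintegralZr//; last first.
    by have := bm _ (bJ 1); apply: eq_integrable => // t _; rewrite /= mulr1.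
  rewrite -RintegralB//; first by apply: eq_Rintegral => t _; rewrite mulrBr.
  - exact: bm.
  - exact: (bm (cst (f s)) (bJ _)).
apply: le_lt_trans (Rintegral_norm_le mJ (g := fun t => 2 * n.+1%:R * C * `|f t - f s|) _ _ _) _.
- exact: Iabs.
- exact: bm.
- by move=> t _; rewrite normrM ler_wpM2r.
have Ia : lam.-integrable J (EFin \o (fun t => `|f t - f s|)).
  by rewrite (_ : _ \o _ = fun t => `|(f t - f s)%:E|%E)//; exact: integrable_abse.
rewrite RintegralZl//.
have r1 : ball_ [eta Num.Def.normr] 0 d1 r by rewrite /= sub0r normrN gtr0_norm.
move: (hd1 r r1 r0).
have -> : davg (f \_ I) s r = ((r *+ 2)^-1 * \int[lam]_(t in J) `|f t - f s|)%:E.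
  rewrite /davg /iavg lebesgue_measure_ball ?ltW//.
  rewrite inver mulrn_eq0/= gt_eqF// EFinM EFin_Rintegral// -JE; congr (_ * _)%E.
  apply: eq_integral => t /set_mem /JI tI /=; rewrite !patchE !mem_set//.
rewrite /= sub0r normrN ger0_norm; last first.
  apply: mulr_ge0; first by rewrite invr_ge0 mulrn_wge0// ltW.
  by apply: Rintegral_ge0.
rewrite ltr_pdivlMr ?mulr_gt0//; apply: le_lt_trans.
have -> : (r *+ 2)^-1 = n.+1%:R / 2 by rewrite -[r *+ 2]mulr_natl invfM /r invrK mulrC.
by rewrite le_eqVlt; apply/orP; left; apply/eqP; field.
Qed.

Lemma mollifier_measurable n s : measurable_fun I (mollifier n s : measurableTypeR R -> R).
Proof. by apply: measurable_funTS; apply: continuous_measurable; exact: continuous_mollifier. Qed.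

Lemma integrable_mul_bounded (g : R -> R) f (M : R) : measurable_fun I (g : measurableTypeR R -> R) ->
  (forall t, I t -> `|g t| <= M) -> lam.-integrable I (EFin \o f) ->
  lam.-integrable I (EFin \o (fun t => g t * f t)).
Proof.
move=> mg gM If; apply: (@integrable_le _ _ _ lam I mI _ (fun t => M * `|f t|)).
- apply: integrableZ_fin => //; rewrite (_ : _ \o _ = fun t => `|(f t)%:E|%E)//.
  exact: integrable_abse.
- by apply: measurable_funM => //; exact: (integrable_measurable If).
- by move=> t It; rewrite normrM ler_wpM2r// gM.
Qed.

Lemma Coo_0_itv_step n s1 s2 : n.+1%:R^-1 < s1 -> s1 <= s2 -> s2 + n.+1%:R^-1 < T ->
  Coo_0_itv T (fun t => step n s1 t - step n s2 t) /\
  derive1 (fun t => step n s1 t - step n s2 t) = fun t => mollifier n s1 t - mollifier n s2 t.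
Proof.
move=> h1 h12 h2; split.
  apply/Coo_0_itvP; split.
    have := smoothD (@smooth_step_n n s1) (smoothM (@smooth_cst R (-1)) (@smooth_step_n n s2)).
    by under eq_fun do rewrite /cst mulN1r.
  apply: (supp_in_closed (C := (`[s1 - n.+1%:R^-1, s2 + n.+1%:R^-1]%classic : set R))).
  - exact: segment_compact.
  - exact: interval_closed.
  - move=> t /=; rewrite !in_itv/= => /andP[ht1 ht2]; apply/andP; split.
      by apply: lt_le_trans ht1; rewrite subr_gt0.
    exact: le_lt_trans ht2 h2.
  - move=> t; apply: contra_neqP => /= /negP; rewrite in_itv/= negb_and -!ltNge => /orP[] ht.
      by rewrite (step0 (ltW ht)) step0 ?subrr// (le_trans (ltW ht))// lerD2r.
    by rewrite (step1 (ltW ht)) step1 ?subrr// (le_trans _ (ltW ht))// lerD2r.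
have [_ ->//] := is_derive_derive1 (fun t => is_deriveB
  (derivable_is_derive1 (fun t => @smooth_step_n n s1 0%N t) t)
  (derivable_is_derive1 (fun t => @smooth_step_n n s2 0%N t) t)).
Qed.

(** The test function is a plateau between [s1] and [s2]; its derivative is a
    difference of mollifiers, which recover the values of [f] at Lebesgue
    points. *)
Lemma weak_derivative_estimate f g s1 s2 : lam.-integrable I (EFin \o f) -> lam.-integrable I (EFin \o g) ->
  (forall theta, Coo_0_itv T theta ->
    \int[lam]_(t in I) (derive1 theta t * f t) = - \int[lam]_(t in I) (theta t * g t)) ->
  I s1 -> I s2 -> s1 <= s2 -> lebesgue_pt (f \_ I) s1 -> lebesgue_pt (f \_ I) s2 ->
  forall delta, 0 < delta -> `|f s2 - f s1| <=
    \int[lam]_(t in I) (\1_(`]s1 - delta, s2 + delta[%classic : set R) t * `|g t|).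
Proof.
move=> If Ig fg Is1 Is2 s12 l1 l2 delta delta0.
have /andP[s10 s1T] : 0 < s1 < T by move: Is1; rewrite /I/= in_itv.
have /andP[s20 s2T] : 0 < s2 < T by move: Is2; rewrite /I/= in_itv.
apply: le_eps => e e0; have e20 : 0 < e / 2 by rewrite divr_gt0.
have [n1 hn1] := mollifier_cvg If Is1 l1 e20.
have [n2 hn2] := mollifier_cvg If Is2 l2 e20.
have [n3 hn3] := @exists_natSinv_lt _ (Num.min (Num.min s1 (T - s2)) delta)
  ltac:(by rewrite !lt_min s10 subr_gt0 s2T).
pose n := maxn n3 (maxn n1 n2).
have nn1 : (n1 <= n)%N by rewrite /n !leq_max leqnn !orbT.
have nn2 : (n2 <= n)%N by rewrite /n !leq_max leqnn !orbT.
have nn3 : (n3 <= n)%N by rewrite /n !leq_max leqnn.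
set r : R := n.+1%:R^-1; have r0 : 0 < r by rewrite invr_gt0.
have : r < Num.min (Num.min s1 (T - s2)) delta.
  by apply: le_lt_trans hn3; rewrite lef_pV2 ?posrE// ler_nat ltnS.
rewrite !lt_min ltrBrDl => /andP[/andP[rs1 rs2] rd].
have [Ct dt] := Coo_0_itv_step rs1 s12 rs2.
have := fg _ Ct; rewrite dt.
have Im s : lam.-integrable I (EFin \o (fun t => mollifier n s t * f t)).
  have [C C0 hC] := mollifier_bounded.
  by apply: (integrable_mul_bounded (M := 2 * n.+1%:R * C)) => //; exact: mollifier_measurable.
have -> : \int[lam]_(t in I) ((mollifier n s1 t - mollifier n s2 t) * f t) =
    \int[lam]_(t in I) (mollifier n s1 t * f t) - \int[lam]_(t in I) (mollifier n s2 t * f t).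
  by rewrite -RintegralB//; apply: eq_Rintegral => t _; rewrite mulrBl.
move=> E; have h1 := hn1 n nn1; have h2 := hn2 n nn2.
have : `|\int[lam]_(t in I) ((step n s1 t - step n s2 t) * g t)| <=
    \int[lam]_(t in I) (\1_(`]s1 - delta, s2 + delta[%classic : set R) t * `|g t|).
  have Igabs : lam.-integrable I (EFin \o (fun t => `|g t|)).
    by rewrite (_ : _ \o _ = fun t => `|(g t)%:E|%E)//; exact: integrable_abse.
  apply: (Rintegral_norm_le mI).
  - apply: (integrable_mul_bounded (M := 1)) => //.
    by move=> t _; rewrite indicE; case: (t \in _); rewrite ?normr1 ?normr0.
  - apply: (integrable_mul_bounded (M := 1)) => //.
      apply: measurable_funTS; apply: continuous_measurable.
      exact: (Coo_0_itv_continuous Ct).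
    by move=> t _; apply: dist_unit_interval; exact: step01.
  - move=> t It; rewrite normrM ler_wpM2r// indicE.
    have [h|] := boolP (t \in _).
      by apply: dist_unit_interval; exact: step01.
    rewrite notin_setE /= in_itv/= => /negP; rewrite negb_and -!leNgt => /orP[] ht.
      have h1t : t <= s1 - r by apply: le_trans ht _; rewrite lerD2l lerN2 ltW.
      by rewrite !step0 ?subrr ?normr0// (le_trans h1t)// lerD2r.
    have h2t : s2 + r <= t by apply: le_trans ht; rewrite lerD2l ltW.
    by rewrite !step1 ?subrr ?normr0// (le_trans _ h2t)// lerD2r.
move=> h3; apply: le_trans (lerD h3 (lexx e)).
by rewrite -[X in X + e]normrN -E; exact: dist_approx h1 h2.
Qed.

Lemma Coo_0_itv_ibp theta g : 0 < T -> Coo_0_itv T theta -> Coo_0_itv T g ->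
  \int[lam]_(t in I) (derive1 theta t * g t) = - \int[lam]_(t in I) (theta t * derive1 g t).
Proof.
move=> T0 Ct Cg; have st := (Coo_0_itvP T theta).1 Ct; have sg := (Coo_0_itvP T g).1 Cg.
have := Rintegral_derive1 T0 (smoothM st.1 sg.1).
have [_ ->] := is_derive_derive1 (fun t => is_deriveM
  (derivable_is_derive1 (fun t => st.1 0%N t) t) (derivable_is_derive1 (fun t => sg.1 0%N t) t)).
have g0 t : t <= 0 \/ T <= t -> g t = 0.
  move=> ht; apply/eqP/negPn/negP => gt; have /(subset_closure (A := [set x | g x != 0])) /(sg.2.2 t) : g t != 0 by [].
  by rewrite /= in_itv/= => /andP[? ?]; case: ht => ?; lra.
rewrite (g0 T) ?(g0 0); [|by left|by right].
rewrite !mulr0 subrr /=.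
have I1 : lam.-integrable I (EFin \o (fun t => theta t * derive1 g t)).
  apply: integrable_mul => //; apply: Coo_0_itv_sqint => //; exact: Coo_0_itv_derive1.
have I2 : lam.-integrable I (EFin \o (fun t => g t * derive1 theta t)).
  apply: integrable_mul => //; apply: Coo_0_itv_sqint => //; exact: Coo_0_itv_derive1.
rewrite (_ : \int[lam]_(t in _) _ = \int[lam]_(t in I) (theta t * derive1 g t + g t * derive1 theta t))//.
rewrite RintegralD// => /eqP; rewrite addrC addr_eq0 => /eqP <-.
by apply: eq_Rintegral => t _; rewrite mulrC.
Qed.

End interval.
End mollifier.

(** * Weak time derivatives *)

Section almost_everywhere.
Context d (T : measurableType d) (R : realType) (mu : {measure set T -> \bar R}).
Implicit Types P Q S : T -> Prop.

Lemma ae_imp P Q : (forall x, P x -> Q x) -> {ae mu, forall x, P x} -> {ae mu, forall x, Q x}.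
Proof. by move=> PQ; apply: (@filterS _ _ (ae_filter_ringOfSetsType mu)). Qed.

Lemma ae_imp2 P Q S : (forall x, P x -> Q x -> S x) ->
  {ae mu, forall x, P x} -> {ae mu, forall x, Q x} -> {ae mu, forall x, S x}.
Proof. by move=> PQ; apply: (@filterS2 _ _ (ae_filter_ringOfSetsType mu)). Qed.

End almost_everywhere.

Lemma ip_le_dense (R : realType) (E : lmodType R) (S : set E) (ip : E -> E -> R)
  (b : nat -> E) u (K : R) : subspace_on S -> semi_inner S ip -> (forall n, S (b n)) ->
  (forall v, S v -> forall e, 0 < e -> exists n, Num.sqrt (ip (v - b n) (v - b n)) < e) ->
  S u -> 0 <= K -> (forall n, `|ip u (b n)| <= K * Num.sqrt (ip (b n) (b n))) ->
  Num.sqrt (ip u u) <= K.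
Proof.
move=> sS ipP Sb db Su K0 h; have SN := ip_seminormed sS ipP.
have bl : bounded_functional S (fun v => Num.sqrt (ip v v)) (ip u).
  split; last by exists (Num.sqrt (ip u u)) => v Sv; exact: (CauchySchwarz_ip sS ipP Su Sv).
  by move=> c v w Sv Sw; rewrite (ipDr sS ipP) ?(ipZr sS ipP)//; exact: (subspaceZ sS).
have /(dual_norm_le_dense SN Sb db bl K0) dK : forall n, `|ip u (b n)| <= K * Num.sqrt (ip (b n) (b n)) by [].
have := le_trans (le_dual_norm SN bl Su) (ler_wpM2r (sqrtr_ge0 (ip u u)) dK).
have [_ _ ip0] := ipP; have -> : ip u u = Num.sqrt (ip u u) ^+ 2 by rewrite sqr_sqrtr.
rewrite ger0_norm ?sqr_ge0// sqrtr_sqr ger0_norm ?sqrtr_ge0// expr2.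
have [->//|N0] := eqVneq (Num.sqrt (ip u u)) 0.
by rewrite ler_pM2r// lt_neqAle eq_sym N0 sqrtr_ge0.
Qed.

Lemma lebesgue_itvoo_lt (R : realType) (a b e : R) : 0 < e -> b - a < e ->
  (lebesgue_measure (`]a, b[%classic : set R) < e%:E)%E.
Proof.
move=> e0 abe; rewrite (@lebesgue_measure_itv R `]a, b[)/=; case: ifP => _; last by rewrite lte_fin.
by rewrite -EFinB lte_fin.
Qed.

Lemma dist_lt_half (R : realFieldType) (a b t e : R) : `|a - t| < e / 2 -> `|b - t| < e / 2 ->
  `|a - b| < e.
Proof. by move=> /ltr_normlP[? ?] /ltr_normlP[? ?]; rewrite ltr_norml; apply/andP; split; lra. Qed.

Lemma add_lt_third (R : realFieldType) (a b e : R) : 0 < e -> a < e / 3 -> b < e / 3 -> a + b < e.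
Proof. lra. Qed.

Section weak_time_derivative.
Context (R : realType) (d : nat) (Omega : set 'rV[R]_d) (T : R).
Hypotheses (oO : open Omega) (bO : bounded_set Omega) (T0 : 0 < T).
Local Notation vfield := ('rV[R]_d -> 'rV[R]_d).
Implicit Types (t s : R) (u v g : R -> vfield) (psi : vfield).
Let mu : {measure set 'rV[R]_d -> \bar R} := lebesgue_rV R d.
Let mD : measurable Omega := measurable_domain oO.
Let lam : {measure set (measurableTypeR R) -> \bar R} := @lebesgue_measure R.
Let I : set (measurableTypeR R) := `]0, T[%classic.
Let mI : measurable I := measurable_itvI T.
Let fI : (lam I < +oo)%E := lebesgue_itvI_lty T.
Local Notation L2v := (L2v Omega).
Local Notation ip := (ipL2v Omega).
Local Notation nrm := (normL2v Omega).
Local Notation L2I_L2 := (L2I_L2 Omega T).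
Let SN : seminormed L2v nrm := normL2v_seminormed oO.
Let sS : subspace_on L2v := L2v_subspace oO.
Let ipP : semi_inner L2v ip := ipL2v_semi_inner oO.

Lemma L2v_dense : exists b : nat -> vfield, (forall n, L2v (b n)) /\
  forall psi, L2v psi -> forall e, 0 < e -> exists n, nrm (psi - b n) < e.
Proof. exact: (L2v_separable oO bO (fun _ h => h) sS). Qed.

Lemma L2I_L2_lin (c : R) u v : L2I_L2 u -> L2I_L2 v -> L2I_L2 (c *: u + v).
Proof. exact: (L2I_lin SN L2v_dense). Qed.

Lemma sqint_ip u psi : L2I_L2 u -> L2v psi -> sqint lam I (fun t => ip (u t) psi).
Proof.
move=> Lu Lpsi; apply: (sqint_le (g := fun t => nrm psi * nrm (u t)) mI).
- exact: (subspaceZ (sqint_subspace lam mI) _ (L2I_sqint SN Lu)).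
- apply: (L2I_caratheodory (Phi := fun _ e => ip e psi) (pr := id) SN _ _ _ _ _ Lu) => //.
  move=> y Iy; exists (nrm psi) => e e' Le Le'; rewrite -(ipBl sS ipP)// mulrC.
  by apply: CauchySchwarz_L2v => //; exact: (subspaceB sS).
- move=> t It; have Lut := L2I_in Lu It.
  rewrite [leRHS]ger0_norm ?mulr_ge0 ?sqrtr_ge0// mulrC.
  exact: CauchySchwarz_L2v.
Qed.

(** Scalar products with a dense sequence of fields reduce the claim to
    countably many scalar functions, each orthogonal to a dense sequence of
    test functions. *)
Lemma is_wdt_unique u g g' : is_wdt Omega T u g -> is_wdt Omega T u g' -> eqQ Omega T g g'.
Proof.
move=> [Lg hg] [Lg' hg']; have [b [Lb db]] := L2v_dense.
have Lgg : L2I_L2 (g - g').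
  by rewrite -scaleN1r addrC; exact: L2I_L2_lin.
have [c [Cc dc]] := Coo_0_itv_dense_sequence T.
have cS n : sqint lam I (c n) by exact: Coo_0_itv_sqint.
have h n : {ae lam, forall t, I t -> ip ((g - g') t) (b n) = 0}.
  apply: (norm2_eq0_ae mI (sqint_ip Lgg (Lb n))).
  apply: (orthogonal_dense_eq0 mI cS dc (sqint_ip Lgg (Lb n))) => m.
  rewrite /ipD; have := hg (c m) _ (Cc m) (Lb n); rewrite (hg' (c m) _ (Cc m) (Lb n)) => /oppr_inj E.
  have -> : \int[lam]_(t in I) (ip ((g - g') t) (b n) * c m t) =
      \int[lam]_(t in I) (c m t * ip (g t) (b n) - c m t * ip (g' t) (b n)).
    apply: eq_Rintegral => t /set_mem It; rewrite -mulrBr mulrC; congr (_ * _).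
    exact: (ipBl sS ipP (L2I_in Lg It) (L2I_in Lg' It) (Lb n)).
  rewrite (RintegralB mI (integrable_mul mI (cS m) (sqint_ip Lg (Lb n)))
    (integrable_mul mI (cS m) (sqint_ip Lg' (Lb n)))).
  by apply/eqP; rewrite subr_eq0; apply/eqP; rewrite -E.
rewrite /eqQ; apply: ae_imp (ae_forall_countable h) => t ht It.
have Lt := L2I_in Lgg It.
have : nrm ((g - g') t) = 0.
  apply: le_anti; rewrite sqrtr_ge0 andbT.
  by apply: (ip_le_dense sS ipP Lb db Lt (lexx 0)) => n; rewrite ht// normr0 mul0r.
move=> /(normL2v_eq0 oO Lt); apply: filterS => x h0 Ox.
by have := h0 Ox; rewrite !fctE => /eqP; rewrite subr_eq0 => /eqP.
Qed.

Lemma wdtP u g : is_wdt Omega T u g -> is_wdt Omega T u (wdt Omega T u).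
Proof. by move=> h; apply: xgetPex; exists g. Qed.

Lemma wdt_eqQ u g : is_wdt Omega T u g -> eqQ Omega T (wdt Omega T u) g.
Proof. by move=> h; apply: is_wdt_unique (wdtP h) h. Qed.

Lemma eqQ_sym (Y : Type) (f h : R -> 'rV[R]_d -> Y) : eqQ Omega T f h -> eqQ Omega T h f.
Proof. by apply: ae_imp => t h1 It; apply: ae_imp (h1 It) => x h2 Ox; rewrite h2. Qed.

Lemma eqQ_trans (Y : Type) (f h k : R -> 'rV[R]_d -> Y) : eqQ Omega T f h -> eqQ Omega T h k -> eqQ Omega T f k.
Proof.
apply: ae_imp2 => t h1 h2 It; apply: ae_imp2 (h1 It) (h2 It) => x h3 h4 Ox.
by rewrite h3// h4.
Qed.

Lemma eqQ_ae (Y : Type) (f h : R -> 'rV[R]_d -> Y) :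
  {ae lam, forall t, I t -> f t = h t} -> eqQ Omega T f h.
Proof. by apply: ae_imp => t fh It; rewrite (fh It); exact: aeW. Qed.

Lemma is_wdt_eqQ u v g : L2I_L2 u -> eqQ Omega T v u ->
  is_wdt Omega T u g -> is_wdt Omega T v g.
Proof.
move=> Lu uv [Lg hg]; split => // theta psi Ct Lpsi; rewrite -(hg _ _ Ct Lpsi).
apply: (ae_eq_Rintegral mI).
  apply: measurable_funM; last exact: (sqint_ip Lu Lpsi).1.
  exact: (Coo_0_itv_sqint (Coo_0_itv_derive1 Ct)).1.
apply: ae_imp uv => t h It; congr (_ * _); have Lut := L2I_in Lu It.
apply: (ae_eq_Rintegral mD).
  apply: integrable_measurable; apply: (integrable_sum_fin mD) => i.
  exact: (integrable_mul mD (Lut i) (Lpsi i)).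
by apply: ae_imp (h It) => x hx Ox; rewrite hx.
Qed.

(** At the common Lebesgue points of its scalar products with a dense sequence,
    [u] oscillates between two times no more than the integral of the norm of
    [g], which is absolutely continuous. *)
Lemma wdt_modulus u g : L2I_L2 u -> is_wdt Omega T u g -> exists G : set R,
  [/\ {ae lam, forall t, G t}, forall e, 0 < e -> exists2 dlt, 0 < dlt &
     forall s1 s2, I s1 -> I s2 -> G s1 -> G s2 -> `|s2 - s1| < dlt -> nrm (u s2 - u s1) < e & True].
Proof.
move=> Lu [Lg hg]; have [b [Lb db]] := L2v_dense.
pose h n t := ip (u t) (b n).
have Ih n : lam.-integrable I (EFin \o h n) by apply: (sqint_integrable mI fI); exact: sqint_ip.
have Ing : lam.-integrable I (EFin \o (fun t => nrm (g t))).
  by apply: (sqint_integrable mI fI); exact: (L2I_sqint SN).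
(* the Lebesgue points common to all scalar products *)
exists [set t | forall n, lebesgue_pt (h n \_ I) t]; split => //.
  apply: ae_foralln => n; apply: lebesgue_differentiation.
  apply: open_integrable_locally => //; first exact: openT.
  have := Ih n; rewrite integrable_mkcond//; apply: eq_integrable => // t _.
  by rewrite /= !patchE; case: ifP.
have key s1 s2 (dlt : R) : I s1 -> I s2 -> s1 <= s2 ->
    (forall n, lebesgue_pt (h n \_ I) s1) -> (forall n, lebesgue_pt (h n \_ I) s2) -> 0 < dlt ->
    nrm (u s2 - u s1) <= \int[lam]_(t in I) (\1_(`]s1 - dlt, s2 + dlt[%classic : set R) t * nrm (g t)).
  move=> Is1 Is2 s12 l1 l2 d0.
  have L1 := L2I_in Lu Is1; have L2 := L2I_in Lu Is2.
  have m1 : measurable_fun I (\1_(`]s1 - dlt, s2 + dlt[%classic : set R) : measurableTypeR R -> R).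
    by apply: measurable_indic; exact: measurable_itv.
  have b1 t : `|\1_(`]s1 - dlt, s2 + dlt[%classic : set R) t : R| <= 1.
    by rewrite indicE; case: (t \in _); rewrite ?normr1 ?normr0.
  apply: (ip_le_dense sS ipP Lb db (subspaceB sS L2 L1)).
    by apply: Rintegral_ge0 => t _; rewrite mulr_ge0 ?sqrtr_ge0// indicE.
  move=> n; rewrite (ipBl sS ipP)//.
  have Ign : lam.-integrable I (EFin \o (fun t => ip (g t) (b n))).
    by apply: (sqint_integrable mI fI); exact: sqint_ip.
  apply: le_trans (weak_derivative_estimate (Ih n) Ign _ Is1 Is2 s12 (l1 n) (l2 n) d0) _.
    by move=> theta Ct; exact: (hg theta (b n) Ct (Lb n)).
  rewrite -RintegralZr//; last by apply: (integrable_mul_bounded (M := 1)).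
  apply: le_Rintegral => //.
  - apply: (integrable_mul_bounded (M := 1)) => //.
    by rewrite (_ : _ \o _ = fun t => `|(ip (g t) (b n))%:E|%E)//; exact: integrable_abse.
  - have := integrable_mul_bounded m1 (fun t _ => b1 t) Ing.
    move=> /(integrableZ_fin mI (nrm (b n))); apply: eq_integrable => // t _.
    by rewrite /= mulrC.
  - move=> t It; rewrite -mulrA ler_wpM2l ?indicE//.
    by apply: CauchySchwarz_L2v => //; exact: (L2I_in Lg).
move=> e e0.
have IT : lam.-integrable setT (EFin \o ((fun t => nrm (g t)) \_ I)).
  have := Ing; rewrite integrable_mkcond//; apply: eq_integrable => // t _.
  by rewrite /= !patchE; case: ifP.
have [dl [dl0 hdl]] := integral_normr_continuous IT e0.
exists (dl / 2); first by rewrite divr_gt0.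
have sym s1 s2 : I s1 -> I s2 -> s1 <= s2 -> (forall n, lebesgue_pt (h n \_ I) s1) ->
    (forall n, lebesgue_pt (h n \_ I) s2) -> `|s2 - s1| < dl / 2 -> nrm (u s2 - u s1) < e.
  move=> Is1 Is2 s12 l1 l2; rewrite ger0_norm ?subr_ge0// => sd.
  apply: le_lt_trans (key s1 s2 (dl / 8) Is1 Is2 s12 l1 l2 ltac:(by rewrite divr_gt0)) _.
  have mA : measurable (`]s1 - dl / 8, s2 + dl / 8[%classic : set (measurableTypeR R)) by exact: measurable_itv.
  pose A : set R := `]s1 - dl / 8, s2 + dl / 8[%classic.
  have /(hdl _ mA) : (lam A < dl%:E)%E.
    by apply: lebesgue_itvoo_lt => //; lra.
  apply: le_lt_trans.
  rewrite le_eqVlt; apply/orP; left; apply/eqP.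
  rewrite Rintegral_mkcond [RHS]Rintegral_mkcond; apply: eq_Rintegral => t _.
  rewrite !patchE indicE; have [tI|tI] := boolP (t \in I); last by case: ifP; rewrite ?normr0.
  by case: ifPn => tA; rewrite ?mul1r ?mul0r// ger0_norm// sqrtr_ge0.
move=> s1 s2 Is1 Is2 l1 l2 sd; have [s12|/ltW s12] := leP s1 s2.
  exact: (sym s1 s2 Is1 Is2 s12 l1 l2 sd).
rewrite (seminormBC SN (L2I_in Lu Is2) (L2I_in Lu Is1)).
by apply: (sym s2 s1 Is2 Is1 s12 l2 l1); rewrite distrC.
Qed.

Lemma L2v_complete (f_ : nat -> vfield) : (forall n, L2v (f_ n)) ->
  (forall e, 0 < e -> exists n0, forall n m : nat, (n0 <= n)%N -> (n0 <= m)%N -> nrm (f_ n - f_ m) < e) ->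
  exists2 z, L2v z & forall e, 0 < e -> exists n0, forall n, (n0 <= n)%N -> nrm (f_ n - z) < e.
Proof.
move=> Lf cf; have fO : (mu Omega < +oo)%E := domain_lty oO bO.
have vB (f h : vfield) i : vcomp (f - h) i = vcomp f i - vcomp h i.
  by apply/funext => x; rewrite /vcomp !fctE !mxE.
have /choice[z hz] : forall i : 'I_d, exists z, sqint mu Omega z /\
    forall e, 0 < e -> exists n0, forall n, (n0 <= n)%N -> norm2 mu Omega (vcomp (f_ n) i - z) < e.
  move=> i; have [||z Lz hz] := L2_complete mD fO (f_ := fun n => vcomp (f_ n) i).
  - by move=> n; exact: Lf.
  - move=> e /cf[n0 hn]; exists n0 => n m nn nm; apply: le_lt_trans (hn n m nn nm).
    by rewrite -vB; apply: norm2_le_normL2v => //; exact: (subspaceB sS).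
  by exists z.
pose Z : vfield := fun x => \row_i z i x.
have ZE i : vcomp Z i = z i by apply/funext => x; rewrite /vcomp mxE.
have LZ : L2v Z by move=> i; rewrite ZE; exact: (hz i).1.
exists Z => // e e0; have e1 : 0 < e / d.+1%:R by rewrite divr_gt0.
have /choice[n0 hn0] : forall i : 'I_d, exists n0, forall n, (n0 <= n)%N ->
    norm2 mu Omega (vcomp (f_ n) i - z i) < e / d.+1%:R by move=> i; exact: (hz i).2.
exists (\max_i n0 i) => n nn; have Ln : L2v (f_ n - Z) by exact: (subspaceB sS).
apply: le_lt_trans (normL2v_le oO Ln) _; apply: le_lt_trans (_ : _ <= \sum_(i < d) e / d.+1%:R) _.
  apply: ler_sum => i _; rewrite vB ZE; apply/ltW/hn0; apply: leq_trans nn; exact: leq_bigmax.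
by rewrite sumr_const card_ord -[ltLHS]mulr_natl mulrCA gtr_pMr// ltr_pdivrMr// mul1r ltr_nat.
Qed.

Lemma ae_dense (G : set R) : {ae lam, forall t, G t} -> forall t, 0 <= t <= T -> forall r, 0 < r ->
  exists2 s, I s /\ G s & `|s - t| < r.
Proof.
move=> aG t /andP[t0 tT] r r0; apply: contrapT => nG.
pose a := Num.max 0 (t - r); pose b := Num.min T (t + r).
have ab : a < b.
  have h1 : t - r < T by lra.
  have h2 : 0 < t + r by lra.
  have h3 : t - r < t + r by lra.
  by rewrite /a /b lt_min !gt_max T0 h1 h2 h3.
have [s] : exists s, `]a, b[%classic s /\ G s.
  apply: contrapT => nab; have [N [mN N0 sN]] := aG.
  have sub : `]a, b[ `<=` N.
    by move=> s hs; apply: sN => /= Gs; apply: nab; exists s.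
  have : (lam `]a, b[%classic <= 0)%E by rewrite -N0; apply: le_measure => //; rewrite inE.
  have -> : lam `]a, b[%classic = lebesgue_measure (`]a, b[%classic : set R) by [].
  by rewrite (@lebesgue_measure_itv R `]a, b[)/= lte_fin ab -EFinB lee_fin subr_le0 leNgt ab.
rewrite /= in_itv/= /a /b gt_max lt_min => -[/andP[/andP[s1 s2] /andP[s3 s4]] Gs].
apply: nG; exists s; first by split => //; rewrite /I/= in_itv/= s1.
by rewrite ltr_norml; apply/andP; split; lra.
Qed.

(** By completeness the uniform continuity off a null set extends to the closed
    interval. *)
Lemma continuous_representative u g : L2I_L2 u -> is_wdt Omega T u g ->
  exists2 uc, CL2 Omega T uc & eqQ Omega T uc u.
Proof.
move=> Lu wu; have [G [aG hG _]] := wdt_modulus Lu wu.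
have tIn t : t \in `[0, T] = (0 <= t <= T) by rewrite in_itv.
have IIn t : I t -> 0 <= t <= T.
  by rewrite /I/= in_itv/= => /andP[/ltW-> /ltW->].
have /choice[z hz] : forall t, exists z, 0 <= t <= T -> [/\ L2v z, I t -> G t -> z = u t &
    forall e, 0 < e -> exists2 dl, 0 < dl & forall s, I s -> G s -> `|s - t| < dl -> nrm (u s - z) < e].
  move=> t; have [ht|nt] := boolP (0 <= t <= T); last by exists 0.
  have [[It Gt]|nIG] := pselect (I t /\ G t).
    exists (u t) => _; split => //; first exact: (L2I_in Lu).
    move=> e /hG[dl dl0 hdl]; exists dl => // s Is Gs; exact: hdl.
  have /choice[s_ hs] : forall n : nat, exists s, (I s /\ G s) /\ `|s - t| < n.+1%:R^-1.
    move=> n; have [s sIG sn] := ae_dense aG ht (r := n.+1%:R^-1) ltac:(by rewrite invr_gt0).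
    by exists s.
  have near_t (dl : R) : 0 < dl -> exists n0, forall n, (n0 <= n)%N -> `|s_ n - t| < dl.
    move=> /exists_natSinv_lt[n0 hn0]; exists n0 => n nn; apply: lt_trans (hs n).2 _.
    by apply: le_lt_trans hn0; rewrite lef_pV2 ?posrE// ler_nat ltnS.
  have [||z Lz hz] := L2v_complete (f_ := fun n => u (s_ n)).
  - by move=> n; apply: (L2I_in Lu); exact: (hs n).1.1.
  - move=> e /hG[dl dl0 hdl]; have [n0 hn0] := near_t (dl / 2) ltac:(by rewrite divr_gt0).
    exists n0 => n m nn nm; apply: hdl; try exact: (hs _).1.1; try exact: (hs _).1.2.
    by apply: (@dist_lt_half _ _ _ t); exact: hn0.
  exists z => _; split => //; first by move=> It Gt; case: nIG.
  move=> e e0; have e20 : 0 < e / 2 by rewrite divr_gt0.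
  have [dl dl0 hdl] := hG _ e20; exists (dl / 2); first by rewrite divr_gt0.
  move=> s Is Gs st; have [n1 hn1] := near_t (dl / 2) ltac:(by rewrite divr_gt0).
  have [n2 hn2] := hz _ e20.
  pose n := maxn n1 n2; have h1 := hn1 n (leq_maxl _ _); have h2 := hn2 n (leq_maxr _ _).
  have Ls := L2I_in Lu Is; have Ln := L2I_in Lu (hs n).1.1.
  apply: le_lt_trans (seminorm_triangle SN Ls Ln Lz) _; rewrite [e]splitr ltrD//.
  apply: hdl => //; try exact: (hs _).1.1; try exact: (hs _).1.2.
  exact: (@dist_lt_half _ _ _ t).
exists z; last first.
  apply: eqQ_ae; apply: ae_imp aG => t Gt It.
  by have [_ ->] := hz t (IIn t It).
split => [t|t]; rewrite tIn => ht; first by have [] := hz t ht.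
move=> e e0; have e30 : 0 < e / 3 by rewrite divr_gt0.
have [Lt _ ct] := hz t ht; have [dt dt0 hdt] := ct _ e30.
exists (dt / 2); first by rewrite divr_gt0.
move=> s; rewrite tIn => hs st; have [Ls _ cs] := hz s hs.
have [ds ds0 hds] := cs _ e30.
have [r [Ir Gr] rs] := ae_dense aG hs (r := Num.min ds (dt / 2)) ltac:(by rewrite lt_min ds0 divr_gt0).
move: rs; rewrite lt_min => /andP[rs1 rs2].
have h1 := hds r Ir Gr rs1.
have h2 : nrm (u r - z t) < e / 3.
  by apply: hdt => //; apply: (@dist_lt_half _ _ _ s) => //; rewrite distrC.
have Lr := L2I_in Lu Ir.
apply: le_lt_trans (seminorm_triangle SN Ls Lr Lt) _.
rewrite (seminormBC SN Ls Lr).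
exact: (add_lt_third e0 h1 h2).
Qed.

End weak_time_derivative.

(** * A product rule by doubling of variables *)

Section fubini.
Context d1 d2 (T1 : measurableType d1) (T2 : measurableType d2) (R : realType).
Variables (m1 : {sigma_finite_measure set T1 -> \bar R}) (m2 : {sigma_finite_measure set T2 -> \bar R}).

Lemma measurable_Rintegral_section (D2 : set T2) (K : T1 * T2 -> R) : measurable D2 ->
  measurable_fun setT K -> measurable_fun setT (fun x => \int[m2]_(y in D2) K (x, y)).
Proof.
move=> mD2 mK; pose f (z : T1 * T2) := (K z * \1_D2 z.2)%:E.
have mf : measurable_fun setT f.
  apply/measurable_EFinP; apply: measurable_funM => //.
  apply: (@measurableT_comp _ _ _ _ _ _ (\1_D2 : T2 -> R)) => //.
have E x : (\int[m2]_(y in D2) (K (x, y))%:E = \int[m2]_y f (x, y))%E.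
  rewrite integral_mkcond; apply: eq_integral => y _; rewrite patchE /f /= indicE.
  by case: (y \in D2); rewrite ?mulr1 ?mulr0.
apply: measurableT_comp => //.
rewrite (_ : (fun x => _) = (fun x => \int[m2]_y f^\+ (x, y) - \int[m2]_y f^\- (x, y))%E).
  apply: emeasurable_funB.
    exact: (@measurable_fun_fubini_tonelli_F _ _ _ _ _ m2 _ (measurable_funepos mf) (fun z => funepos_ge0 f z)).
  exact: (@measurable_fun_fubini_tonelli_F _ _ _ _ _ m2 _ (measurable_funeneg mf) (fun z => funeneg_ge0 f z)).
apply/funext => x; rewrite E integralE; congr (_ - _)%E; apply: eq_integral => y _.
  by rewrite !funeposE.
by rewrite !funenegE.
Qed.

(** By Tonelli's theorem the dominating function makes the kernel integrable on
    the product. *)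
Lemma Fubini_dominated (D1 : set T1) (D2 : set T2) (K : T1 * T2 -> R) (h : T2 -> R) :
  measurable D1 -> measurable D2 -> (m1 D1 < +oo)%E -> measurable_fun (D1 `*` D2) K ->
  m2.-integrable D2 (EFin \o h) -> (forall x y, D1 x -> D2 y -> `|K (x, y)| <= h y) ->
  \int[m1]_(x in D1) \int[m2]_(y in D2) K (x, y) =
  \int[m2]_(y in D2) \int[m1]_(x in D1) K (x, y).
Proof.
move=> mD1 mD2 fD1 mK Ih Kh; pose f (z : T1 * T2) := ((K \_ (D1 `*` D2)) z)%:E.
have mD : measurable (D1 `*` D2) by exact: measurableX.
have mf : measurable_fun setT f.
  by apply/measurable_EFinP; apply: (proj1 (measurable_restrictT _ mD)).
have fE x y : f (x, y) = if (x \in D1) && (y \in D2) then (K (x, y))%:E else 0%E.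
  by rewrite /f patchE in_setX/=; case: ifP.
have mK1 x : D1 x -> measurable_fun D2 (fun y => K (x, y)).
  move=> D1x; have : measurable_fun setT (fun y => f (x, y)) by apply: measurableT_comp.
  move=> /(measurable_funS measurableT (@subsetT _ D2)) h1; apply/measurable_EFinP.
  apply: eq_measurable_fun h1 => y yD; rewrite fE mem_set//= yD//.
have mK2 y : D2 y -> measurable_fun D1 (fun x => K (x, y)).
  move=> D2y; have : measurable_fun setT (fun x => f (x, y)) by apply: measurableT_comp.
  move=> /(measurable_funS measurableT (@subsetT _ D1)) h1; apply/measurable_EFinP.
  by apply: eq_measurable_fun h1 => x xD; rewrite fE xD/= mem_set.
have I1 x : D1 x -> m2.-integrable D2 (EFin \o (fun y => K (x, y))).
  by move=> D1x; apply: (integrable_le mD2 Ih (mK1 x D1x)) => y; exact: Kh.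
have I2 y : D2 y -> m1.-integrable D1 (EFin \o (fun x => K (x, y))).
  by move=> D2y; apply: (integrable_bounded mD1 fD1 (M := h y)) => [|x D1x]; [exact: mK2|exact: Kh].
have E1 : (\int[m1]_(x in D1) (\int[m2]_(y in D2) K (x, y))%:E = \int[m1]_x \int[m2]_y f (x, y))%E.
  rewrite integral_mkcond; apply: eq_integral => x _; rewrite patchE.
  case: ifPn => xD; last by rewrite integral0_eq// => y _; rewrite fE (negbTE xD).
  rewrite EFin_Rintegral//; last by apply: I1; exact: set_mem.
  by rewrite integral_mkcond; apply: eq_integral => y _; rewrite fE xD patchE.
have E2 : (\int[m2]_(y in D2) (\int[m1]_(x in D1) K (x, y))%:E = \int[m2]_y \int[m1]_x f (x, y))%E.
  rewrite integral_mkcond; apply: eq_integral => y _; rewrite patchE.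
  case: ifPn => yD; last by rewrite integral0_eq// => x _; rewrite fE (negbTE yD) andbF.
  rewrite EFin_Rintegral//; last by apply: I2; exact: set_mem.
  by rewrite integral_mkcond; apply: eq_integral => x _; rewrite fE yD patchE andbT.
rewrite /Rintegral E1 E2; congr fine; apply: Fubini; apply/integrable21ltyP => //.
have [_ hlt] := integrableP _ _ _ Ih.
pose c := fine (m1 D1); have cE : m1 D1 = c%:E by rewrite /c fineK// ge0_fin_numE.
apply: le_lt_trans (_ : (\int[m2]_(y in D2) (`|(h y)%:E| * m1 D1) < +oo)%E).
  rewrite [leRHS]integral_mkcond; apply: ge0_le_integral => //.
  - by move=> y _; exact: integral_ge0.
  - exact: (@measurable_fun_fubini_tonelli_G _ _ _ _ _ m1 _ (measurableT_comp (@abse_measurable _ setT) mf) (fun z => abse_ge0 _)).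
  - apply: (proj1 (measurable_restrictT _ mD2)); apply: emeasurable_funM => //.
    by apply: measurableT_comp => //; exact: (measurable_int _ Ih).
  - move=> y _; rewrite patchE; case: ifPn => yD; last first.
      by rewrite integral0_eq// => x _; rewrite fE (negbTE yD) andbF abse0.
    rewrite -integral_cst// [leRHS]integral_mkcond; apply: ge0_le_integral => //.
    + by apply: measurableT_comp => //; apply: measurableT_comp.
    + by apply: (proj1 (measurable_restrictT _ mD1)); exact: measurable_cst.
    + move=> x _; rewrite fE yD andbT patchE; case: ifPn => xD; last by rewrite abse0.
      rewrite lee_fin (le_trans (Kh _ _ (set_mem xD) (set_mem yD)))//.
      exact: ler_norm.
rewrite cE ge0_integralZr//; last 2 first.
- by apply: measurableT_comp => //; exact: (measurable_int _ Ih).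
- by rewrite lee_fin fine_ge0.
by rewrite muleC lte_mul_pinfty ?lee_fin ?fine_ge0.
Qed.

End fubini.

Lemma three_term_bound (R : realFieldType) (a b c C K x r : R) : `|b| < r / 2 -> `|a| <= C * K * x ->
  `|c| <= K * x -> 0 <= x -> x * (C * K + K + 1) < r / 2 -> `|a| + `|b| + `|c| < r.
Proof. lra. Qed.

Section mollified_families.
Context (R : realType) (T : R).
Let lam : {measure set (measurableTypeR R) -> \bar R} := @lebesgue_measure R.
Let I : set (measurableTypeR R) := `]0, T[%classic.
Let mI : measurable I := measurable_itvI T.
Let fI : (lam I < +oo)%E := lebesgue_itvI_lty T.

Lemma measurable_mollifier2 n : measurable_fun setT
  (fun z : measurableTypeR R * measurableTypeR R => mollifier n z.1 z.2 : R).
Proof.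
have m1 : continuous (fun r : R => 2 * n.+1%:R * derive1 (@smooth_step R) r : R).
  exact: (smooth_continuous (smoothM (@smooth_cst R (2 * n.+1%:R)) (smooth_derive1 (@smooth_smooth_step R)))).
rewrite (_ : (fun z => _) = (fun r : R => 2 * n.+1%:R * derive1 (@smooth_step R) r : R) \o
  (fun z : measurableTypeR R * measurableTypeR R => 2 * n.+1%:R * z.2 + - (2 * n.+1%:R * z.1) : R)); last first.
  by apply/funext => z; rewrite /= mollifierE.
apply: (@measurableT_comp _ _ _ _ _ _ (fun r : measurableTypeR R => 2 * n.+1%:R * derive1 (@smooth_step R) r : R)).
  exact: continuous_measurable m1.
apply: measurable_funB; apply: measurable_funM => //.
Qed.

(** The height of a mollifier grows at the rate at which its support shrinks. *)
Lemma mollifier_L1 : exists2 C : R, 0 < C & forall n s,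
  \int[lam]_(t in I) `|mollifier n s t| <= C.
Proof.
have [C C0 hC] := @mollifier_bounded R; exists (4 * C); first by rewrite mulr_gt0.
move=> n s; pose r : R := n.+1%:R^-1; have r0 : 0 < r by rewrite invr_gt0.
pose J : set (measurableTypeR R) := `]s - r, s + r[%classic.
have mJ : measurable J by exact: measurable_itv.
have fJ : lam J = (r *+ 2)%:E.
  have -> : lam J = lebesgue_measure (`]s - r, s + r[%classic : set R) by [].
  have sr : s - r < s + r by rewrite ltrD2l gtrN.
  rewrite (@lebesgue_measure_itv R `]s - r, s + r[)/= lte_fin sr -EFinB.
  by congr EFin; rewrite opprB addrC addrA subrK mulr2n.
have m1 : measurable_fun I (fun t : measurableTypeR R => `|mollifier n s t| : R).
  by apply: measurableT_comp => //; exact: mollifier_measurable.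
have i1 : lam.-integrable I (EFin \o (fun t => `|mollifier n s t|)).
  by apply: (integrable_bounded mI fI m1 (M := 2 * n.+1%:R * C)) => t _; rewrite normr_id.
have mJi : measurable_fun I (fun t : measurableTypeR R => 2 * n.+1%:R * C * \1_J t : R).
  by apply: measurable_funM => //; exact: measurable_indic.
have i2 : lam.-integrable I (EFin \o (fun t => 2 * n.+1%:R * C * \1_J t)).
  apply: (integrable_bounded mI fI mJi (M := 2 * n.+1%:R * C)) => t _.
  rewrite indicE; case: (t \in J); rewrite ?mulr1 ?mulr0 ?normr0 ?ger0_norm ?mulr_ge0//; exact: ltW.
apply: le_trans (le_Rintegral mI i1 i2 _) _.
  move=> t _; rewrite indicE; have [tJ|tJ] := boolP (t \in J); first by rewrite mulr1.
  rewrite mulr0 mollifier_eq0 ?normr0// leNgt; apply/negP => h; move: tJ; rewrite notin_setE; apply.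
  by move: h; rewrite ltr_distl /J/= in_itv.
have iJ : lam.-integrable I (EFin \o (\1_J : measurableTypeR R -> R)).
  by apply: (integrable_bounded mI fI (M := 1)) => [|t _]; [exact: measurable_indic|rewrite indicE; case: (t \in J); rewrite ?normr1 ?normr0].
rewrite RintegralZl//.
have h : \int[lam]_(t in I) (\1_J t : R) <= r *+ 2.
  rewrite -lee_fin EFin_Rintegral// integral_indic// -fJ.
  by apply: le_measure; rewrite ?inE//; exact: measurableI.
have C1 : 0 <= 2 * n.+1%:R * C by rewrite !mulr_ge0// ltW.
apply: le_trans (ler_wpM2l C1 h) _.
have nr : n.+1%:R * r = 1 by rewrite divff.
have -> : 2 * n.+1%:R * C * (r *+ 2) = 4 * C * (n.+1%:R * r).
  by rewrite -[r *+ 2]mulr_natl; ring.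
by rewrite nr mulr1.
Qed.

Variables (E : lmodType R) (S : set E) (N : E -> R) (L : R -> E -> R) (K : R).
Hypotheses (SN : seminormed S N) (K0 : 0 <= K)
  (mL : forall e, S e -> measurable_fun I (L ^~ e : measurableTypeR R -> R))
  (lL : forall t, I t -> linear_on S (L t))
  (bL : forall t e, I t -> S e -> `|L t e| <= K * N e).
Let sS := seminormed_sub SN.

Definition mollified n s e : R := \int[lam]_(t in I) (mollifier n s t * L t e).

Lemma family_lipschitz t e e' : I t -> S e -> S e' -> `|L t e - L t e'| <= K * N (e - e').
Proof.
move=> It Se Se'; rewrite -(linear_onB (lL It) Se Se'); apply: bL => //.
exact: (subspaceB sS).
Qed.

Lemma integrable_family e : S e -> lam.-integrable I (EFin \o L ^~ e).
Proof. by move=> Se; apply: (integrable_bounded mI fI (mL Se) (M := K * N e)) => t It; exact: bL. Qed.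

Let integrable_mollified n s e : S e -> lam.-integrable I (EFin \o (fun t => mollifier n s t * L t e)).
Proof.
move=> Se; have [C C0 hC] := @mollifier_bounded R.
apply: (integrable_mul_bounded (M := 2 * n.+1%:R * C)) => //; last exact: integrable_family.
exact: mollifier_measurable.
Qed.

Lemma mollified_lipschitz : exists2 C, 0 < C & forall n s e e', S e -> S e' ->
  `|mollified n s e - mollified n s e'| <= C * K * N (e - e').
Proof.
have [C C0 hC] := mollifier_L1; exists C => // n s e e' Se Se'.
have [B B0 hB] := @mollifier_bounded R.
have im : lam.-integrable I (EFin \o (fun t => `|mollifier n s t|)).
  apply: (integrable_bounded mI fI (M := 2 * n.+1%:R * B)) => [|t _]; last by rewrite normr_id.
  by apply: measurableT_comp => //; exact: mollifier_measurable.
rewrite /mollified -RintegralB//; try exact: integrable_mollified.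
apply: le_trans (Rintegral_norm_le mI (g := fun t => `|mollifier n s t| * (K * N (e - e'))) _ _ _) _.
- rewrite (_ : _ \o _ = EFin \o (fun t => K * N (e - e') * `|mollifier n s t|)).
    exact: integrableZ_fin.
  by apply/funext => t; rewrite /= mulrC.
- have := integrable_lin mI (-1) (integrable_mollified n s Se') (integrable_mollified n s Se).
  by apply: eq_integrable => // t _; rewrite /= mulN1r addrC.
- by move=> t It; rewrite -mulrBr normrM ler_wpM2l// family_lipschitz.
by rewrite RintegralZr// -mulrA ler_wpM2r// mulr_ge0// (seminorm_ge0 SN).
Qed.

Lemma measurable_mollified n e : S e -> measurable_fun I (mollified n ^~ e : measurableTypeR R -> R).
Proof.
move=> Se; apply: measurable_funTS.
pose Lp (t : measurableTypeR R) := (L ^~ e \_ I) t.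
have mLp : measurable_fun setT (Lp : measurableTypeR R -> R).
  by apply: (proj1 (measurable_restrictT _ mI)); exact: mL.
have := @measurable_Rintegral_section _ _ _ _ R lam I
  (fun z : measurableTypeR R * measurableTypeR R => mollifier n z.1 z.2 * Lp z.2 : R) mI.
rewrite (_ : (fun x => _) = mollified n ^~ e); last first.
  by apply/funext => s; apply: eq_Rintegral => t tI; rewrite /Lp/= patchE tI.
apply; apply: measurable_funM; first exact: measurable_mollifier2.
exact: (measurableT_comp mLp measurable_snd).
Qed.

(** The families are equicontinuous in [e], so that the common Lebesgue points
    of the scalar functions at a dense sequence serve for every [e]. *)
Lemma mollified_cvg (b : nat -> E) : (forall n, S (b n)) ->
  (forall e, S e -> forall r, 0 < r -> exists n, N (e - b n) < r) ->
  {ae lam, forall s, I s -> forall e, S e -> mollified n s e @[n --> \oo] --> L s e}.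
Proof.
move=> Sb db; have [C C0 hC] := mollified_lipschitz.
have : {ae lam, forall s, forall k, lebesgue_pt ((L ^~ (b k)) \_ I) s}.
  apply: ae_foralln => k; apply: lebesgue_differentiation.
  apply: open_integrable_locally => //; first exact: openT.
  have := integrable_family (Sb k); rewrite integrable_mkcond//; apply: eq_integrable => // t _.
  by rewrite /= !patchE; case: ifP.
apply: ae_imp => s hs Is e Se; apply/cvg_seqP => r r0.
have M0 : 0 < C * K + K + 1 by rewrite ltr_wpDl// addr_ge0// mulr_ge0// ltW.
have [k hk] := db e Se (r / 2 / (C * K + K + 1)) ltac:(by rewrite !divr_gt0).
have [n0 hn0] := mollifier_cvg (integrable_family (Sb k)) Is (hs k) (e := r / 2) ltac:(by rewrite divr_gt0).
exists n0 => n nn; have h1 := hn0 n nn; have h2 := hC n s e (b k) Se (Sb k).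
have h3 := family_lipschitz Is (Sb k) Se; rewrite (seminormBC SN (Sb k) Se) in h3.
have -> : mollified n s e - L s e = (mollified n s e - mollified n s (b k)) +
  (mollified n s (b k) - L s (b k)) + (L s (b k) - L s e) by ring.
have h4 := seminorm_ge0 SN (e - b k).
apply: le_lt_trans (ler_normD _ _) _; apply: le_lt_trans (lerD (ler_normD _ _) (lexx _)) _.
rewrite ltr_pdivlMr// in hk.
exact: (three_term_bound h1 h2 h3 h4 hk).
Qed.

Lemma mollified_path (z : R -> E) (g : R -> R) (M : R) :
  L2I T S N z -> measurable_fun I (g : measurableTypeR R -> R) -> (forall t, I t -> `|g t| <= M) ->
  exists C, forall n, measurable_fun I (fun s : measurableTypeR R => g s * mollified n s (z s) : R) /\
    forall s, I s -> `|g s * mollified n s (z s)| <= C * N (z s).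
Proof.
move=> Lz mg gM; have [C C0 hC] := mollified_lipschitz.
have zS t := L2I_in Lz (t := t).
have m0 n s : mollified n s 0 = 0.
  transitivity (\int[lam]_(t in I) (0 : R)); last by rewrite Rintegral_cst// mul0r.
  by apply: eq_Rintegral => t /set_mem It; rewrite (linear_on0 SN (lL It)) mulr0.
exists (M * (C * K)) => n; split.
  apply: measurable_funM => //.
  apply: (L2I_caratheodory (Phi := fun s e => mollified n s e) (pr := id) SN _ _ _ _ _ Lz) => //.
    by move=> e Se; exact: measurable_mollified.
  by move=> s Is; exists (C * K) => e e' Se Se'; exact: hC.
move=> s Is; rewrite normrM -mulrA; apply: ler_pM => //; first exact: gM.
by have := hC n s (z s) 0 (zS s Is) sS.1; rewrite m0 !subr0.
Qed.

Let integrable_norm (z : R -> E) : L2I T S N z -> lam.-integrable I (EFin \o (fun s => N (z s))).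
Proof. by move=> Lz; apply: (sqint_integrable mI fI); exact: (L2I_sqint SN). Qed.

Lemma integrable_mollified_path n (z : R -> E) (g : R -> R) (M : R) :
  L2I T S N z -> measurable_fun I (g : measurableTypeR R -> R) -> (forall t, I t -> `|g t| <= M) ->
  lam.-integrable I (EFin \o (fun s => g s * mollified n s (z s))).
Proof.
move=> Lz mg gM; have [C hC] := mollified_path Lz mg gM.
exact: (integrable_le mI (integrableZ_fin mI C (integrable_norm Lz)) (hC n).1 (hC n).2).
Qed.

Lemma Rintegral_mollified_cvg (b : nat -> E) (z : R -> E) (g : R -> R) (M : R) :
  (forall n, S (b n)) -> (forall e, S e -> forall r, 0 < r -> exists n, N (e - b n) < r) ->
  L2I T S N z -> measurable_fun I (g : measurableTypeR R -> R) -> (forall t, I t -> `|g t| <= M) ->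
  \int[lam]_(s in I) (g s * mollified n s (z s)) @[n --> \oo] --> \int[lam]_(s in I) (g s * L s (z s)).
Proof.
move=> Sb db Lz mg gM; have [C hC] := mollified_path Lz mg gM.
have zS t := L2I_in Lz (t := t).
have mz : measurable_fun I (fun s : measurableTypeR R => g s * L s (z s) : R).
  apply: measurable_funM => //.
  apply: (L2I_caratheodory (Phi := L) (pr := id) SN _ _ _ _ _ Lz) => //.
  by move=> s Is; exists K => e e' Se Se'; exact: family_lipschitz.
have [] := @dominated_convergence _ _ R lam I mI (fun n s => (g s * mollified n s (z s))%:E)
  (fun s => (g s * L s (z s))%:E) (EFin \o (fun s => C * N (z s))).
- by move=> n; apply/measurable_EFinP; exact: (hC n).1.
- by apply/measurable_EFinP; exact: mz.
- apply: ae_imp (mollified_cvg Sb db) => s hs Is; apply: cvg_EFin; first exact: nearW.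
  by apply: cvgM; [exact: cvg_cst|exact: (hs Is (z s) (zS s Is))].
- exact: (integrableZ_fin mI C (integrable_norm Lz)).
- by apply: aeW => s n Is; rewrite /= lee_fin; exact: (hC n).2.
move=> iz _ lim.
rewrite /Rintegral; apply: fine_cvg.
rewrite fineK; first exact: lim.
exact: integrable_fin_num.
Qed.

End mollified_families.

Lemma exchange_opposite (V : zmodType) (a b c x : V) : x + b = 0 -> a + b + c = a - x + c.
Proof. by move=> h; have -> : b = - x by apply/eqP; rewrite -addr_eq0 addrC h. Qed.

Lemma Coo_0_itv_margin (R : realType) (T : R) (g : R -> R) : Coo_0_itv T g ->
  exists2 e : R, 0 < e & forall s, g s != 0 -> e <= s <= T - e.
Proof.
move=> [_ cK KI]; set K := closure _ in cK KI.
have [[x Kx]|nK] := pselect (K !=set0); last first.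
  exists 1 => // s gs; exfalso; apply: nK; exists s; exact: (subset_closure (A := [set x | g x != 0])).
have [a aK ha] := compact_EVT_min (f := id) (ex_intro _ x Kx) cK (@continuous_subspaceT _ _ _ _ (fun x => cvg_id)).
have [b bK hb] := compact_EVT_max (f := id) (ex_intro _ x Kx) cK (@continuous_subspaceT _ _ _ _ (fun x => cvg_id)).
have := KI _ (set_mem aK); have := KI _ (set_mem bK); rewrite /= !in_itv/= => /andP[b0 bT] /andP[a0 aT].
exists (Num.min a (T - b)); first by rewrite lt_min a0 subr_gt0.
move=> s gs; have sK : s \in K by rewrite inE; exact: (subset_closure (A := [set x | g x != 0])).
have h1 := ha s sK; have h2 := hb s sK; rewrite ge_min h1/= lerBrDr addrC -lerBrDr ge_min.
by apply/orP; right; rewrite lerD2l lerN2.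
Qed.

Section translation_kernels.
Context (R : realType).
Implicit Types (f g : R -> R) (c e s t : R).

Lemma smooth_mollifier n s : smooth (mollifier n s).
Proof. by apply: smooth_derive1; exact: smooth_step_n. Qed.

Lemma mollifier_shift n s t : mollifier n s t = mollifier n 0 (t - s).
Proof.
rewrite !mollifierE (_ : 2 * n.+1%:R * t + - (2 * n.+1%:R * s) = 2 * n.+1%:R * (t - s) + - (2 * n.+1%:R * 0))//.
by ring.
Qed.

Lemma derive1_comp_affine f c e : smooth f ->
  derive1 (fun t => f (c * t + e)) = fun t => c * derive1 f (c * t + e).
Proof.
move=> sf; have da (r : R) : is_derive r 1 (fun r => c * r + e) c.
  rewrite -[X in is_derive _ _ _ X]addr0 -[X in is_derive _ _ _ (X + _)]mulr1.
  by apply: is_deriveD; apply: is_deriveZ.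
have [_ ->] := is_derive_derive1 (fun t => @is_derive1_comp _ _ _ t _ _
  (derivable_is_derive1 (fun t => sf 0%N t) (c * t + e)) (da t)).
by apply/funext => t; rewrite mulrC.
Qed.

Lemma smooth_scale_shift c f s : smooth f -> smooth (fun t => c * f (t - s)) /\
  derive1 (fun t => c * f (t - s)) = fun t => c * derive1 f (t - s).
Proof.
move=> sf; have E : (fun t => f (1 * t + - s)) = (fun t => f (t - s)).
  by apply/funext => t; rewrite mul1r.
have sc : smooth (fun t => f (t - s)) by rewrite -E; exact: (@smooth_comp_affine _ _ 1 (- s) sf).
split; first exact: (smoothM (@smooth_cst R c) sc).
have [_ ->] := is_derive_derive1 (fun t => is_deriveZ c (derivable_is_derive1 (fun t => sc 0%N t) t)).
by apply/funext => t; rewrite -E derive1_comp_affine// !mul1r.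
Qed.

Lemma smooth_mul_reflect g f t : smooth g -> smooth f -> smooth (fun s => f (t - s)) /\
  derive1 (fun s => g s * f (t - s)) =
  fun s => derive1 g s * f (t - s) - g s * derive1 f (t - s).
Proof.
move=> sg sf; have E : (fun s => f (-1 * s + t)) = (fun s => f (t - s)).
  by apply/funext => s; rewrite mulN1r addrC.
have sc : smooth (fun s => f (t - s)) by rewrite -E; exact: (@smooth_comp_affine _ _ (-1) t sf).
split => //.
have [_ ->] := is_derive_derive1 (fun s => is_deriveM (derivable_is_derive1 (fun s => sg 0%N s) s)
  (derivable_is_derive1 (fun s => sc 0%N s) s)).
have dE : derive1 (fun s => f (t - s)) = fun s => - derive1 f (t - s).
  by rewrite -E derive1_comp_affine//; apply/funext => s; rewrite !mulN1r (addrC (- s)).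
apply/funext => s; rewrite -[LHS]/(g s * derive1 (fun s => f (t - s)) s + f (t - s) * derive1 g s) dE.
by ring.
Qed.

Lemma mollifier0_bounded n : exists2 M, 0 <= M & forall t : R,
  `|mollifier n 0 t| <= M /\ `|derive1 (mollifier n 0) t| <= M.
Proof.
have Z (t : R) : ~ (`[-1, 1]%classic : set R) t -> mollifier n 0 t = 0.
  rewrite /= in_itv/= -ler_norml => /negP; rewrite -ltNge => h.
  by rewrite mollifier_eq0// subr0 (le_trans _ (ltW h))// invf_le1// ler1n.
have spsi := @smooth_mollifier n 0.
have cpsi := smooth_continuous spsi; have cd := smooth_continuous (smooth_derive1 spsi).
have cK : compact (`[-1, 1]%classic : set R) by exact: segment_compact.
have clK : closed (`[-1, 1]%classic : set R) by exact: interval_closed.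
have sup : supp_in setT (mollifier n (0 : R)).
  by apply: (supp_in_closed cK clK) => // x; apply: contra_neqP => /Z.
have supd : supp_in setT (derive1 (mollifier n (0 : R))).
  rewrite (_ : derive1 _ = fun t => 'D_1 (mollifier n 0) t); first exact: supp_in_derive.
  by apply/funext => t; rewrite derive1E.
have [M1 h1] := supp_in_bounded cpsi sup; have [M2 h2] := supp_in_bounded cd supd.
exists (`|M1| + `|M2|); first by rewrite addr_ge0.
move=> x; split.
  by apply: le_trans (h1 x) _; rewrite (le_trans (ler_norm _))// lerDl.
by apply: le_trans (h2 x) _; rewrite (le_trans (ler_norm _))// lerDr.
Qed.

Lemma Coo_0_itv_bounded_ge0 (T : R) f : Coo_0_itv T f -> exists2 M, 0 <= M & forall t, `|f t| <= M.
Proof. by move=> /Coo_0_itv_bounded[M hM]; exists M => //; exact: le_trans (normr_ge0 _) (hM 0). Qed.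

End translation_kernels.

Section doubling_of_variables.
Context (R : realType) (T : R) (E : lmodType R) (S0 S1 : set E) (N0 N1 : E -> R).
Let lam : {measure set (measurableTypeR R) -> \bar R} := @lebesgue_measure R.
Let I : set (measurableTypeR R) := `]0, T[%classic.
Let mI : measurable I := measurable_itvI T.
Let fI : (lam I < +oo)%E := lebesgue_itvI_lty T.
Variables (alpha beta : R -> E -> R) (C Ka Kb : R) (b0 b1 : nat -> E) (u u' : R -> E).
Hypotheses (SN0 : seminormed S0 N0) (SN1 : seminormed S1 N1) (S10 : S1 `<=` S0)
  (N01 : forall e, S1 e -> N0 e <= C * N1 e)
  (Sb0 : forall n, S0 (b0 n)) (db0 : forall e, S0 e -> forall r, 0 < r -> exists n, N0 (e - b0 n) < r)
  (Sb1 : forall n, S1 (b1 n)) (db1 : forall e, S1 e -> forall r, 0 < r -> exists n, N1 (e - b1 n) < r)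
  (Ka0 : 0 <= Ka) (Kb0 : 0 <= Kb)
  (ma : forall e, S0 e -> measurable_fun I (alpha ^~ e : measurableTypeR R -> R))
  (la : forall t, I t -> linear_on S0 (alpha t))
  (ba : forall t e, I t -> S0 e -> `|alpha t e| <= Ka * N0 e)
  (mb : forall e, S1 e -> measurable_fun I (beta ^~ e : measurableTypeR R -> R))
  (lb : forall t, I t -> linear_on S1 (beta t))
  (bb : forall t e, I t -> S1 e -> `|beta t e| <= Kb * N1 e)
  (Lu : L2I T S1 N1 u) (Lu' : L2I T S0 N0 u')
  (transport : forall theta e, Coo_0_itv T theta -> S1 e ->
     \int[lam]_(t in I) (derive1 theta t * alpha t e + theta t * beta t e) = 0)
  (derivative : forall theta t, Coo_0_itv T theta -> I t ->
     \int[lam]_(s in I) (derive1 theta s * alpha t (u s)) = - \int[lam]_(s in I) (theta s * alpha t (u' s))).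

Let Lu0 : L2I T S0 N0 u. Proof. exact: (L2I_sub SN1 SN0 S10 N01 Lu). Qed.

Section kernel.
Variables (g : R -> R) (n : nat).
Hypothesis Cg : Coo_0_itv T g.
Let psi : R -> R := mollifier n 0.
Let spsi : smooth psi. Proof. exact: smooth_mollifier. Qed.
Let sg : smooth g := ((Coo_0_itvP T g).1 Cg).1.

Let measurable_sub (f : R -> R) : continuous f ->
  measurable_fun setT (fun z : measurableTypeR R * measurableTypeR R => f (z.1 - z.2) : R).
Proof.
move=> cf; apply: (@measurableT_comp _ _ _ _ _ _ (f : measurableTypeR R -> R)).
  exact: continuous_measurable.
exact: measurable_funB.
Qed.

Let measurable_alpha (v : R -> E) : L2I T S0 N0 v -> measurable_fun (I `*` I)
  (fun z : measurableTypeR R * measurableTypeR R => alpha z.1 (v z.2) : R).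
Proof.
move=> Lv; have mII : measurable (I `*` I) by exact: measurableX.
apply: (L2I_caratheodory (Phi := fun z e => alpha z.1 e) (pr := snd) SN0 mII _ _ _ _ Lv).
- exact: measurable_funTS.
- by move=> z [].
- move=> e Se; have mp : measurable_fun setT ((alpha ^~ e : measurableTypeR R -> R) \_ I).
    by apply: (proj1 (measurable_restrictT _ mI)); exact: ma.
  have : measurable_fun (I `*` I) (((alpha ^~ e : measurableTypeR R -> R) \_ I) \o fst).
    by apply: measurable_funTS; exact: measurableT_comp.
  by apply: eq_measurable_fun => z /set_mem[z1 z2] /=; rewrite patchE mem_set.
- move=> z [z1 z2]; exists Ka => e e' Se Se'.
  exact: (family_lipschitz SN0 la ba).
Qed.

(** For fixed [t] the kernel [g s * psi (t - s)] is tested against the time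
    derivative of [u]; for fixed [s] it is tested against the transport
    identity at [u s]. Its two partial derivatives add up to [derive1 g s * psi
    (t - s)]. *)
Lemma doubled_identity : (forall s, g s != 0 -> n.+1%:R^-1 < s < T - n.+1%:R^-1) ->
  \int[lam]_(s in I) (derive1 g s * mollified T alpha n s (u s)) +
  \int[lam]_(s in I) (g s * mollified T beta n s (u s)) +
  \int[lam]_(s in I) (g s * mollified T alpha n s (u' s)) = 0.
Proof.
move=> margin.
have [M M0 hM] := @mollifier0_bounded R n; have [M1 M10 hM1] := Coo_0_itv_bounded_ge0 Cg.
have [M2 M20 hM2] := Coo_0_itv_bounded_ge0 (Coo_0_itv_derive1 Cg).
pose A t s := derive1 g s * psi (t - s) - g s * derive1 psi (t - s).
pose B t s := g s * psi (t - s).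
pose P (z : measurableTypeR R * measurableTypeR R) : R :=
  A z.1 z.2 * alpha z.1 (u z.2) + B z.1 z.2 * alpha z.1 (u' z.2).
have mg : measurable_fun setT (fun z : measurableTypeR R * measurableTypeR R => g z.2 : R).
  apply: (@measurableT_comp _ _ _ _ _ _ (g : measurableTypeR R -> R)) => //.
  by apply: continuous_measurable; exact: smooth_continuous.
have mdg : measurable_fun setT (fun z : measurableTypeR R * measurableTypeR R => derive1 g z.2 : R).
  apply: (@measurableT_comp _ _ _ _ _ _ (derive1 g : measurableTypeR R -> R)) => //.
  by apply: continuous_measurable; apply: smooth_continuous; exact: smooth_derive1.
have mpsi := measurable_sub (smooth_continuous spsi).
have mdpsi := measurable_sub (smooth_continuous (smooth_derive1 spsi)).
have mA : measurable_fun setT (fun z : measurableTypeR R * measurableTypeR R => A z.1 z.2 : R).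
  by apply: measurable_funB; apply: measurable_funM.
have mB : measurable_fun setT (fun z : measurableTypeR R * measurableTypeR R => B z.1 z.2 : R).
  exact: measurable_funM.
have mP : measurable_fun (I `*` I) P.
  apply: measurable_funD; apply: measurable_funM; try exact: measurable_funTS; exact: measurable_alpha.
have hB t s : `|B t s| <= M1 * M by rewrite normrM ler_pM// ?hM1// (hM _).1.
have hA t s : `|A t s| <= M2 * M + M1 * M.
  apply: le_trans (ler_normB _ _) _; rewrite !normrM.
  exact: (lerD (ler_pM (normr_ge0 _) (normr_ge0 _) (hM2 s) (hM (t - s)).1)
    (ler_pM (normr_ge0 _) (normr_ge0 _) (hM1 s) (hM (t - s)).2)).
have iN (v : R -> E) : L2I T S0 N0 v -> lam.-integrable I (EFin \o (fun s => N0 (v s))).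
  by move=> Lv; apply: (sqint_integrable mI fI); exact: (L2I_sqint SN0).
pose h s := (M2 * M + M1 * M) * Ka * N0 (u s) + M1 * M * Ka * N0 (u' s).
have ih : lam.-integrable I (EFin \o h).
  apply: (integrable_lin mI _ (iN _ Lu0)); apply: (integrableZ_fin mI); exact: iN.
have hP t s : I t -> I s -> `|P (t, s)| <= h s.
  move=> It Is; apply: le_trans (ler_normD _ _) _.
  have a1 := ba It (L2I_in Lu0 Is); have a2 := ba It (L2I_in Lu' Is).
  apply: lerD; rewrite normrM -[leRHS]mulrA.
    exact: (ler_pM (normr_ge0 _) (normr_ge0 _) (hA t s) a1).
  exact: (ler_pM (normr_ge0 _) (normr_ge0 _) (hB t s) a2).
have ialpha (f : R -> R) (K : R) e : S0 e -> continuous f -> (forall t, `|f t| <= K) ->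
    lam.-integrable I (EFin \o (fun t => f t * alpha t e)).
  move=> Se cf fK; apply: (integrable_mul_bounded (M := K)) => //.
    by apply: measurable_funTS; exact: continuous_measurable.
  exact: (integrable_family ma ba).
have ibeta (f : R -> R) (K : R) e : S1 e -> continuous f -> (forall t, `|f t| <= K) ->
    lam.-integrable I (EFin \o (fun t => f t * beta t e)).
  move=> Se cf fK; apply: (integrable_mul_bounded (M := K)) => //.
    by apply: measurable_funTS; exact: continuous_measurable.
  exact: (integrable_family mb bb).
(* the inner integral over s vanishes for every t, hence so does that over t *)
have step1 : \int[lam]_(s in I) \int[lam]_(t in I) P (t, s) = 0.
  rewrite -(Fubini_dominated mI mI fI mP ih hP).
  transitivity (\int[lam]_(t in I) (0 : R)); last by rewrite Rintegral_cst// mul0r.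
  apply: eq_Rintegral => t /set_mem It.
  have Ct : Coo_0_itv T (fun s => g s * psi (t - s)).
    by apply: Coo_0_itvMr Cg _; exact: (smooth_mul_reflect t sg spsi).1.
  have := derivative Ct It; rewrite (smooth_mul_reflect t sg spsi).2 => D.
  have isect (f : R -> R) (v : R -> E) (K : R) : continuous f -> (forall s, `|f s| <= K) -> L2I T S0 N0 v ->
      lam.-integrable I (EFin \o (fun s => f s * alpha t (v s))).
    move=> cf fK Lv; apply: (integrable_mul_bounded (M := K)) => //.
      by apply: measurable_funTS; exact: continuous_measurable.
    apply: (integrable_le mI (integrableZ_fin mI Ka (iN _ Lv))).
      apply: (L2I_caratheodory (Phi := fun _ e => alpha t e) (pr := id) SN0 _ _ _ _ _ Lv) => //.
      by move=> s Is; exists Ka => e e' Se Se'; exact: (family_lipschitz SN0 la ba).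
    by move=> s Is; apply: ba => //; exact: (L2I_in Lv).
  have cA : continuous (A t).
    have := smooth_continuous (smooth_derive1 ((Coo_0_itvP T _).1 Ct).1).
    by rewrite (smooth_mul_reflect t sg spsi).2.
  have cB : continuous (B t) := smooth_continuous ((Coo_0_itvP T _).1 Ct).1.
  rewrite /P /= RintegralD//; [|exact: isect (hA t) Lu0|exact: isect (hB t) Lu'].
  by rewrite D addNr.
have mg1 : measurable_fun I (g : measurableTypeR R -> R).
  by apply: measurable_funTS; apply: continuous_measurable; exact: smooth_continuous.
have mdg1 : measurable_fun I (derive1 g : measurableTypeR R -> R).
  by apply: measurable_funTS; apply: continuous_measurable; apply: smooth_continuous; exact: smooth_derive1.
have J1 := integrable_mollified_path SN0 Ka0 ma la ba n Lu0 mdg1 (fun t _ => hM2 t).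
have J2 := integrable_mollified_path SN1 Kb0 mb lb bb n Lu mg1 (fun t _ => hM1 t).
have J3 := integrable_mollified_path SN0 Ka0 ma la ba n Lu' mg1 (fun t _ => hM1 t).
rewrite -[RHS]step1 -(RintegralD mI J1 J2) -(RintegralD mI (integrableD_fin mI J1 J2) J3).
apply: eq_Rintegral => s /set_mem Is.
have Us := L2I_in Lu Is; have U0s := S10 Us; have U's := L2I_in Lu' Is.
have Cs : Coo_0_itv T (fun t => g s * psi (t - s)).
  apply/Coo_0_itvP; split; first exact: (smooth_scale_shift (g s) s spsi).1.
  have [gs0|gs] := eqVneq (g s) 0; first by rewrite (_ : (fun t => _) = (fun=> 0)); [exact: supp_in0|apply/funext => t; rewrite gs0 mul0r].
  have /andP[m1 m2] := margin s gs.
  apply: (supp_in_closed (C := (`[s - n.+1%:R^-1, s + n.+1%:R^-1]%classic : set R))).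
  - exact: segment_compact.
  - exact: interval_closed.
  - move=> t /=; rewrite !in_itv/= => /andP[t1 t2]; apply/andP; split.
      by apply: lt_le_trans t1; rewrite subr_gt0.
    by apply: le_lt_trans t2 _; rewrite -ltrBrDr.
  - move=> t; apply: contra_neqP => /negP; rewrite /= in_itv/= -ler_distlC -ltNge => h1.
    by rewrite /psi mollifier_eq0 ?mulr0// subr0 distrC ltW.
have := transport Cs Us; rewrite (smooth_scale_shift (g s) s spsi).2 => tr.
have cps : continuous (fun t => psi (t - s)).
  by have := smooth_continuous (smooth_scale_shift 1 s spsi).1; under eq_fun do rewrite mul1r.
have cdps : continuous (fun t => derive1 psi (t - s)).
  by have := smooth_continuous (smooth_scale_shift 1 s (smooth_derive1 spsi)).1; under eq_fun do rewrite mul1r.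
have I1 e : S0 e -> lam.-integrable I (EFin \o (fun t => psi (t - s) * alpha t e)).
  by move=> Se; exact: (ialpha _ M _ Se cps (fun t => (hM (t - s)).1)).
have I2 e : S0 e -> lam.-integrable I (EFin \o (fun t => derive1 psi (t - s) * alpha t e)).
  by move=> Se; exact: (ialpha _ M _ Se cdps (fun t => (hM (t - s)).2)).
have I3 e : S1 e -> lam.-integrable I (EFin \o (fun t => psi (t - s) * beta t e)).
  by move=> Se; exact: (ibeta _ M _ Se cps (fun t => (hM (t - s)).1)).
have mE (L : R -> E -> R) e : mollified T L n s e = \int[lam]_(t in I) (psi (t - s) * L t e).
  by apply: eq_Rintegral => t _; rewrite mollifier_shift.
rewrite !mE.
have tr' : g s * \int[lam]_(t in I) (derive1 psi (t - s) * alpha t (u s)) +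
    g s * \int[lam]_(t in I) (psi (t - s) * beta t (u s)) = 0.
  rewrite -tr -!RintegralZl ?I2 ?I3// -RintegralD//.
  - by apply: eq_Rintegral => t _; rewrite !mulrA.
  - by apply: (integrableZ_fin mI); exact: I2.
  - by apply: (integrableZ_fin mI); exact: I3.
have -> : \int[lam]_(t in I) P (t, s) = derive1 g s * \int[lam]_(t in I) (psi (t - s) * alpha t (u s))
   - g s * \int[lam]_(t in I) (derive1 psi (t - s) * alpha t (u s))
   + g s * \int[lam]_(t in I) (psi (t - s) * alpha t (u' s)).
  rewrite -!RintegralZl ?I2 ?I1// -RintegralB//; last 2 first.
  - by apply: (integrableZ_fin mI); exact: I1.
  - by apply: (integrableZ_fin mI); exact: I2.
  rewrite -RintegralD//.
  - by apply: eq_Rintegral => t _; rewrite /P/= /A /B; ring.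
  - have := integrable_lin mI (-1) (integrableZ_fin mI (g s) (I2 _ U0s)) (integrableZ_fin mI (derive1 g s) (I1 _ U0s)).
    by apply: eq_integrable => // t _; rewrite /= mulN1r addrC.
  - by apply: (integrableZ_fin mI); exact: I1.
exact: exchange_opposite tr'.
Qed.

End kernel.
(** The hypothesis [transport] freezes the field and [derivative] freezes the
    time of the form, while [alpha s (u s)] varies through both. They are
    applied with the two times separated by a mollifier, whose derivatives
    cancel, and the limit in [n] puts the times together. *)
Lemma transported_product_rule (g : R -> R) : Coo_0_itv T g ->
  \int[lam]_(s in I) (derive1 g s * alpha s (u s)) +
  \int[lam]_(s in I) (g s * beta s (u s)) +
  \int[lam]_(s in I) (g s * alpha s (u' s)) = 0.
Proof.
move=> Cg; have [M1 M10 hM1] := Coo_0_itv_bounded_ge0 Cg.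
have [M2 M20 hM2] := Coo_0_itv_bounded_ge0 (Coo_0_itv_derive1 Cg).
have mg1 : measurable_fun I (g : measurableTypeR R -> R).
  by apply: measurable_funTS; exact: Coo_0_itv_measurable Cg.
have mdg1 : measurable_fun I (derive1 g : measurableTypeR R -> R).
  by apply: measurable_funTS; exact: (Coo_0_itv_measurable (Coo_0_itv_derive1 Cg)).
have c1 := Rintegral_mollified_cvg SN0 Ka0 ma la ba Sb0 db0 Lu0 mdg1 (fun t _ => hM2 t).
have c2 := Rintegral_mollified_cvg SN1 Kb0 mb lb bb Sb1 db1 Lu mg1 (fun t _ => hM1 t).
have c3 := Rintegral_mollified_cvg SN0 Ka0 ma la ba Sb0 db0 Lu' mg1 (fun t _ => hM1 t).
have [e e0 he] := Coo_0_itv_margin Cg; have [n0 hn0] := exists_natSinv_lt e0.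
have z : (fun n => \int[lam]_(s in I) (derive1 g s * mollified T alpha n s (u s)) +
  \int[lam]_(s in I) (g s * mollified T beta n s (u s)) +
  \int[lam]_(s in I) (g s * mollified T alpha n s (u' s))) @ \oo --> (0 : R).
  apply: cvg_near_cst; exists n0 => // n nn; apply: doubled_identity => // s /he/andP[s1 s2].
  have h : n.+1%:R^-1 < e by apply: le_lt_trans hn0; rewrite lef_pV2 ?posrE// ler_nat ltnS.
  by apply/andP; split; [exact: lt_le_trans h s1|apply: le_lt_trans s2 _; rewrite ltrD2l ltrN2].
exact: (cvg_unique (@Rhausdorff R) (cvgD (cvgD c1 c2) c3) z).
Qed.

End doubling_of_variables.

(** * Forms weighted by the density and the drift *)

Section tensor_test_functions.
Context (R : realType) (d : nat) (Omega : set 'rV[R]_d) (T : R).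
Implicit Types (theta : R -> R) (psi : 'rV[R]_d -> R) (z : 'rV[R]_d.+1).

Lemma continuous_xcoor : continuous (@xcoor R d).
Proof.
move=> z A [P hP PA]; exists (fun i j' => if unlift ord0 j' is Some j then P i j else setT).
  move=> i j'; case: unliftP => [j ->|_]; last exact: filterT.
  by rewrite (ord1 i); have := hP ord0 j; rewrite /xcoor mxE.
move=> y hy; apply: PA => i j; have := hy i (lift ord0 j).
by rewrite liftK mxE ord1.
Qed.

Lemma pderiv_xcoor0 psi : (forall z, derivable (psi \o @xcoor R d) z (delta_mx ord0 ord0)) /\
  pderiv ord0 (psi \o @xcoor R d) = fun=> 0.
Proof.
apply: pderiv_is_derive => z.
have E : (fun h : R => h^-1 *: (((psi \o @xcoor R d) \o shift z) (h *: delta_mx ord0 ord0) -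
    (psi \o @xcoor R d) z)) = fun=> 0.
  apply/funext => h /=; rewrite (_ : xcoor _ = xcoor z) ?subrr ?scaler0//.
  by apply/rowP => j; rewrite !mxE/= mulr0 add0r.
apply: DeriveDef; first by rewrite /derivable E; exact: is_cvg_cst.
by rewrite /derive E; exact: lim_cst.
Qed.

Lemma pderiv_xcoorS psi j : (forall x, derivable psi x (delta_mx ord0 j)) ->
  (forall z, derivable (psi \o @xcoor R d) z (delta_mx ord0 (lift ord0 j))) /\
  pderiv (lift ord0 j) (psi \o @xcoor R d) = pderiv j psi \o @xcoor R d.
Proof.
move=> dpsi; apply: pderiv_is_derive => z.
have E : (fun h : R => h^-1 *: (((psi \o @xcoor R d) \o shift z) (h *: delta_mx ord0 (lift ord0 j)) -
    (psi \o @xcoor R d) z)) =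
    (fun h : R => h^-1 *: ((psi \o shift (xcoor z)) (h *: delta_mx ord0 j) - psi (xcoor z))).
  apply/funext => h /=; congr (_ *: (psi _ - _)); apply/rowP => k; rewrite !mxE/=.
  by rewrite (inj_eq lift_inj).
apply: DeriveDef; first by rewrite /derivable E; exact: dpsi.
by rewrite /derive E.
Qed.

Lemma Ck_xcoor k psi : Ck k psi -> Ck k (psi \o @xcoor R d).
Proof.
elim: k psi => [|k IH] psi Cpsi.
  split => // z; apply: continuous_comp; [exact: continuous_xcoor|exact: (Ck_continuous Cpsi)].
split; first by move=> z; apply: continuous_comp; [exact: continuous_xcoor|exact: (Ck_continuous Cpsi)].
move=> i; case: (unliftP ord0 i) => [j|] ->; last first.
  by have [d1 ->] := pderiv_xcoor0 psi; split => //; exact: (@Ck_cst R d.+1 k 0).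
have [_ /(_ j)[dj Cj]] := Cpsi; have [d1 ->] := pderiv_xcoorS dj.
by split => //; exact: IH.
Qed.

Definition tensor theta psi : 'rV[R]_d.+1 -> R := fun z => theta (tcoor z) * psi (xcoor z).

Lemma Coo_0_tensor theta psi : Coo_0_itv T theta -> Coo_0 Omega psi -> Coo_0 (Q Omega T) (tensor theta psi).
Proof.
move=> Ct [Cpsi [cpsi spsi]]; have [st [ct sst]] := (Coo_0_itvP T theta).1 Ct.
split; first by move=> k; apply: CkM; [exact: Ck_coor|exact: Ck_xcoor].
set K1 := closure _ in ct sst; set K2 := closure _ in cpsi spsi.
pose C : set 'rV[R]_d.+1 := (@tcoor R d @^-1` K1) `&` (@xcoor R d @^-1` K2).
have clC : closed C.
  apply: closedI; apply: preimage_closed; [|exact: closed_closure| |exact: closed_closure].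
    by move=> z _; exact: coord_continuous.
  by move=> z _; exact: continuous_xcoor.
apply: (@supp_in_closed _ _ _ C) => //.
- have [M1 [M10 h1]] : exists M : R, 0 < M /\ forall t, K1 t -> `|t| <= M.
    have [M0 [_ hM]] := compact_bounded ct; exists (`|M0| + 1); split; first by rewrite ltr_wpDl.
    by move=> t K1t; apply: (hM (`|M0| + 1)) => //; rewrite (le_lt_trans (ler_norm _))// ltrDl.
  have [M2 [M20 h2]] := bounded_boxcc (compact_bounded cpsi).
  apply: (subclosed_compact clC (@compact_boxcc R d.+1 (fun=> - (M1 + M2)) (fun=> M1 + M2))).
  move=> z [/h1 z1 /h2 z2] i; case: (unliftP ord0 i) => [j|] ->.
    by have := z2 j; rewrite mxE => /andP[? ?]; apply/andP; split; lra.
  by move: z1; rewrite ler_norml /tcoor => /andP[? ?]; apply/andP; split; lra.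
- by move=> z [/sst z1 /spsi z2]; split.
- move=> z; rewrite /tensor mulf_eq0 negb_or => /andP[z1 z2]; split; rewrite /=.
    exact: (subset_closure (A := [set t | theta t != 0])).
  exact: (subset_closure (A := [set x | psi x != 0])).
Qed.

Lemma tensor_pderiv theta psi t x : smooth theta -> Ck 1 psi ->
  pderiv ord0 (tensor theta psi) (consrV (x, t)) = derive1 theta t * psi x /\
  forall j, pderiv (lift ord0 j) (tensor theta psi) (consrV (x, t)) = theta t * pderiv j psi x.
Proof.
move=> st Cpsi; have C1 : Ck 1 (fun z : 'rV[R]_d.+1 => theta (tcoor z)) by exact: Ck_coor.
have C2 := Ck_xcoor Cpsi.
have tE : tcoor (consrV (x, t)) = t by rewrite /tcoor consrV0.
have xE : xcoor (consrV (x, t)) = x by apply/rowP => j; rewrite mxE consrVS.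
have dt (i : 'I_d.+1) z : pderiv i (fun z : 'rV[R]_d.+1 => theta (tcoor z)) z =
    (ord0 == i)%:R * derive1 theta (tcoor z).
  by rewrite (pderiv_is_derive (fun z => is_derive_coor ord0 i z st)).2.
split=> [|j]; rewrite /tensor (pderivM _ C1 C2) dt tE /= xE.
  by rewrite ?eqxx mul1r (pderiv_xcoor0 psi).2 mulr0 add0r mulrC.
have [_ /(_ j)[dj _]] := Cpsi.
by rewrite (pderiv_xcoorS dj).2/= xE mul0r mulr0 addr0.
Qed.

End tensor_test_functions.

(** The same measure, under a name that carries its sigma-finiteness to
    Fubini's theorem. *)
Definition lebesgue_rVs (R : realType) (n : nat) : set 'rV[R]_n -> \bar R := lebesgue_rV R n.
HB.instance Definition _ (R : realType) n := Measure.copy (@lebesgue_rVs R n) (lebesgue_rV R n).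
HB.instance Definition _ (R : realType) n :=
  Measure_isSigmaFinite.Build _ _ _ (@lebesgue_rVs R n) (@sigma_finite_lebesgue_rV R n).

Section weighted_forms.
Context (R : realType) (d : nat) (Omega : set 'rV[R]_d).
Hypotheses (oO : open Omega) (bO : bounded_set Omega).
Let mu : {measure set 'rV[R]_d -> \bar R} := lebesgue_rV R d.
Let mD : measurable Omega := measurable_domain oO.
Local Notation sqint := (sqint mu Omega).
Local Notation norm2 := (norm2 mu Omega).
Implicit Types (a : R -> 'rV[R]_d -> R) (f v : 'rV[R]_d -> R) (t : R).

Definition bounded_weight (M : R) a :=
  measurable_fun setT (fun z : measurableTypeR R * 'rV[R]_d => a z.1 z.2 : R) /\ forall t x, `|a t x| <= M.

Definition wform a t f v : R := \int[mu]_(x in Omega) (a t x * f x * v x).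

Variables (M : R) (a : R -> 'rV[R]_d -> R).
Hypothesis ha : bounded_weight M a.

Lemma measurable_weight t : measurable_fun Omega (a t).
Proof.
apply: measurable_funTS; have [ma _] := ha.
by have := measurableT_comp ma (measurable_pair1 t).
Qed.

Lemma sqint_weight t f : sqint f -> sqint (fun x => a t x * f x) /\
  norm2 (fun x => a t x * f x) <= M * norm2 f.
Proof.
by move=> Lf; apply: sqint_mul_bounded => //; [exact: measurable_weight|move=> x _; exact: ha.2].
Qed.

Lemma integrable_weight t f v : sqint f -> sqint v -> mu.-integrable Omega (EFin \o (fun x => a t x * f x * v x)).
Proof. by move=> Lf Lv; apply: (integrable_mul mD (sqint_weight t Lf).1 Lv). Qed.

Lemma wform_bound t f v : sqint f -> sqint v -> `|wform a t f v| <= M * norm2 f * norm2 v.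
Proof.
move=> Lf Lv; have [L1 h1] := sqint_weight t Lf.
apply: le_trans (CauchySchwarz_L2 mD L1 Lv) _.
by rewrite ler_wpM2r// sqrtr_ge0.
Qed.

Lemma wform_linr t f c v v' : sqint f -> sqint v -> sqint v' ->
  wform a t f (c *: v + v') = c * wform a t f v + wform a t f v'.
Proof.
move=> Lf Lv Lv'; rewrite /wform -(Rintegral_lin mD c (integrable_weight t Lf Lv) (integrable_weight t Lf Lv')).
by apply: eq_Rintegral => x _; rewrite !fctE -[c *: v x]/(c * v x); ring.
Qed.

Lemma wform_linl t f c f' v : sqint f -> sqint f' -> sqint v ->
  wform a t (c *: f + f') v = c * wform a t f v + wform a t f' v.
Proof.
move=> Lf Lf' Lv; rewrite /wform -(Rintegral_lin mD c (integrable_weight t Lf Lv) (integrable_weight t Lf' Lv)).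
by apply: eq_Rintegral => x _; rewrite !fctE -[c *: f x]/(c * f x); ring.
Qed.

Lemma wform_ae t f f' v v' : sqint f -> sqint v ->
  {ae mu, forall x, Omega x -> f' x = f x} -> {ae mu, forall x, Omega x -> v' x = v x} ->
  wform a t f' v' = wform a t f v.
Proof.
move=> Lf Lv ff vv; apply: (ae_eq_Rintegral mD).
  exact: (integrable_measurable (integrable_weight t Lf Lv)).
by apply: ae_imp2 ff vv => x h1 h2 Ox; rewrite h1// h2.
Qed.

Lemma measurable_wform f v : sqint f -> sqint v ->
  measurable_fun setT (fun t : measurableTypeR R => wform a t f v : R).
Proof.
move=> [mf _] [mv _].
pose K (z : measurableTypeR R * 'rV[R]_d) : R := a z.1 z.2 * (f \_ Omega) z.2 * (v \_ Omega) z.2.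
have mp (h : 'rV[R]_d -> R) : measurable_fun Omega h ->
    measurable_fun setT (fun z : measurableTypeR R * 'rV[R]_d => (h \_ Omega) z.2 : R).
  move=> mh; apply: (@measurableT_comp _ _ _ _ _ _ (h \_ Omega)) => //.
  exact: (proj1 (measurable_restrictT _ mD)).
have mK : measurable_fun setT K.
  by apply: measurable_funM; [apply: measurable_funM; [exact: ha.1|exact: mp]|exact: mp].
have := @measurable_Rintegral_section _ _ _ _ R (@lebesgue_rVs R d) Omega K mD mK.
congr (measurable_fun _ _); apply/funext => t; apply: eq_Rintegral => x xO.
by rewrite /K/= !patchE xO.
Qed.

End weighted_forms.

(** * The transport equation as a product rule *)

Lemma add_pair_lin (R : pzRingType) (c x y x' y' : R) :
  c * x + x' + (c * y + y') = c * (x + y) + (x' + y').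
Proof. by rewrite mulrDr addrACA. Qed.

Lemma weighted_sum_lin (R : comPzRingType) (a b c x y x' y' : R) :
  a * (c * x + x') + b * (c * y + y') = c * (a * x + b * y) + (a * x' + b * y').
Proof. ring. Qed.

Lemma integrable_functional_path (R : realType) (T : R) (E : lmodType R) (S : set E) (N : E -> R)
    (b : R -> E -> R) (K : R) (h : R -> R) (u : R -> E) :
  let I : set (measurableTypeR R) := `]0, T[%classic in
  seminormed S N ->
  (forall e, S e -> measurable_fun I (fun t : measurableTypeR R => b t e : R)) ->
  (forall t, I t -> linear_on S (b t)) -> (forall t e, I t -> S e -> `|b t e| <= K * N e) ->
  sqint (@lebesgue_measure R) I h -> L2I T S N u ->
  (@lebesgue_measure R).-integrable I (EFin \o (fun t => h t * b t (u t))).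
Proof.
move=> I SN mb lb bb Lh Lu; have mI : measurable I := measurable_itvI T.
apply: (integrable_mul mI Lh); apply: (sqint_le (g := fun t => K * N (u t)) mI).
- exact: (subspaceZ (sqint_subspace _ mI) K (L2I_sqint SN Lu)).
- apply: (L2I_caratheodory (Phi := b) (pr := id) SN _ _ _ _ _ Lu) => //.
  move=> t It; exists K => e f Se Sf; rewrite -(linear_onB (lb t It) Se Sf).
  by apply: bb => //; exact: (subspaceB (seminormed_sub SN)).
- move=> t It; apply: le_trans (bb t _ It (L2I_in Lu It)) (ler_norm _).
Qed.

Section transport.
Context (R : realType) (d : nat) (Omega : set 'rV[R]_d) (T : R).
Hypotheses (oO : open Omega) (bO : bounded_set Omega) (T0 : 0 < T).
Local Notation vfield := ('rV[R]_d -> 'rV[R]_d).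
Let mu : {measure set 'rV[R]_d -> \bar R} := lebesgue_rV R d.
Let mD : measurable Omega := measurable_domain oO.
Let lam : {measure set (measurableTypeR R) -> \bar R} := @lebesgue_measure R.
Let I : set (measurableTypeR R) := `]0, T[%classic.
Let mI : measurable I := measurable_itvI T.
Let fI : (lam I < +oo)%E := lebesgue_itvI_lty T.
Local Notation sqint := (sqint mu Omega).
Local Notation norm2 := (norm2 mu Omega).
Local Notation wpderiv := (wpderiv Omega).
Local Notation H1_0 := (H1_0 Omega).
Local Notation nH1 := (normH1 Omega).
Local Notation wform := (wform Omega).
Variables (w : R -> vfield) (rho : R -> 'rV[R]_d -> R).
Variables (M : R) (rr : R -> 'rV[R]_d -> R) (ww : 'I_d -> R -> 'rV[R]_d -> R).
Hypotheses (M0 : 0 <= M) (hrr : bounded_weight M rr) (hww : forall j, bounded_weight M (ww j)).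
Hypothesis rw : {ae lam, forall t, I t -> {ae mu, forall x, Omega x ->
  rho t x = rr t x /\ forall j, rho t x * w t x ord0 j = ww j t x}}.
Hypothesis rho_transported : transported Omega T w rho.
Implicit Types (f v : 'rV[R]_d -> R) (t : R) (theta : R -> R).

(** The form of the derivative of [f v] along the drift, by the product rule in
    space. *)
Definition convection t f v : R :=
  \sum_j (wform (ww j) t f (wpderiv j v) + wform (ww j) t (wpderiv j f) v).

Let H0S f : H1_0 f -> sqint f. Proof. by move=> [/H1_sqint]. Qed.
Let H0W j f : H1_0 f -> sqint (wpderiv j f). Proof. by move=> [/(sqint_wpderiv j)]. Qed.
Let SH0 : seminormed H1_0 nH1.
Proof.
exact: (seminormed_sub_on (normH1_seminormed oO bO) (fun f (Hf : H1_0 f) => Hf.1) (H1_0_subspace oO bO)).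
Qed.

Lemma measurable_convection f v : H1_0 f -> H1_0 v ->
  measurable_fun setT (fun t : measurableTypeR R => convection t f v : R).
Proof.
move=> Hf Hv; apply: measurable_sum => j; apply: measurable_funD.
  exact: (measurable_wform oO (hww j) (H0S Hf) (H0W j Hv)).
exact: (measurable_wform oO (hww j) (H0W j Hf) (H0S Hv)).
Qed.

Lemma convection_bound t f v (K : R) : H1_0 f -> H1_0 v -> 0 <= K ->
  norm2 v <= K -> (forall j, norm2 (wpderiv j v) <= K) -> `|convection t f v| <= (2 * d%:R * M * nH1 f) * K.
Proof.
move=> Hf Hv K0 h1 h2; apply: le_trans (ler_norm_sum _ _ _) _.
have nf := seminorm_ge0 SH0 f.
apply: le_trans (_ : \sum_(j < d) (M * nH1 f * K + M * nH1 f * K) <= _); last first.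
  rewrite sumr_const card_ord -[leLHS]mulr_natl le_eqVlt; apply/orP; left; apply/eqP; ring.
apply: ler_sum => j _; apply: le_trans (ler_normD _ _) _; apply: lerD.
  apply: le_trans (wform_bound oO (hww j) t (H0S Hf) (H0W j Hv)) _.
  apply: ler_pM => //; rewrite ?mulr_ge0 ?sqrtr_ge0// ler_wpM2l//.
  exact: norm2_le_normH1.
apply: le_trans (wform_bound oO (hww j) t (H0W j Hf) (H0S Hv)) _.
apply: ler_pM => //; rewrite ?mulr_ge0 ?sqrtr_ge0// ler_wpM2l//.
exact: norm2_wpderiv_le_normH1.
Qed.

Lemma convection_linr t f c v v' : H1_0 f -> H1_0 v -> H1_0 v' ->
  convection t f (c *: v + v') = c * convection t f v + convection t f v'.
Proof.
move=> Hf Hv Hv'; rewrite /convection mulr_sumr -big_split/=; apply: eq_bigr => j _.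
rewrite (wform_linr oO (hww j) t c (H0W j Hf) (H0S Hv) (H0S Hv')).
rewrite (wform_ae oO (hww j) t (H0S Hf) (sqint_lin mD c (H0W j Hv) (H0W j Hv')) (aeW _ (fun _ _ => erefl))
  (wpderiv_lin oO bO j c Hv.1 Hv'.1)).
rewrite (wform_linr oO (hww j) t c (H0S Hf) (H0W j Hv) (H0W j Hv')).
exact: add_pair_lin.
Qed.

Lemma convection_linl t f c f' v : H1_0 f -> H1_0 f' -> H1_0 v ->
  convection t (c *: f + f') v = c * convection t f v + convection t f' v.
Proof.
move=> Hf Hf' Hv; rewrite /convection mulr_sumr -big_split/=; apply: eq_bigr => j _.
rewrite (wform_linl oO (hww j) t c (H0S Hf) (H0S Hf') (H0W j Hv)).
rewrite (wform_ae oO (hww j) t (sqint_lin mD c (H0W j Hf) (H0W j Hf')) (H0S Hv)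
  (wpderiv_lin oO bO j c Hf.1 Hf'.1) (aeW _ (fun _ _ => erefl))).
rewrite (wform_linl oO (hww j) t c (H0W j Hf) (H0W j Hf') (H0S Hv)).
exact: add_pair_lin.
Qed.

(** The test function on the cylinder is the product of [theta] and [f v]. *)
Lemma transport_smooth theta f v : Coo_0_itv T theta -> Coo_0 Omega f -> Coo_0 Omega v ->
  \int[lam]_(t in I) (derive1 theta t * wform rr t f v + theta t * convection t f v) = 0.
Proof.
move=> Ct Cf Cv; have Cfv := Coo_0Mr Cf Cv.1.
have := rho_transported (Coo_0_tensor Ct Cfv).
have st := ((Coo_0_itvP T theta).1 Ct).1.
have mth : measurable_fun I (theta : measurableTypeR R -> R).
  by apply: measurable_funTS; exact: Coo_0_itv_measurable Ct.
have mdth : measurable_fun I (derive1 theta : measurableTypeR R -> R).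
  by apply: measurable_funTS; exact: (Coo_0_itv_measurable (Coo_0_itv_derive1 Ct)).
have Hf := Coo_0_H1_0 oO bO Cf; have Hv := Coo_0_H1_0 oO bO Cv.
have Lp j h : Coo_0 Omega h -> sqint (pderiv j h).
  by move=> Ch; exact: (Coo_0_sqint oO bO (Coo_0_pderiv j Ch)).
move=> E0; rewrite -[RHS]E0; apply/esym; apply: (ae_eq_Rintegral mI).
  apply: measurable_funD; apply: measurable_funM => //; apply: measurable_funTS.
    exact: (measurable_wform oO hrr (H0S Hf) (H0S Hv)).
  exact: measurable_convection.
apply: ae_imp rw => t ht It.
have convE : convection t f v = \sum_j (wform (ww j) t f (pderiv j v) + wform (ww j) t (pderiv j f) v).
  apply: eq_bigr => j _; congr (_ + _).
    apply: (wform_ae oO (hww j) t (H0S Hf) (Lp j v Cv) (aeW _ (fun _ _ => erefl))).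
    exact: wpderiv_Coo_0.
  apply: (wform_ae oO (hww j) t (Lp j f Cf) (H0S Hv)); last exact: aeW.
  exact: wpderiv_Coo_0.
pose G x : R := derive1 theta t * (rr t x * f x * v x) +
  theta t * \sum_j (ww j t x * f x * pderiv j v x + ww j t x * pderiv j f x * v x).
have i0 := integrable_weight oO hrr t (H0S Hf) (H0S Hv).
have ij j : mu.-integrable Omega (EFin \o (fun x => ww j t x * f x * pderiv j v x + ww j t x * pderiv j f x * v x)).
  apply: (integrableD_fin mD).
    exact: (integrable_weight oO (hww j) t (H0S Hf) (Lp j v Cv)).
  exact: (integrable_weight oO (hww j) t (Lp j f Cf) (H0S Hv)).
have is_ := integrable_sum_fin mD (index_enum 'I_d) ij.
have iG : mu.-integrable Omega (EFin \o G).
  exact: (integrable_lin mD _ i0 (integrableZ_fin mD _ is_)).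
transitivity (\int[mu]_(x in Omega) G x).
  apply: (ae_eq_Rintegral mD); first exact: (integrable_measurable iG).
  apply: ae_imp (ht It) => x hx Ox; have [rE wE] := hx Ox.
  have C1 := Cfv.1 1%N; have [-> dS] := tensor_pderiv t x st C1.
  rewrite /G mulrDr rE; congr (_ + _); first by ring.
  rewrite mulr_sumr [RHS]mulr_sumr; apply: eq_bigr => j _; rewrite dS -wE rE.
  rewrite (pderivM j (Cf.1 1%N) (Cv.1 1%N)); ring.
rewrite /G (Rintegral_lin mD _ i0 (integrableZ_fin mD _ is_)); congr (_ + _).
rewrite RintegralZl// convE Rintegral_sum//; congr (_ * _); apply: eq_bigr => j _.
rewrite RintegralD//.
  exact: (integrable_weight oO (hww j) t (H0S Hf) (Lp j v Cv)).
exact: (integrable_weight oO (hww j) t (Lp j f Cf) (H0S Hv)).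
Qed.

Let tform theta f v t : R := derive1 theta t * wform rr t f v + theta t * convection t f v.

Let tform_bound theta : Coo_0_itv T theta -> exists2 C, 0 <= C & forall f v, H1_0 f -> H1_0 v ->
  lam.-integrable I (EFin \o tform theta f v) /\
  `|\int[lam]_(t in I) tform theta f v t| <= C * (nH1 f * nH1 v).
Proof.
move=> Ct; have [B1 B10 hB1] := Coo_0_itv_bounded_ge0 Ct.
have [B2 B20 hB2] := Coo_0_itv_bounded_ge0 (Coo_0_itv_derive1 Ct).
pose K := B2 * M + B1 * (2 * d%:R * M).
have K0 : 0 <= K by rewrite addr_ge0// !mulr_ge0.
exists (K * fine (lam I)); first by rewrite mulr_ge0// fine_ge0.
move=> f v Hf Hv; have nf := seminorm_ge0 SH0 f; have nv := seminorm_ge0 SH0 v.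
have mt : measurable_fun I (tform theta f v : measurableTypeR R -> R).
  apply: measurable_funD; apply: measurable_funM; apply: measurable_funTS.
  - exact: (Coo_0_itv_measurable (Coo_0_itv_derive1 Ct)).
  - exact: (measurable_wform oO hrr (H0S Hf) (H0S Hv)).
  - exact: Coo_0_itv_measurable Ct.
  - exact: measurable_convection.
have bt t : `|tform theta f v t| <= K * (nH1 f * nH1 v).
  apply: le_trans (ler_normD _ _) _; rewrite !normrM mulrDl; apply: lerD; rewrite -[leRHS]mulrA.
    apply: (ler_pM (normr_ge0 _) (normr_ge0 _) (hB2 t)).
    apply: le_trans (wform_bound oO hrr t (H0S Hf) (H0S Hv)) _; rewrite mulrA.
    exact: (ler_pM (mulr_ge0 M0 (sqrtr_ge0 _)) (sqrtr_ge0 _)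
      (ler_wpM2l M0 (norm2_le_normH1 oO f)) (norm2_le_normH1 oO v)).
  apply: (ler_pM (normr_ge0 _) (normr_ge0 _) (hB1 t)); rewrite mulrA.
  exact: (convection_bound t Hf Hv nv (norm2_le_normH1 oO v) (fun j => norm2_wpderiv_le_normH1 oO j v)).
have it := integrable_bounded mI fI mt (fun t _ => bt t).
split=> //.
have ic : lam.-integrable I (EFin \o cst (K * (nH1 f * nH1 v))).
  by apply: (integrable_bounded mI fI (M := `|K * (nH1 f * nH1 v)|)).
apply: le_trans (Rintegral_norm_le mI ic it (fun t _ => bt t)) _.
by rewrite Rintegral_cst// mulrAC.
Qed.

(** Both sides are continuous in [f] and in [v], and test functions are dense. *)
Lemma transport_H1_0 theta f v : Coo_0_itv T theta -> H1_0 f -> H1_0 v ->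
  \int[lam]_(t in I) (derive1 theta t * wform rr t f v + theta t * convection t f v) = 0.
Proof.
move=> Ct; have [C C0 hC] := tform_bound Ct.
have CH : Coo_0 Omega `<=` H1_0 by move=> h; exact: Coo_0_H1_0.
have dC h : H1_0 h -> forall e, 0 < e -> exists2 k, Coo_0 Omega k & nH1 (h - k) < e.
  by move=> [_ hh] e /hh[k [? ?]]; exists k.
have b0 : bounded_functional H1_0 nH1 (fun=> 0).
  by split; [move=> c h k _ _; rewrite mulr0 addr0|exists 0 => h _; rewrite normr0 mul0r].
have bl v' : H1_0 v' -> bounded_functional H1_0 nH1 (fun f => \int[lam]_(t in I) tform theta f v' t).
  move=> Hv'; split; last first.
    exists (C * nH1 v') => h Hh; apply: le_trans (hC h v' Hh Hv').2 _.
    by rewrite mulrCA mulrC.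
  move=> c h k Hh Hk; rewrite -(Rintegral_lin mI c (hC _ _ Hh Hv').1 (hC _ _ Hk Hv').1).
  apply: eq_Rintegral => t _; rewrite /tform convection_linl//.
  by rewrite (wform_linl oO hrr t c (H0S Hh) (H0S Hk) (H0S Hv')); exact: weighted_sum_lin.
have br f' : H1_0 f' -> bounded_functional H1_0 nH1 (fun v => \int[lam]_(t in I) tform theta f' v t).
  move=> Hf'; split; last first.
    exists (C * nH1 f') => h Hh; apply: le_trans (hC f' h Hf' Hh).2 _.
    by rewrite -mulrA.
  move=> c h k Hh Hk; rewrite -(Rintegral_lin mI c (hC _ _ Hf' Hh).1 (hC _ _ Hf' Hk).1).
  apply: eq_Rintegral => t _; rewrite /tform convection_linr//.
  by rewrite (wform_linr oO hrr t c (H0S Hf') (H0S Hh) (H0S Hk)); exact: weighted_sum_lin.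
move=> Hf Hv; apply: (bounded_functional_eq SH0 CH dC (br f Hf) b0 _ Hv) => v' Cv'.
apply: (bounded_functional_eq SH0 CH dC (bl v' (CH _ Cv')) b0 _ Hf) => f' Cf'.
exact: transport_smooth.
Qed.

Local Notation L2v := (L2v Omega).
Local Notation H1_0v := (H1_0v Omega).
Local Notation seminorm1 := (seminorm1 Omega).

(** The abstract product rule for the forms obtained by fixing [f]. The time
    derivative of [u] is tested with the field whose only component is [rr t *
    f]. *)
Lemma weighted_transport (u u' : R -> vfield) f (i : 'I_d) (g : R -> R) :
  L2I_H1_0 Omega T u -> is_wdt Omega T u u' -> H1_0 f -> Coo_0_itv T g ->
  let h s := derive1 g s * wform rr s f (vcomp (u s) i) +
    g s * convection s f (vcomp (u s) i) + g s * wform rr s f (vcomp (u' s) i) in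
  lam.-integrable I (EFin \o h) /\ \int[lam]_(s in I) h s = 0.
Proof.
move=> Lu [Lu' wu] Hf Cg.
have [P P0 hP] := poincare_vector oO bO.
have SN0 : seminormed L2v (normL2v Omega) := normL2v_seminormed oO.
have SN1 : seminormed H1_0v seminorm1 := seminorm1_seminormed oO bO.
have S10 : H1_0v `<=` L2v by move=> e; exact: H1_0v_L2v.
have [b0 [Sb0 db0]] := L2v_dense oO bO.
have [b1 [Sb1 db1]] := H1_0v_separable oO bO (fun _ h => h) (H1_0v_subspace oO bO).
have nf := seminorm_ge0 SH0 f.
pose Kb := 2 * d%:R * M * nH1 f * (P + 1).
have Kb0 : 0 <= Kb by rewrite !mulr_ge0// addr_ge0// ltW.
pose A t (e : vfield) := wform rr t f (vcomp e i).
pose B t (e : vfield) := convection t f (vcomp e i).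
have mA e : L2v e -> measurable_fun I (fun t : measurableTypeR R => A t e : R).
  by move=> Le; apply: measurable_funTS; exact: (measurable_wform oO hrr (H0S Hf) (Le i)).
have lA t : I t -> linear_on L2v (A t).
  move=> It c e e' Le Le'; rewrite /A vcomp_lin.
  exact: (wform_linr oO hrr t c (H0S Hf) (Le i) (Le' i)).
have bA t e : I t -> L2v e -> `|A t e| <= M * norm2 f * normL2v Omega e.
  move=> It Le; apply: le_trans (wform_bound oO hrr t (H0S Hf) (Le i)) _.
  by rewrite ler_wpM2l ?mulr_ge0 ?sqrtr_ge0//; exact: norm2_le_normL2v.
have mB e : H1_0v e -> measurable_fun I (fun t : measurableTypeR R => B t e : R).
  by move=> He; apply: measurable_funTS; exact: (measurable_convection Hf (He i)).
have lB t : I t -> linear_on H1_0v (B t).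
  move=> It c e e' He He'; rewrite /B vcomp_lin.
  exact: (convection_linr t c Hf (He i) (He' i)).
have bB t e : I t -> H1_0v e -> `|B t e| <= Kb * seminorm1 e.
  move=> It He; rewrite /Kb -mulrA.
  have s0 := seminorm_ge0 SN1 e.
  apply: (convection_bound t Hf (He i)); first by rewrite mulr_ge0// addr_ge0// ltW.
    apply: le_trans (norm2_le_normL2v oO i (S10 _ He)) _; apply: le_trans (hP _ He) _.
    by rewrite ler_wpM2r// lerDl.
  move=> j; apply: le_trans (norm2_wpderiv_le_seminorm1 oO i j e) _.
  by rewrite ler_peMl// lerDr ltW.
have Lu0 : L2I_L2 Omega T u by exact: (L2I_sub SN1 SN0 S10 hP Lu).
have sg := Coo_0_itv_sqint Cg; have sdg := Coo_0_itv_sqint (Coo_0_itv_derive1 Cg).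
have i1 := integrable_functional_path SN0 mA lA bA sdg Lu0.
have i2 := integrable_functional_path SN1 mB lB bB sg Lu.
have i3 := integrable_functional_path SN0 mA lA bA sg Lu'.
have i12 := integrableD_fin mI i1 i2.
split; first exact: (integrableD_fin mI i12 i3).
rewrite (RintegralD mI i12 i3) (RintegralD mI i1 i2).
apply: (@transported_product_rule R T _ L2v H1_0v (normL2v Omega) seminorm1 A B
  P (M * norm2 f) Kb b0 b1 u u' SN0 SN1 S10 hP Sb0 db0 Sb1 db1) => //.
- by rewrite mulr_ge0// sqrtr_ge0.
- move=> theta e Ct He; exact: (transport_H1_0 Ct Hf (He i)).
- move=> theta t Ct It.
  (* the scalar product with [psi] selects the component [i] *)
  pose psi : vfield := fun x => \row_j ((i == j)%:R * (rr t x * f x)).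
  have Lpsi : L2v psi.
    move=> j; rewrite (_ : vcomp psi j = (i == j)%:R *: (fun x => rr t x * f x)).
      by apply: (subspaceZ (sqint_subspace mu mD)); exact: (sqint_weight oO hrr t (H0S Hf)).1.
    by apply/funext => x; rewrite /vcomp mxE.
  have pE (e : vfield) : ipL2v Omega e psi = wform rr t f (vcomp e i).
    apply: eq_Rintegral => x _; rewrite /dotv (bigD1 i)//= big1; last first.
      by move=> j ij; rewrite mxE eq_sym (negbTE ij) mul0r mulr0.
    by rewrite mxE eqxx mul1r addr0 mulrC.
  have := wu theta psi Ct Lpsi.
  under eq_Rintegral do rewrite pE.
  by under [X in _ = - X -> _]eq_Rintegral do rewrite pE.
Qed.

End transport.

(** * Bilinear forms along paths and dual spaces *)

Section bilinear_paths.
Context (R : realType) (T : R) (E E' : lmodType R) (S : set E) (S' : set E') (N : E -> R) (N' : E' -> R).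
Hypotheses (SN : seminormed S N) (SN' : seminormed S' N').
Let sS := seminormed_sub SN.
Let sS' := seminormed_sub SN'.
Let lam : {measure set (measurableTypeR R) -> \bar R} := @lebesgue_measure R.
Let I : set (measurableTypeR R) := `]0, T[%classic.
Let mI : measurable I := measurable_itvI T.
Variables (b : R -> E -> E' -> R) (K : R).
Hypotheses (mb : forall e e', S e -> S' e' -> measurable_fun I (fun t : measurableTypeR R => b t e e' : R))
  (lb : forall t e', I t -> S' e' -> linear_on S (fun e => b t e e'))
  (rb : forall t e, I t -> S e -> linear_on S' (b t e))
  (bb : forall t e e', I t -> S e -> S' e' -> `|b t e e'| <= K * N e * N' e').

(** Measurability is transferred to one argument at a time, the form being
    Lipschitz in each. *)
Lemma measurable_bilinear_path u v : L2I T S N u -> L2I T S' N' v ->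
  measurable_fun I (fun t : measurableTypeR R => b t (u t) (v t) : R).
Proof.
move=> Lu Lv; apply: (L2I_caratheodory (Phi := fun t e' => b t (u t) e') (pr := id) SN' _ _ _ _ _ Lv) => //.
  move=> e' Se'; apply: (L2I_caratheodory (Phi := fun t e => b t e e') (pr := id) SN _ _ _ _ _ Lu) => //.
    by move=> e Se; exact: mb.
  move=> t It; exists (K * N' e') => e f Se Sf.
  rewrite -(linear_onB (lb It Se') Se Sf) mulrAC; apply: bb => //; exact: (subspaceB sS).
move=> t It; exists (K * N (u t)) => e f Se Sf; have Sut := L2I_in Lu It.
rewrite -(linear_onB (rb It Sut) Se Sf); apply: bb => //; exact: (subspaceB sS').
Qed.

Lemma integrable_bilinear_path u v : L2I T S N u -> L2I T S' N' v ->
  lam.-integrable I (EFin \o (fun t => b t (u t) (v t))) /\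
  (0 <= K -> `|\int[lam]_(t in I) b t (u t) (v t)| <= K * normL2I T N u * normL2I T N' v).
Proof.
move=> Lu Lv; have m1 := measurable_bilinear_path Lu Lv.
have L1 := L2I_sqint SN Lu; have L2 := L2I_sqint SN' Lv.
have i1 := integrable_mul mI L1 L2; have i2 := integrableZ_fin mI K i1.
have bt t : I t -> `|b t (u t) (v t)| <= K * (N (u t) * N' (v t)).
  by move=> It; rewrite mulrA; exact: (bb It (L2I_in Lu It) (L2I_in Lv It)).
have i3 := integrable_le mI i2 m1 bt; split => // K0.
apply: le_trans (Rintegral_norm_le mI i2 i3 bt) _.
rewrite RintegralZl// -mulrA ler_wpM2l// !normL2IE.
apply: le_trans (ler_norm _) _; exact: (CauchySchwarz_L2 mI L1 L2).
Qed.

End bilinear_paths.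

Section dual_space.
Context (R : realType) (E : lmodType R) (S : set E) (N : E -> R).
Hypothesis SN : seminormed S N.
Let sS := seminormed_sub SN.

Lemma bounded_functional_subspace : subspace_on (bounded_functional S N).
Proof.
split.
  split; first by move=> c u v _ _; rewrite -[0 (_ : E)]/(0 : R) mulr0 addr0.
  by exists 0 => v _; rewrite normr0 mul0r.
move=> c l l' [ll [C hC]] [ll' [C' hC']].
have E0 v : (c *: l + l') v = c * l v + l' v by [].
split.
  by move=> a u v Su Sv; rewrite !E0 ll// ll'//; ring.
exists (`|c| * C + C') => v Sv; rewrite E0; apply: le_trans (ler_normD _ _) _.
by rewrite normrM mulrDl; apply: lerD; [rewrite -mulrA ler_wpM2l// hC|exact: hC'].
Qed.

(** When the set of values is unbounded its supremum is $0$ by convention. *)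
Lemma dual_norm_nneg l : 0 <= dual_norm S N l.
Proof.
have [hs|hs] := pselect (has_sup [set `|l v| | v in [set v | S v /\ N v <= 1]]); last by rewrite /dual_norm sup_out.
apply: le_trans (normr_ge0 (l 0)) _; apply: ub_le_sup; first by case: hs.
by exists 0 => //; split; [exact: sS.1|rewrite (seminorm0 SN)].
Qed.

Lemma dual_norm_seminormed : seminormed (bounded_functional S N) (dual_norm S N).
Proof.
have sB := bounded_functional_subspace; split => //.
- move=> c l bl; have bcl := subspaceZ sB c bl.
  have le a l1 : bounded_functional S N l1 -> dual_norm S N (a *: l1) <= `|a| * dual_norm S N l1.
    move=> b1; apply: (dual_norm_le SN (subspaceZ sB a b1)); first by rewrite mulr_ge0// dual_norm_nneg.
    by move=> v Sv; rewrite -[(a *: l1) v]/(a * l1 v) normrM -mulrA ler_wpM2l//; exact: le_dual_norm.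
  apply/eqP; rewrite eq_le le//=.
  have [->|c0] := eqVneq c 0; first by rewrite normr0 mul0r dual_norm_nneg.
  have := le c^-1 _ bcl; rewrite scalerA mulVf// scale1r normfV mulrC ler_pdivlMr ?normr_gt0//.
  by rewrite mulrC.
- move=> l l' bl bl'.
  apply: (dual_norm_le SN (subspaceD sB bl bl')); first by rewrite addr_ge0// dual_norm_nneg.
  move=> v Sv; apply: le_trans (ler_normD _ _) _; rewrite mulrDl.
  by apply: lerD; exact: le_dual_norm.
- exact: dual_norm_nneg.
Qed.

End dual_space.

(** * Bounded representatives of the density and the drift *)

Section regular_weights.
Context (R : realType) (d : nat) (Omega : set 'rV[R]_d) (T : R).
Hypotheses (oO : open Omega).
Local Notation vfield := ('rV[R]_d -> 'rV[R]_d).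
Let mu : {measure set 'rV[R]_d -> \bar R} := lebesgue_rV R d.
Let lam : {measure set (measurableTypeR R) -> \bar R} := @lebesgue_measure R.
Let I : set (measurableTypeR R) := `]0, T[%classic.
Let QQ : set 'rV[R]_d.+1 := Q Omega T.

Lemma measurable_cylinder : measurable QQ.
Proof.
rewrite /QQ (_ : Q Omega T = (@xcoor R d @^-1` Omega) `&` (@tcoor R d @^-1` `]0, T[%classic)).
  apply: measurableI; apply: open_measurable_rV; apply: open_comp.
  - by move=> z _; exact: continuous_xcoor.
  - by [].
  - by move=> z _; exact: coord_continuous.
  - exact: interval_open.
by apply/seteqP; split => z [].
Qed.

(** By Tonelli, almost every section in space of a null set of space-time is
    null. *)
Lemma null_section (N : set 'rV[R]_d.+1) : measurable N -> lebesgue_rV R d.+1 N = 0%E ->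
  {ae lam, forall t, {ae mu, forall x, ~ N (consrV (x, t))}}.
Proof.
move=> mN N0; pose A := @consrV R d @^-1` N.
have mA : measurable A by rewrite -[A]setTI; exact: measurable_consrV.
have A0 : (@lebesgue_rVs R d \x lam)%E A = 0%E by exact: N0.
have mf : measurable_fun setT (EFin \o (\1_A : 'rV[R]_d * measurableTypeR R -> R)) by apply/measurable_EFinP.
have f0 z : (0 <= (EFin \o (\1_A : 'rV[R]_d * measurableTypeR R -> R)) z)%E by rewrite lee_fin.
have := fubini_tonelli2 (m1 := @lebesgue_rVs R d) (m2 := lam) _ mf f0.
have -> : (\int[@lebesgue_rVs R d \x lam]_z (EFin \o (\1_A : 'rV[R]_d * measurableTypeR R -> R)) z = 0)%E.
  by rewrite integral_indic// setIT.
move=> /esym; set G := fubini_G _ _ => G0.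
have mG : measurable_fun setT G by exact: measurable_fun_fubini_tonelli_G.
have G_ge0 t : (0 <= G t)%E by apply: integral_ge0 => x _.
have hG : (\int[lam]_t `|G t| = 0)%E by rewrite -[RHS]G0; apply: eq_integral => t _; rewrite gee0_abs.
have /ae_eq_integral_abs := hG; move=> /(_ measurableT mG).
apply: ae_imp => t /(_ Logic.I) /= Gt.
have mAt : measurable (ysection A t) by exact: measurable_ysection.
exists (ysection A t); split => //; last first.
  by move=> x /= /contrapT Nx; rewrite /ysection/= mem_set.
have E : G t = (@lebesgue_rVs R d) (ysection A t).
  by rewrite /G (indic_fubini_tonelli_GE (@lebesgue_rVs R d) mA).
rewrite E in Gt; exact: Gt.
Qed.

Lemma measurable_cylinder_patch (h : R -> 'rV[R]_d -> R) :
  measurable_fun QQ (fun z => h (tcoor z) (xcoor z)) ->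
  measurable_fun setT (fun z : measurableTypeR R * 'rV[R]_d =>
    (if (z.1 \in I) && (z.2 \in Omega) then h z.1 z.2 else 0) : R).
Proof.
move=> mh; have := proj1 (measurable_restrictT _ measurable_cylinder) mh => mp.
have ms : measurable_fun setT (fun z : measurableTypeR R * 'rV[R]_d => consrV (z.2, z.1)).
  apply: (measurableT_comp (@measurable_consrV R d)).
  by apply/measurable_fun_pairP; split; [exact: measurable_snd|exact: measurable_fst].
have := measurableT_comp mp ms; congr (measurable_fun _ _).
apply/funext => -[t x]; rewrite /= patchE.
have tE : tcoor (consrV (x, t)) = t by rewrite /tcoor consrV0.
have xE : xcoor (consrV (x, t)) = x by apply/rowP => j; rewrite mxE consrVS.
rewrite tE xE; congr (if _ then _ else _); apply/idP/andP.
  by rewrite inE /QQ /Q /= tE xE => -[? ?]; split; rewrite inE.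
by move=> [/set_mem tI /set_mem xO]; rewrite inE /QQ /Q/= tE xE.
Qed.

Variables (w : R -> vfield) (rho : R -> 'rV[R]_d -> R) (rmax : R).
Hypotheses (rmax0 : 0 <= rmax) (rho_bound : forall t x, `|rho t x| <= rmax)
  (rho_measurable : measurable_fun QQ (fun z => rho (tcoor z) (xcoor z)))
  (w_bounded : LooQ Omega T w).

(** The velocity is bounded almost everywhere in space-time only; it is cut off
    where it exceeds its essential bound, which changes it on a null set of
    almost every section. *)
Lemma regular_weights : exists (M : R) (rr : R -> 'rV[R]_d -> R) (ww : 'I_d -> R -> 'rV[R]_d -> R),
  [/\ 0 <= M, bounded_weight M rr, forall j, bounded_weight M (ww j) &
   {ae lam, forall t, I t -> {ae mu, forall x, Omega x ->
     rho t x = rr t x /\ forall j, rho t x * w t x ord0 j = ww j t x}}].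
Proof.
have [mw [B hB]] := w_bounded.
pose rr t x : R := if (t \in I) && (x \in Omega) then rho t x else 0.
pose wp j t x : R := if (t \in I) && (x \in Omega) then w t x ord0 j else 0.
pose clip (r : R) : R := if `|r| <= `|B| then r else 0.
have mclip : measurable_fun setT (clip : measurableTypeR R -> R).
  have mabs : measurable_fun setT (fun r : measurableTypeR R => `|r : R| : R).
    by apply: continuous_measurable; exact: norm_continuous.
  have ml : measurable_fun setT (fun r : measurableTypeR R => `|r : R| <= `|B|).
    exact: (measurable_fun_ler mabs (measurable_cst _)).
  apply: (@measurable_fun_ifT _ _ (measurableTypeR R) (measurableTypeR R) id (cst 0) _ ml) => //.
have mrr := measurable_cylinder_patch rho_measurable.
have clipB r : `|clip r| <= `|B| by rewrite /clip; case: ifP => //; rewrite normr0.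
have rrB t x : `|rr t x| <= rmax by rewrite /rr; case: ifP => // _; rewrite normr0.
exists (rmax * (`|B| + 1)), rr, (fun j t x => rr t x * clip (wp j t x)); split.
- by rewrite mulr_ge0// addr_ge0.
- split => // t x; apply: le_trans (rrB t x) _; rewrite ler_peMr// lerDr//.
- move=> j; split.
    apply: measurable_funM => //; apply: (measurableT_comp mclip).
    exact: (measurable_cylinder_patch (h := fun t x => vcomp (w t) j x) (mw j)).
  move=> t x; rewrite normrM; apply: ler_pM => //.
  by apply: le_trans (clipB _) _; rewrite lerDl.
- have [N [mN N0 hN]] := hB.
  apply: ae_imp (null_section mN N0) => t ht It; apply: ae_imp ht => x nN Ox.
  have rE : rr t x = rho t x by rewrite /rr !mem_set.
  rewrite rE; split => // j; congr (_ * _); rewrite /wp !mem_set//=.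
  have tE : tcoor (consrV (x, t)) = t by rewrite /tcoor consrV0.
  have xE : xcoor (consrV (x, t)) = x by apply/rowP => k; rewrite mxE consrVS.
  have : `|w t x| <= B.
    apply: contrapT => nB; apply: nN; apply: hN => /= h; apply: nB.
    by have := h; rewrite tE xE; apply; split; rewrite ?tE ?xE.
  move=> wB; rewrite /clip ifT//; apply: le_trans (ler_norm B); apply: le_trans wB.
  by rewrite [leRHS]mx_normrE; apply/bigmax_geP; right => /=; exists (ord0, j).
Qed.

End regular_weights.

(** * The material derivative as a pair of forms *)

Section momentum_forms.
Context (R : realType) (d : nat) (Omega : set 'rV[R]_d) (T : R).
Hypotheses (oO : open Omega) (bO : bounded_set Omega).
Local Notation vfield := ('rV[R]_d -> 'rV[R]_d).
Let mu : {measure set 'rV[R]_d -> \bar R} := lebesgue_rV R d.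
Let mD : measurable Omega := measurable_domain oO.
Let lam : {measure set (measurableTypeR R) -> \bar R} := @lebesgue_measure R.
Let I : set (measurableTypeR R) := `]0, T[%classic.
Let mI : measurable I := measurable_itvI T.
Local Notation sqint := (sqint mu Omega).
Local Notation norm2 := (norm2 mu Omega).
Local Notation wpderiv := (wpderiv Omega).
Local Notation L2v := (L2v Omega).
Local Notation H1_0v := (H1_0v Omega).
Local Notation seminorm1 := (seminorm1 Omega).
Local Notation nrm := (normL2v Omega).
Local Notation wform := (wform Omega).
Variables (M : R) (rr : R -> 'rV[R]_d -> R) (ww : 'I_d -> R -> 'rV[R]_d -> R).
Hypotheses (M0 : 0 <= M) (hrr : bounded_weight M rr) (hww : forall j, bounded_weight M (ww j)).
Implicit Types (z e : vfield) (t : R) (u v : R -> vfield).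

(** $\int_\Omega \rho\, z \cdot e$, the part of the material derivative that
    sees the time derivative. *)
Definition density_form t z e : R := \sum_i wform rr t (vcomp z i) (vcomp e i).

(** $\int_\Omega \rho\, (\mathbf w \cdot \nabla) z \cdot e$. *)
Definition drift_form t z e : R :=
  \sum_i \sum_j wform (ww j) t (wpderiv j (vcomp z i)) (vcomp e i).

Let HW j i z : H1_0v z -> sqint (wpderiv j (vcomp z i)).
Proof. by move=> Hz; apply: (sqint_wpderiv j); exact: (Hz i).1. Qed.

Lemma density_form_linl t e : L2v e -> linear_on L2v (fun z => density_form t z e).
Proof.
move=> Le c u v Lu Lv; rewrite /density_form mulr_sumr -big_split; apply: eq_bigr => i _.
by rewrite vcomp_lin (wform_linl oO hrr t c (Lu i) (Lv i) (Le i)).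
Qed.

Lemma density_form_linr t z : L2v z -> linear_on L2v (density_form t z).
Proof.
move=> Lz c u v Lu Lv; rewrite /density_form mulr_sumr -big_split; apply: eq_bigr => i _.
by rewrite vcomp_lin (wform_linr oO hrr t c (Lz i) (Lu i) (Lv i)).
Qed.

Lemma drift_form_linl t e : L2v e -> linear_on H1_0v (fun z => drift_form t z e).
Proof.
move=> Le c u v Hu Hv; rewrite /drift_form mulr_sumr -big_split; apply: eq_bigr => i _.
rewrite mulr_sumr -big_split; apply: eq_bigr => j _ /=.
rewrite -(wform_linl oO (hww j) t c (HW j i Hu) (HW j i Hv) (Le i)).
apply: (wform_ae oO (hww j) t (sqint_lin mD c (HW j i Hu) (HW j i Hv)) (Le i)); last exact: aeW.
exact: (wpderiv_vcomp_lin oO bO).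
Qed.

Lemma drift_form_linr t z : H1_0v z -> linear_on L2v (drift_form t z).
Proof.
move=> Hz c u v Lu Lv; rewrite /drift_form mulr_sumr -big_split; apply: eq_bigr => i _.
rewrite mulr_sumr -big_split; apply: eq_bigr => j _ /=.
by rewrite vcomp_lin (wform_linr oO (hww j) t c (HW j i Hz) (Lu i) (Lv i)).
Qed.

Lemma density_form_bound t z e : L2v z -> L2v e -> `|density_form t z e| <= (d%:R * M) * nrm z * nrm e.
Proof.
move=> Lz Le; apply: le_trans (ler_norm_sum _ _ _) _.
apply: le_trans (_ : \sum_(i < d) M * nrm z * nrm e <= _); last first.
  by rewrite sumr_const card_ord -[leLHS]mulr_natl !mulrA.
apply: ler_sum => i _; apply: le_trans (wform_bound oO hrr t (Lz i) (Le i)) _.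
have n1 := norm2_le_normL2v oO i Lz; have n2 := norm2_le_normL2v oO i Le.
by apply: ler_pM; rewrite ?mulr_ge0 ?sqrtr_ge0 ?ler_wpM2l.
Qed.

Lemma drift_form_bound t z e : H1_0v z -> L2v e ->
  `|drift_form t z e| <= (d%:R * (d%:R * M)) * seminorm1 z * nrm e.
Proof.
move=> Hz Le; apply: le_trans (ler_norm_sum _ _ _) _.
apply: le_trans (_ : \sum_(i < d) \sum_(j < d) M * seminorm1 z * nrm e <= _); last first.
  by rewrite !sumr_const !card_ord -[leLHS]mulr_natl -[X in _ * X]mulr_natl !mulrA.
apply: ler_sum => i _; apply: le_trans (ler_norm_sum _ _ _) _; apply: ler_sum => j _.
apply: le_trans (wform_bound oO (hww j) t (HW j i Hz) (Le i)) _.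
have n1 := norm2_wpderiv_le_seminorm1 oO i j z; have n2 := norm2_le_normL2v oO i Le.
by apply: ler_pM; rewrite ?mulr_ge0 ?sqrtr_ge0 ?ler_wpM2l.
Qed.

Lemma measurable_density_form z e : L2v z -> L2v e ->
  measurable_fun I (fun t : measurableTypeR R => density_form t z e : R).
Proof.
move=> Lz Le; apply: measurable_funTS; apply: measurable_sum => i.
exact: (measurable_wform oO hrr (Lz i) (Le i)).
Qed.

Lemma measurable_drift_form z e : H1_0v z -> L2v e ->
  measurable_fun I (fun t : measurableTypeR R => drift_form t z e : R).
Proof.
move=> Hz Le; apply: measurable_funTS; apply: measurable_sum => i; apply: measurable_sum => j.
exact: (measurable_wform oO (hww j) (HW j i Hz) (Le i)).
Qed.

Let SN0 : seminormed L2v nrm := normL2v_seminormed oO.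
Let SN1 : seminormed H1_0v seminorm1 := seminorm1_seminormed oO bO.

Lemma integrable_density_form u v : L2I_L2 Omega T u -> L2I_L2 Omega T v ->
  lam.-integrable I (EFin \o (fun t => density_form t (u t) (v t))) /\
  `|\int[lam]_(t in I) density_form t (u t) (v t)| <=
    (d%:R * M) * normL2I T nrm u * normL2I T nrm v.
Proof.
move=> Lu Lv; have K0 : 0 <= d%:R * M by rewrite mulr_ge0.
have [i1 i2] := integrable_bilinear_path SN0 SN0 measurable_density_form
  (fun t e _ Le => density_form_linl t Le) (fun t e _ Le => density_form_linr t Le)
  (fun t z e _ Lz Le => density_form_bound t Lz Le) Lu Lv.
by split => //; exact: i2.
Qed.

Lemma integrable_drift_form u v : L2I_H1_0 Omega T u -> L2I_L2 Omega T v ->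
  lam.-integrable I (EFin \o (fun t => drift_form t (u t) (v t))) /\
  `|\int[lam]_(t in I) drift_form t (u t) (v t)| <=
    (d%:R * (d%:R * M)) * normL2I T seminorm1 u * normL2I T nrm v.
Proof.
move=> Lu Lv; have K0 : 0 <= d%:R * (d%:R * M) by rewrite !mulr_ge0.
have [i1 i2] := integrable_bilinear_path SN1 SN0 measurable_drift_form
  (fun t e _ Le => drift_form_linl t Le) (fun t e _ Le => drift_form_linr t Le)
  (fun t z e _ Lz Le => drift_form_bound t Lz Le) Lu Lv.
by split => //; exact: i2.
Qed.

Variables (w : R -> vfield) (rho : R -> 'rV[R]_d -> R).

(** [y] stands for the weak time derivative that [mdot] selects; it agrees with
    a given one almost everywhere only. *)
Lemma material_form t z z' e : L2v z' -> H1_0v z -> L2v e ->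
  {ae mu, forall x, Omega x ->
    rho t x = rr t x /\ forall j, rho t x * w t x ord0 j = ww j t x} ->
  forall y : vfield, {ae mu, forall x, Omega x -> y x = z' x} ->
  \int[mu]_(x in Omega) dotv (rho t x *:
     (y x + \row_i \sum_j w t x ord0 j * wpderiv j (vcomp z i) x)) (e x) =
  density_form t z' e + drift_form t z e.
Proof.
move=> Lz' Hz Le hrw y yz'.
have i1 i := integrable_weight oO hrr t (Lz' i) (Le i).
have i2 i j := integrable_weight oO (hww j) t (HW j i Hz) (Le i).
have i3 i := integrable_sum_fin mD (index_enum 'I_d) (i2 i).
have E : density_form t z' e + drift_form t z e = \int[mu]_(x in Omega)
   \sum_i (rr t x * vcomp z' i x * vcomp e i x +
     \sum_j ww j t x * wpderiv j (vcomp z i) x * vcomp e i x).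
  rewrite Rintegral_sum//; last by move=> i; exact: (integrableD_fin mD).
  rewrite /density_form /drift_form -big_split; apply: eq_bigr => i _.
  by rewrite RintegralD//; congr (_ + _); rewrite Rintegral_sum.
rewrite E; apply: (ae_eq_Rintegral mD).
  by apply: integrable_measurable; apply: (integrable_sum_fin mD) => i; exact: (integrableD_fin mD).
apply: ae_imp2 hrw yz' => x hx hy Ox; have [h1 h2] := hx Ox.
rewrite /dotv; apply: eq_bigr => i _; rewrite !mxE hy// h1 mulrDr mulrDl; congr (_ + _).
by rewrite mulr_sumr mulr_suml; apply: eq_bigr => j _; rewrite -h2 -h1 !mulrA.
Qed.

Hypothesis rw : {ae lam, forall t, I t -> {ae mu, forall x, Omega x ->
  rho t x = rr t x /\ forall j, rho t x * w t x ord0 j = ww j t x}}.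

(** The functional $(\rho \dot u, v)_{L^2}$ of a field [u] with time derivative
    [u']. *)
Definition material_functional u u' v : R :=
  \int[lam]_(t in I) (density_form t (u' t) (v t) + drift_form t (u t) (v t)).

Lemma L2I_H1_0_L2 u : L2I_H1_0 Omega T u -> L2I_L2 Omega T u.
Proof.
have [P P0 hP] := poincare_vector oO bO.
by apply: (L2I_sub SN1 SN0) => [e|]; [exact: H1_0v_L2v|exact: hP].
Qed.

Lemma material_functional_integrable u u' v : L2I_H1_0 Omega T u -> L2I_L2 Omega T u' ->
  L2I_L2 Omega T v ->
  lam.-integrable I (EFin \o (fun t => density_form t (u' t) (v t) + drift_form t (u t) (v t))).
Proof.
move=> Lu Lu' Lv; apply: (integrableD_fin mI); first exact: (integrable_density_form Lu' Lv).1.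
exact: (integrable_drift_form Lu Lv).1.
Qed.

Lemma ipQ_mdot u u' v : L2I_H1_0 Omega T u -> is_wdt Omega T u u' -> L2I_L2 Omega T v ->
  ipQ Omega T (rhomul rho (mdot Omega T w u)) v = material_functional u u' v.
Proof.
move=> Lu wu Lv; rewrite /ipQ /intQ; apply: (ae_eq_Rintegral mI).
  exact: (integrable_measurable (material_functional_integrable Lu wu.1 Lv)).
apply: ae_imp2 rw (wdt_eqQ oO bO wu) => t ht hu It.
exact: (material_form (L2I_in wu.1 It) (L2I_in Lu It) (L2I_in Lv It) (ht It) (hu It)).
Qed.

Lemma material_functional_linear u u' : L2I_H1_0 Omega T u -> L2I_L2 Omega T u' ->
  linear_on (L2I_L2 Omega T) (material_functional u u').
Proof.
move=> Lu Lu' c v v' Lv Lv'.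
rewrite /material_functional -(Rintegral_lin mI c (material_functional_integrable Lu Lu' Lv) (material_functional_integrable Lu Lu' Lv')).
apply: eq_Rintegral => t /set_mem It.
rewrite (density_form_linr t (L2I_in Lu' It) c (L2I_in Lv It) (L2I_in Lv' It)).
rewrite (drift_form_linr t (L2I_in Lu It) c (L2I_in Lv It) (L2I_in Lv' It)).
exact: add_pair_lin.
Qed.

Lemma material_functional_linearl c u u' v v' (y : R -> vfield) : L2I_H1_0 Omega T u -> L2I_L2 Omega T u' ->
  L2I_H1_0 Omega T v -> L2I_L2 Omega T v' -> L2I_L2 Omega T y ->
  material_functional (c *: u + v) (c *: u' + v') y =
  c * material_functional u u' y + material_functional v v' y.
Proof.
move=> Lu Lu' Lv Lv' Ly.
rewrite /material_functional -(Rintegral_lin mI c (material_functional_integrable Lu Lu' Ly) (material_functional_integrable Lv Lv' Ly)).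
apply: eq_Rintegral => t /set_mem It.
rewrite (density_form_linl t (L2I_in Ly It) c (L2I_in Lu' It) (L2I_in Lv' It)).
rewrite (drift_form_linl t (L2I_in Ly It) c (L2I_in Lu It) (L2I_in Lv It)).
exact: add_pair_lin.
Qed.

Lemma material_functional_bound u u' : L2I_H1_0 Omega T u -> L2I_L2 Omega T u' ->
  exists2 C, 0 <= C & forall v, L2I_L2 Omega T v ->
    `|material_functional u u' v| <= C * normL2I T nrm v.
Proof.
move=> Lu Lu'.
exists (d%:R * M * normL2I T nrm u' + d%:R * (d%:R * M) * normL2I T seminorm1 u).
  by rewrite addr_ge0// !mulr_ge0// sqrtr_ge0.
move=> v Lv; have [i1 h1] := integrable_density_form Lu' Lv.
have [i2 h2] := integrable_drift_form Lu Lv.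
rewrite /material_functional RintegralD// mulrDl.
by apply: le_trans (ler_normD _ _) _; exact: lerD.
Qed.

End momentum_forms.

(** * The weak material derivative of a smooth field *)

Lemma add_pair_eq0 (R : pzRingType) (x y x' y' : R) : x + y = 0 -> x' + y' = 0 ->
  1 * x + x' + (1 * y + y') = 0.
Proof. by rewrite add_pair_lin => -> ->; rewrite mulr0 addr0. Qed.

Lemma sum_path (S : Type) (E : zmodType) n (F : 'I_n -> S -> E) :
  (fun t => \sum_(k < n) F k t) = \sum_(k < n) F k.
Proof. by apply/funext => t; rewrite fct_sumE. Qed.

Section rhodot_of_smooth.
Context (R : realType) (d : nat) (Omega : set 'rV[R]_d) (T : R).
Hypotheses (oO : open Omega) (bO : bounded_set Omega) (T0 : 0 < T).
Local Notation vfield := ('rV[R]_d -> 'rV[R]_d).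
Let mu : {measure set 'rV[R]_d -> \bar R} := lebesgue_rV R d.
Let lam : {measure set (measurableTypeR R) -> \bar R} := @lebesgue_measure R.
Let I : set (measurableTypeR R) := `]0, T[%classic.
Let mI : measurable I := measurable_itvI T.
Local Notation wpderiv := (wpderiv Omega).
Local Notation L2v := (L2v Omega).
Local Notation H1_0v := (H1_0v Omega).
Local Notation calV := (calV Omega).
Local Notation seminorm1 := (seminorm1 Omega).
Local Notation nrm := (normL2v Omega).
Local Notation ip := (ipL2v Omega).
Local Notation wform := (wform Omega).
Local Notation L2I_L2 := (L2I_L2 Omega T).
Local Notation L2I_H1_0 := (L2I_H1_0 Omega T).
Local Notation X := (X Omega T).
Local Notation normX := (normX Omega T).
Local Notation is_wdt := (is_wdt Omega T).
Implicit Types (t : R) (u v : R -> vfield).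
Let SN0 : seminormed L2v nrm := normL2v_seminormed oO.
Let SN1 : seminormed H1_0v seminorm1 := seminorm1_seminormed oO bO.
Let SV : seminormed calV seminorm1 := seminormed_sub_on SN1 (@calV_H1_0v R d Omega) (calV_subspace oO bO).
Let sS := seminormed_sub SN0.
Let ipP : semi_inner L2v ip := ipL2v_semi_inner oO.

Lemma calV_separable : exists b : nat -> vfield, (forall n, calV (b n)) /\
  forall z, calV z -> forall e, 0 < e -> exists n, seminorm1 (z - b n) < e.
Proof. exact: (H1_0v_separable oO bO (@calV_H1_0v R d Omega) (calV_subspace oO bO)). Qed.

Lemma H1_0v_dense : exists b : nat -> vfield, (forall n, H1_0v (b n)) /\
  forall z, H1_0v z -> forall e, 0 < e -> exists n, seminorm1 (z - b n) < e.
Proof. exact: (H1_0v_separable oO bO (fun _ h => h) (H1_0v_subspace oO bO)). Qed.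

Lemma X_L2I_H1_0 u : X u -> L2I_H1_0 u.
Proof.
by apply: (L2I_sub (C := 1) SV SN1 (@calV_H1_0v R d Omega)) => e _; rewrite mul1r.
Qed.

Lemma X_seminormed : seminormed X normX.
Proof. exact: (normL2I_seminormed T SV calV_separable). Qed.

Lemma L2I_L2_subspace : subspace_on L2I_L2.
Proof. exact: (L2I_subspace T SN0 (L2v_dense oO bO)). Qed.

Lemma L2I_H1_0_subspace : subspace_on L2I_H1_0.
Proof. exact: (L2I_subspace T SN1 H1_0v_dense). Qed.

Lemma normL2I_poincare : exists2 P : R, 0 < P & forall u, L2I_H1_0 u ->
  normL2I T nrm u <= P * normL2I T seminorm1 u.
Proof.
have [P P0 hP] := poincare_vector oO bO; exists P => // u Lu.
have Lu' := L2I_H1_0_L2 oO bO Lu.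
have LN := norm2_seminormed lam mI; have Su := L2I_sqint SN1 Lu.
have E : P * normL2I T seminorm1 u = norm2 lam I (P *: (fun t => seminorm1 (u t))).
  by rewrite (seminormZ LN P Su) ger0_norm ?ltW// -normL2IE.
rewrite E normL2IE; apply: (norm2_le (subspaceZ (seminormed_sub LN) P Su) (L2I_sqint SN0 Lu').1).
move=> t It; rewrite ger0_norm ?sqrtr_ge0// -[(P *: _) t]/(P * seminorm1 (u t)) ger0_norm.
  exact: (hP _ (L2I_in Lu It)).
by rewrite mulr_ge0 ?sqrtr_ge0// ltW.
Qed.

Lemma is_wdt_lin (c : R) u v u' v' : L2I_L2 u -> L2I_L2 v -> is_wdt u u' -> is_wdt v v' ->
  is_wdt (c *: u + v) (c *: u' + v').
Proof.
move=> Lu Lv [Lu' hu] [Lv' hv]; split; first exact: (L2I_L2_lin oO bO).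
move=> theta psi Ct Lpsi.
have st := Coo_0_itv_sqint Ct; have sdt := Coo_0_itv_sqint (Coo_0_itv_derive1 Ct).
have E (h : R -> R) y z : sqint lam I h -> L2I_L2 y -> L2I_L2 z ->
    \int[lam]_(t in I) (h t * ip ((c *: y + z) t) psi) =
    c * \int[lam]_(t in I) (h t * ip (y t) psi) + \int[lam]_(t in I) (h t * ip (z t) psi).
  move=> sh Ly Lz; rewrite -(Rintegral_lin mI c (integrable_mul mI sh (sqint_ip oO Ly Lpsi))
    (integrable_mul mI sh (sqint_ip oO Lz Lpsi))).
  apply: eq_Rintegral => t /set_mem It; have Ly' := L2I_in Ly It; have Lz' := L2I_in Lz It.
  rewrite (ipDl ipP (subspaceZ sS c Ly') Lz' Lpsi) (ipZl sS ipP c Ly' Lpsi); ring.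
by rewrite (E _ _ _ sdt Lu Lv) (E _ _ _ st Lu' Lv') hu// hv// mulrN opprD.
Qed.

Variables (w : R -> vfield) (rho : R -> 'rV[R]_d -> R).
Variables (M : R) (rr : R -> 'rV[R]_d -> R) (ww : 'I_d -> R -> 'rV[R]_d -> R).
Hypotheses (M0 : 0 <= M) (hrr : bounded_weight M rr) (hww : forall j, bounded_weight M (ww j)).
Hypothesis rw : {ae lam, forall t, I t -> {ae mu, forall x, Omega x ->
  rho t x = rr t x /\ forall j, rho t x * w t x ord0 j = ww j t x}}.
Hypothesis rho_transported : transported Omega T w rho.
Local Notation mfun := (material_functional Omega T rr ww).

Lemma wformC (a : R -> 'rV[R]_d -> R) t (f v : 'rV[R]_d -> R) : wform a t f v = wform a t v f.
Proof. by apply: eq_Rintegral => x _; rewrite mulrAC. Qed.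

Lemma scaled_path (g : R -> R) f : Coo_0_itv T g -> calV f ->
  X (fun t => g t *: f) /\ is_wdt (fun t => g t *: f) (fun t => derive1 g t *: f).
Proof.
move=> Cg Vf.
have mg h : Coo_0_itv T h -> measurable_fun I (h : measurableTypeR R -> R).
  by move=> Ch; apply: measurable_funTS; exact: Coo_0_itv_measurable Ch.
have [B hB] := Coo_0_itv_bounded Cg; have Cg' := Coo_0_itv_derive1 Cg.
have [B' hB'] := Coo_0_itv_bounded Cg'.
have Lf := H1_0v_L2v Vf.1.
split.
  exact: (L2I_scale SV calV_separable (mg _ Cg) (fun t _ => hB t) (L2I_cst T SV calV_separable Vf)).
split.
  exact: (L2I_scale SN0 (L2v_dense oO bO) (mg _ Cg') (fun t _ => hB' t) (L2I_cst T SN0 (L2v_dense oO bO) Lf)).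
move=> theta psi Ct Lpsi.
have E (h k : R -> R) : Coo_0_itv T h -> Coo_0_itv T k ->
    \int[lam]_(t in I) (h t * ip (k t *: f) psi) = (\int[lam]_(t in I) (h t * k t)) * ip f psi.
  move=> Ch Ck; rewrite -(RintegralZr (ip f psi) mI (integrable_mul mI (Coo_0_itv_sqint Ch) (Coo_0_itv_sqint Ck))).
  by apply: eq_Rintegral => t _; rewrite (ipZl sS ipP _ Lf Lpsi) mulrA.
by rewrite (E _ _ (Coo_0_itv_derive1 Ct) Cg) (E _ _ Ct Cg') (Coo_0_itv_ibp T0 Ct Cg) mulNr.
Qed.

(** The transport equation for [rho], tested with the scalar products of the
    components. *)
Lemma product_rule u u' g f : L2I_H1_0 u -> is_wdt u u' -> Coo_0_itv T g -> calV f ->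
  mfun (fun t => g t *: f) (fun t => derive1 g t *: f) u + mfun u u' (fun t => g t *: f) = 0.
Proof.
move=> Lu wu Cg Vf; have [Xf wf] := scaled_path Cg Vf.
have Lf := H1_0v_L2v Vf.1; have Hf := Vf.1.
have Lu0 := L2I_H1_0_L2 oO bO Lu; have Lf1 := X_L2I_H1_0 Xf; have Lf0 := L2I_H1_0_L2 oO bO Lf1.
rewrite -(RintegralD mI); last 2 first.
  exact: (material_functional_integrable oO bO M0 hrr hww Lf1 wf.1 Lu0).
  exact: (material_functional_integrable oO bO M0 hrr hww Lu wu.1 Lf0).
have /all_and2[ih Eh] := fun i => weighted_transport oO bO M0 hrr hww rw rho_transported i Lu wu (Hf i) Cg.
have := Rintegral_sum mI (index_enum 'I_d) ih; rewrite [X in _ = X]big1 => [<-|i _]; last exact: Eh.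
apply: eq_Rintegral => s /set_mem Is.
have Ls := L2I_in Lu0 Is; have Hs := L2I_in Lu Is; have Ls' := L2I_in wu.1 Is.
rewrite (linear_onZ SN0 (derive1 g s) (density_form_linl oO hrr s Ls) Lf).
rewrite (linear_onZ SN1 (g s) (drift_form_linl oO bO hww s Ls) Hf).
rewrite (linear_onZ SN0 (g s) (density_form_linr oO hrr s Ls') Lf).
rewrite (linear_onZ SN0 (g s) (drift_form_linr oO hww s Hs) Lf).
rewrite /density_form /drift_form !mulr_sumr -!big_split; apply: eq_bigr => i _ /=.
rewrite /convection big_split/= mulrDr.
rewrite (wformC rr s (vcomp (u' s) i)).
rewrite [X in _ = _ + (g s * X + _) + _](eq_bigr _ (fun j _ => wformC (ww j) s _ _)).
by rewrite -!addrA; congr (_ + _); rewrite addrA addrC.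
Qed.

Lemma is_wdt0 : is_wdt 0 0.
Proof.
split; first exact: L2I_L2_subspace.1.
move=> theta psi _ Lpsi; have E0 : ip 0 psi = 0.
  by rewrite -(scale0r psi) (ipZl sS ipP 0 Lpsi Lpsi) mul0r.
have E h : \int[lam]_(t in I) (h t * ip ((0 : R -> vfield) t) psi) = 0.
  rewrite (_ : (fun t => _) = cst 0) ?Rintegral_cst ?mul0r//.
  by apply/funext => t; rewrite -[RHS](mulr0 (h t)) -E0.
by rewrite !E oppr0.
Qed.

Lemma material_functional0 u : L2I_L2 u -> mfun 0 0 u = 0.
Proof.
move=> Lu; have L00 := L2I_L2_subspace.1; have L10 := L2I_H1_0_subspace.1.
have := material_functional_linearl oO bO M0 hrr hww (-1) L10 L00 L10 L00 Lu.
by rewrite scaler0 addr0 mulN1r addNr.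
Qed.

(** The identity is additive in the test field, so that the products [g *: f]
    suffice. *)
Lemma D0_material phi : D0 Omega T phi -> exists phi', [/\ X phi, is_wdt phi phi' &
  forall u u', L2I_H1_0 u -> is_wdt u u' -> mfun phi phi' u + mfun u u' phi = 0].
Proof.
move=> [n [g [f [hk ->]]]].
pose P (y y' : R -> vfield) := [/\ X y, is_wdt y y' &
  forall u u', L2I_H1_0 u -> is_wdt u u' -> mfun y y' u + mfun u u' y = 0].
exists (\sum_(k < n) (fun t => derive1 (g k) t *: f k)).
rewrite (_ : (fun t => _) = \sum_(k < n) (fun t => g k t *: f k)); last first.
  exact: (sum_path (fun k t => g k t *: f k)).
have S0 := X_seminormed; have sX := seminormed_sub S0.
have PD y y' z z' : P y y' -> P z z' -> P (y + z) (y' + z').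
  move=> [Xy wy hy] [Xz wz hz].
  have Ly := X_L2I_H1_0 Xy; have Lz := X_L2I_H1_0 Xz.
  have Ly0 := L2I_H1_0_L2 oO bO Ly; have Lz0 := L2I_H1_0_L2 oO bO Lz.
  rewrite -[y]scale1r -[y']scale1r; split.
  - exact: sX.2.
  - exact: is_wdt_lin.
  - move=> u u' Lu wu; have Lu0 := L2I_H1_0_L2 oO bO Lu.
    rewrite (material_functional_linearl oO bO M0 hrr hww 1 Ly wy.1 Lz wz.1 Lu0).
    rewrite (material_functional_linear oO bO M0 hrr hww Lu wu.1 1 Ly0 Lz0).
    exact: (add_pair_eq0 (hy _ _ Lu wu) (hz _ _ Lu wu)).
have P1 k : P (fun t => g k t *: f k) (fun t => derive1 (g k) t *: f k).
  have [Cg [_ Vf]] := hk k; have [X1 w1] := scaled_path Cg Vf.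
  by split => // u u' Lu wu; exact: product_rule.
elim/big_rec2 : _ => [|k y' y _ IH]; last exact: PD.
split; [exact: sX.1|exact: is_wdt0|].
move=> u u' Lu wu; rewrite material_functional0; last exact: L2I_H1_0_L2.
by rewrite (linear_on0 (normL2I_seminormed T SN0 (L2v_dense oO bO)) (material_functional_linear oO bO M0 hrr hww Lu wu.1)) addr0.
Qed.

(** Integration by parts in time and space: on the test fields of [D0], the
    functional $-(\rho u, \dot\phi)$ is $(\rho \dot u, \phi)$. The latter is
    bounded on [X] by the Poincare inequality, and [D0] is dense, so that it is
    the extension. *)
Lemma rhodot_smooth u u' : D0_dense Omega T -> X u -> is_wdt u u' ->
  [/\ is_rhodot Omega T w rho u (mfun u u'),
      W Omega T w rho u &
      forall v, X v -> rhodot Omega T w rho u v = mfun u u' v].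
Proof.
move=> dD Xu wu; have Lu := X_L2I_H1_0 Xu; have [P P0 hP] := normL2I_poincare.
have Lu0 := L2I_H1_0_L2 oO bO Lu.
have bm : bounded_functional X normX (mfun u u').
  split.
    move=> c v v' Xv Xv'; apply: (material_functional_linear oO bO M0 hrr hww Lu wu.1);
      apply: (L2I_H1_0_L2 oO bO); exact: X_L2I_H1_0.
  have [C C0 hC] := material_functional_bound oO bO M0 hrr hww Lu wu.1.
  exists (C * P) => v Xv; have Lv := X_L2I_H1_0 Xv.
  apply: le_trans (hC _ (L2I_H1_0_L2 oO bO Lv)) _; rewrite -mulrA ler_wpM2l//.
  exact: hP.
have dE phi : D0 Omega T phi -> mfun u u' phi = - ipQ Omega T (rhomul rho u) (mdot Omega T w phi).
  move=> /D0_material[phi' [Xphi wphi h]].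
  have -> : ipQ Omega T (rhomul rho u) (mdot Omega T w phi) =
      ipQ Omega T (rhomul rho (mdot Omega T w phi)) u.
    apply: eq_Rintegral => t _; apply: eq_Rintegral => x _; apply: eq_bigr => i _.
    by rewrite /rhomul !mxE mulrAC.
  rewrite (ipQ_mdot oO bO M0 hrr hww rw (X_L2I_H1_0 Xphi) wphi Lu0).
  by apply/eqP; rewrite -addr_eq0 addrC; apply/eqP; exact: h.
have rd : is_rhodot Omega T w rho u (mfun u u') by split.
split => //; first by split => //; exists (mfun u u').
have [b1 d1] : is_rhodot Omega T w rho u (rhodot Omega T w rho u) by apply: xgetPex; exists (mfun u u').
have DX : D0 Omega T `<=` X by move=> phi /D0_material[phi' []].
have dX v : X v -> forall e, 0 < e -> exists2 phi, D0 Omega T phi & normX (v - phi) < e.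
  by move=> Xv e e0; have [phi [h1 h2]] := dD v Xv e e0; exists phi.
have E0 phi : D0 Omega T phi -> rhodot Omega T w rho u phi = mfun u u' phi.
  by move=> Dphi; rewrite (d1 _ Dphi) (dE _ Dphi).
exact: (bounded_functional_eq X_seminormed DX dX b1 bm E0).
Qed.

End rhodot_of_smooth.

(** * Families of functionals depending on time *)

Section almost_every_time.
Context (R : realType) (T : R).
Let lam : {measure set (measurableTypeR R) -> \bar R} := @lebesgue_measure R.
Let I : set (measurableTypeR R) := `]0, T[%classic.
Let mI : measurable I := measurable_itvI T.

Lemma good_times (P : R -> Prop) : {ae lam, forall t, I t -> P t} ->
  exists G : set (measurableTypeR R),
    [/\ measurable G, {ae lam, forall t, G t} & forall t, I t -> G t -> P t].
Proof.
move=> [N [mN N0 sN]]; exists (~` N); split; first exact: measurableC.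
  by exists N; split => // t /= /contrapT.
move=> t It nN; apply: contrapT => nP; apply: nN; apply: sN => /= h; exact: nP (h It).
Qed.

(** The test function is the sign of [h]. *)
Lemma ae_eq0_bounded_test (h : R -> R) : lam.-integrable I (EFin \o h) ->
  (forall theta : R -> R, measurable_fun I (theta : measurableTypeR R -> R) ->
     (forall t, I t -> `|theta t| <= 1) -> \int[lam]_(t in I) (theta t * h t) = 0) ->
  {ae lam, forall t, I t -> h t = 0}.
Proof.
move=> ih hth; have mh := integrable_measurable ih.
pose A : set (measurableTypeR R) := I `&` (h : measurableTypeR R -> measurableTypeR R) @^-1` `]-oo, 0[%classic.
have mA : measurable A by apply: mh => //; exact: measurable_itv.
pose theta (t : R) : R := 1 - 2 * \1_A t.
have mth : measurable_fun I (theta : measurableTypeR R -> R).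
  apply: measurable_funB => //; apply: measurable_funM => //; exact: measurable_indic.
have th t : I t -> theta t * h t = `|h t| /\ `|theta t| <= 1.
  move=> It; rewrite /theta indicE.
  have -> : (t \in A) = (h t < 0).
    apply/idP/idP; first by move=> /set_mem[_]; rewrite /= in_itv.
    by move=> ht; apply/mem_set; split => //=; rewrite in_itv.
  case: (ltP (h t) 0) => ht.
    by rewrite mulr1 ltr0_norm//; split; [ring|rewrite ler_norml; lra].
  by rewrite mulr0 subr0 mul1r ger0_norm// normr1.
have := hth theta mth (fun t It => (th t It).2).
have -> : \int[lam]_(t in I) (theta t * h t) = \int[lam]_(t in I) `|h t|.
  by apply: eq_Rintegral => t /set_mem It; exact: (th t It).1.
have ia : lam.-integrable I (EFin \o (fun t => `|h t|)) by exact: integrable_norm.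
move=> h0; have := Rintegral_eq0_ae mI ia (fun t _ => normr_ge0 _) h0.
by apply: ae_imp => t ht It; apply/eqP; rewrite -normr_eq0 ht.
Qed.

End almost_every_time.

Section dual_families.
Context (R : realType) (T : R) (E : lmodType R) (S : set E) (N : E -> R) (b : nat -> E).
Hypotheses (SN : seminormed S N) (Sb : forall n, S (b n))
  (db : forall e, S e -> forall r, 0 < r -> exists n, N (e - b n) < r).
Let lam : {measure set (measurableTypeR R) -> \bar R} := @lebesgue_measure R.
Let I : set (measurableTypeR R) := `]0, T[%classic.
Let mI : measurable I := measurable_itvI T.
Local Notation bounded_functional := (bounded_functional S N).
Local Notation dual_norm := (dual_norm S N).

Definition dual_family (l : R -> E -> R) := (forall t, I t -> bounded_functional (l t)) /\
  forall n, measurable_fun I (fun t : measurableTypeR R => l t (b n) : R).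

Lemma measurable_dual_family l e : dual_family l -> S e ->
  measurable_fun I (fun t : measurableTypeR R => l t e : R).
Proof.
move=> [bl ml] Se.
have /choice[k hk] : forall j : nat, exists n, N (e - b n) < j.+1%:R^-1.
  by move=> j; apply: db => //; rewrite invr_gt0.
apply: (@measurable_fun_cvg _ _ _ _ (fun j t => l t (b (k j)))); first by move=> j; exact: ml.
move=> t It; apply: (lipschitz_cvg SN (C := dual_norm (l t)) (e_ := fun j => b (k j))) => //.
  by move=> f g Sf Sg; exact: (bounded_functional_continuous SN (bl t It) Sf Sg).
apply/cvg_seqP => r r0; have [n0 hn0] := exists_natSinv_lt r0; exists n0 => n nn.
rewrite subr0 ger0_norm ?(seminorm_ge0 SN)// (seminormBC SN)//.
apply: lt_le_trans (hk n) _; apply: le_trans (ltW hn0).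
by rewrite lef_pV2 ?posrE// ler_nat ltnS.
Qed.

(** The set of times where the norm exceeds [r] is a countable union over a
    dense sequence. *)
Lemma measurable_dual_norm l : dual_family l ->
  measurable_fun I (fun t : measurableTypeR R => dual_norm (l t) : R).
Proof.
move=> [bl ml]; apply: (measurability _ (RGenOInfty.measurableE R)) => _ [_ [r ->] <-].
have [r0|r0] := leP 0 r; last first.
  rewrite (_ : _ `&` _ = I)//; apply/seteqP; split => [t []//|t It]; split => //=.
  by rewrite in_itv/= andbT (lt_le_trans r0)// (dual_norm_nneg SN).
rewrite (_ : _ `&` _ = \bigcup_n (I `&` (fun t : measurableTypeR R => `|l t (b n)| : measurableTypeR R) @^-1`
    `]r * N (b n), +oo[%classic)).
  apply: bigcup_measurable => n _.
  have mabs : measurable_fun setT (fun r : measurableTypeR R => `|r : R| : measurableTypeR R).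
    by apply: continuous_measurable; exact: norm_continuous.
  exact: (measurableT_comp mabs (ml n) mI (measurable_itv _)).
apply/seteqP; split => t /=.
  move=> [It]; rewrite in_itv/= andbT => rt; apply: contrapT => h.
  have := (dual_norm_le_dense SN Sb db (bl t It) r0).2.
  rewrite leNgt rt => /(_ _)/negP; apply => // n; rewrite leNgt; apply/negP => hn.
  by apply: h; exists n => //; split => //=; rewrite in_itv/= andbT.
move=> [n _ [It]]; rewrite /= !in_itv/= !andbT => hn; split => //.
rewrite ltNge; apply/negP => /(dual_norm_le_dense SN Sb db (bl t It) r0).1/(_ n).
by rewrite leNgt hn.
Qed.

Lemma dual_family_path l v : dual_family l -> L2I T S N v ->
  measurable_fun I (fun t : measurableTypeR R => l t (v t) : R).
Proof.
move=> hl Lv; apply: (L2I_caratheodory (Phi := l) (pr := id) SN _ _ _ _ _ Lv) => //.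
  by move=> e Se; exact: measurable_dual_family.
move=> t It; exists (dual_norm (l t)) => e f Se Sf.
exact: (bounded_functional_continuous SN (hl.1 t It) Se Sf).
Qed.

Lemma dual_family_integrable l v (beta : R -> R) : dual_family l ->
  sqint lam I beta -> (forall t, I t -> dual_norm (l t) <= beta t) ->
  L2I T S N v -> lam.-integrable I (EFin \o (fun t => l t (v t))).
Proof.
move=> hl Lb lb Lv; apply: (integrable_le mI (integrable_mul mI Lb (L2I_sqint SN Lv))).
  exact: dual_family_path.
move=> t It; have Sv := L2I_in Lv It; apply: le_trans (le_dual_norm SN (hl.1 t It) Sv) _.
by rewrite ler_wpM2r ?(seminorm_ge0 SN)// lb.
Qed.

Lemma dual_family_restrict l (G : set (measurableTypeR R)) : measurable G -> dual_family l ->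
  dual_family (fun t => if t \in G then l t else 0).
Proof.
move=> mG [bl ml]; split.
  move=> t It; case: ifP => _; first exact: bl.
  exact: (bounded_functional_subspace S N).1.
move=> n; have mx : measurable_fun I (fun t : measurableTypeR R => (\1_G t : R) * l t (b n) : R).
  by apply: measurable_funM; [exact: measurable_indic|exact: ml].
apply: eq_measurable_fun mx => t _; rewrite indicE; case: ifP => _; rewrite ?mul1r ?mul0r//.
Qed.

(** The exceptional null sets of countably many points have a null union, on
    which the functionals are replaced by zero. *)
Lemma measurable_modification l : (forall t, I t -> bounded_functional (l t)) ->
  (forall n, exists2 m : R -> R, measurable_fun I (m : measurableTypeR R -> R) &
     {ae lam, forall t, I t -> l t (b n) = m t}) ->
  exists G : set (measurableTypeR R), [/\ measurable G, {ae lam, forall t, G t} &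
    dual_family (fun t => if t \in G then l t else 0)].
Proof.
move=> bl hl; have /choice[m hm0] : forall n, exists m : R -> R, measurable_fun I (m : measurableTypeR R -> R) /\
    {ae lam, forall t, I t -> l t (b n) = m t} by move=> n; have [m ? ?] := hl n; exists m.
have mm n := (hm0 n).1; have hm n := (hm0 n).2.
have h : {ae lam, forall t, I t -> forall n, l t (b n) = m n t}.
  by have := ae_foralln hm; apply: ae_imp => t ht It n; exact: ht.
have [G [mG aG hG]] := good_times h; exists G; split => //; split.
  move=> t It; case: ifP => _; first exact: bl.
  exact: (bounded_functional_subspace S N).1.
move=> n; have mx : measurable_fun I (fun t : measurableTypeR R => (\1_G t : R) * m n t : R).
  by apply: measurable_funM; [exact: measurable_indic|exact: mm].
apply: eq_measurable_fun mx => t /set_mem It; rewrite indicE; case: ifP => tG; rewrite ?mul1r ?mul0r//.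
by rewrite hG//; exact: set_mem.
Qed.

End dual_families.

(** * Recovering the pressure *)

Lemma dual_norm_ext (R : realType) (E : lmodType R) (S : set E) (N : E -> R) (l l' : E -> R) :
  (forall v, S v -> l v = l' v) -> dual_norm S N l = dual_norm S N l'.
Proof.
move=> ll'; congr sup; apply/seteqP; split => _ [v [Sv Nv] <-]; exists v => //.
  by rewrite ll'.
by rewrite ll'.
Qed.

Section pressure.
Context (R : realType) (d : nat) (Omega : set 'rV[R]_d) (T : R).
Hypotheses (oO : open Omega) (bO : bounded_set Omega) (derham : de_rham Omega).
Local Notation vfield := ('rV[R]_d -> 'rV[R]_d).
Let mu : {measure set 'rV[R]_d -> \bar R} := lebesgue_rV R d.
Let mD : measurable Omega := measurable_domain oO.
Let lam : {measure set (measurableTypeR R) -> \bar R} := @lebesgue_measure R.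
Let I : set (measurableTypeR R) := `]0, T[%classic.
Let mI : measurable I := measurable_itvI T.
Local Notation norm2 := (norm2 mu Omega).
Local Notation H1_0v := (H1_0v Omega).
Local Notation calV := (calV Omega).
Local Notation seminorm1 := (seminorm1 Omega).
Local Notation L2_0 := (L2_0 Omega).
Local Notation Hm1 := (Hm1 Omega).
Local Notation normHm1 := (normHm1 Omega).
Local Notation weak_gradient := (weak_gradient Omega).
Implicit Types (t : R) (p q : 'rV[R]_d -> R) (v : vfield).
Let SN1 : seminormed H1_0v seminorm1 := seminorm1_seminormed oO bO.
Let SV : seminormed calV seminorm1 := seminormed_sub_on SN1 (@calV_H1_0v R d Omega) (calV_subspace oO bO).
Let SH := dual_norm_seminormed SN1.
Let sH := seminormed_sub SH.
Let ipP := ipD_semi_inner mu mD.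
Let sS := sqint_subspace mu mD.

Lemma weak_gradient_lin c p q v : L2_0 p -> L2_0 q -> H1_0v v ->
  weak_gradient (c *: p + q) v = c * weak_gradient p v + weak_gradient q v.
Proof.
move=> [Lp _] [Lq _] Hv; have Ld := sqint_divergence oO Hv.
have E : ipL2 Omega (c *: p + q) (divergence Omega v) =
    c * ipL2 Omega p (divergence Omega v) + ipL2 Omega q (divergence Omega v).
  rewrite -(ipZl sS ipP c Lp Ld); exact: (ipDl ipP (subspaceZ sS c Lp) Lq Ld).
by rewrite /weak_gradient E opprD mulrN.
Qed.

(** By de Rham an equivalent norm on [L2_0]. Along a path of pressures it only
    depends on the functionals that the pressures represent, hence is
    measurable in time. *)
Definition gradient_norm p : R := normHm1 (weak_gradient p).

Lemma gradient_norm_lin c p q : L2_0 p -> L2_0 q ->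
  gradient_norm (c *: p + q) = normHm1 (c *: weak_gradient p + weak_gradient q).
Proof. by move=> Lp Lq; apply: dual_norm_ext => v Hv; exact: weak_gradient_lin. Qed.

Lemma gradient_norm_seminormed : seminormed L2_0 gradient_norm.
Proof.
have s0 := L2_0_subspace oO bO; have [hm _ _] := derham.
have n0 : gradient_norm 0 = 0.
  have := gradient_norm_lin (-1) s0.1 s0.1; rewrite scaler0 addr0 scaleN1r addNr => ->.
  exact: (seminorm0 SH).
split => //.
- move=> c p Lp; have := gradient_norm_lin c Lp s0.1; rewrite addr0 => ->.
  rewrite -(seminormZ SH c (hm p Lp).1); apply: dual_norm_ext => v Hv.
  have := weak_gradient_lin (-1) s0.1 s0.1 Hv; rewrite scaler0 addr0 mulN1r addNr => E0.
  by rewrite -[LHS]/(c * weak_gradient p v + weak_gradient 0 v) E0 addr0.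
- move=> p q Lp Lq; have := gradient_norm_lin 1 Lp Lq; rewrite !scale1r => ->.
  exact: (seminormD SH (hm p Lp).1 (hm q Lq).1).
- by move=> p; exact: (seminorm_ge0 SH).
Qed.

Lemma gradient_norm_separable : exists b : nat -> 'rV[R]_d -> R, (forall n, L2_0 (b n)) /\
    forall p, L2_0 p -> forall e, 0 < e -> exists n, gradient_norm (p - b n) < e.
Proof.
have [b [Lb db]] := L2_0_separable oO bO; have [_ _ [c [C [c0 C0 h]]]] := derham.
exists b; split => // p Lp e e0; have [n hn] := db p Lp (e / C) ltac:(by rewrite divr_gt0).
exists n; have /h/andP[_ h2] := subspaceB (L2_0_subspace oO bO) Lp (Lb n).
apply: le_lt_trans h2 _; move: hn; rewrite ltr_pdivlMr// mulrC; exact.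
Qed.

(** Tested with [theta t *: e n], for [e] dense in [calV] and [theta] the sign
    of [l t (e n)], the hypothesis makes [l t] vanish on [calV] for almost
    every [t]; de Rham's theorem then provides [p t] for each of these times,
    and Pettis' criterion the measurability of [p]. *)
Lemma pressure_exists (l : R -> vfield -> R) (beta : R -> R) :
  (forall t, I t -> Hm1 (l t)) -> sqint lam I beta ->
  (forall t, I t -> normHm1 (l t) <= beta t) ->
  (forall e, H1_0v e -> exists2 m : R -> R, measurable_fun I (m : measurableTypeR R -> R) &
     {ae lam, forall t, I t -> l t e = m t}) ->
  (forall v : R -> vfield, X Omega T v -> \int[lam]_(t in I) l t (v t) = 0) ->
  exists2 p, L2I_L2_0 Omega T p &
    {ae lam, forall t, I t -> forall v, H1_0v v -> l t v = weak_gradient (p t) v}.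
Proof.
move=> bl Lbeta lbeta ml lX; have [b [Sb db]] := H1_0v_dense oO bO.
have [hm1 hm2 [c [C [c0 C0 hc]]]] := derham.
have [G [mG aG hG]] := measurable_modification bl (fun n => ml (b n) (Sb n)).
set l1 := (fun t => _) in hG.
have beta0 t : I t -> 0 <= beta t.
  by move=> It; apply: le_trans (lbeta t It); exact: (seminorm_ge0 SH).
have nres (H : set (measurableTypeR R)) (k : R -> vfield -> R) :
    (forall t, I t -> normHm1 (k t) <= beta t) ->
    forall t, I t -> normHm1 (if t \in H then k t else 0) <= beta t.
  move=> hk t It; case: ifP => _; first exact: hk.
  by apply: le_trans (beta0 t It); rewrite le_eqVlt; apply/orP; left; apply/eqP; exact: (seminorm0 SH).
have l1beta := nres G l lbeta.
have l1l : {ae lam, forall t, I t -> l t = l1 t}.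
  by apply: ae_imp aG => t Gt _; rewrite /l1 mem_set.
have [e [Ve de]] := calV_separable oO bO.
have l1e n : {ae lam, forall t, I t -> l1 t (e n) = 0}.
  have Xe := L2I_cst T SV (calV_separable oO bO) (Ve n).
  apply: ae_eq0_bounded_test.
    exact: (dual_family_integrable SN1 Sb db hG Lbeta l1beta (X_L2I_H1_0 oO bO Xe)).
  move=> theta mth th1.
  have Xv := L2I_scale SV (calV_separable oO bO) mth th1 Xe.
  rewrite -[RHS](lX _ Xv); apply/esym.
  have mp := dual_family_path SN1 Sb db hG (X_L2I_H1_0 oO bO Xv).
  have -> : \int[lam]_(t in I) (theta t * l1 t (e n)) = \int[lam]_(t in I) l1 t (theta t *: e n).
    apply: eq_Rintegral => t /set_mem It.
    by rewrite (linear_onZ SN1 _ (hG.1 t It).1 (Ve n).1).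
  by apply: (ae_eq_Rintegral mI mp); apply: ae_imp l1l => t h It; rewrite h.
have h1 : {ae lam, forall t, I t -> forall n, l1 t (e n) = 0}.
  by have := ae_foralln l1e; apply: ae_imp => t ht It n; exact: ht.
have [G2 [mG2 aG2 hG2]] := good_times h1.
pose l2 t := if t \in G2 then l1 t else 0.
have dl2 : dual_family T H1_0v seminorm1 b l2 := dual_family_restrict mG2 hG.
have l2V t v : I t -> calV v -> l2 t v = 0.
  move=> It Vv; rewrite /l2; case: ifP => [tG2|//].
  have [ll [K hK]] := hG.1 t It.
  have bV : bounded_functional calV seminorm1 (l1 t).
    split; last by exists K => u [Hu _]; exact: hK.
    by move=> a u u' [Hu _] [Hu' _]; exact: ll.
  have bV0 : bounded_functional calV seminorm1 (fun=> 0).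
    by split; [move=> a u u' _ _; rewrite mulr0 addr0|exists 0 => u _; rewrite normr0 mul0r].
  apply: (bounded_functional_eq SV (D := range e) _ _ bV bV0 _ Vv).
  - by move=> _ [n _ <-]; exact: Ve.
  - by move=> u Vu r r0; have [n hn] := de u Vu r r0; exists (e n) => //; exists n.
  - by move=> _ [n _ <-]; apply: hG2 => //; exact: set_mem.
have /choice[p hp] : forall t, exists p, I t -> L2_0 p /\ forall v, H1_0v v -> l2 t v = weak_gradient p v.
  move=> t; have [It|nI] := pselect (I t); last by exists 0.
  by have [p Lp hp] := hm2 _ (dl2.1 t It) (fun v Vv => l2V t v It Vv); exists p.
exists p; last first.
  apply: ae_imp2 aG aG2 => t Gt G2t It v Hv; rewrite -(hp t It).2//.
  by rewrite /l2 /l1 !mem_set.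
have sL0 : seminormed L2_0 norm2 := seminormed_sub_on (norm2_seminormed mu mD)
  (fun p (Lp : L2_0 p) => Lp.1) (L2_0_subspace oO bO).
have Lp : L2I T L2_0 gradient_norm p.
  apply: (L2I_pettis gradient_norm_seminormed gradient_norm_separable (h := beta) _ _ Lbeta).
  - by move=> t It; exact: (hp t It).1.
  - move=> q Lq; pose l3 t := l2 t - weak_gradient q.
    have dl3 : dual_family T H1_0v seminorm1 b l3.
      split; first by move=> t It; exact: (subspaceB sH (dl2.1 t It) (hm1 q Lq).1).
      by move=> n; apply: measurable_funB => //; exact: dl2.2.
    apply: eq_measurable_fun (measurable_dual_norm SN1 Sb db dl3) => t /set_mem It.
    have [Lpt Ept] := hp t It.
    apply: dual_norm_ext => v Hv.
    have := weak_gradient_lin (-1) Lq Lpt Hv; rewrite scaleN1r addrC mulN1r => ->.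
    by rewrite -Ept// addrC.
  - move=> t It; have [Lpt Ept] := hp t It.
    rewrite /gradient_norm (_ : normHm1 _ = normHm1 (l2 t)); first exact: (nres G2 l1 l1beta).
    by apply: dual_norm_ext => v Hv; rewrite Ept.
apply: (L2I_sub (C := c^-1) gradient_norm_seminormed sL0 _ _ Lp) => // q Lq.
by have /andP[h _] := hc q Lq; rewrite mulrC ler_pdivlMr// mulrC.
Qed.

(** The difference of the pressures has weak gradient zero on a dense sequence
    of fields, for almost every time. *)
Lemma pressure_unique (p q : R -> 'rV[R]_d -> R) : L2I_L2_0 Omega T p -> L2I_L2_0 Omega T q ->
  (forall v : R -> vfield, L2I_H1_0 Omega T v ->
    \int[lam]_(t in I) ipL2 Omega (p t) (divergence Omega (v t)) =
    \int[lam]_(t in I) ipL2 Omega (q t) (divergence Omega (v t))) ->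
  eqQ Omega T p q.
Proof.
move=> Lp Lq pq; have [b [Sb db]] := H1_0v_dense oO bO.
have fI := lebesgue_itvI_lty T.
have [hm1 hm2 [c [C [c0 C0 hc]]]] := derham.
have sL0 : seminormed L2_0 norm2 := seminormed_sub_on (norm2_seminormed mu mD)
  (fun p (Lp : L2_0 p) => Lp.1) (L2_0_subspace oO bO).
have Lpq : L2I_L2_0 Omega T (p - q).
  have := L2I_lin sL0 (L2_0_separable oO bO) (-1) Lq Lp.
  by rewrite scaleN1r addrC.
have ih n (theta : R -> R) y : sqint lam I theta -> L2I_L2_0 Omega T y ->
    lam.-integrable I (EFin \o (fun t => theta t * ipL2 Omega (y t) (divergence Omega (b n)))).
  move=> sth Ly; have Ld := sqint_divergence oO (Sb n).
  apply: (integrable_functional_path (b := fun t f => ipL2 Omega f (divergence Omega (b n)))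
    (K := norm2 (divergence Omega (b n))) sL0 _ _ _ sth Ly).
  - by move=> f _; exact: measurable_cst.
  - move=> t _ a f f' [Lf _] [Lf' _].
    have := ipDl ipP (subspaceZ sS a Lf) Lf' Ld; rewrite (ipZl sS ipP a Lf Ld); exact.
  - by move=> t f _ [Lf _]; rewrite mulrC; exact: (CauchySchwarz_L2 mD Lf Ld).
have h n : {ae lam, forall t, I t -> ipL2 Omega ((p - q) t) (divergence Omega (b n)) = 0}.
  apply: ae_eq0_bounded_test.
    have := ih n (cst 1) _ (sqint_cst mI fI 1) Lpq.
    by congr (_.-integrable _ _); apply/funext => t /=; rewrite mul1r.
  move=> theta mth th1; have sth : sqint lam I theta := sqint_bounded mI fI mth th1.
  have Lv := L2I_scale SN1 (H1_0v_dense oO bO) mth th1 (L2I_cst T SN1 (H1_0v_dense oO bO) (Sb n)).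
  have dE (y : R -> 'rV[R]_d -> R) t : L2I_L2_0 Omega T y -> I t ->
      ipL2 Omega (y t) (divergence Omega (theta t *: b n)) = theta t * ipL2 Omega (y t) (divergence Omega (b n)).
    move=> Ly It; have Lyt := (L2I_in Ly It).1.
    apply: (linear_onZ SN1 (l := fun v => ipL2 Omega (y t) (divergence Omega v)) _ _ (Sb n)).
    by move=> a u u' Hu Hu'; exact: (ipL2_divergence_lin oO bO a Lyt Hu Hu').
  have E := pq _ Lv.
  have := RintegralB mI (ih n theta p sth Lp) (ih n theta q sth Lq).
  rewrite (_ : \int[lam]_(t in I) (theta t * ipL2 Omega (p t) (divergence Omega (b n))) =
    \int[lam]_(t in I) ipL2 Omega (p t) (divergence Omega (theta t *: b n))); last first.
    by apply: eq_Rintegral => t /set_mem It; rewrite dE.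
  rewrite E (_ : \int[lam]_(t in I) (theta t * ipL2 Omega (q t) (divergence Omega (b n))) =
    \int[lam]_(t in I) ipL2 Omega (q t) (divergence Omega (theta t *: b n))); last first.
    by apply: eq_Rintegral => t /set_mem It; rewrite dE.
  rewrite subrr => E0; rewrite -[RHS]E0; apply: eq_Rintegral => t /set_mem It; rewrite -mulrBr; congr (_ * _).
  exact: (ipBl sS ipP (L2I_in Lp It).1 (L2I_in Lq It).1 (sqint_divergence oO (Sb n))).
rewrite /eqQ; apply: ae_imp (ae_foralln h) => t ht It.
have Lt := L2I_in Lpq It.
have g0 : gradient_norm ((p - q) t) <= 0.
  apply: (dual_norm_le_dense SN1 Sb db (hm1 _ Lt).1 (lexx 0)).2 => n.
  by rewrite mul0r normrN ht// normr0.
have : norm2 ((p - q) t) = 0.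
  have /andP[h1 _] := hc _ Lt; apply: le_anti; rewrite sqrtr_ge0 andbT.
  by rewrite -(pmulr_rle0 _ c0); exact: le_trans h1 g0.
move=> /(norm2_eq0_ae mD Lt.1); apply: ae_imp => x h0 Ox.
by have := h0 Ox; rewrite !fctE => /eqP; rewrite subr_eq0 => /eqP.
Qed.

End pressure.

(** * Fields that agree almost everywhere *)

Lemma subrACA (V : zmodType) (a b c e : V) : a - b - (c - e) = a - c - (b - e).
Proof. by rewrite !opprB addrACA [- b - c]addrC addrACA. Qed.

(** Membership in a Bochner space is required at every time: this restores it
    for a path that lies in [S'] at almost every time only. *)
Lemma L2I_restrict (R : realType) (T : R) (E : lmodType R) (S S' : set E) (N : E -> R)
    (G : set (measurableTypeR R)) (u : R -> E) :
  seminormed S N -> S' `<=` S -> seminormed S' N ->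
  (exists c : nat -> E, (forall n, S' (c n)) /\
    forall e, S' e -> forall r, 0 < r -> exists n, N (e - c n) < r) ->
  measurable G -> (forall t, `]0, T[%classic t -> G t -> S' (u t)) ->
  L2I T S N u -> L2I T S' N (fun t => if t \in G then u t else 0).
Proof.
move=> SN SS' SN' sep mG uS' Lu; have sS' := seminormed_sub SN'.
set I : set (measurableTypeR R) := `]0, T[%classic in uS' *.
have mI : measurable I := measurable_itvI T.
apply: (L2I_pettis SN' sep (h := fun t => N (u t))).
- by move=> t It; case: ifP => [/set_mem Gt|_]; [exact: uS'|exact: sS'.1].
- move=> e Se; have mu := measurable_norm SN (fun t => L2I_in Lu (t := t)) (L2I_strong Lu) (SS' _ Se).
  have mx : measurable_fun I (fun t : measurableTypeR R => (\1_G t : R) * N (u t - e) + (1 - \1_G t) * N (- e) : R).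
    apply: measurable_funD; apply: measurable_funM.
    - exact: measurable_indic.
    - exact: mu.
    - by apply: measurable_funB; [exact: measurable_cst|exact: measurable_indic].
    - exact: measurable_cst.
  apply: eq_measurable_fun mx => t _; rewrite indicE; case: ifP => _.
    by rewrite mul1r subrr mul0r addr0.
  by rewrite mul0r subr0 mul1r add0r sub0r.
- exact: (L2I_sqint SN Lu).
- move=> t It; case: ifP => _ //; rewrite (seminorm0 SN); exact: (seminorm_ge0 SN).
Qed.

Section almost_everywhere_fields.
Context (R : realType) (d : nat) (Omega : set 'rV[R]_d) (T : R).
Hypotheses (oO : open Omega) (bO : bounded_set Omega).
Local Notation vfield := ('rV[R]_d -> 'rV[R]_d).
Let mu : {measure set 'rV[R]_d -> \bar R} := lebesgue_rV R d.
Let mD : measurable Omega := measurable_domain oO.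
Let lam : {measure set (measurableTypeR R) -> \bar R} := @lebesgue_measure R.
Let I : set (measurableTypeR R) := `]0, T[%classic.
Let mI : measurable I := measurable_itvI T.
Local Notation sqint := (sqint mu Omega).
Local Notation norm2 := (norm2 mu Omega).
Local Notation L2v := (L2v Omega).
Local Notation H1_0v := (H1_0v Omega).
Local Notation calV := (calV Omega).
Local Notation seminorm1 := (seminorm1 Omega).
Local Notation divergence := (divergence Omega).
Local Notation nrm := (normL2v Omega).
Implicit Types (t : R) (u v : R -> vfield) (z e : vfield).
Let SN0 : seminormed L2v nrm := normL2v_seminormed oO.
Let SN1 : seminormed H1_0v seminorm1 := seminorm1_seminormed oO bO.
Let sS0 := sqint_subspace mu mD.

Lemma wpderiv_ae0 i f : H1 Omega f -> {ae mu, forall x, Omega x -> f x = 0} ->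
  norm2 (wpderiv Omega i f) = 0.
Proof.
move=> Hf f0; have L0 := sqint0 mu Omega.
have w0 : is_wpderiv Omega i f 0.
  split => // phi Cphi; have Lp := Coo_0_sqint oO bO (Coo_0_pderiv i Cphi).
  have E0 : ipL2 Omega 0 (pderiv i phi) = 0.
    rewrite /ipL2 (_ : (fun x => _) = cst 0) ?Rintegral_cst ?mul0r//.
    by apply/funext => x; rewrite mul0r.
  have E1 : ipL2 Omega 0 phi = 0.
    rewrite /ipL2 (_ : (fun x => _) = cst 0) ?Rintegral_cst ?mul0r//.
    by apply/funext => x; rewrite mul0r.
  rewrite E1 oppr0 -[RHS]E0; apply: (ipD_ae mD L0 Lp f0); exact: aeW.
rewrite (norm2_ae mD L0 (is_wpderiv_unique oO bO (wpderivP i Hf) w0)).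
exact: (seminorm0 (norm2_seminormed mu mD)).
Qed.

Lemma seminorm1_ae0 z : H1_0v z -> {ae mu, forall x, Omega x -> z x = 0} -> seminorm1 z = 0.
Proof.
move=> Hz z0; rewrite /seminorm1 big1 ?sqrtr0// => i _; rewrite big1// => j _.
have -> : normL2 Omega (wpderiv Omega j (vcomp z i)) = 0.
  apply: wpderiv_ae0; first exact: (Hz i).1.
  by apply: ae_imp z0 => x h Ox; rewrite /vcomp h// mxE.
by rewrite expr0n.
Qed.

Lemma CL2_sub u v : CL2 Omega T u -> CL2 Omega T v -> CL2 Omega T (u - v).
Proof.
move=> [Lu cu] [Lv cv]; have sS := seminormed_sub SN0.
have Luv t : t \in `[0, T] -> L2v ((u - v) t).
  by move=> tT; apply: (subspaceB sS); [exact: Lu|exact: Lv].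
split => // t tT e e0; have e2 : 0 < e / 2 by rewrite divr_gt0.
have [d1 d10 h1] := cu t tT _ e2; have [d2 d20 h2] := cv t tT _ e2.
exists (Num.min d1 d2); first by rewrite lt_min d10.
move=> s sT; rewrite lt_min => /andP[s1 s2].
have -> : (u - v) s - (u - v) t = (u s - u t) - (v s - v t).
  exact: subrACA.
apply: le_lt_trans (seminormB SN0 (subspaceB sS (Lu s sT) (Lu t tT)) (subspaceB sS (Lv s sT) (Lv t tT))) _.
by rewrite [e]splitr; exact: (ltrD (h1 s sT s1) (h2 s sT s2)).
Qed.

Lemma L2I_divergence u : L2I_H1_0 Omega T u -> L2I_L2_0 Omega T (fun t => divergence (u t)).
Proof.
move=> Lu; have sL0 : seminormed (L2_0 Omega) norm2 := seminormed_sub_on (norm2_seminormed mu mD)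
  (fun p (Lp : L2_0 Omega p) => Lp.1) (L2_0_subspace oO bO).
apply: (L2I_pettis sL0 (L2_0_separable oO bO) (h := fun t => d%:R * seminorm1 (u t))).
- by move=> t It; apply: divergence_L2_0 => //; exact: (L2I_in Lu It).
- move=> q [Lq _]; apply: (L2I_caratheodory (Phi := fun _ z => norm2 (divergence z - q)) (pr := id) SN1 _ _ _ _ _ Lu) => //.
  move=> t It; exists d%:R => z z' Hz Hz'.
  have Lz := sqint_divergence oO Hz; have Lz' := sqint_divergence oO Hz'.
  have Hzz := subspaceB (H1_0v_subspace oO bO) Hz Hz'.
  have nS := norm2_seminormed mu mD.
  apply: le_trans (seminorm_dist nS (subspaceB sS0 Lz Lq) (subspaceB sS0 Lz' Lq)) _.
  rewrite opprB addrA subrK; apply: le_trans (norm2_divergence oO Hzz).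
  rewrite le_eqVlt; apply/orP; left; apply/eqP; apply: (norm2_ae mD (sqint_divergence oO Hzz)).
  have := divergence_lin oO bO (-1) Hz' Hz; rewrite scaleN1r [- z' + z]addrC.
  by apply: ae_imp => x h Ox; rewrite h// scaleN1r addrC.
- exact: (subspaceZ (sqint_subspace lam mI) _ (L2I_sqint SN1 Lu)).
- move=> t It; exact: (norm2_divergence oO (L2I_in Lu It)).
Qed.

Lemma ipL2_divergence_path (p : R -> 'rV[R]_d -> R) v : L2I_L2_0 Omega T p -> L2I_H1_0 Omega T v ->
  lam.-integrable I (EFin \o (fun t => ipL2 Omega (p t) (divergence (v t)))).
Proof.
move=> Lp Lv; have sL0 : seminormed (L2_0 Omega) norm2 := seminormed_sub_on (norm2_seminormed mu mD)
  (fun p (Lp : L2_0 Omega p) => Lp.1) (L2_0_subspace oO bO).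
apply: (integrable_bilinear_path (b := fun t q z => ipL2 Omega q (divergence z)) (K := d%:R) sL0 SN1 _ _ _ _ Lp Lv).1.
- by move=> q z _ _; exact: measurable_cst.
- move=> t z It Hz c q q' [Lq _] [Lq' _]; have Ld := sqint_divergence oO Hz.
  have ipP := ipD_semi_inner mu mD.
  have := ipDl ipP (subspaceZ sS0 c Lq) Lq' Ld; rewrite (ipZl sS0 ipP c Lq Ld); exact.
- by move=> t q It [Lq _] c z z' Hz Hz'; exact: (ipL2_divergence_lin oO bO c Lq Hz Hz').
- move=> t q z It [Lq _] Hz; have Ld := sqint_divergence oO Hz.
  apply: le_trans (CauchySchwarz_L2 mD Lq Ld) _; rewrite mulrC.
  rewrite [leRHS]mulrAC ler_wpM2r ?sqrtr_ge0//; exact: (norm2_divergence oO Hz).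
Qed.

(** The trace at time $0$ is defined by approximations of [u] in the norm of
    [W], and the initial value by a continuous representative. The evaluation
    at $0$ being bounded on [U], the initial values of the approximations
    converge to that of the representative. *)
Lemma initial_value (w : R -> vfield) (rho : R -> 'rV[R]_d -> R) u : 0 < T ->
  bounded_evaluation Omega T w rho -> U Omega T u -> trace_at Omega T w rho u 0 0 ->
  value_at Omega T u 0 0.
Proof.
move=> T0 ev [Xu [g wu]] [_ [u_ [z_ [hu cu cz]]]].
have Lu := L2I_H1_0_L2 oO bO (X_L2I_H1_0 oO bO Xu).
have [uc Cuc uuc] := continuous_representative oO bO T0 Lu wu.
have t0 : (0 : R) \in `[0, T] by rewrite in_itv/= lexx ltW.
have Lc := Cuc.1 0 t0; exists uc; split => //.
have sS := seminormed_sub SN0.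
suff n0 : nrm (uc 0) = 0 by exact: normL2v_eq0.
apply: le_anti; rewrite sqrtr_ge0 andbT; apply: le_eps => e e0; rewrite add0r.
have [C hC] := ev 0 t0.
have [n1 hn1] := (cvg_seqP _ _).1 cu (e / 2 / (`|C| + 1)) ltac:(by rewrite !divr_gt0// ltr_wpDl).
have [n2 hn2] := (cvg_seqP _ _).1 cz (e / 2) ltac:(by rewrite divr_gt0).
pose n := maxn n1 n2; have := hn1 n (leq_maxl _ _); have := hn2 n (leq_maxr _ _).
rewrite !subr0 (ger0_norm (sqrtr_ge0 _)) (ger0_norm (sqrtr_ge0 _)) => z1 u1.
have [[Xn [gn wn]] [un [Cun unu unz]]] := hu n.
have Ln := Cun.1 0 t0.
have Lun := L2I_H1_0_L2 oO bO (X_L2I_H1_0 oO bO Xn).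
have zE : nrm (z_ n) = nrm (un 0).
  congr Num.sqrt; apply: (ae_eq_Rintegral mD).
    apply: integrable_measurable; apply: (integrable_sum_fin mD) => i.
    exact: (integrable_mul mD (Ln i) (Ln i)).
  by apply: ae_imp unz => x h Ox; rewrite h.
have Ud : U Omega T (u_ n - u).
  split; first exact: (subspaceB (seminormed_sub (X_seminormed T oO bO)) Xn Xu).
  exists (-1 *: g + gn); rewrite addrC -scaleN1r; exact: is_wdt_lin.
have vd : value_at Omega T (u_ n - u) 0 (un 0 - uc 0).
  exists (un - uc); split; [exact: CL2_sub| |exact: aeW].
  apply: ae_imp2 unu uuc => t h1 h2 It; apply: ae_imp2 (h1 It) (h2 It) => x h3 h4 Ox.
  by rewrite !fctE h3// h4.
have := hC _ _ Ud vd => h.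
have h1 : nrm (un 0 - uc 0) <= e / 2.
  apply: le_trans h _; move: u1; rewrite ltr_pdivlMr ?ltr_wpDl// => /ltW; apply: le_trans.
  by rewrite mulrC ler_wpM2l ?sqrtr_ge0// (le_trans (ler_norm _))// lerDl.
have := seminorm_triangle SN0 Lc Ln sS.1; rewrite !subr0 (seminormBC SN0 Lc Ln) -zE => h2.
by apply: le_trans h2 _; rewrite [e]splitr lerD// ltW.
Qed.

End almost_everywhere_fields.

(** * The saddle point problem *)

Lemma residual_bound_sum (R : numDomainType) (f s k n P l m c : R) :
  f * s + (k * n * (P * s) + l * m * (P * s)) + c * m * s <=
  (f + (k * P * n + (l * P * m + c * m))) * s.
Proof. rewrite le_eqVlt; apply/orP; left; apply/eqP; ring. Qed.

Section saddle_point.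
Context (R : realType) (d : nat) (Omega : set 'rV[R]_d) (T : R).
Hypotheses (oO : open Omega) (bO : bounded_set Omega) (T0 : 0 < T) (derham : de_rham Omega).
Local Notation vfield := ('rV[R]_d -> 'rV[R]_d).
Let mu : {measure set 'rV[R]_d -> \bar R} := lebesgue_rV R d.
Let mD : measurable Omega := measurable_domain oO.
Let lam : {measure set (measurableTypeR R) -> \bar R} := @lebesgue_measure R.
Let I : set (measurableTypeR R) := `]0, T[%classic.
Let mI : measurable I := measurable_itvI T.
Local Notation norm2 := (norm2 mu Omega).
Local Notation L2v := (L2v Omega).
Local Notation H1_0v := (H1_0v Omega).
Local Notation calV := (calV Omega).
Local Notation seminorm1 := (seminorm1 Omega).
Local Notation nrm := (normL2v Omega).
Local Notation Hm1 := (Hm1 Omega).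
Local Notation normHm1 := (normHm1 Omega).
Local Notation divergence := (divergence Omega).
Local Notation X := (X Omega T).
Local Notation U := (U Omega T).
Local Notation L2I_L2 := (L2I_L2 Omega T).
Local Notation L2I_H1_0 := (L2I_H1_0 Omega T).
Local Notation L2I_L2_0 := (L2I_L2_0 Omega T).
Local Notation is_wdt := (is_wdt Omega T).
Local Notation eqQ := (eqQ Omega T).
Implicit Types (t : R) (u v g : R -> vfield) (z e : vfield) (p q : R -> 'rV[R]_d -> R).
Let SN0 : seminormed L2v nrm := normL2v_seminormed oO.
Let SN1 : seminormed H1_0v seminorm1 := seminorm1_seminormed oO bO.
Let SV : seminormed calV seminorm1 := seminormed_sub_on SN1 (@calV_H1_0v R d Omega) (calV_subspace oO bO).
Let SH := dual_norm_seminormed SN1.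

Variables (w : R -> vfield) (rho : R -> 'rV[R]_d -> R).
Variables (M : R) (rr : R -> 'rV[R]_d -> R) (ww : 'I_d -> R -> 'rV[R]_d -> R).
Hypotheses (M0 : 0 <= M) (hrr : bounded_weight M rr) (hww : forall j, bounded_weight M (ww j)).
Hypothesis rw : {ae lam, forall t, I t -> {ae mu, forall x, Omega x ->
  rho t x = rr t x /\ forall j, rho t x * w t x ord0 j = ww j t x}}.
Hypothesis rho_transported : transported Omega T w rho.
Hypothesis D0_dense_X : D0_dense Omega T.
Local Notation mfun := (material_functional Omega T rr ww).
Local Notation density_form := (density_form Omega rr).
Local Notation drift_form := (drift_form Omega ww).

Variables (a : R -> vfield -> vfield -> R) (Gammat : R) (F : R -> vfield -> R).
Hypotheses (a_bilinear : bilinear_a Omega T a) (a_measurable : measurable_a Omega T a)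
  (Gammat_gt0 : 0 < Gammat)
  (a_bounded : forall t : R, t \in `]0, T[ -> forall z e, calV z -> H1_0v e ->
     a t z e <= Gammat * seminorm1 z * seminorm1 e)
  (F_L2I_Hm1 : L2I_Hm1 Omega T F).

Lemma a_abs t z e : I t -> calV z -> H1_0v e -> `|a t z e| <= Gammat * seminorm1 z * seminorm1 e.
Proof.
move=> It Vz He; rewrite ler_norml (a_bounded It Vz He) andbT lerNl.
have sS := H1_0v_subspace oO bO.
have := a_bounded It Vz (subspaceZ sS (-1) He).
rewrite (linear_onZ SN1 _ ((a_bilinear It).2 z Vz) He) mulN1r (seminormZ SN1 _ He).
by rewrite normrN1 mul1r.
Qed.

(** Off a null set of times the values of the form are those of a measurable
    function, which its bound makes integrable. *)
Lemma a_path u v : X u -> L2I_H1_0 v ->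
  exists2 h : R -> R, lam.-integrable I (EFin \o h) & {ae lam, forall t, I t -> a t (u t) (v t) = h t}.
Proof.
move=> Xu Lv; have [h mh ah] := a_measurable Xu Lv.
have [G [mG aG hG]] := good_times ah; exists (fun t => (\1_G t : R) * h t); last first.
  by apply: ae_imp2 ah aG => t ht Gt It; rewrite indicE mem_set// mul1r ht.
have Lp := integrableZ_fin mI Gammat (integrable_mul mI (L2I_sqint SV Xu) (L2I_sqint SN1 Lv)).
apply: (integrable_le mI Lp).
  by apply: measurable_funM; [exact: measurable_indic|exact: mh].
move=> t It; rewrite indicE; have [/set_mem Gt|_] := boolP (t \in G); last first.
  by rewrite mul0r normr0 mulr_ge0 ?mulr_ge0 ?sqrtr_ge0// ltW.
rewrite mul1r -(hG t It Gt) mulrA; exact: (a_abs It (L2I_in Xu It) (L2I_in Lv It)).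
Qed.

Lemma F_path v : L2I_H1_0 v -> lam.-integrable I (EFin \o (fun t => F t (v t))).
Proof.
move=> Lv.
apply: (integrable_bilinear_path (b := fun t (l : vfield -> R) e => l e) (K := 1) SH SN1 _ _ _ _ F_L2I_Hm1 Lv).1.
- by move=> l e _ _; exact: measurable_cst.
- by move=> t e _ _ c l l' _ _.
- by move=> t l _ [ll _].
- by move=> t l e _ bl He; rewrite mul1r; exact: (le_dual_norm SN1 bl He).
Qed.

(** What the momentum equation without pressure leaves at time [t]. *)
Definition residual u g t e : R :=
  F t e - (density_form t (g t) e + drift_form t (u t) e) - a t (u t) e.

Lemma residual_path u g v : X u -> L2I_L2 g -> L2I_H1_0 v ->
  (exists2 h : R -> R, measurable_fun I (h : measurableTypeR R -> R) &
     {ae lam, forall t, I t -> residual u g t (v t) = h t}) /\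
  \int[lam]_(t in I) residual u g t (v t) = pairing T F v - mfun u g v - int_a T a u v.
Proof.
move=> Xu Lg Lv; have [h ih ah] := a_path Xu Lv; have iF := F_path Lv.
have Lu := X_L2I_H1_0 oO bO Xu; have Lv0 := L2I_H1_0_L2 oO bO Lv.
have im := material_functional_integrable oO bO M0 hrr hww Lu Lg Lv0.
pose m t := density_form t (g t) (v t) + drift_form t (u t) (v t).
have iN (f : R -> R) : lam.-integrable I (EFin \o f) -> lam.-integrable I (EFin \o (fun t => - f t)).
  by move=> i; exact: (integrableN_fin i).
have i1 := integrableD_fin mI iF (iN _ im).
have i2 := integrableD_fin mI i1 (iN _ ih).
have mr := integrable_measurable i2.
have ar : {ae lam, forall t, I t -> residual u g t (v t) = F t (v t) - m t - h t}.
  by apply: ae_imp ah => t ht It; rewrite /residual ht.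
split; first by exists (fun t => F t (v t) - m t - h t).
rewrite (ae_eq_Rintegral mI mr ar) (RintegralB mI i1 ih) (RintegralB mI iF im).
by rewrite /int_a (ae_eq_Rintegral mI (integrable_measurable ih) ah).
Qed.

Lemma residual_bound u g : X u -> L2I_L2 g -> exists2 beta : R -> R, sqint lam I beta &
  forall t, I t -> Hm1 (residual u g t) /\ normHm1 (residual u g t) <= beta t.
Proof.
move=> Xu Lg; have [P P0 hP] := poincare_vector oO bO.
have sI := sqint_subspace lam mI.
exists (fun t => normHm1 (F t) + (d%:R * M * P * nrm (g t) +
    (d%:R * (d%:R * M) * P * seminorm1 (u t) + Gammat * seminorm1 (u t)))).
  apply: (subspaceD sI (L2I_sqint SH F_L2I_Hm1)).
  apply: (sI.2 (d%:R * M * P) _ _ (L2I_sqint SN0 Lg)).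
  apply: (sI.2 (d%:R * (d%:R * M) * P) _ _ (L2I_sqint SV Xu)).
  exact: (subspaceZ sI Gammat (L2I_sqint SV Xu)).
move=> t It; have bF := L2I_in F_L2I_Hm1 It; have Lgt := L2I_in Lg It.
have Vu := L2I_in Xu It; have Hu := Vu.1.
set beta := (X in _ <= X).
have nF : 0 <= normHm1 (F t) by exact: (seminorm_ge0 SH).
have beta0 : 0 <= beta.
  have ng := seminorm_ge0 SN0 (g t); have nu := seminorm_ge0 SN1 (u t).
  by do !apply: addr_ge0 => //; rewrite ?mulr_ge0// ltW.
have hb e : H1_0v e -> `|residual u g t e| <= beta * seminorm1 e.
  move=> He; have Le := H1_0v_L2v He; have hPe := hP e He.
  have h1 := le_dual_norm SN1 bF He.
  have h2 := density_form_bound oO M0 hrr t Lgt Le.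
  have h3 := drift_form_bound oO M0 hww t Hu Le.
  have h4 := a_abs It Vu He.
  have k1 : 0 <= d%:R * M * nrm (g t) by rewrite !mulr_ge0// sqrtr_ge0.
  have k2 : 0 <= d%:R * (d%:R * M) * seminorm1 (u t) by rewrite !mulr_ge0// sqrtr_ge0.
  have h5 := le_trans h2 (ler_wpM2l k1 hPe); have h6 := le_trans h3 (ler_wpM2l k2 hPe).
  apply: le_trans (ler_normB _ _) _; apply: le_trans (lerD (ler_normB _ _) h4) _.
  apply: le_trans (lerD (lerD h1 (le_trans (ler_normD _ _) (lerD h5 h6))) (lexx _)) _.
  exact: (residual_bound_sum (normHm1 (F t)) (seminorm1 e) (d%:R * M) (nrm (g t)) P (d%:R * (d%:R * M)) (seminorm1 (u t)) Gammat).
have lr : linear_on H1_0v (residual u g t).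
  move=> c e e' He He'; have Le := H1_0v_L2v He; have Le' := H1_0v_L2v He'.
  rewrite /residual bF.1// (density_form_linr oO hrr t Lgt c Le Le').
  rewrite (drift_form_linr oO hww t Hu c Le Le') ((a_bilinear It).2 _ Vu c _ _ He He'); ring.
have br : Hm1 (residual u g t) by split => //; exists beta.
by split => //; exact: (dual_norm_le SN1 br beta0 hb).
Qed.

Lemma ipL2_divergence_calV (f : 'rV[R]_d -> R) z : calV z -> ipL2 Omega f (divergence z) = 0.
Proof.
move=> [_ dz]; transitivity (\int[mu]_(x in Omega) (0 : R)); last by rewrite Rintegral_cst ?mul0r.
apply: (ae_eq_Rintegral mD); first exact: measurable_cst.
by apply: ae_imp dz => x hx Ox; rewrite hx// mulr0.
Qed.

Lemma int_divergence_calV p u : (forall t, I t -> calV (u t)) ->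
  \int[lam]_(t in I) ipL2 Omega (p t) (divergence (u t)) = 0.
Proof.
move=> Vu; transitivity (\int[lam]_(t in I) (0 : R)); last by rewrite Rintegral_cst ?mul0r.
by apply: eq_Rintegral => t /set_mem It; exact: ipL2_divergence_calV (Vu t It).
Qed.

(** The residual of the solution integrates to zero against every path in
    [calV]; its pressure is the one sought. *)
Lemma saddle_of_solution u : U u -> value_at Omega T u 0 0 ->
  (forall v, X v -> rhodot Omega T w rho u v + int_a T a u v = pairing T F v) ->
  exists p, solves_saddle Omega T w rho a F u p.
Proof.
move=> [Xu [g wu]] vu su; have Lg := wu.1; have Lu := X_L2I_H1_0 oO bO Xu.
have [beta Lb hb] := residual_bound Xu Lg.
have [_ _ rE] := rhodot_smooth oO bO T0 M0 hrr hww rw rho_transported D0_dense_X Xu wu.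
have [p Lp hp] : exists2 p, L2I_L2_0 p & {ae lam, forall t, I t -> forall z, H1_0v z ->
    residual u g t z = weak_gradient Omega (p t) z}.
  apply: (pressure_exists oO bO derham (l := residual u g) (fun t It => (hb t It).1) Lb
    (fun t It => (hb t It).2)).
    move=> e He; have Le := L2I_cst T SN1 (H1_0v_dense oO bO) He.
    exact: (residual_path Xu Lg Le).1.
  move=> v Xv; rewrite (residual_path Xu Lg (X_L2I_H1_0 oO bO Xv)).2 -(su v Xv) (rE v Xv).
  by rewrite [_ + int_a _ _ _ _]addrC addrK subrr.
exists p; split => //.
- by split => //; exists g.
- move=> v Lv; rewrite (ipQ_mdot oO bO M0 hrr hww rw Lu wu (L2I_H1_0_L2 oO bO Lv)).
  have ip := ipL2_divergence_path oO bO Lp Lv.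
  have E : \int[lam]_(t in I) residual u g t (v t) =
      - \int[lam]_(t in I) ipL2 Omega (p t) (divergence (v t)).
    rewrite -mulN1r -(RintegralZl _ mI ip); apply: (ae_eq_Rintegral mI).
      by apply: measurable_funM => //; exact: (integrable_measurable ip).
    by apply: ae_imp hp => t h It; rewrite (h It _ (L2I_in Lv It)) mulN1r.
  move: E; rewrite (residual_path Xu Lg Lv).2 => E.
  by move/eqP: E; rewrite -addrA -opprD subr_eq => /eqP ->; rewrite addrC.
- by move=> q Lq; apply: int_divergence_calV => t It; exact: (L2I_in Xu It).
Qed.

Lemma int_a_ae u u' v : X u -> L2I_H1_0 v ->
  {ae lam, forall t, I t -> a t (u' t) (v t) = a t (u t) (v t)} -> int_a T a u' v = int_a T a u v.
Proof.
move=> Xu Lv h; have [k ik ak] := a_path Xu Lv; have mk := integrable_measurable ik.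
rewrite /int_a (ae_eq_Rintegral mI mk ak); apply: (ae_eq_Rintegral mI mk).
by apply: ae_imp2 h ak => t h1 h2 It; rewrite h1// h2.
Qed.

(** Fields that agree almost everywhere are at distance zero in the norms that
    control the forms. *)
Lemma momentum_eqQ u u' g v : X u -> X u' -> is_wdt u g -> eqQ u' u -> L2I_H1_0 v ->
  mfun u' g v = mfun u g v /\ int_a T a u' v = int_a T a u v.
Proof.
move=> Xu Xu' wu uu' Lv; have Lv0 := L2I_H1_0_L2 oO bO Lv; have sV := seminormed_sub SV.
have n0 : {ae lam, forall t, I t -> seminorm1 (u' t - u t) = 0}.
  apply: ae_imp uu' => t h It; apply: (seminorm1_ae0 oO bO).
    exact: (subspaceB sV (L2I_in Xu' It) (L2I_in Xu It)).1.
  by apply: ae_imp (h It) => x hx Ox; rewrite !fctE hx// subrr.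
split; last first.
  apply: (int_a_ae Xu Lv); apply: ae_imp n0 => t h It.
  have Vu := L2I_in Xu It; have Vu' := L2I_in Xu' It; have Hv := L2I_in Lv It.
  apply/eqP; rewrite -subr_eq0 -normr_le0.
  rewrite -(linear_onB ((a_bilinear It).1 _ Hv) Vu' Vu).
  by apply: le_trans (a_abs It (subspaceB sV Vu' Vu) Hv) _; rewrite h// mulr0 mul0r.
apply: (ae_eq_Rintegral mI).
  exact: (integrable_measurable (material_functional_integrable oO bO M0 hrr hww (X_L2I_H1_0 oO bO Xu) wu.1 Lv0)).
apply: ae_imp n0 => t h It; apply: (congr1 (+%R (density_form t (g t) (v t)))).
have Vu := (L2I_in Xu It).1; have Vu' := (L2I_in Xu' It).1; have Lvt := L2I_in Lv0 It.
apply/eqP; rewrite -subr_eq0 -normr_le0.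
rewrite -(linear_onB (drift_form_linl oO bO hww t Lvt) Vu' Vu).
apply: le_trans (drift_form_bound oO M0 hww t (subspaceB (seminormed_sub SN1) Vu' Vu) Lvt) _.
by rewrite h// mulr0 mul0r.
Qed.

Lemma normW0 : normW Omega T w rho 0 = 0.
Proof.
have S0 := X_seminormed T oO bO; have X0 := (seminormed_sub S0).1.
have w0 := is_wdt0 T oO bO.
have [_ _ rE] := rhodot_smooth oO bO T0 M0 hrr hww rw rho_transported D0_dense_X X0 w0.
have d0 : dual_norm X (normX Omega T) (rhodot Omega T w rho 0) = 0.
  rewrite -(seminorm0 (dual_norm_seminormed S0)); apply: dual_norm_ext => v Xv; rewrite (rE v Xv).
  exact: (material_functional0 oO bO M0 hrr hww (L2I_H1_0_L2 oO bO (X_L2I_H1_0 oO bO Xv))).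
by rewrite /normW d0 (seminorm0 S0) expr0n addr0 sqrtr0.
Qed.

(** The second equation, tested with the divergence itself, puts almost every
    value of the velocity in [calV]. Tested with paths in [calV], the first
    equation then loses its pressure term. *)
Lemma solution_of_saddle u p : solves_saddle Omega T w rho a F u p ->
  exists u1 g, [/\ X u1, is_wdt u g, {ae lam, forall t, I t -> u t = u1 t} &
    solves_star Omega T w rho a F u1].
Proof.
move=> [[Lu [g wu]] vu Lp hv hq].
have Ld := L2I_divergence oO bO Lu; have id := ipL2_divergence_path oO bO Ld Lu.
have d0 : {ae lam, forall t, I t -> calV (u t)}.
  have := Rintegral_eq0_ae mI id _ (hq _ Ld) => /(_ (fun t _ => _)) h.
  have {}h := h ltac:(move=> t; apply: Rintegral_ge0 => x _; rewrite -expr2; exact: sqr_ge0).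
  apply: ae_imp h => t h It; split; first exact: (L2I_in Lu It).
  apply: (norm2_eq0_ae mD (sqint_divergence oO (L2I_in Lu It))).
  by rewrite /norm2 -[ipD _ _ _ _]/(ipL2 Omega _ _) h// sqrtr0.
have [G [mG aG hG]] := good_times d0.
pose u1 t := if t \in G then u t else 0.
have Xu1 : X u1 := L2I_restrict SN1 (@calV_H1_0v R d Omega) SV (calV_separable oO bO) mG hG Lu.
have uu1 : {ae lam, forall t, I t -> u t = u1 t}.
  by apply: ae_imp aG => t Gt _; rewrite /u1 mem_set.
have u1u : eqQ u1 u by apply: eqQ_ae; apply: ae_imp uu1 => t h It; rewrite h.
have wu1 := is_wdt_eqQ oO (L2I_H1_0_L2 oO bO Lu) u1u wu.
exists u1, g; split => //.
have [_ W1 rE] := rhodot_smooth oO bO T0 M0 hrr hww rw rho_transported D0_dense_X Xu1 wu1.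
have U1 : U u1 by split => //; exists g.
have S0 := X_seminormed T oO bO.
split.
  split.
    by split => // e e0; exists u1; split => //; rewrite subrr normW0.
  split; first exact: (L2v_subspace oO).1.
  exists (fun=> u1), (fun=> 0); split.
  - move=> n; split => //; have [uc [cuc uuc uc0]] := vu; exists uc; split => //.
    by apply: eqQ_trans uuc _; exact: eqQ_sym.
  - by rewrite subrr normW0; exact: cvg_cst.
  - by rewrite subrr (seminorm0 SN0); exact: cvg_cst.
move=> v Xv; have Lv := X_L2I_H1_0 oO bO Xv; have Lv0 := L2I_H1_0_L2 oO bO Lv.
have := hv v Lv; rewrite (ipQ_mdot oO bO M0 hrr hww rw Lu wu Lv0).
rewrite (int_divergence_calV p (fun t It => L2I_in Xv It)) subr0 => <-.
have ha : {ae lam, forall t, I t -> a t (u t) (v t) = a t (u1 t) (v t)}.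
  by apply: ae_imp uu1 => t h It; rewrite h.
rewrite (rE v Xv) (int_a_ae Xu1 Lv ha); apply: (congr1 (+%R^~ (int_a T a u1 v))).
apply/esym; apply: (ae_eq_Rintegral mI).
  exact: (integrable_measurable (material_functional_integrable oO bO M0 hrr hww (X_L2I_H1_0 oO bO Xu1) wu1.1 Lv0)).
by apply: ae_imp uu1 => t h It; rewrite h.
Qed.

Lemma saddle_unique ustar pstar u p : X ustar ->
  (forall u, solves_star Omega T w rho a F u -> eqQ u ustar) ->
  solves_saddle Omega T w rho a F ustar pstar ->
  solves_saddle Omega T w rho a F u p -> eqQ u ustar /\ eqQ p pstar.
Proof.
move=> Xs uniq [_ _ Lps hs _] sp; have [u1 [g [Xu1 wu uu1 s1]]] := solution_of_saddle sp.
have [[Lu _] _ Lp hv _] := sp.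
have u1s := uniq _ s1; have uu1' : eqQ u u1 by exact: eqQ_ae.
have us : eqQ u ustar := eqQ_trans uu1' u1s.
split => //; apply: (pressure_unique oO bO derham Lp Lps) => v Lv.
have Lv0 := L2I_H1_0_L2 oO bO Lv; have Ls := X_L2I_H1_0 oO bO Xs.
have ws : is_wdt ustar g := is_wdt_eqQ oO (L2I_H1_0_L2 oO bO Lu) (eqQ_sym us) wu.
have := hv v Lv; rewrite -(hs v Lv).
rewrite (ipQ_mdot oO bO M0 hrr hww rw Ls ws Lv0) (ipQ_mdot oO bO M0 hrr hww rw Lu wu Lv0).
have [E1 E2] := momentum_eqQ Xs Xu1 ws u1s Lv.
have E3 : mfun u g v = mfun ustar g v.
  rewrite -E1; apply: (ae_eq_Rintegral mI).
    exact: (integrable_measurable (material_functional_integrable oO bO M0 hrr hww (X_L2I_H1_0 oO bO Xu1) wu.1 Lv0)).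
  by apply: ae_imp uu1 => t h It; rewrite h.
have ha : {ae lam, forall t, I t -> a t (u t) (v t) = a t (u1 t) (v t)}.
  by apply: ae_imp uu1 => t h It; rewrite h.
have E4 : int_a T a u v = int_a T a ustar v by rewrite (int_a_ae Xu1 Lv ha).
by rewrite E3 E4 => /addrI /oppr_inj.
Qed.

End saddle_point.

Theorem theorem5p1 (R : realType) (d : nat) (hd : (0 < d)%N)
  (Omega : set 'rV[R]_d) (T : R)
  (Omega1 Omega2 : R -> set 'rV[R]_d) (rho1 rho2 : R)
  (w : R -> 'rV[R]_d -> 'rV[R]_d)
  (a : R -> ('rV[R]_d -> 'rV[R]_d) -> ('rV[R]_d -> 'rV[R]_d) -> R)
  (gamma Gamma Gammat : R)
  (F : R -> ('rV[R]_d -> 'rV[R]_d) -> R)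
  (ustar : R -> 'rV[R]_d -> 'rV[R]_d)
  (Omega_domain : [/\ open Omega, bounded_set Omega, connected Omega &
                      Omega !=set0])
  (T_gt0 : 0 < T)
  (Omega12 : subdomains Omega T Omega1 Omega2)
  (interface_connected : connected (interface T Omega1 Omega2))
  (interface_lipschitz : lipschitz_hypersurface (interface T Omega1 Omega2))
  (rho_gt0 : 0 < rho1 /\ 0 < rho2)
  (rho_measurable : measurable_fun (Q Omega T)
     (fun z => density Omega1 rho1 rho2 (tcoor z) (xcoor z)))
  (w_continuous : CL2 Omega T w)
  (w_bounded : LooQ Omega T w)
  (div_w : div_zero Omega T w)
  (rho_transported : transported Omega T w (density Omega1 rho1 rho2))
  (derham : de_rham Omega)
  (C1_0_dense_calV : C1_0_dense Omega)
  (D0_dense_X : D0_dense Omega T)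
  (evaluation : bounded_evaluation Omega T w (density Omega1 rho1 rho2))
  (a_bilinear : bilinear_a Omega T a)
  (a_measurable : measurable_a Omega T a)
  (constants_gt0 : [/\ 0 < gamma, 0 < Gamma & 0 < Gammat])
  (a_coercive : forall t : R, t \in `]0, T[ -> forall v, calV Omega v ->
     gamma * seminorm1 Omega v ^+ 2 <= a t v v)
  (a_bounded : forall t : R, t \in `]0, T[ -> forall u v,
     calV Omega u -> calV Omega v ->
     a t u v <= Gamma * seminorm1 Omega u * seminorm1 Omega v)
  (a_bounded_H1_0 : forall t : R, t \in `]0, T[ -> forall v v',
     calV Omega v -> H1_0v Omega v' ->
     a t v v' <= Gammat * seminorm1 Omega v * seminorm1 Omega v')
  (F_L2I_Hm1 : L2I_Hm1 Omega T F)
  (ustar_solution :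
     solves_star Omega T w (density Omega1 rho1 rho2) a F ustar)
  (ustar_unique : forall u,
     solves_star Omega T w (density Omega1 rho1 rho2) a F u ->
     eqQ Omega T u ustar)
  (ustar_smooth : U Omega T ustar) :
  exists u p,
    [/\ solves_saddle Omega T w (density Omega1 rho1 rho2) a F u p,
        eqQ Omega T u ustar &
        forall u' p',
          solves_saddle Omega T w (density Omega1 rho1 rho2) a F u' p' ->
          eqQ Omega T u' u /\ eqQ Omega T p' p].
Proof.
have [oO bO _ _] := Omega_domain.
have rho_bound t x : `|density Omega1 rho1 rho2 t x| <= `|rho1| + `|rho2|.
  by rewrite /density; case: ifP => _; rewrite ?lerDl ?lerDr.
have [M [rr [ww [M0 hrr hww hrw]]]] :=
  regular_weights oO (addr_ge0 (normr_ge0 rho1) (normr_ge0 rho2)) rho_bound rho_measurable w_bounded.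
have [[_ tr0] su] := ustar_solution; have [_ _ Gt0] := constants_gt0.
have vu := initial_value oO bO T_gt0 evaluation ustar_smooth tr0.
have [p sp] := saddle_of_solution oO bO T_gt0 derham M0 hrr hww hrw rho_transported D0_dense_X
  a_bilinear a_measurable Gt0 a_bounded_H1_0 F_L2I_Hm1 ustar_smooth vu su.
exists ustar, p; split => //.
  by apply: eqQ_ae; exact: aeW.
move=> u' p'; exact: (saddle_unique oO bO T_gt0 derham M0 hrr hww hrw rho_transported D0_dense_X
  a_bilinear a_measurable Gt0 a_bounded_H1_0 ustar_smooth.1 ustar_unique sp).
Qed.
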